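(* Let $(V(\mathbb{Q}),C,\Gamma)$ be a polyhedral triple and let $F$ be a face of $C_+$. The image of the homomorphism $N_\Gamma(F)\to\Gamma(F)\times\Gamma(F^\dagger)$ is of finite index in the latter, and the elements in its kernel that act trivially on $T_F$ form a free abelian subgroup $U_\Gamma(F)$ of finite index in that kernel. The action of $U_\Gamma(F)$ on $V$ is 2-step unipotent (so $(u-1)^3=0$ for each $u\in U_\Gamma(F)$) and is given by a unique homomorphism $$u\in U_\Gamma(F)\mapsto\sigma_u\in\mathrm{Hom}(V/V_F,V^F)$$ with the following properties: (i) $\sigma_u$ maps $T_F$ to $V_F$ and the induced maps $$j_u:V/V^F\to T_F\quad\text{and}\quad k_u:T_F\to V_F$$ are such that $u(x)=x+\sigma_u(x')+\tfrac12 k_uj_u(x'')$ for all $x\in V$, where $x'$ resp. $x''$ denote the images of $x$ in $V/V_F$ resp. $V/V^F$; (ii) for $u,v\in U_\Gamma(F)$, we have $k_uj_v=k_vj_u$; (iii) $k_uj_u$ maps $\pi^F(C)$ to $F-\{0\}$, unless $u=1$.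
   Context: $V$ is a real finite dimensional vector space with $\mathbb{Q}$-structure $V(\mathbb{Q})$ and $C\subset V$ is an open convex cone (nonempty, stable under positive scalars) that is nondegenerate (contains no affine line). $[Z]$ is the convex hull of $Z$. $C_+:=[\bar C\cap V(\mathbb{Q})]$; $C^*\subset V^*$ is the set of linear forms $\ge 0$ on $C$, $C^\circ$ its interior, and $C^\circ_+:=[C^*\cap V^*(\mathbb{Q})]$. $(V(\mathbb{Q}),C,\Gamma)$ is a polyhedral triple if $\Gamma\subset\mathrm{GL}(V)$ is a subgroup stabilizing $C$ and some lattice in $V(\mathbb{Q})$ and there is a polyhedral cone (convex cone spanned by finitely many vectors) $\Pi\subset C_+$ with $\Gamma\cdot\Pi=C_+$. A face of a convex set $X$ is a nonempty convex subset $F$ such that every segment in $X$ which meets $F$ is either contained in $F$ or meets $F$ only in an end point. For a face $F$ of $C_+$: $F^\dagger$ is the set of $\xi\in C^\circ_+$ which vanish on $F$ (a face of $C^\circ_+$); $V_F$ is the linear span of $F$; $V^F$ is the common zero set in $V$ of the elements of $F^\dagger$, so $0\subset V_F\subset V^F\subset V$; $T_F:=V^F/V_F\subset V/V_F$; $\pi^F:V\to V/V^F$ is the projection. The map $V/V^F\to T_F$ induced by $\sigma_u$ is obtained from $\sigma_u:V/V_F\to V^F$ by passing to the quotients by $T_F$ and $V_F$ respectively; $k_u=\sigma_u|_{T_F}$. For $\Gamma$ acting on a set $X$ and $Y\subset X$, $N_\Gamma(Y)$ resp. $Z_\Gamma(Y)$ is the subgroup of elements leaving $Y$ invariant resp.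 pointwise fixed, and $\Gamma(Y):=N_\Gamma(Y)/Z_\Gamma(Y)$. $\Gamma$ acts on $V^*$ by the contragradient action; $N_\Gamma(F)$ acts on $F$ and on $F^\dagger$, which gives the homomorphism $N_\Gamma(F)\to\Gamma(F)\times\Gamma(F^\dagger)$. *)

(* Defs.v *)
From HB Require Import structures.
From mathcomp Require Import all_boot all_order all_algebra.
From mathcomp Require Import generic_quotient ring_quotient.
From mathcomp Require Import boolp classical_sets functions cardinality.
From mathcomp Require Import reals topology normedtype convex.
From mathcomp.multinomials Require Import freeg.

Set Implicit Arguments.
Unset Strict Implicit.
Unset Printing Implicit Defensive.

Import Order.TTheory GRing.Theory Num.Theory.
Import numFieldNormedType.Exports.
Import passmx.

Local Open Scope classical_set_scope.
Local Open Scope ring_scope.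

Section Groups.
Variable gT : groupType.
Implicit Types (G H N Z A B : set gT) (g : gT).

Definition is_subgroup G : Prop :=
  [/\ G 1%g, forall g h, G g -> G h -> G (g * h)%g & forall g, G g -> G g^-1%g].

Definition set_mulg A B : set gT := [set (a * b)%g | a in A & b in B].

Definition left_coset g Z : set gT := [set (g * z)%g | z in Z].

(* The carrier of N / Z; its group law is [set_mulg]. *)
Definition coset_group N Z : set (set gT) := [set left_coset g Z | g in N].

(* [I] may be infinite: the rank is not assumed finite. *)
Definition is_free_abelian G : Prop :=
  exists (I : choiceType)
         (f : {freeg I / int} -> gT),
    (forall x y, f (x + y) = (f x * f y)%g) /\ set_bij [set: _] G f.

Variables (X : Type) (act : gT -> X -> X).

Definition stabilizer G (Y : set X) : set gT :=
  [set g | G g /\ act g @` Y = Y].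

Definition fixator G (Y : set X) : set gT :=
  [set g | G g /\ forall y, Y y -> act g y = y].

Definition induced_group G (Y : set X) : set (set gT) :=
  coset_group (stabilizer G Y) (fixator G Y).

End Groups.

(* The group law is explicit because this is used both in a [groupType] and in
   a product of two groups of cosets. *)
Definition finite_index (T : Type) (mul : T -> T -> T) (H G : set T) : Prop :=
  H `<=` G /\ finite_set [set [set mul g h | h in H] | g in G].

Definition prod_law (T1 T2 : Type) (mul1 : T1 -> T1 -> T1)
    (mul2 : T2 -> T2 -> T2) (p q : T1 * T2) : T1 * T2 :=
  (mul1 p.1 q.1, mul2 p.2 q.2).

Section GeneralLinear.
Variables (K : fieldType) (V : vectType K).

Definition GL : Type := {f : 'End(V) | lker f == 0%VS}.
HB.instance Definition _ := Choice.on GL.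

Definition GL_end (g : GL) : 'End(V) := \val g.
Definition GL_fun (g : GL) : V -> V := GL_end g.

Fact GL_one_subproof : lker (\1%VF : 'End(V)) == 0%VS.
Proof. by apply/lker0P => x y; rewrite !id_lfunE. Qed.

Fact GL_mul_subproof (g h : GL) : lker (\val g \o \val h)%VF == 0%VS.
Proof.
apply/lker0P => x y; rewrite !comp_lfunE.
by move/(lker0P (valP g))/(lker0P (valP h)).
Qed.

Fact GL_inv_subproof (g : GL) : lker (\val g)^-1%VF == 0%VS.
Proof.
have gK : cancel (\val g)^-1%VF (\val g).
  move=> x; rewrite -[RHS](@id_lfunE _ _ x) -(lker0_compfV (valP g)).
  by rewrite comp_lfunE.
exact/lker0P/(can_inj gK).
Qed.

Definition GL_one : GL := Sub \1%VF GL_one_subproof.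
Definition GL_mul (g h : GL) : GL :=
  Sub (\val g \o \val h)%VF (GL_mul_subproof g h).
Definition GL_inv (g : GL) : GL := Sub (\val g)^-1%VF (GL_inv_subproof g).

Fact GL_mulA : associative GL_mul.
Proof. by move=> f g h; apply: val_inj; rewrite /= comp_lfunA. Qed.
Fact GL_mul1 : left_id GL_one GL_mul.
Proof. by move=> f; apply: val_inj; rewrite /= comp_lfun1l. Qed.
Fact GL_mulr1 : right_id GL_one GL_mul.
Proof. by move=> f; apply: val_inj; rewrite /= comp_lfun1r. Qed.
Fact GL_mulV : left_inverse GL_one GL_inv GL_mul.
Proof. by move=> f; apply: val_inj; rewrite /= lker0_compVf ?(valP f). Qed.
Fact GL_mulrV : right_inverse GL_one GL_inv GL_mul.
Proof. by move=> f; apply: val_inj; rewrite /= lker0_compfV ?(valP f). Qed.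

HB.instance Definition _ :=
  isGroup.Build GL GL_mulA GL_mul1 GL_mulr1 GL_mulV GL_mulrV.

End GeneralLinear.

Coercion GL_fun : GL >-> Funclass.

Section VectorQuotient.
Local Open Scope quotient_scope.
Variables (K : fieldType) (V : vectType K) (W : {vspace V}).

Definition quotv : Type := Quotient.quot W.
HB.instance Definition _ := GRing.Zmodule.on quotv.

Definition quotv_pi (x : V) : quotv := \pi_(Quotient.quot W) x.
Definition quotv_repr (y : quotv) : V := repr (y : Quotient.quot W).

Lemma quotv_reprK : cancel quotv_repr quotv_pi.
Proof. by move=> y; rewrite /quotv_pi /quotv_repr reprK. Qed.

Lemma quotv_piP (x y : V) : quotv_pi x = quotv_pi y <-> x - y \in W.
Proof.
by rewrite (Quotient.idealrBE (W : zmodClosed V)); split => [/eqP|/eqP].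
Qed.

Lemma quotv_pi_repr (x : V) : x - quotv_repr (quotv_pi x) \in W.
Proof. by apply/quotv_piP; rewrite quotv_reprK. Qed.

Fact quotv_pi_add : {morph quotv_pi : x y / x + y}.
Proof. by move=> x y; rewrite /quotv_pi !raddfD. Qed.

Definition quotv_scale (a : K) (y : quotv) : quotv :=
  quotv_pi (a *: quotv_repr y).

Fact quotv_pi_scale (a : K) (x : V) :
  quotv_scale a (quotv_pi x) = quotv_pi (a *: x).
Proof.
apply/quotv_piP; rewrite -scalerBr memvZ // -memvN opprB.
exact: quotv_pi_repr.
Qed.

Fact quotv_scaleA a b y :
  quotv_scale a (quotv_scale b y) = quotv_scale (a * b) y.
Proof. by rewrite -(quotv_reprK y) !quotv_pi_scale scalerA. Qed.
Fact quotv_scale1 : left_id 1 quotv_scale.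
Proof. by move=> y; rewrite -(quotv_reprK y) quotv_pi_scale scale1r. Qed.
Fact quotv_scaleDr : right_distributive quotv_scale +%R.
Proof.
move=> a y z; rewrite -(quotv_reprK y) -(quotv_reprK z) -quotv_pi_add.
by rewrite !quotv_pi_scale scalerDr quotv_pi_add.
Qed.
Fact quotv_scaleDl y : {morph quotv_scale^~ y : a b / a + b}.
Proof.
move=> a b /=; rewrite -(quotv_reprK y) !quotv_pi_scale scalerDl.
exact: quotv_pi_add.
Qed.

HB.instance Definition _ := GRing.Zmodule_isLmodule.Build K quotv
  quotv_scaleA quotv_scale1 quotv_scaleDr quotv_scaleDl.

Fact quotv_pi_linear : linear quotv_pi.
Proof. by move=> a x y; rewrite quotv_pi_add -quotv_pi_scale. Qed.
HB.instance Definition _ :=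
  GRing.isLinear.Build K V quotv *:%R quotv_pi quotv_pi_linear.

Let compl_proj (x : V) : subvs_of (W^C)%VS :=
  vsproj (W^C)%VS (daddv_pi (W^C)%VS W x).
Let compl_proj_linear : linear compl_proj.
Proof. by move=> a x y; rewrite /compl_proj !linearP. Qed.

Let coord_compl : subvs_of (W^C)%VS -> 'rV[K]_(\dim {:subvs_of (W^C)%VS}) :=
  rVof (vbasis {:subvs_of (W^C)%VS}).

Fact quotv_vector_axiom :
  vector_axiom_def (\dim {:subvs_of (W^C)%VS}) quotv.
Proof.
have basisW := vbasisP {:subvs_of (W^C)%VS}.
have capW : (W^C :&: W = 0)%VS by rewrite capvC capv_compl.
have projW x : x - \val (compl_proj x) \in W.
  have -> : \val (compl_proj x) = daddv_pi (W^C)%VS W x.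
    by apply: vsprojK; exact: memv_pi.
  have xf : x \in (W^C + W)%VS by rewrite addvC addv_complf memvf.
  by rewrite -{1}(daddv_pi_add capW xf) addrC addKr memv_pi.
have projE x y : x - y \in W -> compl_proj x = compl_proj y.
  move=> xyW; apply/val_inj/eqP; rewrite -subr_eq0 -memv0 -capW memv_cap.
  rewrite memvB ?subvsP //=.
  have -> : \val (compl_proj x) - \val (compl_proj y) =
      (x - y) - (x - \val (compl_proj x)) + (y - \val (compl_proj y)).
    by rewrite opprB [x - y + _]addrC !addrA !subrK.
  by rewrite memvD ?projW // memvB ?projW.
exists (fun y => coord_compl (compl_proj (quotv_repr y))).
  move=> a y z; rewrite -[RHS]linearP; congr coord_compl.
  rewrite -compl_proj_linear; apply: projE; apply/quotv_piP.
  by rewrite quotv_reprK linearP /= !quotv_reprK.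
exists (fun r => quotv_pi (\val (vecof (vbasis {:subvs_of (W^C)%VS}) r))) => [y|r].
  rewrite /coord_compl rVofK // -[RHS]quotv_reprK.
  by apply/quotv_piP; rewrite -memvN opprB.
rewrite -[RHS](vecofK basisW); congr coord_compl.
apply/val_inj/eqP; rewrite -subr_eq0 -memv0 -capW memv_cap memvB ?subvsP //=.
pose x := vsval (vecof (vbasis {:subvs_of (W^C)%VS}) r); rewrite -/x.
set y := quotv_repr _.
have -> : vsval (compl_proj y) - x = (y - x) - (y - vsval (compl_proj y)).
  by rewrite opprB [RHS]addrC !addrA !subrK.
by rewrite memvB ?projW // -memvN opprB quotv_pi_repr.
Qed.

HB.instance Definition _ :=
  Lmodule_hasFinDim.Build K quotv quotv_vector_axiom.

Definition quot_map : 'Hom(V, quotv) := linfun quotv_pi.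

Lemma quot_mapP (x y : V) : quot_map x = quot_map y <-> x - y \in W.
Proof. by rewrite !lfunE; exact: quotv_piP. Qed.

Lemma quot_map_surj (y : quotv) : exists x, quot_map x = y.
Proof. by exists (quotv_repr y); rewrite lfunE /= quotv_reprK. Qed.

End VectorQuotient.

Section Spans.
Variables (K : fieldType) (V : vectType K).

Definition lin_span (A : set V) : {vspace V} :=
  xget 0%VS [set W : {vspace V} | A `<=` [set` W] /\
    forall U : {vspace V}, A `<=` [set` U] -> (W <= U)%VS].

Lemma lin_spanP (A : set V) : A `<=` [set` lin_span A] /\
  forall U : {vspace V}, A `<=` [set` U] -> (lin_span A <= U)%VS.
Proof.
rewrite /lin_span; case: xgetP => [W _ //|noW]; exfalso.
pose P n := `[< exists W : {vspace V}, A `<=` [set` W] /\ \dim W = n >].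
have exP : exists n, P n.
  by exists (\dim {:V}); apply/asboolP; exists fullv; split=> // x _; exact: memvf.
have [n /asboolP [W [AW dimW]] minn] := ex_minnP exP.
apply: (noW W); split=> // U AU; apply/capv_idPl/eqP.
rewrite -dimv_leqif_eq ?capvSl // eqn_leq dimvS ?capvSl //= dimW.
apply: minn; apply/asboolP; exists (W :&: U)%VS; split=> // x Ax /=.
by rewrite memv_cap; apply/andP; split; [exact: AW|exact: AU].
Qed.

Definition common_zeros (A : set 'Hom(V, K^o)) : {vspace V} :=
  lin_span [set x | forall xi : 'Hom(V, K^o), A xi -> xi x = 0].

Lemma common_zerosP (A : set 'Hom(V, K^o)) (x : V) :
  x \in common_zeros A <-> forall xi : 'Hom(V, K^o), A xi -> xi x = 0.
Proof.
have [sub min] := lin_spanP [set x | forall xi : 'Hom(V, K^o), A xi -> xi x = 0].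
split=> [xz xi Axi|]; last exact: sub.
apply/eqP; rewrite -memv_ker; apply: (subvP (min (lker xi) _)) xz => y /= yz.
by rewrite memv_ker yz.
Qed.

End Spans.

Section Cones.
Variables (R : realType) (V : vectType R).
Implicit Types (C X Z F L VQ : set V) (b s : seq V).

Definition convex_hull (W : lmodType R) (Z : set W) : set W :=
  smallest (@convex_set R W) Z.

Definition segment (x y : V) : set V :=
  [set (1 - t) *: x + t *: y | t in [set t : R | 0 <= t <= 1]].

Definition is_face X F : Prop :=
  [/\ F `<=` X, F !=set0, convex_set F &
    forall x y, segment x y `<=` X -> segment x y `&` F !=set0 ->
      segment x y `<=` F \/
      exists2 e, e = x \/ e = y & segment x y `&` F = [set e]].

(* The topology of V is transported from R^n through coordinates; it does not
   depend on the basis. *)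
Definition coordinates : V -> 'rV[R]_(\dim {:V}) := rVof (vbasis {:V}).
Definition openV X : Prop := open (coordinates @` X).
Definition closureV X : set V := coordinates @^-1` closure (coordinates @` X).

Record open_nondegenerate_cone C : Prop := {
  cone_open : openV C;
  cone_convex : convex_set C;
  cone_nonempty : C !=set0;
  cone_scale : forall (a : R) x, 0 < a -> C x -> C (a *: x);
  cone_no_line : ~ exists p d : V, d != 0 /\ forall t : R, C (p + t *: d) }.

Definition cone_spanned_by s : set V :=
  [set \sum_(i < size s) a i *: s`_i | a in
    [set a : 'I_(size s) -> R | forall i, 0 <= a i]].

Definition is_polyhedral_cone X : Prop := exists s, X = cone_spanned_by s.

Definition rat_span b : set V :=
  [set \sum_(i < size b) ratr (q i) *: b`_i | q in [set: 'I_(size b) -> rat]].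

Definition int_span b : set V :=
  [set \sum_(i < size b) (z i)%:~R *: b`_i | z in [set: 'I_(size b) -> int]].

Definition is_rat_basis VQ b : Prop :=
  basis_of {:V}%VS b /\ VQ = rat_span b.

Definition is_rat_structure VQ : Prop := exists b, is_rat_basis VQ b.

Definition is_lattice VQ L : Prop :=
  exists2 b, is_rat_basis VQ b & L = int_span b.

Definition rat_hull VQ C : set V := convex_hull (closureV C `&` VQ).

Definition dual_rat VQ : set 'Hom(V, R^o) :=
  [set xi : 'Hom(V, R^o) | forall x, VQ x -> exists q : rat, xi x = ratr q].

Definition dual_cone C : set 'Hom(V, R^o) :=
  [set xi : 'Hom(V, R^o) | forall x, C x -> 0 <= (xi x : R)].

Definition dual_rat_hull VQ C : set 'Hom(V, R^o) :=
  convex_hull (dual_cone C `&` dual_rat VQ).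

Record polyhedral_triple VQ C (Gam : set (GL V)) : Prop := {
  triple_rat : is_rat_structure VQ;
  triple_cone : open_nondegenerate_cone C;
  triple_group : is_subgroup Gam;
  triple_stab_cone : forall g : GL V, Gam g -> g @` C = C;
  triple_stab_lattice : exists2 L, is_lattice VQ L &
    forall g : GL V, Gam g -> g @` L = L;
  triple_polyhedral : exists P,
    [/\ is_polyhedral_cone P, P `<=` rat_hull VQ C &
        \bigcup_(g in Gam) ((g : GL V) @` P) = rat_hull VQ C] }.

End Cones.

Section Face.
Variables (R : realType) (V : vectType R).
Variables (VQ C : set V) (Gam : set (GL V)) (F : set V).

Definition contragredient (g : GL V) (xi : 'Hom(V, R^o)) : 'Hom(V, R^o) :=
  (xi \o GL_end (g^-1)%g)%VF.

Definition face_dual : set 'Hom(V, R^o) :=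
  [set xi | dual_rat_hull VQ C xi /\ forall x, F x -> xi x = 0].

(* V_F and V^F, in this order. *)
Definition V_lower : {vspace V} := lin_span F.
Definition V_upper : {vspace V} := common_zeros face_dual.

Definition T_face : {vspace quotv V_lower} := (quot_map V_lower @: V_upper)%VS.

Definition N_face : set (GL V) := stabilizer (@GL_fun R V) Gam F.

Definition Gam_face : set (set (GL V)) := induced_group (@GL_fun R V) Gam F.
Definition Gam_face_dual : set (set (GL V)) :=
  induced_group contragredient Gam face_dual.

Definition face_hom (g : GL V) : set (GL V) * set (GL V) :=
  (left_coset g (fixator (@GL_fun R V) Gam F),
   left_coset g (fixator contragredient Gam face_dual)).

Definition face_ker : set (GL V) :=
  [set g | N_face g /\ face_hom g = face_hom 1%g].

Definition U_face : set (GL V) :=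
  [set g | face_ker g /\
    forall x, x \in V_upper -> quot_map V_lower (g x) = quot_map V_lower x].

(* [j] and [k] are the maps induced by [s] on V/V^F = (V/V_F)/T_F and on T_F;
   as [quot_map] is surjective, [s] determines them, and they exist if and only
   if [s] maps T_F to V_F. *)
Definition induced_j (s : 'Hom(quotv V_lower, subvs_of V_upper))
    (j : 'Hom(quotv V_upper, subvs_of T_face)) : Prop :=
  forall x, \val (j (quot_map V_upper x)) =
            quot_map V_lower (\val (s (quot_map V_lower x))).

Definition induced_k (s : 'Hom(quotv V_lower, subvs_of V_upper))
    (k : 'Hom(subvs_of T_face, subvs_of V_lower)) : Prop :=
  forall t, \val (k t) = \val (s (\val t)).

(* Only the values of [sigma], [j] and [k] on [U_face] are constrained. *)
Definition log_hom (sigma : GL V -> 'Hom(quotv V_lower, subvs_of V_upper)) :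
    Prop :=
  (forall u v, U_face u -> U_face v -> sigma (u * v)%g = sigma u + sigma v) /\
  (forall u, U_face u ->
     forall t, t \in T_face -> \val (sigma u t) \in V_lower) /\
  exists (j : GL V -> 'Hom(quotv V_upper, subvs_of T_face))
         (k : GL V -> 'Hom(subvs_of T_face, subvs_of V_lower)),
    [/\ forall u, U_face u ->
          induced_j (sigma u) (j u) /\ induced_k (sigma u) (k u),
        forall u, U_face u -> forall x,
          u x = x + \val (sigma u (quot_map V_lower x))
                + 2^-1 *: \val (k u (j u (quot_map V_upper x))),
        forall u v, U_face u -> U_face v -> (k u \o j v = k v \o j u)%VF &
        forall u, U_face u -> u <> 1%g -> forall x, C x ->
          (F `\ 0) (\val (k u (j u (quot_map V_upper x))))].

End Face.

Section Unipotent.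
Variables (K : fieldType) (V : vectType K).

(* The group preserves a flag 0 <= W1 <= W2 <= V and acts trivially on the
   successive quotients. *)
Definition two_step_unipotent (U : set (GL V)) : Prop :=
  exists W1 W2 : {vspace V}, (W1 <= W2)%VS /\
    forall u : GL V, U u ->
      [/\ forall x, x \in W1 -> u x = x,
          forall x, x \in W2 -> u x - x \in W1 &
          forall x, u x - x \in W2].

End Unipotent.

(* Main.v *)
(* Write C^ for the closure of C, L for the lattice, f for a lattice point spanning the
   face F, and O = C + V_F.  The lattice points of C^ are well-quasi-ordered modulo the
   stabilizer of f and V_F (Dickson's lemma on the polyhedral cone Pi), and no infinite sum of
   lattice points of C^ outside V_F stays below a point of O.  Hence the orbits of bounded
   lattice points of O are finite in number, and counting lattice points in the order intervals
   (X + C^) /\ (- X - C^), which Gamma permutes, shows that the lineality space V' of the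
   closure of O is spanned by lattice vectors.  Then V' = V^F, and the finite index of the image
   in Gamma(F) x Gamma(F^dagger) follows by minimizing an integral form of kernel V^F over
   orbits.

   Let K be the kernel, acting on T = V^F / V_F.  For x in C let A_n be the image in T of the
   symmetric interval of X_n = x + n f.  Each h in K maps A_n into 2 A_n for n large.  A lattice
   vector of T in A_n / k has k^2 = O(n) by concavity of i |-> min xi0 (K (x + i v)), while
   polarity, applied to the forms near-minimized on K x at a point of A_n, gives at least
   c n^(r/2) lattice points in A_n, r = dim T.  So A_n is comparable to sqrt n times a
   fundamental cell, and the number of images of K in GL(T) is bounded: U has finite index in K.

   Elements of U act trivially on V_F, V^F / V_F and V / V^F.  A commutator moves points along
   lines, which C does not contain, so U is commutative, sigma = log is additive and 2 log
   embeds U in a group of integral matrices.  Finally k_u j_u = (u - 1)^2 is the leading term of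
   u^n, so it maps C^ to C^. *)

(* Two obstacles shape the argument. This count is monotone in X for the order defined by C^, it is
   unchanged by Gamma, and a dilation multiplies it by a bounded factor, so it plays the part of the
   characteristic function of the cone. The second obstacle is that O is invariant under translation
   by V^F, so positivity on O says nothing about T. The group K is visible on T only through the
   multiple of f needed to bring a point of O back into C; this is why a parameter n accompanies
   every estimate on T, and why the constants must not depend on it. *)
Require Import Defs.
From mathcomp.multinomials Require Import freeg.
From HB Require Import structures.
From mathcomp Require Import all_boot all_order all_algebra.
From mathcomp Require Import boolp classical_sets functions cardinality.
From mathcomp Require Import reals topology normedtype.
From mathcomp Require Import ring lra zify.

Set Implicit Arguments.
Unset Strict Implicit.
Unset Printing Implicit Defensive.

Import Order.TTheory GRing.Theory Num.Theory.
Local Open Scope classical_set_scope.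
Local Open Scope ring_scope.

(** * Linear identities *)

Section LinearIdentities.
Variables (K : comPzRingType) (V : lmodType K).

Inductive vexp :=
  | VAtom of nat | VZero | VAdd of vexp & vexp | VOpp of vexp | VScale of K & vexp.

Fixpoint veval (env : seq V) e : V := match e with
  | VAtom n => nth 0 env n
  | VZero => 0
  | VAdd e1 e2 => veval env e1 + veval env e2
  | VOpp e1 => - veval env e1
  | VScale a e1 => a *: veval env e1
  end.

Fixpoint vcoef (e : vexp) (n : nat) : K := match e with
  | VAtom m => if eqn m n then 1 else 0
  | VZero => 0
  | VAdd e1 e2 => vcoef e1 n + vcoef e2 n
  | VOpp e1 => - vcoef e1 n
  | VScale a e1 => a * vcoef e1 n
  end.

Lemma vevalE env e : veval env e = \sum_(i < size env) vcoef e i *: env`_i.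
Proof.
elim: e => [n||e1 IH1 e2 IH2|e1 IH1|a e1 IH1] /=.
- have [ln|ln] := ltnP n (size env); last first.
    rewrite nth_default // big1 // => i _.
    have -> : eqn n i = false 
      by apply/negbTE/eqP => e; move: ln; rewrite e leqNgt ltn_ord.
    by rewrite scale0r.
  rewrite (bigD1 (Ordinal ln)) //= -[eqn n n]/(n == n) eqxx scale1r big1 ?addr0 //.
  move=> i; rewrite -val_eqE /= eq_sym => /negbTE h.
  by rewrite -[eqn n i]/(n == i) h scale0r.
- by rewrite big1 // => i _; rewrite scale0r.
- by rewrite IH1 IH2 -big_split; apply: eq_bigr => i _; rewrite scalerDl.
- by rewrite IH1 -sumrN; apply: eq_bigr => i _; rewrite scaleNr.
- by rewrite IH1 scaler_sumr; apply: eq_bigr => i _; rewrite scalerA.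
Qed.

Fixpoint vcoefs_eq e1 e2 n : Prop :=
  if n is m.+1 then vcoef e1 m = vcoef e2 m /\ vcoefs_eq e1 e2 m else True.

Lemma veval_eq env e1 e2 :
  vcoefs_eq e1 e2 (size env) -> veval env e1 = veval env e2.
Proof.
rewrite !vevalE => h; apply: eq_bigr => i _; congr (_ *: _).
by elim: (size env) h i => [_ []//|n IH /= [h1 /IH h2] i]; have [] := unliftP ord_max i;
  [move=> j ->; have := h2 j; rewrite /= /bump leqNgt ltn_ord add0n | move=> ->].
Qed.

End LinearIdentities.

Ltac vmem x l := lazymatch l with
  | @nil _ => constr:(false)
  | cons ?y ?l' => lazymatch x with y => constr:(true) | _ => vmem x l' end
  end.
Ltac vadd x l := lazymatch vmem x l with true => l | false => constr:(cons x l) end.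
Ltac vatoms t l := lazymatch t with
  | @GRing.zero _ => l
  | @GRing.add _ ?x ?y => let l1 := vatoms x l in vatoms y l1
  | @GRing.opp _ ?x => vatoms x l
  | @GRing.scale _ _ _ ?x => vatoms x l
  | _ => vadd t l
  end.
Ltac vfind x l := lazymatch l with
  | cons ?y ?l' => lazymatch x with y => constr:(0%N) | _ => let n := vfind x l' in constr:(n.+1) end
  end.
Ltac vreify K t l := lazymatch t with
  | @GRing.zero _ => constr:(@VZero K)
  | @GRing.add _ ?x ?y => let e1 := vreify K x l in let e2 := vreify K y l in constr:(@VAdd K e1 e2)
  | @GRing.opp _ ?x => let e1 := vreify K x l in constr:(@VOpp K e1)
  | @GRing.scale _ _ ?a ?x => let e1 := vreify K x l in constr:(@VScale K a e1)
  | _ => let n := vfind t l in constr:(@VAtom K n)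
  end.

(* [lmod K] reduces an identity between linear combinations of vectors to the
   equalities of coefficients. *)
Ltac lmod_goals K := lazymatch goal with |- @eq ?T ?t ?u =>
  let l0 := vatoms t constr:(@nil T) in let l := vatoms u l0 in
  let e1 := vreify K t l in let e2 := vreify K u l in
  apply: (@veval_eq _ _ l e1 e2); cbn [vcoefs_eq vcoef size eqn]; do ?split
  end.
Ltac lmod K := lmod_goals K; (trivial; ring).
Ltac lmod_field K :=
  lmod_goals K; field; do ?(apply/andP; split); first [done | apply: lt0r_neq0; first [assumption | lra]].

(** * Sequences, well-quasi-orders and pigeonholes *)

Definition increasing (s : nat -> nat) := forall i j, (i < j)%N -> (s i < s j)%N.

Lemma increasingS (s : nat -> nat) :
  (forall i, (s i < s i.+1)%N) -> increasing s.
Proof.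
move=> sS i j; elim: j => // j IH; rewrite ltnS leq_eqVlt => /orP[/eqP -> //|].
by move/IH => h; exact: ltn_trans h (sS j).
Qed.

Lemma increasing_comp s t : increasing s -> increasing t -> increasing (s \o t).
Proof. by move=> hs ht i j /ht/hs. Qed.

Lemma increasing_le s i j : increasing s -> (i <= j)%N -> (s i <= s j)%N.
Proof. by move=> hs; rewrite leq_eqVlt => /orP[/eqP -> //|/hs/ltnW]. Qed.

Lemma increasing_ge s n : increasing s -> (n <= s n)%N.
Proof. by move=> hs; elim: n => // n /leq_ltn_trans; apply; exact: hs. Qed.

Lemma frequently_subseq (P : nat -> Prop) :
  (forall n, exists2 k, (n <= k)%N & P k) ->
  exists2 s, increasing s & forall n, P (s n).
Proof.
move=> h; have /choice[f hf] : forall n, exists k, (n <= k)%N /\ P k.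
  by move=> n; have [k ? ?] := h n; exists k.
exists (fun n => iter n (fun m => f m.+1) (f 0%N)).
  by apply: increasingS => i /=; exact: (hf _).1.
by case=> [|n] /=; exact: (hf _).2.
Qed.

Lemma const_subseq (I : finType) (f : nat -> I) :
  exists2 s, increasing s & forall n, f (s n) = f (s 0%N).
Proof.
have [v hv] : exists v, forall n, exists2 k, (n <= k)%N & f k = v.
  apply: contrapT => /forallNP h.
  have /choice[N hN] : forall v, exists N, forall k, (N <= k)%N -> f k <> v.
    move=> v; have /existsNP[n hn] := h v.
    by exists n => k nk fk; apply: hn; exists k.
  pose M := \max_v N v; apply: (hN (f M) M) => //.
  exact: (leq_bigmax (f M)).
have [s s_inc hs] := frequently_subseq hv.
by exists s => // n; rewrite !hs.
Qed.

Lemma mono_subseq (f : nat -> nat) :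
  exists2 s, increasing s & forall i j, (i <= j)%N -> (f (s i) <= f (s j))%N.
Proof.
have /choice[g hg] : forall n, exists k, (n <= k)%N /\
    forall l, (n <= l)%N -> (f k <= f l)%N.
  move=> n; pose P v := `[< exists2 k, (n <= k)%N & f k = v >].
  have exP : exists v, P v by exists (f n); apply/asboolP; exists n.
  case: (ex_minnP exP) => v /asboolP[k nk <-] hmin; exists k; split=> // l nl.
  by apply: hmin; apply/asboolP; exists l.
pose s n := iter n (fun m => g m.+1) (g 0%N).
have sS i : (s i < s i.+1)%N by exact: (hg _).1.
have s_inc := increasingS sS; exists s => // i j ij.
have := increasing_le s_inc ij; case: i {ij} => [|i] /= h.
  exact: (hg 0%N).2.
by apply: (hg _).2; apply: leq_trans h; exact: (hg _).1.
Qed.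

(** Monotone subsequences are extracted one coordinate at a time, each inside the previous one. *)
Lemma dickson (k : nat) (m : nat -> 'I_k -> nat) :
  exists2 s, increasing s &
    forall i j l, (i <= j)%N -> (m (s i) l <= m (s j) l)%N.
Proof.
suff h (ls : seq 'I_k) : exists2 s, increasing s &
    forall i j l, l \in ls -> (i <= j)%N -> (m (s i) l <= m (s j) l)%N.
  have [s s_inc hs] := h (enum 'I_k); exists s => // i j l.
  by apply: hs; rewrite mem_enum.
elim: ls => [|l ls [s s_inc hs]]; first by exists id.
have [t t_inc ht] := mono_subseq (fun n => m (s n) l).
exists (s \o t); first exact: increasing_comp.
move=> i j l'; rewrite inE => /orP[/eqP ->|l'ls] ij; first exact: ht.
by apply: hs => //; exact: increasing_le.
Qed.

Lemma const_fam_subseq (I : finType) (T : eqType) (A : seq T) (f : nat -> I -> T) :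
  (forall n i, f n i \in A) ->
  exists2 s, increasing s & forall n i, f (s n) i = f (s 0%N) i.
Proof.
move=> fA; pose F n := [ffun i => inord (index (f n i) A) : 'I_(size A).+1].
have [s s_inc hs] := const_subseq F; exists s => // n i.
have /ffunP/(_ i) := hs n; rewrite !ffunE => /(congr1 (@nat_of_ord _)).
rewrite !inordK ?ltnS ?index_size // => e.
have x0 : T by have := fA 0%N i; case: (A).
by rewrite -(nth_index x0 (fA (s n) i)) e nth_index.
Qed.

(* Greedy choice: if no finite subset of [P] covers [P], one builds a sequence
   in [P] no term of which is covered by an earlier one. *)
Lemma finite_cover (T : Type) (P : T -> Prop) (E : T -> T -> Prop) :
  (forall p : nat -> T, (forall n, P (p n)) -> exists i j, (i < j)%N /\ E (p i) (p j)) ->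
  exists (n : nat) (x : 'I_n -> T), (forall i, P (x i)) /\
    forall p, P p -> exists i, E (x i) p.
Proof.
move=> wqo; apply: contrapT => /forallNP noc.
have step (l : seq T) : exists y, (forall i x0, (i < size l)%N -> P (nth x0 l i)) ->
    P y /\ (forall i x0, (i < size l)%N -> ~ E (nth x0 l i) y).
  have [hl|hl] := pselect (forall i x0, (i < size l)%N -> P (nth x0 l i)); last first.
    have [p0|nop] := pselect (exists p, P p).
      by case: p0 => y _; exists y => /hl.
    case: l hl => [|a l] hl; last by exists a.
    by exfalso; apply: hl.
  apply: contrapT => /forallNP hy; apply: (noc (size l)).
  case: l hl hy => [|a l] hl hy.
    have f0 : 'I_0 -> T by case.
    exists f0; split; first by case.
    move=> p Pp; exfalso; apply: (hy p) => _; split=> //.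
  exists (fun i => nth a (a :: l) i); split=> [i|p Pp]; first exact: hl.
  apply: contrapT => /forallNP hE; apply: (hy p) => _; split=> // i x0 il.
  by rewrite (set_nth_default a) //; exact: (hE (Ordinal il)).
have [g hg] := choice step.
pose l n := iter n (fun s => rcons s (g s)) [::].
have szl n : size (l n) = n by elim: n => //= n IH; rewrite size_rcons IH.
have lP n i x0 : (i < n)%N -> P (nth x0 (l n) i).
  elim: n i x0 => // n IH i x0; rewrite ltnS /= nth_rcons szl leq_eqVlt.
  move=> /orP[/eqP ->|lti]; last by rewrite lti; exact: IH.
  by rewrite ltnn eqxx; apply: (hg _ _).1 => j y; rewrite szl; exact: IH.
pose p n := g (l n).
have pE n i x0 : (i < n)%N -> nth x0 (l n) i = p i.
  elim: n => // n IH; rewrite ltnS /= nth_rcons szl leq_eqVlt.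
  by move=> /orP[/eqP ->|lti]; rewrite ?ltnn ?eqxx // lti IH.
have hp n : P (p n) /\ forall i x0, (i < n)%N -> ~ E (nth x0 (l n) i) (p n).
  have [|h1 h2] := hg (l n); first by move=> i x0; rewrite szl; exact: lP.
  by split=> // i x0 lti; apply: h2; rewrite szl.
have [i [j [ij Eij]]] := wqo p (fun n => (hp n).1).
by apply: ((hp j).2 i (p 0%N) ij); rewrite pE.
Qed.

Lemma inj_finite_list (T : eqType) (I : finType) (A : T -> Prop) (f : T -> I) :
  (forall x y, A x -> A y -> f x = f y -> x = y) ->
  exists s : seq T, forall x, A x -> x \in s.
Proof.
move=> f_inj; have [[x0 _]|noA] := pselect (exists x, A x); last first.
  by exists [::] => x Ax; exfalso; apply: noA; exists x.
have /choice[g hg] : forall i, exists y, forall x, A x -> f x = i -> x = y.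
  move=> i; have [[x [Ax fx]]|no] := pselect (exists x, A x /\ f x = i).
    by exists x => y Ay fy; apply: f_inj => //; rewrite fx.
  by exists x0 => x Ax fx; exfalso; apply: no; exists x.
exists (map g (enum I)) => x Ax.
by rewrite (hg (f x) x) //; apply: map_f; rewrite mem_enum.
Qed.

Section IntegerBox.
Variables (R : realType) (m N : nat).

Definition box_code (v : 'I_m -> R) : {ffun 'I_m -> 'I_(N + N).+1} :=
  [ffun i => inord (Num.truncn (v i + N%:R))].

Lemma box_code_inj (v w : 'I_m -> R) :
  (forall i, v i \is a Num.int) -> (forall i, `|v i| <= N%:R) ->
  (forall i, w i \is a Num.int) -> (forall i, `|w i| <= N%:R) ->
  box_code v = box_code w -> forall i, v i = w i.
Proof.
move=> vI vN wI wN /ffunP e i; have := e i; rewrite !ffunE => /(congr1 (@nat_of_ord _)).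
have nat_sh x : x \is a Num.int -> `|x| <= N%:R -> x + N%:R \is a @Num.nat R.
  by move=> xI; rewrite ler_norml natrEint rpredD ?rpred_nat //= => /andP[h _]; lra.
have sh_le x : x \is a Num.int -> `|x| <= N%:R -> (@Num.truncn R (x + N%:R) < (N + N).+1)%N.
  move=> xI xN; have := nat_sh _ xI xN; rewrite natrEtruncn => /eqP xE.
  rewrite ltnS -(ler_nat R) xE natrD lerD2r.
  by apply: le_trans xN; exact: ler_norm.
rewrite !inordK ?sh_le // => te.
have := nat_sh _ (vI i) (vN i); rewrite natrEtruncn => /eqP vE.
have := nat_sh _ (wI i) (wN i); rewrite natrEtruncn => /eqP wE.
by apply: (addIr N%:R); rewrite -vE -wE te.
Qed.

Lemma box_finite_list (T : eqType) (A : T -> Prop) (phi : T -> 'I_m -> R) :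
  (forall x i, A x -> phi x i \is a Num.int /\ `|phi x i| <= N%:R) ->
  (forall x y, A x -> A y -> phi x =1 phi y -> x = y) ->
  exists s : seq T, forall x, A x -> x \in s.
Proof.
move=> hA phi_inj; apply: (inj_finite_list (f := fun x => box_code (phi x))) => x y Ax Ay e.
apply: phi_inj => //; apply: box_code_inj => // i.
- by have [] := hA _ i Ax.
- by have [] := hA _ i Ax.
- by have [] := hA _ i Ay.
- by have [] := hA _ i Ay.
Qed.

Lemma box_const_subseq (phi : nat -> 'I_m -> R) :
  (forall n i, phi n i \is a Num.int /\ `|phi n i| <= N%:R) ->
  exists2 s, increasing s & forall n i, phi (s n) i = phi (s 0%N) i.
Proof.
move=> h; have [s s_inc hs] := const_subseq (fun n => box_code (phi n)).
exists s => // n i; apply: box_code_inj (hs n) i => j.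
- by have [] := h (s n) j.
- by have [] := h (s n) j.
- by have [] := h (s 0%N) j.
- by have [] := h (s 0%N) j.
Qed.

End IntegerBox.

(** * Open convex cones *)

Section OpenCones.
Variables (R : realType) (V : vectType R).
Implicit Types (x y z v w : V) (O : set V) (H : {vspace V}).

(** Openness is asked only along lines. For convex sets in finite dimension this amounts to
    openness, and it can be checked for [Oc] without any topology. *)
Record is_open_cone O : Prop := {
  oc_ne : O !=set0;
  oc_add : forall x y, O x -> O y -> O (x + y);
  oc_scale : forall (a : R) x, 0 < a -> O x -> O (a *: x);
  oc_open : forall x v, O x -> exists2 e : R, 0 < e & O (x + e *: v) }.

(** For an open convex cone, the z with z + O inside O form the topological closure (see
    [closureV_cone]); stability under sums and under the group is then immediate. *)
Definition cone_closure O : set V := [set z | forall x, O x -> O (z + x)].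

Definition dual_of O : set 'Hom(V, R^o) :=
  [set th : 'Hom(V, R^o) | forall x, O x -> 0 <= (th x : R)].

Section Theory.
Variables (O : set V) (hO : is_open_cone O).

Lemma oc_convex x y (t : R) : 0 <= t <= 1 -> O x -> O y -> O ((1 - t) *: x + t *: y).
Proof.
move=> /andP[t0 t1] Ox Oy.
have [->|tn0] := eqVneq t 0; first by rewrite subr0 scale1r scale0r addr0.
have [->|tn1] := eqVneq t 1; first by rewrite subrr scale1r scale0r add0r.
apply: (oc_add hO); apply: (oc_scale hO) => //.
  by rewrite subr_gt0 lt_neqAle tn1.
by rewrite lt_neqAle eq_sym tn0.
Qed.

Lemma oc_open_le x v : O x -> exists2 e : R, 0 < e &
  forall t : R, 0 <= t <= e -> O (x + t *: v).
Proof.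
move=> Ox; have [e e0 Oe] := oc_open hO v Ox; exists e => // t /andP[t0 te].
have -> : x + t *: v = (1 - t / e) *: x + (t / e) *: (x + e *: v).
  rewrite scalerDr scalerA mulfVK ?gt_eqF // addrA -scalerDl subrK.
  by rewrite scale1r.
apply: oc_convex => //; rewrite divr_ge0 ?(ltW e0) //=.
by rewrite ler_pdivrMr // mul1r.
Qed.

Lemma oc_absorb x v : O x ->
  exists n : nat, forall a : R, n%:R <= a -> O (a *: x + v).
Proof.
move=> Ox; have [e e0 Oe] := oc_open_le v Ox.
exists (Num.truncn e^-1).+1 => a na.
have ea : e^-1 < a.
  by apply: lt_le_trans na; have := truncnS_gt (e^-1).
have a0 : 0 < a by apply: lt_trans ea; rewrite invr_gt0.
have -> : a *: x + v = a *: (x + a^-1 *: v).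
  by rewrite scalerDr scalerA mulfV ?gt_eqF // scale1r.
apply: (oc_scale hO) => //; apply: Oe; rewrite invr_ge0 ltW //=.
by rewrite invf_ple ?posrE // ltW.
Qed.

Lemma oc_closureD z x : cone_closure O z -> O x -> O (z + x).
Proof. by move=> h /h. Qed.

Lemma oc_sub_closure x : O x -> cone_closure O x.
Proof. by move=> Ox y; exact: (oc_add hO). Qed.

Lemma clo_add y z : cone_closure O y -> cone_closure O z -> cone_closure O (y + z).
Proof. by move=> hy hz x Ox; rewrite -addrA; apply/hy/hz. Qed.

Lemma clo0 : cone_closure O 0.
Proof. by move=> x; rewrite add0r. Qed.

Lemma clo_scale (a : R) z : 0 <= a -> cone_closure O z -> cone_closure O (a *: z).
Proof.
move=> a0 hz; have [->|an0] := eqVneq a 0; first by rewrite scale0r; exact: clo0.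
have a_gt0 : 0 < a by rewrite lt_neqAle eq_sym an0.
move=> x Ox; have -> : a *: z + x = a *: (z + a^-1 *: x).
  by rewrite scalerDr scalerA mulfV // scale1r.
by apply: (oc_scale hO) => //; apply: hz; apply: (oc_scale hO); rewrite ?invr_gt0.
Qed.

Lemma clo_sum (I : Type) (r : seq I) (P : pred I) (f : I -> V) :
  (forall i, P i -> cone_closure O (f i)) -> cone_closure O (\sum_(i <- r | P i) f i).
Proof.
by move=> h; elim/big_ind: _ => //; [exact: clo0|move=> *; exact: clo_add].
Qed.

(** The points z + p / (n + 1) tend to z: closedness of the cone is used in this form. *)
Lemma clo_lim z p : cone_closure O p ->
  (forall n : nat, cone_closure O (n.+1%:R *: z + p)) -> cone_closure O z.
Proof.
move=> clp h x Ox; have [n hn] := oc_absorb (- p) Ox.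
have -> : z + x = n.+1%:R^-1 *: ((n.+1%:R *: z + p) + (n.+1%:R *: x - p)).
  rewrite addrACA subrr addr0 -scalerDr scalerA mulVf ?scale1r //.
  by rewrite pnatr_eq0.
apply: (oc_scale hO); first by rewrite invr_gt0 ltr0Sn.
by apply: h; apply: hn; rewrite ler_nat.
Qed.

(** A version of [oc_absorb] uniform in the coefficients: one n serves the whole unit cube, so that
    a large multiple of x stays in O after rounding to the lattice. *)
Lemma oc_absorb_fam (I : Type) (r : seq I) (f : I -> V) x : O x ->
  exists n : nat, forall (a : R) (c : I -> R), n%:R <= a ->
    (forall i, `|c i| <= 1) -> O (a *: x + \sum_(i <- r) c i *: f i).
Proof.
move=> Ox; elim: r => [|i r [n hn]].
  exists 1%N => a c a1 _; rewrite big_nil addr0; apply: (oc_scale hO) => //.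
  exact: lt_le_trans a1.
have [n1 h1] := oc_absorb (f i) Ox; have [n2 h2] := oc_absorb (- f i) Ox.
exists (n1 + n2 + n)%N => a c; rewrite big_cons !natrD => na hc.
have a1 : n1%:R + n2%:R <= a - n%:R by rewrite lerBrDr.
have -> : a *: x + (c i *: f i + \sum_(j <- r) c j *: f j) =
   ((a - n%:R) *: x + c i *: f i) + (n%:R *: x + \sum_(j <- r) c j *: f j).
  by rewrite addrACA -scalerDl subrK.
apply: (oc_add hO); last exact: hn.
have /andP[l1 l2] : -1 <= c i <= 1 by rewrite -ler_norml.
have -> : (a - n%:R) *: x + c i *: f i =
  (1 - (1 + c i) / 2) *: ((a - n%:R) *: x - f i) +
  ((1 + c i) / 2) *: ((a - n%:R) *: x + f i).
  by lmod_goals R; field.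
apply: oc_convex.
- by apply/andP; split; lra.
- by apply: h2; have := ler0n R n1; lra.
- by apply: h1; have := ler0n R n2; lra.
Qed.

End Theory.

Lemma hom_sep H a : a \notin H ->
  exists2 th : 'Hom(V, R^o), th a = 1 & forall h, h \in H -> th h = 0.
Proof.
move=> aH; pose X := in_tuple (a :: vbasis H).
have frX : free X.
  by rewrite /= free_cons (span_basis (vbasisP H)) aH (basis_free (vbasisP H)).
pose th : 'Hom(V, R^o) := linfun (coord X ord0 : V -> R^o).
exists th.
  rewrite lfunE /= -[a in coord _ _ a]/(X`_(ord0 : 'I_(size (a :: vbasis H)))).
  by rewrite coord_free.
move=> h /coord_vbasis ->; rewrite linear_sum big1 // => i _.
rewrite linearZ /= lfunE /=.
have il : (i.+1 < size (a :: vbasis H))%N by rewrite /= ltnS size_tuple ltn_ord.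
have -> : (vbasis H)`_i = X`_(Ordinal il) by [].
by rewrite coord_free //= scaler0.
Qed.

(* The set of [w] such that [O] meets [w + H], for [H] a maximal subspace
   disjoint from [O], is an open half-space. *)
Lemma oc_separation O : is_open_cone O -> ~ O 0 ->
  exists th : 'Hom(V, R^o), forall x, O x -> 0 < (th x : R).
Proof.
move=> hO O0.
pose P n := `[< exists H, (forall h, h \in H -> ~ O h) /\ \dim H = n >].
have exP : exists n, P n.
  by exists 0%N; apply/asboolP; exists 0%VS; rewrite dimv0; split=> // h; rewrite memv0 => /eqP ->.
have bP n : P n -> (n <= \dim {:V})%N.
  by move=> /asboolP[H [_ <-]]; exact: dimvS (subvf H).
case: (ex_maxnP exP bP) => m /asboolP[H [HO dimH]] maxm {exP bP}.
have Hmax w : w \notin H -> exists2 h, h \in H & O (h + w) \/ O (h - w).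
  move=> wH; apply: contrapT => /forall2NP hw.
  have lt : (\dim H < \dim (H + <[w]>)%VS)%N.
    rewrite ltnNge; apply/negP => le; move/negP: wH; apply.
    have := dimv_leqif_eq (addvSl H <[w]>%VS); move=> [l1 l2].
    have /eqP -> : H == (H + <[w]>)%VS by rewrite -l2 eqn_leq l1 le.
    by rewrite (subvP (addvSr _ _)) ?memv_line.
  suff : (\dim (H + <[w]>)%VS <= m)%N by rewrite -dimH leqNgt lt.
  apply: maxm; apply/asboolP; exists (H + <[w]>)%VS; split=> // v.
  case/memv_addP => h hH [u /vlineP[c ->] ->] Ohcw.
  have [c0|c0|c0] := ltrgt0P c.
  - have [//|[]] := hw (c^-1 *: h); first by rewrite memvZ.
    left; have := oc_scale hO _ Ohcw; move/(_ c^-1); rewrite invr_gt0 c0.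
    by rewrite scalerDr scalerA mulVf ?gt_eqF // scale1r; exact.
  - have [//|[]] := hw ((- c)^-1 *: h); first by rewrite memvZ.
    right; have := oc_scale hO _ Ohcw; move/(_ (- c)^-1).
    rewrite invr_gt0 oppr_gt0 c0 scalerDr scalerA invrN mulNr mulVf ?lt_eqF //.
    by rewrite scaleN1r; exact.
  - by move: Ohcw; rewrite c0 scale0r addr0; exact: HO.
pose Pw w := exists2 h, h \in H & O (h + w).
have PwN w : Pw w -> Pw (- w) -> False.
  move=> [h hH Oh] [k kH Ok]; apply: (HO (h + k)); first exact: memvD.
  by have := oc_add hO Oh Ok; rewrite addrACA subrr addr0.
have [a Oa] := oc_ne hO.
have aH : a \notin H by apply/negP => /HO.
have Pa : Pw a by exists 0; rewrite ?mem0v ?add0r.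
(* The segment w from a to c misses H because c lies outside H + <a>. Each of its points satisfies
   Pw (w t) or Pw (- w t), two exclusive open conditions, so c is on the side of a; the supremum of
   S replaces connectedness. Applied to v and - v, this forces H + <a> to be the whole space. *)
have key c : c \notin (H + <[a]>)%VS -> Pw c.
  move=> cH; pose w (t : R) := a + t *: (c - a).
  have wH t : w t \notin H.
    apply/negP => wt; have [t0|t0] := eqVneq t 0.
      by move: wt; rewrite /w t0 scale0r addr0; exact/negP.
    move/negP: cH; apply.
    have -> : c = t^-1 *: w t + (1 - t^-1) *: a.
      by rewrite /w; lmod_goals R; field.
    by rewrite memv_add ?memvZ // memv_line.
  have wD t s : w (t + s) = w t + s *: (c - a) by rewrite /w scalerDl addrA.
  have Pdich t : Pw (w t) \/ Pw (- w t).
    by have [h hH [|]] := Hmax _ (wH t); [left|right]; exists h.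
  have Popen t : Pw (w t) -> exists2 e : R, 0 < e & forall s, 0 <= s <= e -> Pw (w (t + s)).
    move=> [h hH Oh]; have [e e0 he] := oc_open_le hO (c - a) Oh.
    by exists e => // s /he; rewrite -addrA -wD; exists h.
  have PopenN t : Pw (- w t) -> exists2 e : R, 0 < e & forall s, 0 <= s <= e -> Pw (- w (t - s)).
    move=> [h hH Oh]; have [e e0 he] := oc_open_le hO (c - a) Oh.
    exists e => // s /he; rewrite wD scaleNr opprB addrAC -addrA.
    by rewrite [_ - w t]addrC; exists h.
  pose S := [set t : R | 0 <= t <= 1 /\ Pw (w t)].
  have S0 : S 0 by split; rewrite ?lexx ?ler01 // /w scale0r addr0.
  have Sub : has_sup S by split; [exists 0|exists 1 => t [/andP[]]].
  pose t0 := sup S.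
  have t00 : 0 <= t0 by exact: (ub_le_sup Sub.2 S0).
  have t01 : t0 <= 1 by apply: (ge_sup Sub.1) => t [/andP[]].
  have [Pt0|Nt0] := Pdich t0.
    have [t1|t1] := leP 1 t0.
      have -> : c = w 1 by rewrite /w scale1r addrC subrK.
      by have /eqP <- : t0 == 1 by rewrite eq_le t01.
    have [e e0 he] := Popen _ Pt0.
    pose s := Num.min e (1 - t0).
    have s0 : 0 < s by rewrite lt_min e0 subr_gt0.
    have : S (t0 + s).
      split; first by rewrite addr_ge0 ?(ltW s0) //= -lerBrDl ge_min lexx orbT.
      by apply: he; rewrite (ltW s0) ge_min lexx.
    by move/(ub_le_sup Sub.2); rewrite -/t0 gerDl leNgt s0.
  have [e e0 he] := PopenN _ Nt0.
  have [t [t01' Pt] tt0] := sup_adherent e0 Sub.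
  have ttle : t <= t0 by exact: (ub_le_sup Sub.2).
  exfalso; apply: (PwN (w t)) => //.
  have -> : t = t0 - (t0 - t) by rewrite opprB addrC subrK.
  by apply: he; rewrite subr_ge0 ttle lerBlDl -lerBlDr ltW.
have full v : v \in (H + <[a]>)%VS.
  apply/negPn/negP => vH; apply: (PwN v); apply: key => //.
  by rewrite memvN.
have [th tha thH] := hom_sep aH; exists th => x Ox.
have /memv_addP[h hH [u /vlineP[t ->] xE]] := full x.
rewrite xE linearD linearZ /= thH // add0r tha /GRing.scale /= mulr1.
rewrite ltNge; apply/negP => t0.
suff : O h by exact: HO.
have [tz|tn0] := eqVneq t 0; first by move: Ox; rewrite xE tz scale0r addr0.
have := oc_add hO Ox (oc_scale hO (a := - t) _ Oa).
by rewrite xE -addrA scaleNr subrr addr0; apply; rewrite oppr_gt0 lt_neqAle tn0.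
Qed.

End OpenCones.

(** * Lattices and integral linear forms *)

Section LinearForms.
Variables (K : fieldType) (V : vectType K) (th : 'Hom(V, K^o)).

Lemma homD u v : th (u + v) = th u + th v :> K. Proof. by rewrite linearD. Qed.
Lemma homB u v : th (u - v) = th u - th v :> K. Proof. by rewrite linearB. Qed.
Lemma homZ (a : K) u : th (a *: u) = a * th u :> K. Proof. by rewrite linearZ. Qed.
Lemma hom0 : th 0 = 0 :> K. Proof. by rewrite linear0. Qed.
Lemma hom_sum (I : Type) (r : seq I) (P : pred I) (f : I -> V) :
  th (\sum_(i <- r | P i) f i) = \sum_(i <- r | P i) (th (f i) : K) :> K.
Proof. by rewrite linear_sum. Qed.

End LinearForms.

(** This is [oc_separation] for the cone of all o - a p with a >= 0, which misses 0. A form positive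
    on it cannot be positive at p, since a multiple of p would then cancel its value at x. *)
Lemma oc_separation_point (R : realType) (V : vectType R) (O : set V) (p : V) :
  is_open_cone O -> ~ O p ->
  exists2 th : 'Hom(V, R^o), (forall x, O x -> 0 < (th x : R)) & (th p : R) <= 0.
Proof.
move=> hO Op; have O0 : ~ O 0.
  move=> O0; apply: Op; have [n hn] := oc_absorb hO p O0.
  by have := hn n%:R (lexx _); rewrite scaler0 add0r.
pose O' := [set z | exists (o : V) (a : R), [/\ O o, 0 <= a & z = o - a *: p]].
have hO' : is_open_cone O'.
  have [x Ox] := oc_ne hO; split.
  - by exists x, x, 0; rewrite scale0r subr0.
  - move=> _ _ [o [a [Oo a0 ->]]] [o' [a' [Oo' a'0 ->]]].
    exists (o + o'), (a + a'); split; [exact: (oc_add hO)|exact: addr_ge0|].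
    by lmod R.
  - move=> c _ c0 [o [a [Oo a0 ->]]]; exists (c *: o), (c * a).
    by split; [exact: (oc_scale hO)|exact: mulr_ge0 (ltW c0) a0|lmod R].
  - move=> _ v [o [a [Oo a0 ->]]]; have [e e0 Oe] := oc_open hO v Oo.
    by exists e => //; exists (o + e *: v), a; split=> //; lmod R.
have O'0 : ~ O' 0.
  move=> [o [a [Oo a0 /esym/eqP]]]; rewrite subr_eq0 => /eqP oE.
  move: a0; rewrite le_eqVlt => /orP[/eqP a0|a0].
    by apply: O0; rewrite oE -a0 scale0r in Oo.
  apply: Op; have -> : p = a^-1 *: o by rewrite oE scalerA mulVf ?gt_eqF // scale1r.
  by apply: (oc_scale hO); rewrite ?invr_gt0.
have [th hth] := oc_separation hO' O'0; exists th.
  by move=> x Ox; apply: hth; exists x, 0; rewrite scale0r subr0.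
have [x Ox] := oc_ne hO; rewrite leNgt; apply/negP => thp.
have : O' (x - (th x / th p) *: p).
  exists x, (th x / th p); split=> //; rewrite divr_ge0 ?ltW //.
  by apply: hth; exists x, 0; rewrite scale0r subr0.
by move/hth; rewrite homB homZ mulfVK ?gt_eqF // subrr ltxx.
Qed.

Lemma hom_span (K : fieldType) (V : vectType K) (ds : seq 'Hom(V, K^o)) (eta : 'Hom(V, K^o)) :
  (forall v, (forall d, d \in ds -> d v = 0) -> eta v = 0) ->
  exists c : nat -> K, forall v, eta v = \sum_(i < size ds) c i * (ds`_i v : K).
Proof.
elim: ds eta => [|d ds IH] eta h.
  by exists (fun=> 0) => v; rewrite big_ord0 h.
have [hd|/existsNP[v0 /not_implyP[ds0 /eqP d0]]] :=
    pselect (forall v, (forall d', d' \in ds -> d' v = 0) -> d v = 0).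
  have [|c hc] := IH eta.
    move=> v hv; apply: h => d'; rewrite inE => /orP[/eqP ->|]; last exact: hv.
    exact: hd.
  exists (fun n => if n is m.+1 then c m else 0) => v.
  by rewrite hc /= big_ord_recl mul0r add0r.
have [|c hc] := IH (eta - (eta v0 / d v0 : K) *: d).
  move=> v hv; rewrite add_lfunE opp_lfunE scale_lfunE.
  have /h : forall d', d' \in d :: ds -> d' (v - (d v / d v0) *: v0) = 0.
    move=> d'; rewrite inE homB homZ => /orP[/eqP ->|d'ds].
      by rewrite mulfVK // subrr.
    by rewrite (hv _ d'ds : d' v = 0 :> K) (ds0 _ d'ds : d' v0 = 0 :> K) mulr0 subr0.
  rewrite homB homZ => /eqP; rewrite subr_eq0 => /eqP ->.
  by rewrite /GRing.scale /=; field.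
exists (fun n => if n is m.+1 then c m else eta v0 / d v0) => v.
have := hc v; rewrite add_lfunE opp_lfunE scale_lfunE big_ord_recl /= => <-.
by rewrite /GRing.scale /= addrC subrK.
Qed.

Section Lattice.
Variables (R : realType) (V : vectType R) (b : seq V) (hb : basis_of {:V} b).
Let Lat := int_span b.
Implicit Types (v w : V).

Definition crd (i : 'I_(size b)) v : R := coord (in_tuple b) i v.

Definition crdf (i : 'I_(size b)) : 'Hom(V, R^o) :=
  linfun (coord (in_tuple b) i : V -> R^o).

Lemma crdfE i v : crdf i v = crd i v.
Proof. by rewrite lfunE. Qed.

Lemma crdE v : v = \sum_(i < size b) crd i v *: b`_i.
Proof. by exact: (@coord_basis _ _ _ _ (in_tuple b) v hb (memvf v)). Qed.

Lemma crd_sumE (c : 'I_(size b) -> R) i : crd i (\sum_(j < size b) c j *: b`_j) = c i.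
Proof. by apply: (coord_sum_free (X := in_tuple b)); exact: basis_free hb. Qed.

Lemma crdD i v w : crd i (v + w) = crd i v + crd i w.
Proof. exact: raddfD. Qed.

Lemma crdZ i (a : R) v : crd i (a *: v) = a * crd i v.
Proof. by rewrite /crd linearZ. Qed.

Lemma latP v : Lat v <-> forall i, crd i v \is a Num.int.
Proof.
split=> [[z _ <-] i|h]; first by rewrite crd_sumE.
have /choice[z hz] : forall i, exists z : int, crd i v = z%:~R by move=> i; apply/intrP.
by exists z => //=; rewrite [RHS]crdE; apply: eq_bigr => i _; rewrite hz.
Qed.

Lemma lat0 : Lat 0.
Proof. by apply/latP => i; rewrite /crd linear0 rpred0. Qed.

Lemma latD v w : Lat v -> Lat w -> Lat (v + w).
Proof. by move=> /latP hv /latP hw; apply/latP => i; rewrite crdD rpredD. Qed.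

Lemma latZ (a : R) v : a \is a Num.int -> Lat v -> Lat (a *: v).
Proof. by move=> ha /latP hv; apply/latP => i; rewrite crdZ rpredM. Qed.

Lemma latN v : Lat v -> Lat (- v).
Proof. by move=> hv; rewrite -scaleN1r; apply: latZ; rewrite // rpredN rpred1. Qed.

Lemma latB v w : Lat v -> Lat w -> Lat (v - w).
Proof. by move=> hv hw; apply/latD/latN. Qed.

Lemma latZn (n : nat) v : Lat v -> Lat (n%:R *: v).
Proof. by apply: latZ; rewrite rpred_nat. Qed.

Lemma lat_sum (I : Type) (r : seq I) (P : pred I) (f : I -> V) :
  (forall i, P i -> Lat (f i)) -> Lat (\sum_(i <- r | P i) f i).
Proof. by move=> h; elim/big_ind: _ => //; [exact: lat0|move=> *; exact: latD]. Qed.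

Lemma lat_basis i : (i < size b)%N -> Lat b`_i.
Proof.
move=> ib; apply/latP => j.
by have := @coord_free _ _ _ (in_tuple b) (Ordinal ib) j (basis_free hb); rewrite /crd /= => ->; rewrite rpred_nat.
Qed.

Definition intform (th : 'Hom(V, R^o)) := forall v, Lat v -> (th v : R) \is a Num.int.

Definition lat_round v : V := \sum_(i < size b) (Num.floor (crd i v))%:~R *: b`_i.

Lemma lat_roundP v : Lat (lat_round v).
Proof. by apply: lat_sum => i _; apply: latZ; [exact: intr_int|exact: lat_basis]. Qed.

Lemma lat_round_err v : exists2 c : 'I_(size b) -> R, forall i, 0 <= c i <= 1 &
  v - lat_round v = \sum_(i < size b) c i *: b`_i.
Proof.
exists (fun i => crd i v - (Num.floor (crd i v))%:~R) => [i|].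
  have := floor_itv (crd i v); rewrite intrD => /andP[l1 l2].
  by apply/andP; split; lra.
rewrite {1}[v]crdE -sumrB; apply: eq_bigr => i _; rewrite scalerBl //.
Qed.

(** When x is added to the span, an equation e0 with e0 x <> 0 is eliminated: every e becomes (e0 x)
    e - (e x) e0, which is still integral because x is a lattice vector. *)
Lemma lat_equations (s : seq V) : (forall x, x \in s -> Lat x) ->
  exists2 es : seq 'Hom(V, R^o), forall e, e \in es -> intform e &
    forall v, v \in <<s>>%VS <-> forall e, e \in es -> e v = 0.
Proof.
elim: s => [_|x s IH hs].
  exists [seq crdf i | i <- enum 'I_(size b)].
    by move=> _ /mapP[i _ ->] v /latP/(_ i); rewrite lfunE.
  move=> v; rewrite span_nil memv0; split=> [/eqP -> e _|h]; first by rewrite linear0.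
  apply/eqP; rewrite [v]crdE big1 // => i _.
  have := h (crdf i); rewrite crdfE => -> //.
    by rewrite scale0r.
  by apply/mapP; exists i => //; rewrite mem_enum.
have [es hes esP] := IH (fun y ys => hs y (mem_behead (s := x :: s) ys)).
have Lx : Lat x by apply: hs; rewrite mem_head.
have [xs|/existsNP[e0 /not_implyP[e0s /eqP e0x]]] := pselect (forall e, e \in es -> e x = 0).
  exists es => // v; rewrite -esP span_cons.
  suff /addv_idPr -> : (<[x]> <= <<s>>)%VS by [].
  by rewrite -memvE; apply/esP.
pose F (e : 'Hom(V, R^o)) : 'Hom(V, R^o) := (e0 x : R) *: e - (e x : R) *: e0.
have FE e v : F e v = (e0 x : R) * e v - (e x : R) * e0 v.
  by rewrite add_lfunE opp_lfunE !scale_lfunE.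
exists (map F es).
  move=> _ /mapP[e ees ->] v Lv; rewrite FE.
  by rewrite rpredB // rpredM // ?hes.
move=> v; rewrite span_cons; split.
  move=> /memv_addP[u /vlineP[c ->] [w /esP hw ->]] _ /mapP[e ees ->].
  rewrite FE !homD !homZ !hw // !addr0.
  by ring.
move=> h; have -> : v = (e0 v / e0 x : R) *: x + (v - (e0 v / e0 x : R) *: x).
  by rewrite addrC subrK.
apply: memv_add; first by rewrite memvZ // memv_line.
apply/esP => e ees; have /eqP := h (F e) (map_f F ees).
rewrite FE subr_eq0 => /eqP eE; rewrite homB homZ.
by apply: (mulfI e0x); rewrite mulr0 mulrBr eE; field.
Qed.

(* A real form of [dual_of O] is rounded inside [dual_of O] because the forms
   vanishing on [V'] are differences of elements of [dual_of O]. *)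
Lemma rational_dual (O : set V) (V' : {vspace V}) (s : seq V) :
  is_open_cone O ->
  (forall v, v \in V' <-> forall x (t : R), O x -> O (x + t *: v)) ->
  (forall x, x \in s -> Lat x) -> V' = <<s>>%VS ->
  exists ths : seq 'Hom(V, R^o), [/\ forall th, th \in ths -> intform th,
    forall th, th \in ths -> dual_of O th &
    forall v, v \in V' <-> forall th, th \in ths -> th v = 0].
Proof.
move=> hO V'P sL V'E.
have dualV' th v : dual_of O th -> v \in V' -> th v = 0.
  move=> Dth /V'P hv; have [x Ox] := oc_ne hO; apply: contrapT => /eqP thv.
  have := Dth _ (hv x (- (th x + 1) / th v) Ox).
  rewrite homD homZ mulfVK // opprD addrA subrr add0r.
  by rewrite ler0N1.
have sepV' v : v \notin V' -> exists2 th, dual_of O th & th v != 0.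
  move=> vV'; have : ~ forall x (t : R), O x -> O (x + t *: v) by move/V'P; exact/negP.
  move=> /existsNP[x /existsNP[t /not_implyP[Ox Oxt]]].
  have [th th0 thp] := oc_separation_point hO Oxt; exists th.
    by move=> y /th0/ltW.
  apply/eqP => thv; move: thp; rewrite homD homZ thv mulr0 addr0.
  by rewrite leNgt th0.
have [ds dsD dsV'] : exists2 ds : seq 'Hom(V, R^o), forall d, d \in ds -> dual_of O d &
    forall v, (forall d, d \in ds -> d v = 0) -> v \in V'.
  pose P n := `[< exists2 ds : seq 'Hom(V, R^o), (forall d, d \in ds -> dual_of O d) &
     \dim (common_zeros [set` ds]) = n >].
  have exP : exists n, P n.
    by exists (\dim (common_zeros [set` ([::] : seq 'Hom(V, R^o))])); apply/asboolP; exists [::].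
  case: (ex_minnP exP) => n /asboolP[ds dsD dsn] minn; exists ds => // v hv.
  apply/negPn/negP => /sepV'[th thD thv].
  have sub : (common_zeros [set` th :: ds] <= common_zeros [set` ds])%VS.
    apply/subvP => w /common_zerosP hw; apply/common_zerosP => d dd.
    by apply: hw; rewrite /= inE (dd : d \in ds) orbT.
  have [] := dimv_leqif_eq sub; rewrite dsn => le eqE.
  have : P (\dim (common_zeros [set` th :: ds])).
    apply/asboolP; exists (th :: ds) => // d; rewrite inE => /orP[/eqP ->//|].
    exact: dsD.
  move/minn => ge; move: eqE; rewrite eqn_leq le ge /= => /esym/eqP e.
  have : v \in common_zeros [set` ds] by apply/common_zerosP => d; exact: hv.
  rewrite -e => /common_zerosP/(_ th); rewrite /= mem_head => /(_ isT) /eqP.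
  by rewrite (negbTE thv).
have [es esI esV'] := lat_equations sL; rewrite -V'E in esV'.
have esds (e : 'Hom(V, R^o)) : e \in es -> exists c : nat -> R, forall v, e v = \sum_(i < size ds) c i * (ds`_i v : R).
  by move=> ees; apply: hom_span => v /dsV' /esV'; apply.
have /choice[c hc] : forall j : 'I_(size es), exists c : nat -> R,
    forall v, es`_j v = \sum_(i < size ds) c i * (ds`_i v : R).
  by move=> j; apply: esds; rewrite mem_nth.
(* M dominates all coefficients of the [es] in terms of the [ds]. Hence [ths] plus any combination
   of the [es] with coefficients in [-1, 1] still has nonnegative coefficients on the [ds]; this is
   [perturb]. *)
pose M : R := \sum_(j < size es) \sum_(i < size ds) `|c j i|.
pose ths : 'Hom(V, R^o) := M *: \sum_(i < size ds) ds`_i.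
have thsE v : ths v = \sum_(i < size ds) M * (ds`_i v : R).
  by rewrite scale_lfunE sum_lfunE scaler_sumr.
have perturb (x : V) (eps : 'I_(size es) -> R) : O x -> (forall j, `|eps j| <= 1) ->
    0 <= (ths x : R) + \sum_(j < size es) eps j * (es`_j x : R).
  move=> Ox heps; rewrite thsE.
  have -> : \sum_(j < size es) eps j * (es`_j x : R) =
      \sum_(i < size ds) (\sum_(j < size es) eps j * c j i) * (ds`_i x : R).
    under [RHS]eq_bigr do rewrite mulr_suml.
    rewrite exchange_big /=; apply: eq_bigr => j _; rewrite hc mulr_sumr.
    by apply: eq_bigr => i _; rewrite mulrA.
  rewrite -big_split /=; apply: sumr_ge0 => i _; rewrite -mulrDl.
  apply: mulr_ge0; last by apply: dsD; rewrite ?mem_nth.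
  rewrite -lerBlDr sub0r; apply: le_trans (_ : `|\sum_j eps j * c j i| <= _).
    by rewrite -normrN ler_norm.
  apply: le_trans (ler_norm_sum _ _ _) _; apply: ler_sum => j _.
  rewrite normrM; apply: le_trans (_ : `|c j i| <= _).
    by rewrite ler_piMl.
  by rewrite (bigD1 i) //= lerDl sumr_ge0.
have [a ha] : exists a : nat -> R, forall v, ths v = \sum_(j < size es) a j * (es`_j v : R).
  apply: hom_span => v /esV' vV'; rewrite thsE big1 // => i _.
  have -> : ds`_i v = 0 :> R by apply: dualV' => //; apply: dsD; rewrite mem_nth.
  by rewrite mulr0.
(* Rounding is applied to 2 [ths]: one copy of [ths] absorbs the rounding error, the other absorbs
   the extra summand e in [th0D]. *)
pose th0 : 'Hom(V, R^o) := \sum_(j < size es) (Num.floor (2 * a j))%:~R *: es`_j.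
have th0E v : th0 v = \sum_(j < size es) (Num.floor (2 * a j))%:~R * (es`_j v : R).
  by rewrite sum_lfunE; apply: eq_bigr => j _; rewrite scale_lfunE.
have th0I : intform th0.
  move=> v Lv; rewrite th0E rpred_sum // => j _; apply: rpredM; first exact: intr_int.
  by apply: esI => //; rewrite mem_nth.
have th0D (e : 'Hom(V, R^o)) : e = 0 \/ e \in es -> dual_of O (th0 + e).
  move=> he x Ox; rewrite add_lfunE th0E.
  have p1 := perturb x (fun j => (Num.floor (2 * a j))%:~R - 2 * a j) Ox.
  have {}p1 : 0 <= 2 * (ths x : R) + \sum_(j < size es) ((Num.floor (2 * a j))%:~R - 2 * a j) * (es`_j x : R)
       - (ths x : R).
    have := p1 _; rewrite mulr2n mulrDl mul1r addrAC addrK; apply => j.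
    have /andP[l1 l2] := floor_itv (2 * a j); rewrite intrD in l2.
    by rewrite ler_norml; apply/andP; split; lra.
  have p2 : 0 <= (ths x : R) + (e x : R).
    case: he => [->|ees].
      rewrite zero_lfunE addr0; have := perturb x (fun=> 0) Ox.
      by rewrite big1 ?addr0 => [|j _]; [apply => j; rewrite normr0 ler01|rewrite mul0r].
    have ie : (index e es < size es)%N by rewrite index_mem.
    have := perturb x (fun j => (j == Ordinal ie)%:R) Ox.
    rewrite (bigD1 (Ordinal ie)) //= eqxx mul1r nth_index // big1 ?addr0.
      by apply => j; case: eqP; rewrite ?normr1 ?normr0 ?ler01.
    by move=> j /negbTE ->; rewrite mul0r.
  have e2 : 2 * (ths x : R) = \sum_(j < size es) 2 * a j * (es`_j x : R).
    by rewrite ha mulr_sumr; apply: eq_bigr => j _; rewrite mulrA.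
  move: p1; rewrite e2 -big_split /=.
  under eq_bigr do rewrite mulrBl addrC subrK.
  by move=> p1; have := addr_ge0 p1 p2; rewrite addrA subrK.
exists (th0 :: [seq th0 + e | e <- es]); split.
- move=> th; rewrite inE => /orP[/eqP ->//|/mapP[e ees ->]] v Lv.
  by rewrite add_lfunE; apply: rpredD; [exact: th0I|exact: esI].
- move=> th; rewrite inE => /orP[/eqP ->|/mapP[e ees ->]]; last by apply: th0D; right.
  by rewrite -[th0]addr0; apply: th0D; left.
- move=> v; split.
    move=> vV' th; rewrite inE => /orP[/eqP ->|/mapP[e ees ->]].
      by rewrite -[th0]addr0; apply: dualV' => //; apply: th0D; left.
    by apply: dualV' => //; apply: th0D; right.
  move=> h; apply/esV' => e ees.
  have := h (th0 + e); rewrite inE map_f ?orbT // => /(_ isT).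
  by rewrite add_lfunE h ?mem_head // add0r.
Qed.

End Lattice.

(** * Lattice cones with a face *)

Section GLTheory.
Variables (K : fieldType) (V : vectType K).
Implicit Types (g h : GL V) (x y : V).

Lemma GLD g x y : g (x + y) = g x + g y. Proof. exact: raddfD. Qed.
Lemma GLB g x y : g (x - y) = g x - g y. Proof. exact: raddfB. Qed.
Lemma GLN g x : g (- x) = - g x. Proof. exact: raddfN. Qed.
Lemma GLZ g (a : K) x : g (a *: x) = a *: g x. Proof. exact: linearZ. Qed.
Lemma GL0 g : g 0 = 0. Proof. exact: raddf0. Qed.
Lemma GL_sum g (I : Type) (r : seq I) (P : pred I) (f : I -> V) :
  g (\sum_(i <- r | P i) f i) = \sum_(i <- r | P i) g (f i).
Proof. exact: raddf_sum. Qed.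
Lemma GLM g h x : GL_fun (g * h)%g x = g (h x). Proof. by rewrite /GL_fun comp_lfunE. Qed.
Lemma GL1 x : GL_fun (1%g : GL V) x = x. Proof. by rewrite /GL_fun id_lfunE. Qed.
Lemma GLK g : cancel (GL_fun g) (GL_fun g^-1%g).
Proof. by move=> x; rewrite -GLM mulVg GL1. Qed.
Lemma GLKV g : cancel (GL_fun g^-1%g) (GL_fun g).
Proof. by move=> x; rewrite -GLM mulgV GL1. Qed.
Lemma GL_inj g : injective g. Proof. exact: can_inj (GLK g). Qed.

Lemma GL_ext g h : g =1 h -> g = h.
Proof. by move=> e; apply/val_inj/lfunP => x; exact: e. Qed.

Lemma GL_span g h (s : seq V) :
  (forall x, x \in s -> g x = h x) -> forall v, v \in <<s>>%VS -> g v = h v.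
Proof.
move=> e v /(coord_span (X := in_tuple s)) ->; rewrite !GL_sum.
by apply: eq_bigr => i _; rewrite !GLZ e // mem_nth.
Qed.

Lemma GL_span_stable g (s : seq V) (W : {vspace V}) :
  (forall x, x \in s -> g x \in W) -> forall v, v \in <<s>>%VS -> g v \in W.
Proof.
move=> e v /(coord_span (X := in_tuple s)) ->; rewrite GL_sum.
by apply: memv_suml => i _; rewrite GLZ memvZ // e // mem_nth.
Qed.

End GLTheory.

Lemma dual_closure (R : realType) (V : vectType R) (O : set V) (th : 'Hom(V, R^o)) z :
  is_open_cone O -> dual_of O th -> cone_closure O z -> 0 <= (th z : R).
Proof.
move=> hO Dth hz; have [x Ox] := oc_ne hO; rewrite leNgt; apply/negP => thz.
(* This multiple of x is so small that th (z + t x) <= th z / 2 < 0. *)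
have t0 : 0 < - th z / (2 * (th x + 1)).
  by rewrite divr_gt0 ?oppr_gt0 // mulr_gt0 ?ltr0n // ltr_wpDl ?ltr01 // Dth.
have := Dth _ (hz _ (oc_scale hO t0 Ox)); rewrite homD homZ => h.
have Dx := Dth _ Ox.
suff : - th z / (2 * (th x + 1)) * th x <= - th z / 2 by lra.
rewrite invfM mulrA -mulrA ler_piMr ?divr_ge0 ?oppr_ge0 ?ltW //.
by rewrite mulrC ltr_pdivrMr ?mul1r; lra.
Qed.

(* [pc_z] spans a polyhedral cone whose translates contain the lattice points of
   the closed cone, and [pc_fs] spans a face. *)
Record polycone (R : realType) (V : vectType R) := PolyCone {
  pc_b : seq V;
  pc_C : set V;
  pc_G : set (GL V);
  pc_k : nat;
  pc_z : 'I_pc_k -> V;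
  pc_xis : seq 'Hom(V, R^o);
  pc_fs : seq V;
  pc_basis : basis_of {:V} pc_b;
  pc_open : is_open_cone pc_C;
  pc_noline : forall p d, (forall t : R, pc_C (p + t *: d)) -> d = 0;
  pc_group : is_subgroup pc_G;
  pc_GC : forall g : GL V, pc_G g -> forall x, pc_C x -> pc_C (g x);
  pc_GL : forall g : GL V, pc_G g -> forall x, int_span pc_b x -> int_span pc_b (g x);
  pc_z_lat : forall i, int_span pc_b (pc_z i);
  pc_z_clo : forall i, cone_closure pc_C (pc_z i);
  pc_z_neq0 : forall i, pc_z i <> 0;
  pc_cover : forall p, cone_closure pc_C p -> int_span pc_b p ->
    exists2 g : GL V, pc_G g & exists2 a : 'I_pc_k -> R, forall i, 0 <= a i &
      p = g (\sum_i a i *: pc_z i);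
  pc_xis_int : forall th, th \in pc_xis -> intform pc_b th;
  pc_xis_dual : forall th, th \in pc_xis -> dual_of pc_C th;
  pc_xis_ker : forall v, (forall th, th \in pc_xis -> th v = 0) -> v = 0;
  pc_fs_lat : forall x, x \in pc_fs -> int_span pc_b x;
  pc_fs_clo : forall x, x \in pc_fs -> cone_closure pc_C x;
  pc_face : forall x y, int_span pc_b x -> cone_closure pc_C x ->
    int_span pc_b y -> cone_closure pc_C y ->
    x + y \in <<pc_fs>>%VS -> x \in <<pc_fs>>%VS }.

Section PolyConeBasics.
Variables (R : realType) (V : vectType R) (S : polycone V).
Local Notation L := (int_span (pc_b S)).
Local Notation C := (pc_C S).
Local Notation Cb := (cone_closure (pc_C S)).
Local Notation G := (pc_G S).
Local Notation VF := <<pc_fs S>>%VS.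
Local Notation hC := (pc_open S).
Implicit Types (x y z v w p : V) (g h : GL V).

(** Every generator of the face occurs in the sum, so f is in its relative interior: multiples of f
    absorb V_F ([VF_absorb]), and an element of the group fixing f preserves V_F ([Gf_VF]). *)
Definition f_ : V := \sum_(x <- pc_fs S) x.
(** A height: it is integral, positive on the closed cone outside 0, and only finitely many lattice
    points of the closed cone lie below a given height. *)
Definition xi0 : 'Hom(V, R^o) := \sum_(th <- pc_xis S) th.
Definition Oc : set V := [set x | exists2 w, w \in VF & C (x + w)].
Definition Gf : set (GL V) := [set g | G g /\ g f_ = f_].
Local Notation f := f_.
Local Notation O := Oc.

Lemma G1 : G 1%g. Proof. by have [] := pc_group S. Qed.
Lemma GM g h : G g -> G h -> G (g * h)%g.
Proof. by have [_ h1 _] := pc_group S; exact: h1. Qed.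
Lemma GV g : G g -> G g^-1%g.
Proof. by have [_ _ h1] := pc_group S; exact: h1. Qed.

Lemma GCb g z : G g -> Cb z -> Cb (g z).
Proof.
move=> Gg hz x Cx; rewrite -[x](GLKV g) -GLD; apply: (pc_GC Gg); apply: hz.
exact: (pc_GC (GV Gg)).
Qed.

Lemma xi0E x : xi0 x = \sum_(th <- pc_xis S) (th x : R).
Proof. by rewrite sum_lfunE. Qed.

Lemma xi0_int : intform (pc_b S) xi0.
Proof.
move=> v Lv; rewrite xi0E big_seq; apply: rpred_sum => th hth.
by rewrite (pc_xis_int hth).
Qed.

Lemma xis_ge0 th z : th \in pc_xis S -> Cb z -> 0 <= (th z : R).
Proof. by move=> hth; apply: dual_closure (pc_open S) (pc_xis_dual hth). Qed.

Lemma xis_le_xi0 th z : th \in pc_xis S -> Cb z -> (th z : R) <= xi0 z.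
Proof.
move=> hth hz; rewrite xi0E (big_rem th) //= lerDl big_seq.
by apply: sumr_ge0 => th' /mem_rem h'; exact: xis_ge0.
Qed.

Lemma xi0_ge0 z : Cb z -> 0 <= (xi0 z : R).
Proof. by move=> hz; rewrite xi0E big_seq; apply: sumr_ge0 => th hth; exact: xis_ge0. Qed.

Lemma xi0_eq0 z : Cb z -> xi0 z = 0 -> z = 0.
Proof.
move=> hz e; apply: (@pc_xis_ker _ _ S) => th hth; apply/eqP; rewrite eq_le.
by rewrite xis_ge0 // andbT -[leRHS]e xis_le_xi0.
Qed.

Lemma xi0_ge1 z : L z -> Cb z -> z <> 0 -> 1 <= (xi0 z : R).
Proof.
move=> Lz hz zn0; have := xi0_ge0 hz; rewrite le_eqVlt => /orP[/eqP e|].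
  by exfalso; apply: zn0; apply: xi0_eq0.
have /intrP[n ->] := xi0_int Lz.
by rewrite ltr0z ler1z.
Qed.

Lemma xi0_finite (B : R) :
  exists A : seq V, forall z, L z -> Cb z -> (xi0 z : R) <= B -> z \in A.
Proof.
pose N := (Num.truncn B).+1.
have [||A hA] := @box_finite_list R (size (pc_xis S)) N V
   (fun z => [/\ L z, Cb z & (xi0 z : R) <= B]) (fun z i => (pc_xis S)`_i z).
- move=> z i [Lz hz zB]; have hth : (pc_xis S)`_i \in pc_xis S by rewrite mem_nth.
  split; first exact: (pc_xis_int hth).
  rewrite ger0_norm ?xis_ge0 //; apply: le_trans (xis_le_xi0 hth hz) _.
  by apply: le_trans zB _; exact/ltW/truncnS_gt.
- move=> x y _ _ e; apply/eqP; rewrite -subr_eq0; apply/eqP.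
  apply: (@pc_xis_ker _ _ S) => th hth.
  have ith : (index th (pc_xis S) < size (pc_xis S))%N by rewrite index_mem.
  have := e (Ordinal ith); rewrite /= nth_index // => exy.
  by rewrite homB exy subrr.
by exists A => z *; exact: hA.
Qed.

Lemma f_lat : L f.
Proof. by rewrite /f_ big_seq; apply: lat_sum (pc_basis S) _ _ _ _ _; exact: pc_fs_lat. Qed.

Lemma f_clo : Cb f.
Proof. by rewrite /f_ big_seq; apply: clo_sum; exact: pc_fs_clo. Qed.

Lemma f_VF : f \in VF.
Proof. by rewrite /f_ big_seq; apply: memv_suml => x; exact: memv_span. Qed.

Lemma nf_clo (a : R) : 0 <= a -> Cb (a *: f).
Proof. by move=> a0; apply: (clo_scale hC) => //; exact: f_clo. Qed.

Lemma nf_C (a : R) x : 0 <= a -> C x -> C (a *: f + x).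
Proof. by move=> a0; exact: (nf_clo a0). Qed.

Lemma VF_absorb w : w \in VF -> exists n : nat, forall a : R, n%:R <= a -> Cb (a *: f + w).
Proof.
move=> /(coord_span (X := in_tuple (pc_fs S))) wE.
pose c i := coord (in_tuple (pc_fs S)) i w.
exists (Num.truncn (\sum_i `|c i|)).+1 => a ha.
rewrite wE /f_ (big_nth 0) big_mkord scaler_sumr -big_split /=.
apply: clo_sum => i _; rewrite -scalerDl; apply: (clo_scale hC); last first.
  by apply: pc_fs_clo; rewrite mem_nth.
rewrite -lerBlDr sub0r; apply: le_trans ha.
apply: le_trans (_ : `|c i| <= _); first by rewrite -normrN ler_norm.
apply: le_trans (_ : \sum_i `|c i| <= _); last exact/ltW/truncnS_gt.
by rewrite (bigD1 i) //= lerDl sumr_ge0.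
Qed.

Lemma face_lat x y : L x -> Cb x -> L y -> Cb y -> x + y \in VF -> x \in VF.
Proof. exact: pc_face. Qed.

Lemma face_sum (I : eqType) (r : seq I) (F : I -> V) :
  (forall i, i \in r -> L (F i) /\ Cb (F i)) -> \sum_(i <- r) F i \in VF ->
  forall i, i \in r -> F i \in VF.
Proof.
move=> hF hs i ir; have [LF CF] := hF i ir; move: hs; rewrite (big_rem i) //=.
apply: face_lat => //; rewrite big_seq.
  by apply: (lat_sum (pc_basis S)) => j /mem_rem /hF[].
by apply: clo_sum => j /mem_rem /hF[].
Qed.

Lemma Gf1 : Gf 1%g. Proof. by split; [exact: G1|rewrite GL1]. Qed.
Lemma GfM g h : Gf g -> Gf h -> Gf (g * h)%g.
Proof. by move=> [Gg gf] [Gh hf]; split; [exact: GM|rewrite GLM hf]. Qed.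
Lemma GfV g : Gf g -> Gf g^-1%g.
Proof. by move=> [Gg gf]; split; [exact: GV|rewrite -{1}gf GLK]. Qed.

(** The images g x lie in the closed cone and add up to g f = f; a face contains the summands of its
    points. *)
Lemma Gf_fs g x : Gf g -> x \in pc_fs S -> g x \in VF.
Proof.
move=> [Gg gf] xs.
apply: (face_sum (r := pc_fs S) (F := fun x => g x)) => // [y ys|].
  by split; [exact: pc_GL (pc_fs_lat ys)|exact: GCb (pc_fs_clo ys)].
by rewrite -GL_sum -/f_ gf f_VF.
Qed.

Lemma Gf_VF g w : Gf g -> w \in VF -> g w \in VF.
Proof. by move=> hg; apply: GL_span_stable => x; exact: Gf_fs. Qed.

Lemma C_sub_O x : C x -> O x.
Proof. by move=> Cx; exists 0; rewrite ?mem0v ?addr0. Qed.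

Lemma O_VF x w : w \in VF -> O x -> O (x + w).
Proof.
move=> hw [v hv Cv]; exists (v - w); first exact: memvB.
by have -> : x + w + (v - w) = x + v by lmod R.
Qed.

Lemma O_open_cone : is_open_cone O.
Proof.
have [x Cx] := oc_ne hC; split.
- by exists x; exact: C_sub_O.
- move=> y z [v hv Cv] [w hw Cw]; exists (v + w); first exact: memvD.
  by rewrite addrACA; exact: (oc_add hC).
- move=> a y a0 [v hv Cv]; exists (a *: v); first exact: memvZ.
  by rewrite -scalerDr; exact: (oc_scale hC).
- move=> y v [w hw Cw]; have [e e0 Ce] := oc_open hC v Cw.
  by exists e => //; exists w => //; rewrite addrAC.
Qed.

Lemma O_absorb x : O x -> exists n : nat, forall a : R, n%:R <= a -> C (x + a *: f).
Proof.
move=> [w hw Cw]; have [n hn] := VF_absorb (w := - w) (rpredNr hw).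
exists n => a /hn h; have := h _ Cw.
by have -> : a *: f - w + (x + w) = x + a *: f by lmod R.
Qed.

Lemma O_clo x z : O x -> Cb z -> O (x + z).
Proof. by move=> [w hw Cw] hz; exists w => //; rewrite addrAC addrC; exact: hz. Qed.

Lemma Gf_O g x : Gf g -> O x -> O (g x).
Proof.
move=> hg [w hw Cw]; exists (g w); first exact: Gf_VF.
by rewrite -GLD; apply: pc_GC Cw; case: hg.
Qed.

End PolyConeBasics.

(** * Well-quasi-ordering of lattice points modulo the stabilizer of a face *)

Lemma dependent_family (K : fieldType) (V : vectType K) (m : nat) (v : 'I_m -> V) :
  (\dim {:V} < m)%N -> exists2 c : 'I_m -> K, \sum_i c i *: v i = 0 & exists i, c i != 0.
Proof.
move=> dm; pose X := [tuple v i | i < m].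
have : ~~ free X.
  apply/negP => /eqP fX; have := dimvS (subvf <<X>>%VS).
  by rewrite fX size_tuple leqNgt dm.
move/freeP/existsNP => [c /not_implyP[c0 /existsNP[i /eqP ci]]].
exists c; last by exists i.
by rewrite -[RHS]c0; apply: eq_bigr => j _; rewrite -tnth_nth tnth_mktuple.
Qed.

(** The dependency that is subtracted has coefficient sum 0, so the total weight is kept; this costs
    one more vector than the purely conic statement. The total weight is what yields a large
    coefficient in [bounded_sums]. *)
Lemma conic_caratheodory (R : realType) (V : vectType R) (n : nat) (z : 'I_n -> V) (mu : 'I_n -> R) :
  (forall i, 0 <= mu i) ->
  exists nu : 'I_n -> R, [/\ forall i, 0 <= nu i, \sum_i nu i *: z i = \sum_i mu i *: z i,
    \sum_i nu i = \sum_i mu i & (#|[set i | nu i != 0%R]%SET| <= (\dim {:V}).+1)%N].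
Proof.
move: {2}#|_| (leqnn #|[set i | mu i != 0%R]%SET|) => N.
elim: N mu => [|N IH] mu leN mu0.
  by exists mu; split=> //; apply: leq_trans leN _.
have [small|big] := leqP #|[set i | mu i != 0%R]%SET| (\dim {:V}).+1.
  by exists mu; split.
set A := [set i | mu i != 0%R]%SET in leN big.
pose m := (#|A|).-1.
have cA : #|A| = m.+1 by rewrite prednK //; apply: leq_trans big.
pose e (i : 'I_m.+1) : 'I_n := enum_val (cast_ord (esym cA) i).
have eA i : e i \in A by exact: enum_valP.
have e_inj : injective e by move=> i j /enum_val_inj /cast_ord_inj.
have [|c c0 [i0 ci0]] := @dependent_family _ _ m (fun i => z (e (lift ord0 i)) - z (e ord0)).
  by rewrite -ltnS -cA.
pose c' (i : 'I_m.+1) := if unlift ord0 i is Some j then c j else - \sum_j c j.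
have c'l j : c' (lift ord0 j) = c j by rewrite /c' liftK.
have c'o : c' ord0 = - \sum_j c j by rewrite /c' unlift_none.
have c'0 : \sum_i c' i = 0.
  rewrite big_ord_recl c'o (eq_bigr _ (fun j _ => c'l j)).
  by rewrite addNr.
have c'z : \sum_i c' i *: z (e i) = 0.
  rewrite big_ord_recl c'o scaleNr scaler_suml -sumrN -big_split /= -[RHS]c0.
  by apply: eq_bigr => j _; rewrite c'l scalerBr addrC.
have [i1 ci1] : exists i, 0 < c' i.
  apply: contrapT => /forallNP h.
  have le0 i : c' i <= 0 by rewrite leNgt; apply/negP/h.
  have /eqP : c' (lift ord0 i0) == 0.
    rewrite eq_le le0 /=; move/eqP: c'0; rewrite (bigD1 (lift ord0 i0)) //= addr_eq0 => /eqP ->.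
    by rewrite oppr_ge0; apply: sumr_le0.
  by rewrite /c' liftK => /eqP; exact/negP.
pose Q i := 0 < c' i.
(* The least ratio is the largest t for which mu - t d stays nonnegative, and it cancels the
   coefficient at [e i2]. *)
have [i2 Qi2 hmin] := @arg_minP _ _ _ i1 Q (fun i => mu (e i) / c' i) ci1.
pose t := mu (e i2) / c' i2.
have t0 : 0 <= t by rewrite divr_ge0 // ltW.
pose d (i : 'I_n) := \sum_(j | e j == i) c' j.
have de j : d (e j) = c' j.
  by rewrite /d (bigD1 j) //= big1 ?addr0 // => k /andP[/eqP /e_inj -> /eqP].
have dN i : i \notin A -> d i = 0.
  by move=> iA; rewrite /d big1 // => j /eqP ej; move: iA; rewrite -ej eA.
have sumd (W : lmodType R) (F : 'I_n -> W) : \sum_i d i *: F i = \sum_j c' j *: F (e j).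
  rewrite /d; under eq_bigr do rewrite scaler_suml.
  rewrite (exchange_big_dep predT) //=; apply: eq_bigr => j _.
  by rewrite (big_pred1 (e j)) // => i; rewrite eq_sym.
pose mu' i := mu i - t * d i.
have Ae i : i \in A -> exists j, e j = i.
  move=> iA; exists (cast_ord cA (enum_rank_in iA i)).
  by rewrite /e cast_ordK enum_rankK_in.
have mu'0 i : 0 <= mu' i.
  have [/Ae[j <-]|iA] := boolP (i \in A); last by rewrite /mu' dN // mulr0 subr0.
  rewrite /mu' de subr_ge0; have [cj|cj] := ltP 0 (c' j).
    by rewrite -ler_pdivlMr //; exact: hmin.
  by apply: le_trans (mu0 _); rewrite mulr_ge0_le0.
have [||nu [nu0 nuz nu1 nuc]] := IH mu'; last 1 first.
- exists nu; split=> //.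
    rewrite nuz /mu'; under eq_bigr do rewrite scalerBl -scalerA.
    by rewrite sumrB -scaler_sumr sumd c'z scaler0 subr0.
  rewrite nu1 /mu' sumrB -mulr_sumr.
  have := sumd R^o (fun=> 1); rewrite /GRing.scale /=.
  under eq_bigr do rewrite mulr1; under [X in _ = X -> _]eq_bigr do rewrite mulr1.
  by move=> ->; rewrite c'0 mulr0 subr0.
- rewrite -ltnS; apply: leq_trans leN; apply: proper_card.
  apply/properP; split.
    apply/fintype.subsetP => i; rewrite !inE; apply: contraNN => /eqP mi.
    by rewrite /mu' mi dN ?mulr0 ?subr0 // inE mi eqxx.
  exists (e i2); first exact: eA.
  by rewrite inE /mu' de /t divfK ?subrr ?eqxx // gt_eqF.
- by [].
Qed.

Section WellQuasiOrder.
Variables (R : realType) (V : vectType R) (S : polycone V).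
Local Notation k := (pc_k S).
Local Notation L := (int_span (pc_b S)).
Local Notation hb := (pc_basis S).
Local Notation C := (pc_C S).
Local Notation Cb := (cone_closure (pc_C S)).
Local Notation G := (pc_G S).
Local Notation VF := <<pc_fs S>>%VS.
Local Notation hC := (pc_open S).
Local Notation f := (f_ S).
Local Notation O := (Oc S).
Local Notation Gf := (Gf S).
Local Notation xi0 := (xi0 S).
Local Notation z_ := (@pc_z _ _ S).
Implicit Types (x y z v w p : V) (g h : GL V).

(* For [n] large, [p + n f = gam (\sum a_i z_i)] where [gam^-1 f] stays in a
   finite set, because [xi0] is comparable to [\sum a_i] on the cone spanned by
   the [z_i] while [1 <= xi0 (gam z_i)] for all [gam]. *)
Lemma lattice_cover : exists (N : nat) (phi : 'I_N -> GL V) (al : seq V),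
  [/\ forall j, G (phi j), forall a, a \in al -> L a /\ Cb a &
   forall p, L p -> O p -> exists g (j : 'I_N) a (m : 'I_k -> nat) w,
    [/\ Gf g, a \in al, w \in VF &
        p = g (phi j (a + \sum_i (m i)%:R *: z_ i)) + w]].
Proof.
pose Cz : R := \sum_i xi0 (z_ i).
have z1 g i : G g -> 1 <= (xi0 (g (z_ i)) : R).
  move=> Gg; apply: xi0_ge1; first exact: pc_GL (pc_z_lat i).
    exact: GCb (pc_z_clo i).
  by move/eqP; rewrite -(GL0 g) (inj_eq (@GL_inj _ _ g)) => /eqP; exact: pc_z_neq0.
have zCz i : (xi0 (z_ i) : R) <= Cz.
  by rewrite /Cz (bigD1 i) //= lerDl; apply: sumr_ge0 => j _; apply/xi0_ge0/pc_z_clo.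
have [A hA] := xi0_finite S (Cz * (1 + xi0 f)).
have [A2 hA2] := xi0_finite S Cz.
(* For each member of A in the orbit of f, one group element carrying it to f is fixed once and for
   all. Composing gam with the inverse of such an element produces an element fixing f. *)
have /choice[phi hphi] : forall j : 'I_(size A), exists g, G g /\
    ((exists2 g', G g' & g' (A`_j) = f) -> g (A`_j) = f).
  move=> j; have [[g Gg gA]|no] := pselect (exists2 g', G g' & g' (A`_j) = f).
    by exists g.
  by exists 1%g; split=> //; exact: G1.
exists (size A), phi, [seq x <- A2 | `[< L x /\ Cb x >]]; split.
- by move=> j; have [] := hphi j.
- by move=> a; rewrite mem_filter => /andP[/asboolP].
move=> p Lp Op; have [n0 hn0] := O_absorb Op.
pose p' := p + n0%:R *: f.
have Cp' : C p' by exact: hn0.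
have Lp' : L p' by apply: (latD hb) => //; apply: (latZn hb); exact: f_lat.
have xp' : 0 <= (xi0 p' : R) by apply/xi0_ge0/(oc_sub_closure hC).
(* As n exceeds the height of p', the height of q is at most n (1 + xi0 f). Division by n bounds the
   height of gam^-1 f independently of p. *)
pose n := (Num.truncn (xi0 p')).+1.
have n_gt0 : 0 < n%:R :> R by rewrite ltr0Sn.
have xn : (xi0 p' : R) <= n%:R by exact/ltW/truncnS_gt.
pose q := p' + n%:R *: f.
have Cq : Cb q by apply: (clo_add (oc_sub_closure hC Cp')); apply: nf_clo; exact: ltW.
have Lq : L q by apply: (latD hb) => //; apply: (latZn hb); exact: f_lat.
have [gam Ggam [a a0 qE]] := pc_cover Cq Lq.
have GVgam := GV Ggam.
have suma : \sum_i a i <= xi0 q.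
  rewrite qE GL_sum hom_sum; apply: ler_sum => i _.
  by rewrite GLZ homZ ler_peMr // z1.
have gq : GL_fun gam^-1%g q = \sum_i a i *: z_ i by rewrite qE GLK.
pose phif := GL_fun gam^-1%g f.
have Lphif : L phif by apply: (pc_GL GVgam); exact: f_lat.
have Cphif : Cb phif by apply: GCb => //; exact: f_clo.
have fA : phif \in A.
  apply: hA => //; rewrite -(ler_pM2l n_gt0).
  apply: le_trans (_ : xi0 (GL_fun gam^-1%g q) <= _).
    rewrite /q GLD GLZ homD homZ -/phif lerDr; apply/xi0_ge0/GCb => //.
    exact: (oc_sub_closure hC).
  rewrite gq hom_sum; apply: le_trans (_ : Cz * \sum_i a i <= _).
    rewrite mulr_sumr; apply: ler_sum => i _; rewrite homZ mulrC.
    by apply: ler_wpM2r => //; exact: zCz.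
  rewrite mulrCA; apply: ler_wpM2l.
    by apply: sumr_ge0 => i _; apply/xi0_ge0/pc_z_clo.
  apply: le_trans suma _; rewrite /q homD homZ mulrDr mulr1 lerD2r //.
have jA : (index phif A < size A)%N by rewrite index_mem.
pose j := Ordinal jA.
have phij : phi j phif = f.
  have [_ h] := hphi j; rewrite -[phif](nth_index 0 fA); apply: h.
  by exists gam => //; rewrite /= nth_index // /phif GLKV.
pose m i := Num.truncn (a i).
pose al := \sum_i (a i - (m i)%:R) *: z_ i.
have mle i : 0 <= a i - (m i)%:R <= 1.
  have /andP[l1 l2] := truncn_itv (a0 i).
  by rewrite -natr1 -/(m i) in l1 l2; apply/andP; split; lra.
have alE : GL_fun gam^-1%g q = al + \sum_i (m i)%:R *: z_ i.
  by rewrite gq /al -big_split /=; apply: eq_bigr => i _; rewrite -scalerDl subrK.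
have Cal : Cb al.
  apply: clo_sum => i _; apply: (clo_scale hC); last exact: pc_z_clo.
  by case/andP: (mle i).
have Lal : L al.
  have -> : al = GL_fun gam^-1%g q - \sum_i (m i)%:R *: z_ i by rewrite alE addrK.
  apply: (latB hb); first exact: (pc_GL GVgam).
  by apply: (lat_sum hb) => i _; apply: (latZn hb); exact: pc_z_lat.
have alA : al \in A2.
  apply: hA2 => //; rewrite hom_sum; apply: ler_sum => i _; rewrite homZ.
  apply: ler_piMl; first by apply/xi0_ge0/pc_z_clo.
  by case/andP: (mle i).
have Gphij : G (phi j) by have [] := hphi j.
exists (gam * (phi j)^-1)%g, j, al, m, (- (n0%:R + n%:R) *: f); split.
- split; first exact: GM (GV _).
  by rewrite GLM -{1}phij GLK /phif GLKV.
- by rewrite mem_filter alA andbT; apply/asboolP.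
- by rewrite memvZ // f_VF.
- rewrite GLM GLK -alE GLKV /q /p'; lmod R.
Qed.

(** In [lattice_cover] the data j and a take finitely many values and become constant on a
    subsequence; Dickson's lemma makes the multiplicities m increase, and d is the image of their
    difference. *)
Lemma lattice_wqo (p : nat -> V) : (forall n, L (p n) /\ O (p n)) ->
  exists2 s, increasing s & forall i j, (i < j)%N -> exists g d w,
    [/\ Gf g, L d, Cb d, w \in VF & p (s j) = g (p (s i)) + d + w].
Proof.
move=> hp; have [N [phi [al [Gphi hal cov]]]] := lattice_cover.
have /choice[D hD] : forall n, exists D : GL V * 'I_N * V * ('I_k -> nat) * V,
    [/\ Gf D.1.1.1.1, D.1.1.2 \in al, D.2 \in VF &
     p n = D.1.1.1.1 (phi D.1.1.1.2 (D.1.1.2 + \sum_i (D.1.2 i)%:R *: z_ i)) + D.2].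
  move=> n; have [Lp Op] := hp n; have [g [j [a [m [w h]]]]] := cov _ Lp Op.
  by exists (g, j, a, m, w).
have [s1 s1i h1] := const_subseq (fun n => (D n).1.1.1.2).
have [s2 s2i h2] := @const_fam_subseq unit _ al (fun n _ => (D (s1 n)).1.1.2)
  (fun n _ => let: And4 _ h _ _ := hD (s1 n) in h).
have [s3 s3i h3] := dickson (fun n => (D (s1 (s2 n))).1.2).
exists (s1 \o (s2 \o s3)); first by do 2?apply: increasing_comp.
move=> i j ij /=; pose a := s1 (s2 (s3 i)); pose c := s1 (s2 (s3 j)); rewrite -/a -/c.
have [Gfc alc wc pc] := hD c; have [Gfa ala wa pa] := hD a.
have ac1 : (D a).1.1.1.2 = (D c).1.1.1.2 by rewrite /a /c !h1.
have ac2 : (D a).1.1.2 = (D c).1.1.2 by have := h2 (s3 i) tt; rewrite -(h2 (s3 j) tt).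
have ac3 l : ((D a).1.2 l <= (D c).1.2 l)%N by apply: h3; exact: ltnW.
move: pc pa; rewrite ac1 ac2.
set gc := (D c).1.1.1.1; set ga := (D a).1.1.1.1; set ph := phi _; set aa := (D c).1.1.2.
move=> pc pa; pose dl := \sum_l ((D c).1.2 l - (D a).1.2 l)%:R *: z_ l.
have Ggc : G gc by case: Gfc.
exists (gc * ga^-1)%g, (gc (ph dl)), ((D c).2 - GL_fun (gc * ga^-1)%g (D a).2).
have Gg : Gf (gc * ga^-1)%g by apply: GfM => //; exact: GfV.
split=> //.
- apply: (pc_GL Ggc); apply: (pc_GL (Gphi _)).
  by apply: (lat_sum hb) => l _; apply: (latZn hb); exact: pc_z_lat.
- apply: GCb => //; apply: GCb; first exact: Gphi.
  by apply: clo_sum => l _; apply: (clo_scale hC); rewrite ?ler0n //; exact: pc_z_clo.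
- by apply: memvB => //; exact: Gf_VF.
rewrite pc pa GLD GLM GLK.
have -> : \sum_l ((D c).1.2 l)%:R *: z_ l = \sum_l ((D a).1.2 l)%:R *: z_ l + dl.
  rewrite /dl -big_split /=; apply: eq_bigr => l _.
  by rewrite -scalerDl natrB // addrC subrK.
rewrite addrA !GLD; set u1 := gc (ph _); set u2 := gc (ph _); set u3 := gc (ph _).
by lmod R.
Qed.

(** After adding multiples of f, p' = g p' + e' - N f. Iteration expresses p' by g^n p' and the sum
    of the g^i e', whose total height grows at most linearly in n. Infinitely many g^i e' therefore
    have height below 2 M, two of them coincide, and some g^m fixes e'. If e1 is the sum of the g^i
    e' for i < m, then d = m N f - e1 is fixed by g^m and (g^m)^q p' = p' + q d, so d is in the
    closed cone. As e1 + d is a multiple of f, the face property puts e1, and then e', in V_F. *)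
Lemma no_shift p g e w : L p -> O p -> Gf g -> L e -> Cb e -> w \in VF ->
  p = g p + e + w -> e \in VF.
Proof.
move=> Lp Op Gg Le Ce wVF pE.
have [N hN] := VF_absorb wVF.
pose e' := e + (N%:R *: f + w).
have Lw : L w.
  have -> : w = p - g p - e by rewrite {1}pE; lmod R.
  by apply: (latB hb) => //; apply: (latB hb) => //; apply: pc_GL => //; case: Gg.
have Lf := f_lat S.
have LN : L (N%:R *: f + w) by apply: (latD hb) => //; exact: (latZn hb).
have Le' : L e' by exact: (latD hb).
have Ce' : Cb e' by apply: (clo_add Ce); exact: hN.
suff : e' \in VF.
  move=> h; have -> : e = e' - (N%:R *: f + w) by rewrite /e' addrK.
  by rewrite memvB // memvD // memvZ // f_VF.
have [n0 hn0] := O_absorb Op.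
pose p' := p + n0%:R *: f.
have Cp' : C p' by exact: hn0.
have p'E : p' = g p' + e' - N%:R *: f.
  by rewrite /p' GLD GLZ Gg.2 {1}pE /e'; lmod R.
clearbody p' e'.
have GgX n : G (g ^+ n)%g by elim: n => [|n IH]; rewrite ?expg0 ?expgS; [exact: G1|apply: GM => //; case: Gg].
have gX n x : GL_fun (g ^+ n.+1)%g x = g (GL_fun (g ^+ n)%g x) by rewrite expgS GLM.
have SE n : \sum_(i < n.+1) GL_fun (g ^+ i)%g e' = e' + g (\sum_(i < n) GL_fun (g ^+ i)%g e').
  rewrite big_ord_recl expg0 GL1 GL_sum; congr (_ + _).
  by apply: eq_bigr => i _; rewrite -gX.
have iter n : p' = GL_fun (g ^+ n)%g p' + \sum_(i < n) GL_fun (g ^+ i)%g e' - (n * N)%:R *: f.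
  elim: n => [|n IH]; first by rewrite expg0 GL1 big_ord0 mul0n; lmod R.
  rewrite SE gX {1}p'E; move: IH; set sm := \sum_(i < n) _ => IH.
  by rewrite {1}IH GLB GLD GLZ Gg.2 mulSn natrD; lmod R.
pose xe i : R := xi0 (GL_fun (g ^+ i)%g e').
have LX i : L (GL_fun (g ^+ i)%g e') by exact: pc_GL.
have CX i : Cb (GL_fun (g ^+ i)%g e') by exact: GCb.
have xe0 i : 0 <= xe i by apply: xi0_ge0.
pose M : R := N%:R * xi0 f + 1.
have M0 : 0 < M by rewrite /M ltr_wpDl // mulr_ge0 ?ler0n //; apply/xi0_ge0/f_clo.
have sumxe n : \sum_(i < n) xe i <= xi0 p' + n%:R * M.
  have := congr1 (fun v => xi0 v : R) (iter n); rewrite homB homD hom_sum homZ natrM => h.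
  have := xi0_ge0 (GCb (GgX n) (oc_sub_closure hC Cp')).
  have := ler0n R n; rewrite /M mulrDr mulr1 mulrA; lra.
have [A hA] := xi0_finite S (2 * M).
have [s s_inc hs] : exists2 s, increasing s & forall i, GL_fun (g ^+ s i)%g e' \in A.
  apply: (@frequently_subseq (fun i => GL_fun (g ^+ i)%g e' \in A)) => n; apply: contrapT => no.
  have big i : (n <= i)%N -> 2 * M <= xe i.
    move=> ni; rewrite leNgt; apply/negP => lt; apply: no; exists i => //.
    by apply: hA => //; exact: ltW.
  pose m := (Num.truncn ((xi0 p' + 2 * n%:R * M) / M)).+1.
  have /= := sumxe (n + m)%N; rewrite big_split_ord /= leNgt => /negP; apply.
  apply: lt_le_trans (_ : \sum_(i < m) 2 * M <= _); last first.
    rewrite -[leLHS]add0r lerD ?sumr_ge0 //.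
    by apply: ler_sum => i _; apply: big; rewrite leq_addr.
  rewrite sumr_const card_ord -[(2 * M) *+ m]mulr_natl natrD.
  have : (xi0 p' + 2 * n%:R * M) / M < m%:R by exact: truncnS_gt.
  rewrite ltr_pdivrMr // => lt1.
  have : 0 <= n%:R * M by rewrite mulr_ge0 ?ler0n // ltW.
  by move: lt1; move: (xi0 p' : R) (n%:R : R) (m%:R : R) => a b c; nra.
have [t t_inc ht] := @const_fam_subseq unit _ A (fun i _ => GL_fun (g ^+ s i)%g e') (fun n _ => hs n).
pose i0 := s (t 0%N); pose j0 := s (t 1%N).
have ij0 : (i0 < j0)%N by apply/s_inc/t_inc.
pose m := (j0 - i0)%N.
have ge' : GL_fun (g ^+ m)%g e' = e'.
  have := ht 1%N tt; rewrite -/i0 -/j0 -{1}(subnKC (ltnW ij0)) -/m expgnDr GLM.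
  exact: GL_inj.
pose e1 := \sum_(i < m) GL_fun (g ^+ i)%g e'.
have ge1 : GL_fun (g ^+ m)%g e1 = e1.
  have g1 : g e1 = e1.
    by have := SE m; rewrite big_ord_recr /= ge' -/e1 addrC => /addrI.
  elim: (m) => [|q IH]; first by rewrite expg0 GL1.
  by rewrite gX IH.
have gf : GL_fun (g ^+ m)%g f = f.
  by elim: (m) => [|q IH]; rewrite ?expg0 ?GL1 // gX IH Gg.2.
pose d := (m * N)%:R *: f - e1.
have gd : GL_fun (g ^+ m)%g d = d by rewrite /d GLB GLZ gf ge1.
have iterm q : p' + q%:R *: d = GL_fun ((g ^+ m) ^+ q)%g p'.
  elim: q => [|q IH]; first by rewrite expg0 GL1 scale0r addr0.
  rewrite expgS GLM -IH GLD GLZ gd -natr1.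
  have -> : GL_fun (g ^+ m)%g p' = p' + d by rewrite {2}(iter m) /d -/e1; lmod R.
  by lmod R.
have Ld : L d.
  by apply: (latB hb); [exact: (latZn hb)|apply: (lat_sum hb) => i _].
have Ce1 : Cb e1 by apply: clo_sum.
have Le1 : L e1 by apply: (lat_sum hb).
have Cd : Cb d.
  apply: (clo_lim hC (oc_sub_closure hC Cp')) => n.
  rewrite addrC iterm; apply: (oc_sub_closure hC); apply: (pc_GC _ Cp').
  by elim: n => [|n IH]; rewrite ?expg1 // expgS; exact: GM.
have e1VF : e1 \in VF.
  apply: (face_lat Le1 Ce1 Ld Cd); rewrite /d addrC subrK.
  by rewrite memvZ // f_VF.
have m0 : (0 < m)%N by rewrite subn_gt0.
have := @face_sum _ _ S 'I_m (enum 'I_m) (fun i => GL_fun (g ^+ i)%g e').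
rewrite big_enum => /(_ _ e1VF (Ordinal m0)); rewrite /= expg0 GL1; apply => //.
by rewrite mem_enum.
Qed.

Definition M0 : set V := [set z | [/\ L z, Cb z & z \notin VF]].

Lemma Gf_M0 g z : Gf g -> M0 z -> M0 (g z).
Proof.
move=> Gg [Lz Cz zV]; have Gg' : G g by case: Gg.
split; [exact: pc_GL|exact: GCb|apply: contra zV => h].
by rewrite -[z](GLK g); apply: Gf_VF => //; exact: GfV.
Qed.

(** Two of the remainders x - (z 0 + ... + z (n - 1)) are comparable by [lattice_wqo]; [no_shift]
    then puts the sum of the intermediate z i, and so each of them, in V_F. *)
Lemma no_descending x (z : nat -> V) : L x ->
  (forall n, M0 (z n)) -> (forall n, O (x - \sum_(i < n) z i)) -> False.
Proof.
move=> Lx hz hO.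
have [|s s_inc hs] := @lattice_wqo (fun n => x - \sum_(i < n) z i).
  by move=> n; split=> //; apply: (latB hb) => //; apply: (lat_sum hb) => i _; case: (hz i).
have [g [d [w [Gg Ld Cd wV E]]]] := hs 0%N 1%N isT.
have lt : (s 0 < s 1)%N by exact: s_inc.
pose n := (s 1 - s 0)%N; pose sz := \sum_(i < n) z (s 0 + i)%N.
have n0 : (0 < n)%N by rewrite subn_gt0.
have szE : \sum_(i < s 1%N) z i = \sum_(i < s 0%N) z i + sz.
  by rewrite -(subnKC (ltnW lt)) big_split_ord.
have Lsz : L sz by apply: (lat_sum hb) => i _; case: (hz (s 0 + i)%N).
have Csz : Cb sz by apply: clo_sum => i _; case: (hz (s 0 + i)%N).
pose q := x - \sum_(i < s 0%N) z i.
have Lq : L q by apply: (latB hb) => //; apply: (lat_sum hb) => i _; case: (hz i).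
have dV : d + sz \in VF.
  have Ldsz : L (d + sz) by exact: (latD hb).
  have Cdsz : Cb (d + sz) by exact: clo_add.
  have Oq : O q by exact: hO.
  apply: (@no_shift q g (d + sz) w) => //.
  move: E; rewrite szE -/q opprD addrA -/q => E.
  by rewrite -[LHS](subrK sz) E; lmod R.
have szV : sz \in VF by apply: (face_lat Lsz Csz Ld Cd); rewrite addrC.
have := @face_sum _ _ S 'I_n (enum 'I_n) (fun i => z (s 0 + i)%N).
rewrite big_enum => /(_ _ szV (Ordinal n0)) h.
have := h (fun i _ => let: And3 a b _ := hz (s 0 + i)%N in conj a b).
rewrite mem_enum => /(_ isT); apply/negP.
by case: (hz (s 0 + 0)%N).
Qed.

(** If arbitrarily long sums stay below x, Caratheodory rewrites such a sum on few vectors with the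
    same total weight, so some z in [M0] satisfies K z <= x with K as large as desired. A sequence
    with 2^(i + 2) z_i <= x then has all its partial sums below x, against [no_descending]. *)
Lemma bounded_sums x : L x -> O x -> exists N : nat, forall s : seq V,
  (forall z, z \in s -> M0 z) -> O (x - \sum_(z <- s) z) -> (size s <= N)%N.
Proof.
move=> Lx Ox; apply: contrapT => /forallNP unb.
have hO := O_open_cone S.
have key (K : nat) : exists z, M0 z /\ O (x - K%:R *: z).
  have /existsNP[s /not_implyP[sM /not_implyP[sO /negP]]] := unb (K * (\dim {:V}).+1)%N.
  rewrite -ltnNge => big; pose n := size s.
  have [nu [nu0 nuz nu1 nuc]] := @conic_caratheodory R V n (fun i => s`_i) (fun=> 1) (fun=> ler01).
  have [i hi] : exists i, K%:R <= nu i.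
    apply: contrapT => /forallNP h.
    have : \sum_i nu i <= K%:R * (\dim {:V}).+1%:R.
      rewrite (bigID (fun i => nu i != 0)) /= [X in _ + X]big1 ?addr0; last first.
        by move=> i /negPn/eqP.
      apply: le_trans (_ : \sum_(i in [set i | nu i != 0]%SET) K%:R <= _).
        rewrite big_set /=; apply: ler_sum => i _.
        by rewrite leNgt; apply/negP => /ltW /h.
      by rewrite sumr_const -[leLHS]mulr_natr ler_wpM2l ?ler0n // ler_nat.
    by rewrite nu1 sumr_const card_ord -natrM ler_nat leqNgt big.
  have si : s`_i \in s by rewrite mem_nth.
  exists s`_i; split; first exact: sM.
  have -> : x - K%:R *: s`_i = (x - \sum_(z <- s) z) +
     ((nu i - K%:R) *: s`_i + \sum_(j < n | j != i) nu j *: s`_j).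
    have -> : \sum_(z <- s) z = \sum_(j < n) nu j *: s`_j.
      by rewrite nuz (big_nth 0) big_mkord; apply: eq_bigr => j _; rewrite scale1r.
    by rewrite [X in _ = _ - X + _](bigD1 i) //=; set T := \sum_(j < n | _) _; lmod R.
  apply: O_clo => //; apply: clo_add.
    apply: (clo_scale hC); first by rewrite subr_ge0.
    by case: (sM _ si).
  by apply: clo_sum => j _; apply: (clo_scale hC) => //; case: (sM s`_j (mem_nth _ (ltn_ord j))).
have /choice[z hz] : forall i, exists z, M0 z /\ O (x - (2 ^ i.+2)%:R *: z) by move=> i; exact: key.
apply: (@no_descending x z Lx) => [n|n]; first by case: (hz n).
(* The sharper claim, with x / 2^(n + 1) removed, is the one that passes to n + 1: half of that term
   pays for z n. *)
suff : O (x - \sum_(i < n) z i - ((2 ^ n.+1)%:R^-1 : R) *: x).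
  move=> h; have -> : x - \sum_(i < n) z i = (x - \sum_(i < n) z i - ((2 ^ n.+1)%:R^-1 : R) *: x) + ((2 ^ n.+1)%:R^-1 : R) *: x.
    by rewrite subrK.
  apply: (oc_add hO) => //; apply: (oc_scale hO) => //.
  by rewrite invr_gt0 ltr0n expn_gt0.
have p0 q : (2 ^ q)%:R != 0 :> R by rewrite pnatr_eq0 expn_eq0.
elim: n => [|n IH].
  rewrite big_ord0 subr0 expn1 -{1}[x]scale1r -scalerBl; apply: (oc_scale hO) => //.
  by lra.
rewrite big_ord_recr /=; have [_ hzn] := hz n.
have q0 : 0 < ((2 ^ n.+2)%:R^-1 : R) by rewrite invr_gt0 ltr0n expn_gt0.
have := oc_add hO IH (oc_scale hO q0 hzn).
congr O; rewrite scalerBr scalerA mulVf // scale1r.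
have -> : ((2 ^ n.+1)%:R^-1 : R) = 2 * (2 ^ n.+2)%:R^-1.
  by rewrite [(2 ^ n.+2)%N]expnS natrM invfM mulrA mulfV ?mul1r // pnatr_eq0.
set a : R := _^-1; set y := \sum_(i < n) _.
move: (z n) a y => zn a y.
by lmod R.
Qed.

(** When two successive terms of the subsequence are inequivalent, their increment d is outside V_F.
    Infinitely many such places would make terms of the sequence contain sums of arbitrarily many
    elements of [M0], all below x. *)
Lemma bounded_orbits x (p : nat -> V) : L x -> O x ->
  (forall n, [/\ L (p n), O (p n) & O (x - p n)]) ->
  exists2 s, increasing s & forall i j, (i < j)%N -> exists2 g, Gf g & p (s j) - g (p (s i)) \in VF.
Proof.
move=> Lx Ox hp; have [|s s_inc hs] := lattice_wqo (p := p).
  by move=> n; case: (hp n).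
pose q n := p (s n); pose E i j := exists2 g, Gf g & q j - g (q i) \in VF.
have Etrans i j l : E i j -> E j l -> E i l.
  move=> [g Gg gV] [h Gh hV]; exists (h * g)%g; first exact: GfM.
  have -> : q l - GL_fun (h * g)%g (q i) = (q l - h (q j)) + h (q j - g (q i)).
    by rewrite GLM GLB; lmod R.
  by rewrite memvD // Gf_VF.
suff [N hN] : exists N, forall i, (N <= i)%N -> E i i.+1.
  exists (fun i => s (N + i)%N) => [i j ij|i j].
    by apply: s_inc; rewrite ltn_add2l.
  elim: j => // j IH; rewrite ltnS leq_eqVlt => /orP[/eqP ->|ij].
    by rewrite addnS; apply: hN; rewrite leq_addr.
  by apply: (Etrans _ (N + j)%N) (IH ij) _; rewrite addnS; apply: hN; rewrite leq_addr.
apply: contrapT => /forallNP no.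
have [|t t_inc ht] := @frequently_subseq (fun i => ~ E i i.+1).
  by move=> n; have /existsNP[i /not_implyP[ni Ei]] := no n; exists i.
have dec i j : (i <= j)%N -> exists g d w, [/\ Gf g, L d, Cb d, w \in VF & q j = g (q i) + d + w].
  rewrite leq_eqVlt => /orP[/eqP ->|]; last exact: hs.
  exists 1%g, 0, 0; split; [exact: Gf1|exact: (lat0 hb)|exact: clo0|exact: mem0v|].
  by rewrite GL1 !addr0.
have chain n : exists g (r : seq V) w, [/\ Gf g, forall z, z \in r -> M0 z, w \in VF, size r = n &
    q (t n) = g (q (t 0%N)) + \sum_(z <- r) z + w].
  elim: n => [|n [g [r [w [Gg hr wV sr qE]]]]].
    exists 1%g, [::], 0; split=> //; [exact: Gf1|exact: mem0v|].
    by rewrite GL1 big_nil !addr0.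
  have [h [d [v [Gh Ld Cd vV E1]]]] := dec _ _ (leqnSn (t n)).
  have [h' [d' [v' [Gh' Ld' Cd' vV' E2]]]] := dec _ _ (t_inc n n.+1 (ltnSn n)).
  have dV : d \notin VF.
    apply/negP => dV; apply: (ht n); exists h => //.
    have -> : q (t n).+1 - h (q (t n)) = d + v by rewrite E1; lmod R.
    exact: memvD.
  exists (h' * h * g)%g, ((h' d + d') :: [seq GL_fun (h' * h)%g z | z <- r]),
    (GL_fun (h' * h)%g w + h' v + v').
  have Ghh : Gf (h' * h)%g by exact: GfM.
  have [hG hG'] : G h' /\ G (h' * h)%g by split; [case: Gh'|case: Ghh].
  split.
  - exact: GfM.
  - move=> z; rewrite inE => /orP[/eqP ->|/mapP[y yr ->]]; last exact/Gf_M0/hr.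
    split; first by apply: (latD hb) => //; exact: pc_GL.
      by apply: clo_add => //; exact: GCb.
    apply/negP => hV; have : h' d \in VF.
      by apply: face_lat hV => //; [exact: pc_GL|exact: GCb].
    move/(Gf_VF (GfV Gh')); rewrite GLK; exact/negP.
  - by rewrite memvD // memvD // Gf_VF.
  - by rewrite /= size_map sr.
  rewrite E2 E1 qE big_cons big_map -GL_sum !GLM.
  move: (\sum_(z <- r) z) => sm; rewrite !GLD.
  by lmod R.
have [N hN] := bounded_sums Lx Ox.
have [g [r [w [Gg hr wV sr qE]]]] := chain N.+1.
have := hN r hr; rewrite sr ltnn => h; suff /h : O (x - \sum_(z <- r) z) by [].
have [_ Op0 _] := hp (s (t 0%N)); have [_ _ Oxp] := hp (s (t N.+1)).
have -> : x - \sum_(z <- r) z = (x - q (t N.+1)) + g (q (t 0%N)) + w.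
  by rewrite qE; lmod R.
by apply: O_VF => //; apply: (oc_add (O_open_cone S)) => //; exact: Gf_O.
Qed.

End WellQuasiOrder.

(** * Counting lattice points in symmetric order intervals *)

Section SymmetricBox.
Variables (R : realType) (V : vectType R) (O : set V) (hO : is_open_cone O).
Implicit Types (x y z t u X Y : V).

Definition sym_box X : set V := [set t | O (X + t) /\ O (X - t)].
Local Notation B := sym_box.

Lemma boxN X t : B X t -> B X (- t).
Proof. by move=> [h1 h2]; split=> //; rewrite opprK. Qed.

Lemma boxO X t : B X t -> O X.
Proof.
move=> [h1 h2]; have -> : X = (2^-1 : R) *: ((X + t) + (X - t)) by lmod_goals R; field.
by apply: (oc_scale hO); [rewrite invr_gt0 ltr0n|exact: (oc_add hO)].
Qed.

Lemma box0 X : B X 0 <-> O X.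
Proof. by rewrite /sym_box /= subr0 addr0; split=> [[]|]. Qed.

Lemma boxD X Y t u : B X t -> B Y u -> B (X + Y) (t + u).
Proof.
move=> [h1 h2] [h3 h4]; split; first by rewrite addrACA; exact: (oc_add hO).
by rewrite opprD addrACA; exact: (oc_add hO).
Qed.

Lemma boxB X Y t u : B X t -> B Y u -> B (X + Y) (t - u).
Proof. by move=> h1 h2; apply: boxD => //; exact: boxN. Qed.

Lemma box_clo X Y t : B X t -> cone_closure O Y -> B (X + Y) t.
Proof.
move=> [h1 h2] h; split; first by rewrite addrAC addrC; exact: h.
by rewrite addrAC addrC; exact: h.
Qed.

Lemma boxZ (a : R) X t : 0 < a -> B X t -> B (a *: X) (a *: t).
Proof.
by move=> a0 [h1 h2]; split; rewrite -?scalerBr -?scalerDr; apply: (oc_scale hO).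
Qed.

Lemma box_shrink (a : R) X t : `|a| <= 1 -> B X t -> B X (a *: t).
Proof.
move=> a1 h; have [h1 h2] := h; move: a1; rewrite ler_norml => /andP[a1 a2].
have a3 : 0 <= (1 + a) / 2 <= 1 by apply/andP; split; lra.
split.
  have -> : X + a *: t = (1 - (1 + a) / 2) *: (X - t) + ((1 + a) / 2) *: (X + t).
    by lmod_goals R; field.
  exact: (oc_convex hO).
have -> : X - a *: t = (1 - (1 + a) / 2) *: (X + t) + ((1 + a) / 2) *: (X - t).
  by lmod_goals R; field.
exact: (oc_convex hO).
Qed.

End SymmetricBox.

Section Counting.
Variables (R : realType) (V : vectType R) (S : polycone V).
Local Notation L := (int_span (pc_b S)).
Local Notation hb := (pc_basis S).
Local Notation C := (pc_C S).
Local Notation Cb := (cone_closure (pc_C S)).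
Local Notation G := (pc_G S).
Local Notation hC := (pc_open S).
Local Notation d := (size (pc_b S)).
Implicit Types (x y z t u X Y : V) (g h : GL V).

Local Notation B := (sym_box C).

Lemma box_GL g X t : G g -> B X t -> B (g X) (g t).
Proof. by move=> Gg [h1 h2]; split; rewrite -?GLB -?GLD; apply: pc_GC. Qed.

Lemma box_finite X : exists A : seq V, forall t, L t -> B X t -> t \in A.
Proof.
pose N := (Num.truncn (xi0 S X)).+1.
have [||A hA] := @box_finite_list R (size (pc_xis S)) N V
   (fun t => L t /\ B X t) (fun t i => (pc_xis S)`_i t).
- move=> t i [Lt [h1 h2]]; have hth : (pc_xis S)`_i \in pc_xis S by rewrite mem_nth.
  split; first exact: (pc_xis_int hth).
  have c1 := xis_ge0 hth (oc_sub_closure hC h1).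
  have c2 := xis_ge0 hth (oc_sub_closure hC h2).
  rewrite homD in c1; rewrite homB in c2.
  have c3 := xis_le_xi0 hth (oc_sub_closure hC (boxO hC (conj h1 h2))).
  have c4 : xi0 S X < N%:R by exact: truncnS_gt.
  by rewrite ler_norml; apply/andP; split; lra.
- move=> x y _ _ e; apply/eqP; rewrite -subr_eq0; apply/eqP.
  apply: (@pc_xis_ker _ _ S) => th hth.
  have ith : (index th (pc_xis S) < size (pc_xis S))%N by rewrite index_mem.
  have := e (Ordinal ith); rewrite /= nth_index // => exy.
  by rewrite homB exy subrr.
by exists A => t Lt Bt; exact: hA.
Qed.

Fact box_list_ex X : exists A : seq V, uniq A /\ forall t, t \in A <-> L t /\ B X t.
Proof.
have [A hA] := box_finite X; exists (undup [seq t <- A | `[< L t /\ B X t >]]).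
split=> [|t]; first exact: undup_uniq.
rewrite mem_undup mem_filter; split=> [/andP[/asboolP //]|[Lt Bt]].
by rewrite hA // andbT; apply/asboolP.
Qed.

Definition box_list X : seq V := projT1 (cid (box_list_ex X)).
Definition cnt X : nat := size (box_list X).

Lemma box_list_uniq X : uniq (box_list X).
Proof. by rewrite /box_list; case: cid => A []. Qed.

Lemma mem_box_list X t : t \in box_list X <-> L t /\ B X t.
Proof. by rewrite /box_list; case: cid => A []. Qed.

Lemma le_cnt X (A : seq V) : uniq A -> (forall t, t \in A -> L t /\ B X t) -> (size A <= cnt X)%N.
Proof.
move=> uA h; apply: uniq_leq_size => // t /h; exact: (mem_box_list X t).2.
Qed.

Lemma cnt_GL g X : G g -> (cnt X <= cnt (g X))%N.
Proof.
move=> Gg; rewrite {1}/cnt -(size_map g); apply: le_cnt.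
  by rewrite map_inj_uniq ?box_list_uniq //; exact: GL_inj.
move=> t /mapP[u /mem_box_list[Lu Bu] ->]; split; first exact: pc_GL.
exact: box_GL.
Qed.

Lemma cnt_mono X Y : Cb (Y - X) -> (cnt X <= cnt Y)%N.
Proof.
move=> h; apply: le_cnt; first exact: box_list_uniq.
move=> t /mem_box_list[Lt Bt]; split=> //.
by rewrite -[Y](subrK X) addrC; exact: box_clo.
Qed.

Lemma cnt_gt0 X : C X -> (0 < cnt X)%N.
Proof.
move=> CX; suff : 0 \in box_list X by rewrite /cnt; case: box_list.
by apply/mem_box_list; split; [exact: (lat0 hb)|exact/box0].
Qed.

(* Two lattice points of [B (M X)] congruent modulo [2 M] differ by [2 M] times a
   lattice point of [B X]. *)
Lemma cnt_dilate (M : nat) X : (0 < M)%N -> (cnt (M%:R *: X) <= (2 * M) ^ d * cnt X)%N.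
Proof.
move=> M0; pose q := (2 * M)%N; have q0 : (0 < q)%N by rewrite muln_gt0.
have qR : q%:R != 0 :> R by rewrite pnatr_eq0 -lt0n.
pose cl t : {ffun 'I_d -> 'I_q.-1.+1} :=
  [ffun i => inord `|(Num.floor (crd i t) %% q%:Z)%Z|%N].
pose A := box_list (M%:R *: X).
have clP t u : L t -> L u -> cl t = cl u -> L ((q%:R^-1 : R) *: (t - u)).
  move=> Lt Lu /ffunP e; apply/(latP hb) => i.
  have := e i; rewrite !ffunE => /(congr1 (@nat_of_ord _)).
  have nn (c : int) : (c %% q%:Z)%Z = `|(c %% q%:Z)%Z|%N.
    by rewrite gez0_abs // modz_ge0 // -lt0n.
  have lt (c : int) : (`|(c %% q%:Z)%Z|%N < q.-1.+1)%N.
    by rewrite prednK // -ltz_nat -nn ltz_pmod.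
  rewrite !inordK // => eqn.
  have /eqP : ((Num.floor (crd i t)) %% q%:Z)%Z = ((Num.floor (crd i u)) %% q%:Z)%Z.
    by rewrite nn eqn -nn.
  rewrite eqz_mod_dvd => /dvdzP[c hc].
  have It := (latP hb t).1 Lt i; have Iu := (latP hb u).1 Lu i.
  have -> : crd i ((q%:R^-1 : R) *: (t - u)) = c%:~R.
    rewrite crdZ -[- u]scaleN1r crdD crdZ mulN1r.
    rewrite -(floorK It) -(floorK Iu) -intrB hc intrM mulrC mulfK //.
  exact: intr_int.
rewrite /cnt -/A; have [->|[t0 t0A]] : A = [::] \/ exists t0, t0 \in A.
- by case: A => [|t0 A']; [left|right; exists t0; rewrite mem_head].
- by [].
have /choice[r hr] : forall v, exists r, (exists2 u, u \in A & cl u = v) -> r \in A /\ cl r = v.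
  move=> v; have [[u uA uv]|no] := pselect (exists2 u, u \in A & cl u = v).
    by exists u.
  by exists t0.
pose F t := (cl t, (q%:R^-1 : R) *: (t - r (cl t))).
have FA : {subset [seq F t | t <- A] <= [seq (v, u) | v <- enum {ffun 'I_d -> 'I_q.-1.+1}, u <- box_list X]}.
  move=> _ /mapP[t tA ->]; have [Lt Bt] := (mem_box_list _ _).1 tA.
  have [rA rcl] := hr (cl t) (ex_intro2 _ _ t tA erefl).
  have [Lr Br] := (mem_box_list _ _).1 rA.
  apply: allpairs_f; first by rewrite mem_enum.
  apply/mem_box_list; split; first exact: clP.
  have -> : X = (q%:R^-1 : R) *: (M%:R *: X + M%:R *: X).
    have M0' : M%:R != 0 :> R by rewrite pnatr_eq0 -lt0n.
    by rewrite /q natrM; lmod_goals R; field.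
  apply: (boxZ hC); last exact: (boxB hC).
  by rewrite invr_gt0 ltr0n.
have F_inj : {in A &, injective F}.
  move=> t u tA uA [-> /(scalerI _) h]; apply: (addIr (- r (cl u))); apply: h.
  by rewrite invr_eq0.
rewrite -(size_map F).
apply: leq_trans (uniq_leq_size _ FA) _.
  by rewrite map_inj_in_uniq // box_list_uniq.
by rewrite size_allpairs -cardE card_ffun !card_ord prednK.
Qed.

(** The k points i u / k are rounded to lattice points e i. The translates by e i of the lattice
    points of the box of X1 / 4 are disjoint, since an overlap would put u / k in the box of X1, and
    they lie in the box of 2 X2. The factors 8^d and 4^d of the dilations by 4 and 2 make 32^d. *)
Lemma packing X1 X2 u (k : nat) : (0 < k)%N -> Cb (X2 - X1) -> B X2 u ->
  ~ B X1 ((k%:R^-1 : R) *: u) ->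
  (forall c : 'I_d -> R, (forall i, `|c i| <= 1) ->
     B ((4^-1 : R) *: X1) (\sum_(i < d) c i *: (pc_b S)`_i)) ->
  (k * cnt X1 <= 32 ^ d * cnt X2)%N.
Proof.
move=> k0 X12 Bu nB cube; pose Y := (4^-1 : R) *: X1.
have kR : 0 < k%:R :> R by rewrite ltr0n.
have N1 : (cnt X1 <= 8 ^ d * cnt Y)%N.
  have -> : X1 = (4%:R : R) *: Y by rewrite /Y; lmod_goals R; field.
  exact: (@cnt_dilate 4).
have N2 : (cnt ((2%:R : R) *: X2) <= 4 ^ d * cnt X2)%N by exact: (@cnt_dilate 2).
pose e (i : 'I_k) := lat_round (pc_b S) ((i%:R / k%:R : R) *: u).
have eP (i : 'I_k) : exists2 r, e i = (i%:R / k%:R : R) *: u - r & B Y r.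
  have [c hc cE] := lat_round_err hb ((i%:R / k%:R : R) *: u).
  exists (\sum_(j < d) c j *: (pc_b S)`_j); first by rewrite -cE opprB addrC subrK.
  by apply: cube => j; have /andP[c1 c2] := hc j; rewrite ger0_norm.
have eL i : L (e i) by exact: (lat_roundP hb).
have inj (i j : 'I_k) t t' : B Y t -> B Y t' -> e i + t = e j + t' -> (i <= j)%N.
  move=> Bt Bt' E; rewrite leqNgt; apply/negP => ji; apply: nB.
  have [r rE Br] := eP i; have [r' rE' Br'] := eP j.
  pose a : R := i%:R - j%:R.
  have a1 : 1 <= a by rewrite /a lerBrDl natr1 ler_nat.
  have a0 : 0 < a by apply: lt_le_trans a1.
  have -> : (k%:R^-1 : R) *: u = a^-1 *: ((r + t') - (t + r')).
    have -> : (r + t') - (t + r') = (a / k%:R) *: u.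
      have -> : (r + t') - (t + r') = (r - r') + (t' - t) by lmod R.
      have -> : t' - t = e i - e j.
        by apply/eqP; rewrite subr_eq addrAC eq_sym subr_eq E addrC.
      by rewrite rE rE' /a; lmod R.
    by rewrite scalerA mulrA mulVf ?mul1r // gt_eqF.
  apply: (box_shrink hC); first by rewrite normfV (ger0_norm (ltW a0)) invf_le1.
  have -> : X1 = (Y + Y) + (Y + Y) by rewrite /Y; lmod_goals R; field.
  by apply: (boxB hC); apply: (boxD hC).
have bigger : (k * cnt Y <= cnt ((2%:R : R) *: X2))%N.
  pose E := [seq e i + t | i <- enum 'I_k, t <- box_list Y].
  have -> : (k * cnt Y = size E)%N.
    by rewrite size_allpairs -cardE card_ord.
  apply: le_cnt.
    apply: allpairs_uniq; [exact: enum_uniq|exact: box_list_uniq|].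
    move=> [i t] [j t'] /allpairsP[[i1 t1] /= [_ h1 [-> ->]]].
    move=> /allpairsP[[j1 t1'] /= [_ h1' [-> ->]]] E1.
    have [_ Bt] := (mem_box_list _ _).1 h1; have [_ Bt'] := (mem_box_list _ _).1 h1'.
    have ij : i1 = j1.
      by apply/val_inj/eqP; rewrite eqn_leq (inj _ _ _ _ Bt Bt' E1) (inj _ _ _ _ Bt' Bt (esym E1)).
    by move: E1; rewrite ij => /addrI ->.
  move=> _ /allpairsP[[i t] /= [_ /mem_box_list[Lt Bt] ->]]; split.
    exact: (latD hb).
  have [r -> Br] := eP i.
  have -> : (2%:R : R) *: X2 = (X2 + (Y + Y)) + ((X2 - X1) + Y + Y).
    by rewrite /Y; lmod_goals R; field.
  have CY : Cb Y by apply: (oc_sub_closure hC); exact: (boxO hC Br).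
  apply: box_clo; last by apply: clo_add => //; apply: clo_add.
  have -> : (i%:R / k%:R : R) *: u - r + t = (i%:R / k%:R : R) *: u + (t - r) by lmod R.
  apply: (boxD hC); last exact: (boxB hC).
  apply: (box_shrink hC) => //; rewrite ger0_norm ?divr_ge0 ?ler0n //.
  by rewrite ler_pdivrMr // mul1r ler_nat ltnW.
apply: leq_trans (leq_mul (leqnn k) N1) _; rewrite mulnCA.
apply: leq_trans (leq_mul (leqnn _) bigger) _.
apply: leq_trans (leq_mul (leqnn _) N2) _.
by rewrite mulnA -expnMn.
Qed.

Lemma cube_absorb X : C X -> exists n : nat, forall a : R, n%:R <= a ->
  forall c : 'I_d -> R, (forall i, `|c i| <= 1) ->
    B (a *: X) (\sum_(i < d) c i *: (pc_b S)`_i).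
Proof.
move=> CX; have [n hn] := oc_absorb_fam hC (index_enum _) (fun i : 'I_d => (pc_b S)`_i) CX.
exists n => a na c hc; split; first exact: hn.
rewrite -sumrN; under eq_bigr do rewrite -scaleNr.
by apply: hn => // i; rewrite normrN.
Qed.

End Counting.

(** * Rationality of the lineality space of [C + V_F] *)

Lemma lin_span_seq (K : fieldType) (V : vectType K) (A : set V) :
  exists s : seq V, [/\ free s, forall x, x \in s -> A x & lin_span A = <<s>>%VS].
Proof.
pose P n := `[< exists s : seq V, [/\ free s, forall x, x \in s -> A x & size s = n] >].
have exP : exists n, P n by exists 0%N; apply/asboolP; exists [::]; split; rewrite ?nil_free.
have bdP n : P n -> (n <= \dim {:V})%N.
  move=> /asboolP[s [fs _ <-]]; rewrite -(eqP fs); exact/dimvS/subvf.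
have [n /asboolP[s [fs sA sn]] nmax] := ex_maxnP exP bdP.
exists s; split=> //; have [Asub Amin] := lin_spanP A.
apply/eqP; rewrite eqEsubv; apply/andP; split; last first.
  by apply/span_subvP => x /sA; exact: Asub.
apply: Amin => a Aa /=; apply: contrapT => /negP as_.
have := nmax n.+1; rewrite ltnn => h; apply/notF/h; apply/asboolP; exists (a :: s).
split; [by rewrite free_cons as_ fs| |by rewrite /= sn].
by move=> x; rewrite inE => /orP[/eqP ->|/sA].
Qed.

Lemma mem_lin_span (K : fieldType) (V : vectType K) (A : set V) :
  A 0 -> (forall x y, A x -> A y -> A (x + y)) -> (forall a x, A x -> A (a *: x)) ->
  forall v, v \in lin_span A <-> A v.
Proof.
move=> A0 AD AZ v; split; last exact: (lin_spanP A).1.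
have [s [_ sA ->]] := lin_span_seq A.
move/(coord_span (X := in_tuple s)) ->.
by elim/big_ind: _ => // i _; apply: AZ; apply: sA; rewrite mem_nth.
Qed.

Section Lineality.
Variables (R : realType) (V : vectType R) (S : polycone V).
Local Notation L := (int_span (pc_b S)).
Local Notation b := (pc_b S).
Local Notation hb := (pc_basis S).
Local Notation C := (pc_C S).
Local Notation Cb := (cone_closure (pc_C S)).
Local Notation G := (pc_G S).
Local Notation hC := (pc_open S).
Local Notation d := (size (pc_b S)).
Local Notation VF := <<pc_fs S>>%VS.
Local Notation f := (f_ S).
Local Notation O := (Oc S).
Local Notation Ob := (cone_closure (Oc S)).
Local Notation Gf := (Gf S).
Local Notation cnt := (cnt S).
Local Notation hO := (O_open_cone S).
Implicit Types (x y z t u v w X Y : V) (g h : GL V).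

Definition Vu : {vspace V} := lin_span [set v | Ob v /\ Ob (- v)].

Lemma VuP v : v \in Vu <-> Ob v /\ Ob (- v).
Proof.
rewrite /Vu; apply: (mem_lin_span (A := [set v | Ob v /\ Ob (- v)])) => /=.
- by rewrite oppr0; split; exact: clo0.
- by move=> x y [h1 h2] [h3 h4]; rewrite opprD; split; exact: clo_add.
move=> a x [h1 h2]; have [a0|a0] := leP 0 a.
  by rewrite -scalerN; split; exact: (clo_scale hO).
have -> : - (a *: x) = (- a) *: x by rewrite scaleNr.
have -> : a *: x = (- a) *: (- x) by rewrite scalerN scaleNr opprK.
by split; apply: (clo_scale hO) => //; rewrite oppr_ge0 ltW.
Qed.

Lemma VF_Vu w : w \in VF -> w \in Vu.
Proof.
by move=> wV; apply/VuP; split=> x Ox; rewrite addrC; apply: O_VF => //; rewrite memvN.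
Qed.

Lemma O_Vu x v : v \in Vu -> O x -> O (x + v).
Proof. by move=> /VuP[h _] Ox; rewrite addrC; exact: h. Qed.

Lemma Gf_Vu g v : Gf g -> v \in Vu -> g v \in Vu.
Proof.
move=> Gg /VuP[h1 h2]; apply/VuP; split=> x Ox.
  by rewrite -[x](GLKV g) -GLD; apply: (Gf_O Gg); apply: h1; exact: Gf_O (GfV Gg) Ox.
by rewrite -[x](GLKV g) -GLN -GLD; apply: (Gf_O Gg); apply: h2; exact: Gf_O (GfV Gg) Ox.
Qed.

Lemma lat_point : exists2 x, L x & C x.
Proof.
have [x Cx] := oc_ne hC.
have [n hn] := oc_absorb_fam hC (index_enum _) (fun i : 'I_d => b`_i) Cx.
exists (lat_round b (n%:R *: x)); first exact: (lat_roundP hb).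
have [c hc cE] := lat_round_err hb (n%:R *: x).
have -> : lat_round b (n%:R *: x) = n%:R *: x + \sum_(i < d) (- c i) *: b`_i.
  under eq_bigr do rewrite scaleNr.
  by rewrite sumrN -cE opprB addrC subrK.
by apply: hn => // i; have /andP[h1 h2] := hc i; rewrite normrN ger0_norm.
Qed.

(** Outside V_F, the constant sequence z could be subtracted from a point of O forever. *)
Lemma Vu_lat z : L z -> Cb z -> z \in Vu -> z \in VF.
Proof.
move=> Lz Cz zV; apply: contrapT => /negP zn.
have [x Lx Cx] := lat_point.
apply: (@no_descending _ _ S x (fun=> z) Lx) => // n.
rewrite sumr_const card_ord -scaler_nat; apply: O_Vu; last exact: C_sub_O.
by rewrite memvN memvZ.
Qed.

(* Pigeonhole on the fractional parts of a sequence of vectors. *)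
Lemma frac_close (w : nat -> V) (M : nat) : (0 < M)%N ->
  exists2 s, increasing s & forall i j, exists2 c : 'I_d -> R, forall l, `|c l| <= M%:R^-1 &
    (w (s j) - lat_round b (w (s j))) - (w (s i) - lat_round b (w (s i))) = \sum_(l < d) c l *: b`_l.
Proof.
move=> M0; have MR : 0 < M%:R :> R by rewrite ltr0n.
have /choice[c hc] : forall n, exists c : 'I_d -> R, (forall l, 0 <= c l <= 1) /\
    w n - lat_round b (w n) = \sum_(l < d) c l *: b`_l.
  by move=> n; have [c] := lat_round_err hb (w n); exists c.
pose F n := [ffun l : 'I_d => inord (Num.truncn (c n l * M%:R)) : 'I_M.+1].
have [s s_inc hs] := const_subseq F; exists s => // i j.
exists (fun l => c (s j) l - c (s i) l) => [l|]; last first.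
  rewrite (hc (s j)).2 (hc (s i)).2 -sumrB.
  by apply: eq_bigr => l _; rewrite scalerBl.
have cM n : 0 <= c n l * M%:R <= M%:R.
  by have /andP[h1 h2] := (hc n).1 l; rewrite mulr_ge0 ?ler0n //= ler_piMl.
have tr n : (Num.truncn (c n l * M%:R) < M.+1)%N.
  have /andP[h1 h2] := cM n; rewrite ltnS -(ler_nat R); apply: le_trans h2.
  by have /andP[] := truncn_itv h1.
have : F (s j) = F (s i) by rewrite !hs.
move/ffunP/(_ l); rewrite !ffunE => /(congr1 (@nat_of_ord _)); rewrite !inordK // => e.
have /andP[hj1 _] := cM (s j); have /andP[hi1 _] := cM (s i).
have /andP[a1 a2] := truncn_itv hj1; have /andP[a3 a4] := truncn_itv hi1.
rewrite e in a1 a2; rewrite -natr1 in a2; rewrite -natr1 in a4.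
rewrite -[M%:R^-1]mul1r ler_pdivlMr // -[X in _ * X](ger0_norm (ltW MR)) -normrM mulrBl ler_norml.
by apply/andP; split; lra.
Qed.

(** The candidate N' is the span of the lattice vectors lying in arbitrarily small neighbourhoods of
    [Vu]. If N' left [Vu], lattice vectors would come close to the points of a ray that leaves O,
    and would give lattice points p k of bounded size closer and closer to the boundary of O. By
    [bounded_orbits] they are equivalent modulo V_F, so their boxes contain comparable numbers of
    lattice points; but [packing] makes the box of p k poor compared with that of x1 when k is
    large. *)
Lemma Vu_rational : exists2 us : seq V, forall u, u \in us -> L u & Vu = <<us>>%VS.
Proof.
have [x1 Lx1 Cx1] := lat_point; have Ox1 := C_sub_O Cx1.
pose B (e : R) v := sym_box O (e *: x1) v.
have Bmono e e' v : e <= e' -> B e v -> B e' v.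
  rewrite /B => ee h; have -> : e' *: x1 = e *: x1 + (e' - e) *: x1 by lmod R.
  apply: box_clo => //; apply: (clo_scale hO); first by rewrite subr_ge0.
  exact: (oc_sub_closure hO).
have BD e e' v v' : B e v -> B e' v' -> B (e + e') (v + v').
  by rewrite /B scalerDl; exact: (boxD hO).
have BB e e' v v' : B e v -> B e' v' -> B (e + e') (v - v').
  by rewrite /B scalerDl; exact: (boxB hO).
have BVu e v : 0 < e -> v \in Vu -> B e v.
  move=> e0 /VuP[h1 h2]; have Oe := oc_scale hO e0 Ox1.
  by split; rewrite addrC; [exact: h1|exact: h2].
have Bex v : exists M : nat, B M%:R v.
  have [n hn] := oc_absorb hO v Ox1; have [m hm] := oc_absorb hO (- v) Ox1.
  exists (n + m)%N; split; first by apply: hn; rewrite ler_nat leq_addr.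
  by apply: hm; rewrite ler_nat leq_addl.
have B0 e : 0 < e -> B e 0 by move=> e0; apply/box0/(oc_scale hO).
have BZ e (a : R) v : 0 < a -> B e v -> B (a * e) (a *: v).
  by rewrite /B -scalerA; exact: (boxZ hO).
(* The boxes B e shrink to [Vu] as e tends to 0, and the spans Ne e decrease with e, so they are
   constant for e <= e0. *)
pose Ne (e : R) := lin_span [set l | L l /\ B e l].
have Ne_mono e e' : e <= e' -> (Ne e <= Ne e')%VS.
  move=> ee; apply: (lin_spanP _).2 => l [Ll Bl]; apply: (lin_spanP _).1.
  by split=> //; exact: Bmono Bl.
pose P n := `[< exists2 e : R, 0 < e & \dim (Ne e) = n >].
have exP : exists n, P n by exists (\dim (Ne 1)); apply/asboolP; exists 1.
have [n0 /asboolP[e0 e0_gt0 dimN] nmin] := ex_minnP exP.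
have NeE e : 0 < e -> e <= e0 -> Ne e = Ne e0.
  move=> e_gt0 ee; apply/eqP; rewrite -dimv_leqif_eq ?Ne_mono // eqn_leq dimvS ?Ne_mono //=.
  by rewrite dimN; apply: nmin; apply/asboolP; exists e.
pose N' := Ne e0.
have dens v (eta : R) : v \in N' -> 0 < eta -> exists2 l, L l & B eta (v - l).
  move=> vN eta0; pose D := \dim {:V}.
  pose e := Num.min e0 (eta / D.+1%:R).
  have e_gt0 : 0 < e by rewrite /e lt_min e0_gt0 divr_gt0 // ltr0n.
  have ee : e <= e0 by rewrite /e ge_min lexx.
  move: vN; rewrite /N' -(NeE e) // /Ne; have [s [fs sA ->]] := lin_span_seq [set l | L l /\ B e l].
  pose c i := coord (in_tuple s) i v.
  move=> /(coord_span (X := in_tuple s)) vE; pose l := \sum_(i < size s) (Num.floor (c i))%:~R *: s`_i.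
  have Ls (i : 'I_(size s)) : L s`_i /\ B e s`_i by apply: sA; rewrite mem_nth.
  exists l; first by apply: (lat_sum hb) => i _; apply: (latZ hb); rewrite ?intr_int //; case: (Ls i).
  have -> : v - l = \sum_(i < size s) (c i - (Num.floor (c i))%:~R) *: s`_i.
    by rewrite vE /l -sumrB; apply: eq_bigr => i _; rewrite scalerBl.
  have bnd (r : seq 'I_(size s)) : B ((size r).+1%:R * e) (\sum_(i <- r) (c i - (Num.floor (c i))%:~R) *: s`_i).
    elim: r => [|i r IH]; first by rewrite big_nil mul1r; exact: B0.
    rewrite big_cons /= -[(size r).+2]addn1 natrD mulrDl mul1r addrC.
    apply: BD => //; apply: (box_shrink hO); last by case: (Ls i).
    have /andP[h1 h2] := floor_itv (c i); rewrite intrD in h2.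
    by rewrite ger0_norm ?subr_ge0 //; lra.
  have := bnd (enum 'I_(size s)); rewrite big_enum size_enum_ord; apply: Bmono.
  have sD : (size s <= D)%N by rewrite -(eqP fs); exact/dimvS/subvf.
  apply: le_trans (_ : D.+1%:R * e <= _).
    by rewrite ler_wpM2r ?ler_nat ?ltnS // ltW.
  by rewrite mulrC -ler_pdivlMr ?ltr0n // /e ge_min lexx orbT.
(* By pigeonhole some k v with k >= 1 is so close to a lattice vector l that l lies in B e0, hence
   in N'. A form th vanishing on N' with th v = 1 would give k = th (k v - l) < 1; the choice of M
   ensures both estimates. *)
have VuN : (Vu <= N')%VS.
  apply/subvP => v vV; apply: contrapT => /negP vN.
  have [th th1 thN] := hom_sep vN.
  pose T := \sum_(l < d) `|th b`_l : R|.
  have T0 : 0 <= T by apply: sumr_ge0.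
  have [M1 hM1] := oc_absorb_fam hO (index_enum _) (fun i : 'I_d => b`_i) Ox1.
  pose M := (Num.truncn (2 * (M1%:R + 1) / e0 + T)).+1.
  have MR : 0 < M%:R :> R by rewrite ltr0n.
  have Mbig : 2 * (M1%:R + 1) / e0 + T < M%:R by exact: truncnS_gt.
  have q0 : 0 <= 2 * (M1%:R + 1) / e0 :> R.
    by rewrite divr_ge0 ?mulr_ge0 ?addr_ge0 ?ler0n // ltW.
  have [s s_inc hs] := @frac_close (fun k => k%:R *: v) M isT.
  have [c hc cE] := hs 0%N 1%N.
  have s01 : (s 0 < s 1)%N by exact: s_inc.
  pose l := lat_round b ((s 1%N)%:R *: v) - lat_round b ((s 0%N)%:R *: v).
  have Ll : L l by apply: (latB hb); exact: (lat_roundP hb).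
  pose k := (s 1 - s 0)%N.
  have lE : l = k%:R *: v - \sum_(i < d) c i *: b`_i.
    by rewrite -cE /l /k natrB ?(ltnW s01) //; lmod R.
  have smallB : B (M1%:R / M%:R) (\sum_(i < d) c i *: b`_i).
    have -> : \sum_(i < d) c i *: b`_i = (M%:R^-1 : R) *: \sum_(i < d) (M%:R * c i) *: b`_i.
      rewrite scaler_sumr; apply: eq_bigr => i _.
      by rewrite scalerA mulrA mulVf ?mul1r // gt_eqF.
    have hc' i : `|M%:R * c i| <= 1.
      by rewrite normrM ger0_norm ?ler0n // -ler_pdivlMl // mulr1.
    rewrite mulrC; apply: BZ; first by rewrite invr_gt0.
    split; first exact: hM1.
    rewrite -sumrN; under eq_bigr do rewrite -scaleNr.
    by apply: hM1 => // i; rewrite normrN.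
  have Bl : B e0 l.
    rewrite lE; apply: (@Bmono (e0 / 2 + M1%:R / M%:R)).
      have : M1%:R / M%:R <= e0 / 2.
        have M2 : 2 * (M1%:R + 1) < M%:R * e0 by rewrite -ltr_pdivrMr //; lra.
        by rewrite ler_pdivrMr //; lra.
      by lra.
    apply: BB => //; apply: BVu; first by rewrite divr_gt0.
    exact: memvZ.
  have lN : l \in N' by apply: (lin_spanP _).1.
  have := thN l lN; rewrite lE homB homZ th1 mulr1 hom_sum => /eqP.
  rewrite subr_eq0 => /eqP kE.
  have : k%:R <= T / M%:R.
    rewrite kE; apply: le_trans (ler_norm _) _; apply: le_trans (ler_norm_sum _ _ _) _.
    rewrite mulr_suml; apply: ler_sum => i _; rewrite homZ normrM mulrC.
    by apply: ler_wpM2l.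
  rewrite ler_pdivlMr // => h.
  have k1 : 1 <= k%:R :> R by rewrite ler1n subn_gt0.
  have : M%:R <= k%:R * M%:R :> R by rewrite ler_peMl // ltW.
  by lra.
suff NVu : (N' <= Vu)%VS.
  have [s [_ sA sE]] := lin_span_seq [set l | L l /\ B e0 l].
  exists s => [u /sA[]//|]; apply/eqP; rewrite -sE -/(Ne e0) -/N'.
  by rewrite eqEsubv VuN NVu.
apply/subvP => n nN; apply: contrapT => nV.
have [m mN mC] : exists2 m, m \in N' & ~ Ob (- m).
  have [h1|h1] := pselect (Ob n).
    by exists n => // h2; apply/nV/VuP.
  by exists (- n); rewrite ?memvN // opprK.
have [s s0 Os] : exists2 s : R, 0 < s & ~ O (x1 - s *: m).
  apply: contrapT => no; apply: mC; apply: (@clo_lim _ _ _ hO (- m) x1).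
    exact: (oc_sub_closure hO).
  move=> k; apply: (oc_sub_closure hO); rewrite addrC scalerN; apply: contrapT => h.
  by apply: no; exists k.+1%:R.
have [M hM] := Bex (s *: m).
pose Cn := (M + 2)%N.
have pk k : exists p, [/\ L p, O p, O (Cn%:R *: x1 - p) & ~ O (p - (k.+1%:R^-1 : R) *: x1)].
  have [K KE K1] : exists2 K : R, K = k.+1%:R & 1 <= K by exists k.+1%:R; rewrite ?ler1n.
  have K0 : 0 < K by lra.
  rewrite -KE.
  have [M' M'0 MM'] : exists2 M', (0 < M')%N & (M <= M')%N by exists M.+1.
  have M'R : 0 < M'%:R :> R by rewrite ltr0n.
  (* One step s / N along the ray is worth at most x1 / (2 K). As y is the division point before the
     first one outside O, y - x1 / (2 K) is outside O; the other half of x1 / K pays for replacing t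
     m by the lattice vector l. *)
  pose N := (2 * k.+1 * M')%N.
  have N0 : (0 < N)%N by rewrite !muln_gt0.
  have NR : N%:R = 2 * K * M'%:R :> R by rewrite /N !natrM KE.
  have N0R : 0 < N%:R :> R by rewrite ltr0n.
  pose Q i := ~~ `[< O (x1 - (i%:R * s / N%:R) *: m) >].
  have exQ : exists i, Q i.
    exists N; apply/negP => /asboolP; have -> : N%:R * s / N%:R = s :> R by field; rewrite gt_eqF.
    exact: Os.
  have [i Qi imin] := ex_minnP exQ.
  have iN : (i <= N)%N.
    apply: imin; apply/negP => /asboolP; have -> : N%:R * s / N%:R = s :> R by field; rewrite gt_eqF.
    exact: Os.
  case: i Qi imin iN => [|i] Qi imin iN.
    by exfalso; move/negP: Qi; apply; apply/asboolP; rewrite !mul0r scale0r subr0.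
  pose t := i%:R * s / N%:R; pose y := x1 - t *: m.
  have Oy : O y.
    by apply: contrapT => h; have := imin i; rewrite ltnn => /(_ _)/notF; apply; apply/negP => /asboolP.
  have step : O (((2 * K)^-1 : R) *: x1 - (s / N%:R) *: m).
    have -> : ((2 * K)^-1 : R) *: x1 - (s / N%:R) *: m = (N%:R^-1 : R) *: (M'%:R *: x1 - s *: m).
      by rewrite NR; lmod_field R.
    apply: (oc_scale hO); first by rewrite invr_gt0.
    have /Bmono h := hM; by have [] := h M'%:R; rewrite ?ler_nat.
  have nOy : ~ O (y - ((2 * K)^-1 : R) *: x1).
    move=> h; move/negP: Qi; apply; apply/asboolP.
    have -> : x1 - (i.+1%:R * s / N%:R) *: m = (y - ((2 * K)^-1 : R) *: x1) + (((2 * K)^-1 : R) *: x1 - (s / N%:R) *: m).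
      by rewrite /y /t -natr1; lmod_field R.
    exact: (oc_add hO).
  have [eta' eta'0 Oeta] := oc_open_le hO (- x1) Oy.
  pose eta := Num.min eta' (2 * K)^-1.
  have eta0 : 0 < eta by rewrite lt_min eta'0 invr_gt0 mulr_gt0.
  have etaK : eta <= (2 * K)^-1 by rewrite ge_min lexx orbT.
  have Oye : O (y - eta *: x1) by rewrite -scalerN; apply: Oeta; rewrite (ltW eta0) ge_min lexx.
  have [l Ll [Bl1 Bl2]] := dens (t *: m) eta (memvZ _ mN) eta0.
  exists (x1 - l); split.
  - exact: (latB hb).
  - have -> : x1 - l = (y - eta *: x1) + (eta *: x1 + (t *: m - l)) by rewrite /y; lmod R.
    exact: (oc_add hO).
  - have Bl : B (M%:R + eta) (t *: m - (t *: m - l)).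
      apply: BB => //; have -> : t *: m = (i%:R / N%:R) *: (s *: m) by rewrite /t; lmod R.
      apply: (box_shrink hO) hM; rewrite ger0_norm ?divr_ge0 ?ler0n //.
      by rewrite ler_pdivrMr // mul1r ler_nat ltnW.
    have e1 : eta <= 1.
      apply: le_trans etaK _; rewrite invf_le1 ?mulr_gt0 //.
      by lra.
    have [h _] : B (M%:R + 1) l.
      have lE : t *: m - (t *: m - l) = l by lmod R.
      by move: Bl; rewrite lE; apply: Bmono; rewrite lerD2l.
    by have -> : Cn%:R *: x1 - (x1 - l) = (M%:R + 1) *: x1 + l by rewrite /Cn natrD; lmod R.
  - move=> h; apply: nOy.
    have -> : y - ((2 * K)^-1 : R) *: x1 = (x1 - l - (K^-1 : R) *: x1) +
        (((2 * K)^-1 - eta) *: x1 + (eta *: x1 - (t *: m - l))).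
      by rewrite /y; lmod_field R.
    apply: (oc_add hO) => //.
    apply: (oc_closureD (clo_scale hO _ (oc_sub_closure hO Ox1))) => //.
    by rewrite subr_ge0.
have /choice[p hp] := pk.
have LCx : L (Cn%:R *: x1) by exact: (latZn hb).
have OCx : O (Cn%:R *: x1) by apply: (oc_scale hO) => //; rewrite ltr0n /Cn addn2.
have [|sq sq_inc hsq] := @bounded_orbits _ _ S _ p LCx OCx.
  by move=> k; have [] := hp k.
pose p0 := p (sq 0%N); have [Lp0 Op0 _ _] := hp (sq 0%N).
have [D [D6 OD]] : exists D : nat, (6 <= D)%N /\ O (p0 - (D%:R^-1 : R) *: x1).
  have [n1 hn1] := oc_absorb hO (- x1) Op0.
  exists (n1 + 6)%N; split; first by rewrite leq_addl.
  have D0 : 0 < (n1 + 6)%:R :> R by rewrite ltr0n addn_gt0 orbT.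
  have n1le : n1%:R <= (n1 + 6)%:R :> R by rewrite ler_nat leq_addr.
  move: (n1 + 6)%:R D0 n1le => a D0 n1le.
  have -> : p0 - (a^-1 : R) *: x1 = (a^-1 : R) *: (a *: p0 - x1).
    by lmod_field R.
  apply: (oc_scale hO); first by rewrite invr_gt0.
  exact: hn1.
have D0 : 0 < D%:R :> R by rewrite ltr0n; apply: leq_trans D6.
(* The factor 32^d comes from [packing], and (2 Cn D)^d from comparing Cn Y with Y / D. The index
   E.+1 makes K > E. *)
pose E := (32 ^ d * (2 * (Cn * D)) ^ d)%N.
pose k := sq E.+1; pose K := k.+1.
have KE : (E < K)%N by rewrite ltnS; apply: leq_trans (increasing_ge E.+1 sq_inc).
have KR : 0 < K%:R :> R by rewrite ltr0n.
have [g Gg gw] := hsq 0%N E.+1 isT.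
pose w := p k - g p0; rewrite -/p0 -/k -/w in gw.
have [_ _ OCk nOk] := hp k.
have [n1 hn1] := VF_absorb gw.
have [n2 hn2] := O_absorb OD.
have [n3 hn3] := O_absorb OCk.
(* This multiple of f turns the relations known only in O or modulo V_F into relations in C. The
   requirement 6 <= D keeps n' / 2 - 3 n' / D nonnegative. *)
pose n' : R := (n1 + (2 * n2) + n3)%:R.
have n'0 : 0 <= n' by rewrite ler0n.
have n'1 : n1%:R <= n' by rewrite ler_nat -addnA leq_addr.
have n'2 : n2%:R <= n' / 2.
  by rewrite ler_pdivlMr // -natrM ler_nat mulnC addnAC leq_addl.
have n'3 : n3%:R <= n' by rewrite ler_nat leq_addl.
have Gg' : G g by case: Gg.
pose Y := x1 + (3 * n') *: f; pose X := p k + (2 * n') *: f.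
have Cf : Cb f by exact: f_clo.
have DYX : C (p0 + n' *: f - (D%:R^-1 : R) *: Y).
  have -> : p0 + n' *: f - (D%:R^-1 : R) *: Y =
      (n' * (1 / 2 - 3 / D%:R)) *: f + (p0 - (D%:R^-1 : R) *: x1 + (n' / 2) *: f).
    by rewrite /Y; lmod_field R.
  apply: nf_C; last exact: hn2.
  rewrite mulr_ge0 // subr_ge0 ler_pdivrMr //.
  have : 6 <= D%:R :> R by rewrite ler_nat.
  by lra.
have CY : C Y.
  by rewrite /Y addrC; apply: nf_C => //; rewrite mulr_ge0.
have CpX : Cb (X - g (p0 + n' *: f)).
  have -> : X - g (p0 + n' *: f) = n' *: f + w.
    by rewrite /X /w GLD GLZ Gg.2; lmod R.
  exact: hn1.
have CX : C X.
  rewrite -[X](subrK (g (p0 + n' *: f))); apply: CpX; apply: (pc_GC Gg').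
  rewrite -[X in C X](subrK ((D%:R^-1 : R) *: Y)); apply: (oc_add hC) => //.
  by apply: (oc_scale hC) => //; rewrite invr_gt0.
have [m1 hm1] := cube_absorb CX.
pose M4 := (4 * m1.+1)%N; have M40 : 0 < M4%:R :> R by rewrite ltr0n.
have Cn2 : 2 <= Cn%:R :> R by rewrite ler_nat leq_addl.
suff : (K * cnt (M4%:R *: X) <= 32 ^ d * cnt (M4%:R *: (Cn%:R *: Y)))%N.
  apply/negP; rewrite -ltnNge.
  have CD0 : (0 < Cn * D)%N by rewrite muln_gt0 /Cn addn2 /=; apply: leq_trans D6.
  have cX : (0 < cnt (M4%:R *: X))%N by apply/cnt_gt0/(oc_scale hC).
  have -> : M4%:R *: (Cn%:R *: Y) = (Cn * D)%:R *: (M4%:R *: ((D%:R^-1 : R) *: Y)).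
    by rewrite natrM; lmod_field R.
  set Z := M4%:R *: ((D%:R^-1 : R) *: Y); have dil := @cnt_dilate _ _ S _ Z CD0.
  apply: leq_ltn_trans (leq_mul (leqnn (32 ^ d)%N) dil) _.
  rewrite mulnA -/E; apply: leq_ltn_trans (_ : E * cnt (M4%:R *: X) < _)%N; last by rewrite ltn_pmul2r.
  rewrite leq_mul2l; apply/orP; right.
  pose W := M4%:R *: g (p0 + n' *: f); apply: (@leq_trans (cnt W)).
    rewrite /W -GLZ; apply: leq_trans (cnt_GL _ Gg'); apply: cnt_mono.
    rewrite -scalerBr; apply: (clo_scale hC); first exact: ltW.
    exact: (oc_sub_closure hC).
  by apply: cnt_mono; rewrite -scalerBr; apply: (clo_scale hC); rewrite ?ltW.
apply: (@packing _ _ S _ _ (M4%:R *: x1)) => //.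
- rewrite -scalerBr; apply: (clo_scale hC); first exact: ltW.
  have -> : Cn%:R *: Y - X = (n' * (3 * Cn%:R - 3)) *: f + (Cn%:R *: x1 - p k + n' *: f).
    by rewrite /Y /X; lmod R.
  apply: clo_add; last by apply: (oc_sub_closure hC); exact: hn3.
  by apply: nf_clo; rewrite mulr_ge0 //; lra.
- apply: (boxZ hC) => //.
  have -> : Cn%:R *: Y = Cn%:R *: x1 + (Cn%:R * (3 * n')) *: f by rewrite /Y; lmod R.
  apply: box_clo; last by apply: nf_clo; rewrite !mulr_ge0 // ?ler0n.
  split.
    have -> : Cn%:R *: x1 + x1 = (Cn%:R + 1) *: x1 by lmod R.
    by apply: (oc_scale hC) => //; lra.
  have -> : Cn%:R *: x1 - x1 = (Cn%:R - 1) *: x1 by lmod R.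
  by apply: (oc_scale hC) => //; lra.
- move=> [_ h]; apply: nOk.
  have -> : p k - (k.+1%:R^-1 : R) *: x1 = (M4%:R^-1 : R) *: (M4%:R *: X - (K%:R^-1 : R) *: (M4%:R *: x1)) + (- (2 * n')) *: f.
    by rewrite /X -/K; lmod_field R.
  apply: O_VF; first by rewrite memvZ // f_VF.
  by apply: C_sub_O; apply: (oc_scale hC) => //; rewrite invr_gt0.
- move=> c hc; have -> : (4^-1 : R) *: (M4%:R *: X) = m1.+1%:R *: X.
    by rewrite /M4 natrM; lmod_goals R; field.
  by apply: hm1 => //; rewrite ler_nat.
Qed.

Lemma Vu_forms : exists ths : seq 'Hom(V, R^o), [/\ forall th, th \in ths -> intform b th,
    forall th, th \in ths -> dual_of O th &
    forall v, v \in Vu <-> forall th, th \in ths -> th v = 0].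
Proof.
have [us usL usE] := Vu_rational; apply: (rational_dual hb hO _ usL usE) => v.
split=> [vV x t Ox|h]; first by apply: O_Vu => //; exact: memvZ.
by apply/VuP; split=> x Ox; rewrite addrC; [have := h x 1 Ox|have := h x (-1) Ox];
   rewrite ?scale1r ?scaleN1r.
Qed.

End Lineality.

(** * Geometry of numbers *)

(** A basis with maximal determinant is chosen among the vectors of A. By Cramer's rule, replacing
    its i-th member by a multiplies the determinant by the i-th coordinate of a, which is therefore
    at most 1 in absolute value. *)
Lemma auerbach (R : realType) (V : vectType R) (A : seq V) :
  exists v : 'I_(\dim <<A>>) -> V, [/\ forall i, v i \in A, free [tuple v i | i < \dim <<A>>] &
    forall a, a \in A -> exists2 c : 'I_(\dim <<A>>) -> R, forall i, `|c i| <= 1 & a = \sum_i c i *: v i].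
Proof.
pose k := \dim <<A>>; pose e := vbasis <<A>>.
have eB : basis_of <<A>>%VS e by exact: vbasisP.
have AE a : a \in A -> a = \sum_(j < k) coord e j a *: e`_j.
  by move=> aA; apply: coord_basis eB _; exact: memv_span.
pose Mx (p : {ffun 'I_k -> 'I_(size A)}) := \matrix_(i < k, j < k) coord e j A`_(p i).
have [p0 p0n] : exists p, \det (Mx p) != 0.
  have [s [fs sA' sE]] := lin_span_seq [set x : V | x \in A].
  have sA x : x \in s -> x \in A by exact: sA'.
  have sE' : <<s>>%VS = <<A>>%VS.
    apply/eqP; rewrite eqEsubv; apply/andP; split; apply/span_subvP => x xs.
      by apply: memv_span; exact: sA.
    by rewrite -sE; exact: (lin_spanP _).1.
  have sk : size s = k by rewrite /k -sE'; apply/esym/eqP.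
  have iA (i : 'I_k) : (index (s`_i)%R A < size A)%N by rewrite index_mem; apply: sA; rewrite mem_nth // sk.
  exists [ffun i => Ordinal (iA i)]; set M := Mx _.
  have ME i j : M i j = coord e j s`_i.
    by rewrite mxE ffunE /= nth_index //; apply: sA; rewrite mem_nth // sk.
  rewrite -unitfE -[_ \is a _]/(M \in unitmx) -row_free_unit -kermx_eq0.
  apply/eqP/row_matrixP => l; rewrite row0.
  have : row l (kermx M) *m M = 0 by apply/sub_kermxP; exact: row_sub.
  move: (row l (kermx M)) => u uM.
  have fs' : free (in_tuple s) by [].
  have /freeP h := fs'.
  have u0 (i : 'I_(size s)) : u 0 (cast_ord sk i) = 0.
    apply: (h (fun i => u 0 (cast_ord sk i))).
    have /= -> : \sum_(i < size s) u 0 (cast_ord sk i) *: (in_tuple s)`_i =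
        \sum_(j < k) (u *m M) 0 j *: e`_j.
      rewrite (reindex (cast_ord (esym sk))) /=; last first.
        by exists (cast_ord sk) => ? _; rewrite ?cast_ordK ?cast_ordKV.
      under [RHS]eq_bigr do rewrite mxE scaler_suml.
      rewrite [RHS]exchange_big /=; apply: eq_bigr => l' _; rewrite cast_ordKV.
      rewrite {1}[s`_l']AE ?sA ?mem_nth ?sk // scaler_sumr.
      by apply: eq_bigr => j _; rewrite scalerA ME.
    by rewrite uM big1 // => j _; rewrite mxE scale0r.
  by apply/rowP => i; rewrite mxE -(cast_ordKV sk i) u0.
have [p _ pmax] := @arg_maxP _ _ _ p0 predT (fun p => `|\det (Mx p)|) isT.
have pn : \det (Mx p) != 0.
  by rewrite -normr_gt0; apply: lt_le_trans (pmax p0 isT); rewrite normr_gt0.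
pose M := Mx p; have uM : M \in unitmx by rewrite unitmxE unitfE.
exists (fun i => A`_(p i)); split.
- by move=> i; rewrite mem_nth.
- apply/freeP => c /= c0 i.
  pose u := \row_i c i.
  have : u *m M = 0.
    apply/rowP => j; rewrite !mxE.
    transitivity (coord e j (\sum_(i < k) c i *: [tuple A`_(p i) | i < k]`_i)); last by rewrite c0 linear0.
    rewrite linear_sum; apply: eq_bigr => l _; rewrite !mxE linearZ /=.
      by rewrite (nth_map l) ?size_enum_ord // nth_ord_enum.
  move/(congr1 (mulmx^~ (invmx M))); rewrite mulmxK // mul0mx => /rowP/(_ i).
  by rewrite !mxE.
move=> a aA; pose ra := \row_(j < k) coord e j a; pose be := ra *m invmx M.
have beM : be *m M = ra by rewrite mulmxKV.
exists (be 0) => [i|]; last first.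
  rewrite [LHS]AE //.
  have -> : \sum_(j < k) coord e j a *: e`_j = \sum_(j < k) (be *m M) 0 j *: e`_j.
    by apply: eq_bigr => j _; rewrite beM mxE.
  under eq_bigr do rewrite mxE scaler_suml.
  rewrite exchange_big /=; apply: eq_bigr => i _.
  rewrite [A`_(p i)]AE ?mem_nth // scaler_sumr.
  by apply: eq_bigr => j _; rewrite scalerA [M i j]mxE.
have ia : (index a A < size A)%N by rewrite index_mem.
pose p' := [ffun l => if l == i then Ordinal ia else p l].
have : `|\det (Mx p')| <= `|\det (Mx p)| := pmax p' isT.
have -> : \det (Mx p') = be 0 i * \det M.
  rewrite (expand_det_row _ i).
  have -> : be 0 i * \det M = (be *m M *m \adj M) 0 i.
    by rewrite -mulmxA mul_mx_adj mul_mx_scalar [RHS]mxE mulrC.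
  rewrite beM mxE; apply: eq_bigr => j _; rewrite !mxE ffunE eqxx /= nth_index //.
  congr (_ * _); rewrite /cofactor; congr (_ * \det _).
  by apply/matrixP => x y; rewrite !mxE ffunE eq_sym (negbTE (neq_lift _ _)).
by rewrite normrM ger_pMl // normr_gt0.
Qed.

Section SmithIndex.
Variables (r : nat) (M : 'M[int]_r).

(* By the Smith normal form the row lattices of [M] and [M^T] have the same index. *)
Lemma transpose_index : \det M != 0 ->
  exists (T : finType) (A : {set T}) (co : 'rV[int]_r -> T) (rep : T -> 'rV[int]_r),
  [/\ forall v, co v \in A,
      forall v w, co v = co w -> exists c, v - w = c *m M^T &
      forall s t c, s \in A -> t \in A -> rep s - rep t = c *m M -> s = t].
Proof.
move=> dM; have [Lm uL [Rm uR [ds _ ME]]] := int_Smith_normal_form M.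
move: ME; set Dg := \matrix_(i, j) _ => ME.
pose dz (j : 'I_r) : int := ds`_j; pose d j := absz (dz j).
have d0 j : (0 < d j)%N.
  rewrite lt0n; apply: contraNneq dM => dj; rewrite ME !det_mulmx.
  suff -> : \det Dg = 0 by rewrite mulr0 mul0r.
  rewrite (expand_det_row _ j) big1 // => l _; rewrite mxE; have [e|] := eqVneq (val j) (val l).
    have /eqP := dj; rewrite absz_eq0 => /eqP dj0.
    by rewrite -[ds`_j]/(dz j) dj0 mul0rn mul0r.
  by rewrite mulr0n mul0r.
pose N := \max_j d j; have dN j : (d j <= N)%N by rewrite /N; exact: leq_bigmax.
pose T := {ffun 'I_r -> 'I_N.+1}.
(* Since M = L D R and M^T = R^T D L^T with D diagonal, classes modulo the rows of M^T are read on v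
   (L^T)^-1 modulo the entries of D, while representatives modulo the rows of M are the residues
   multiplied by R. Both are indexed by the same residues. *)
pose yz (v : 'rV[int]_r) j : int := (v *m invmx Lm^T) 0 j.
pose co (v : 'rV[int]_r) : T := [ffun j => inord (absz (yz v j %% dz j)%Z)].
have md (z : int) j : (absz (z %% dz j)%Z < d j)%N.
  have dj : dz j != 0 by have := d0 j; rewrite /d absz_gt0.
  by rewrite -ltz_nat gez0_abs ?modz_ge0 // /d abszE ltz_mod.
have coE v j : co v j = absz (yz v j %% dz j)%Z :> nat.
  by rewrite ffunE inordK // ltnS; apply: leq_trans (ltnW (md _ _)) (dN j).
exists T, [set f : T | [forall j, f j < d j]%N]%SET, co, (fun f : T => (\row_j (f j : nat)%:Z) *m Rm).
have uLT : Lm^T \in unitmx by rewrite unitmx_tr.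
have uRT : Rm^T \in unitmx by rewrite unitmx_tr.
split.
- by move=> v; rewrite inE; apply/forallP => j; rewrite coE md.
- move=> v w cvw; have dj j : dz j != 0 by have := d0 j; rewrite /d absz_gt0.
  have /choice[q hq] : forall j, exists q, ((v - w) *m invmx Lm^T) 0 j = q * dz j.
    move=> j; have := coE v j; rewrite cvw coE => e.
    have /eqP : (yz v j %% dz j)%Z = (yz w j %% dz j)%Z.
      have nn (c : int) : (c %% dz j)%Z = absz (c %% dz j)%Z :> int by rewrite gez0_abs // modz_ge0.
      by rewrite nn [RHS]nn e.
    by rewrite eqz_mod_dvd => /dvdzP[q hq]; exists q; rewrite mulmxBl -hq /yz !mxE.
  exists ((\row_j q j) *m invmx Rm^T).
  rewrite ME !trmx_mul -!mulmxA (mulmxA _ Rm^T) mulVmx // mul1mx.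
  suff E : (v - w) *m invmx Lm^T = \row_j q j *m Dg^T by rewrite mulmxA -E mulmxKV.
  apply/rowP => j; rewrite hq mxE (bigD1 j) //= big1 => [|l lj].
    by rewrite addr0 !mxE eqxx mulr1n.
  have ljn : (l == j :> nat) = false by exact: negbTE lj.
  by rewrite !mxE ?ljn ?(eq_sym (j : nat)) ?ljn mulr0n mulr0.
move=> s t c; rewrite !inE => /forallP hs /forallP ht.
rewrite -mulmxBl ME !mulmxA => /(can_inj (mulmxK uR)) /rowP e.
apply/ffunP => j; apply/val_inj => /=.
have := e j; rewrite !mxE (bigD1 j) //= big1 => [|l lj]; last first.
  have ljn : (l == j :> nat) = false by exact: negbTE lj.
  by rewrite !mxE ?ljn ?(eq_sym (j : nat)) ?ljn mulr0n mulr0.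
rewrite addr0 !mxE eqxx mulr1n => e'.
have : ((s j)%:Z = (t j)%:Z %[mod dz j])%Z.
  by apply/eqP; rewrite eqz_mod_dvd; apply/dvdzP; exists (\sum_j0 c 0 j0 * Lm j0 j).
by rewrite -!(modz_abs _ (dz j)) !modz_nat !modn_small ?hs ?ht // => -[].
Qed.

End SmithIndex.

(** Coordinates in [-1, 1] are shifted to [0, 2] and truncated at resolution 1 / N, hence the 2 N +
    1 cells. *)
Lemma code_close (R : realType) (N : nat) (x y : R) : (0 < N)%N -> `|x| <= 1 -> `|y| <= 1 ->
  (Num.truncn ((x + 1) * N%:R) < (2 * N).+1)%N /\
  (Num.truncn ((x + 1) * N%:R) = Num.truncn ((y + 1) * N%:R) -> `|x - y| <= N%:R^-1).
Proof.
move=> N0; have NR : 0 < N%:R :> R by rewrite ltr0n.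
rewrite !ler_norml => /andP[x1 x2] /andP[y1 y2].
have x0 : 0 <= (x + 1) * N%:R by rewrite mulr_ge0 ?ler0n //; lra.
have y0 : 0 <= (y + 1) * N%:R by rewrite mulr_ge0 ?ler0n //; lra.
have /andP[a1 a2] := truncn_itv x0; have /andP[a3 a4] := truncn_itv y0.
split.
  rewrite ltnS -(ler_nat R) natrM; apply: le_trans a1 _; rewrite ler_wpM2r ?ler0n //; lra.
move=> e; rewrite e in a1 a2; rewrite -natr1 in a2; rewrite -natr1 in a4.
by apply/andP; split; rewrite -(ler_pM2r NR) ?mulNr mulVf ?gt_eqF //; lra.
Qed.

Lemma free_unitmx (F : fieldType) (r : nat) (v : 'I_r -> 'rV[F]_r) :
  free [tuple v i | i < r] -> \matrix_i v i \in unitmx.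
Proof.
move=> /freeP h; rewrite -row_free_unit -kermx_eq0.
apply/eqP/row_matrixP => l; rewrite row0.
have : row l (kermx (\matrix_i v i)) *m (\matrix_i v i) = 0 by apply/sub_kermxP; exact: row_sub.
move: (row l _) => u uM; apply/rowP => i; rewrite [RHS]mxE.
apply: (h (fun i => u 0 i)); rewrite -[RHS]uM mulmx_sum_row; apply: eq_bigr => j _.
by rewrite rowK /= (nth_map j) ?size_enum_ord // nth_ord_enum.
Qed.

Section Gauge.
Variables (R : realType) (r : nat).
Local Notation rv := 'rV[R]_r.
Local Notation zv := 'rV[int]_r.
Local Notation ir := (map_mx (intmul (1 : R))).

(* [G l] is the dilate by [l] of a symmetric convex body. *)
Record is_gauge (G : R -> set rv) : Prop := {
  g_add : forall l m a b, G l a -> G m b -> G (l + m) (a + b);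
  g_scale : forall s l a, 0 < s -> G l a -> G (s * l) (s *: a);
  g_shrink : forall s l a, `|s| <= 1 -> G l a -> G l (s *: a);
  g_zero : forall l, 0 < l -> G l 0;
  g_fin : forall l, exists A : seq zv, forall v : zv, G l (ir v) -> v \in A }.

Variables (G : R -> set rv) (hG : is_gauge G).

Lemma g_mono l m a : l <= m -> G l a -> G m a.
Proof.
rewrite le_eqVlt => /orP[/eqP -> //|lm] h; rewrite -[a]addr0 -[m](subrK l) addrC.
by apply: (g_add hG) => //; apply: (g_zero hG); rewrite subr_gt0.
Qed.

(** The strict inequality leaves room for the empty sum: 0 is known to lie in G l only for l > 0. *)
Lemma g_sum (k : nat) (s : 'I_k -> R) (a : 'I_k -> rv) l m t : 0 < t ->
  (forall i, G l (a i)) -> (forall i, `|s i| <= t) -> k%:R * (t * l) < m ->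
  G m (\sum_i s i *: a i).
Proof.
move=> t0 Ga st km.
have key (q : seq 'I_k) e : 0 < e -> G ((size q)%:R * (t * l) + e) (\sum_(i <- q) s i *: a i).
  move=> e0; elim: q => [|i q IH]; first by rewrite big_nil mul0r add0r; exact: g_zero.
  rewrite big_cons /= -natr1 mulrDl mul1r [_ + t * l]addrC -addrA; apply: (g_add hG) => //.
  have -> : s i *: a i = t *: ((s i / t) *: a i) by rewrite scalerA mulrC divfK // gt_eqF.
  apply: (g_scale hG) => //; apply: (g_shrink hG) => //.
  by rewrite normrM normfV (gtr0_norm t0) ler_pdivrMr // mul1r.
have := key (enum 'I_k) (m - k%:R * (t * l)).
by rewrite big_enum size_enum_ord subr_gt0 addrC subrK; apply.
Qed.

Fact pts_ex l : exists A : seq zv, uniq A /\ forall v, v \in A <-> G l (ir v).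
Proof.
have [A hA] := g_fin hG l; exists (undup [seq v <- A | `[< G l (ir v) >]]).
split=> [|t]; first exact: undup_uniq.
rewrite mem_undup mem_filter; split=> [/andP[/asboolP //]|h].
by rewrite hA // andbT; apply/asboolP.
Qed.

Definition pts l : seq zv := projT1 (cid (pts_ex l)).
Definition cntZ l : nat := size (pts l).

Lemma pts_uniq l : uniq (pts l).
Proof. by rewrite /pts; case: cid => A []. Qed.

Lemma mem_pts l v : v \in pts l <-> G l (ir v).
Proof. by rewrite /pts; case: cid => A []. Qed.

Definition dot (c : zv) (a : rv) : R := \sum_j (c 0 j)%:~R * a 0 j.

Lemma dotD c a b : dot c (a + b) = dot c a + dot c b.
Proof. by rewrite -big_split /=; apply: eq_bigr => j _; rewrite mxE mulrDr. Qed.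

Lemma dotZ c (s : R) a : dot c (s *: a) = s * dot c a.
Proof. by rewrite /dot mulr_sumr; apply: eq_bigr => j _; rewrite mxE mulrCA. Qed.

Lemma dot_sum c (k : nat) (s : 'I_k -> R) (a : 'I_k -> rv) :
  dot c (\sum_i s i *: a i) = \sum_i s i * dot c (a i).
Proof.
elim/big_ind2: _ => [|a1 b1 a2 b2 e1 e2|i _]; last exact: dotZ.
  by rewrite /dot big1 // => j _; rewrite mxE mulr0.
by rewrite dotD e1 e2.
Qed.

(** A discrete polarity. Let M be an Auerbach basis of the lattice points of G 1, and D the integral
    forms at most rho on it. Among the (rho + 1)^r vectors of the cube, those congruent modulo the
    rows of M^T differ by the values on M of a form of D, so the cube has at most #|D| times index
    many points. That index is also the index of the rows of M, whose classes have representatives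
    in the fundamental cell, inside G (r + 1). *)
Lemma polar_count (rho : nat) :
  (forall j, G ((2 * r.+1)%:R^-1) (delta_mx 0 j)) ->
  exists D : seq zv, [/\ uniq D, (rho.+1 ^ r <= size D * cntZ r.+1%:R)%N &
    forall c l a, c \in D -> 0 < l -> G l a -> `|dot c a| <= (4 * r.+1 ^ 2 * rho)%:R * l].
Proof.
move=> Gd; pose A := map ir (pts 1).
have Ad j : delta_mx 0 j \in A.
  have dE : ir (delta_mx 0 j) = delta_mx 0 j :> rv by apply/rowP => i; rewrite !mxE rmorph_nat.
  apply/mapP; exists (delta_mx 0 j) => //; apply/mem_pts; rewrite dE.
  apply: g_mono (Gd j); rewrite invf_le1 ?ltr0n // ler1n //.
have kE : \dim <<A>> = r.
  have -> : <<A>>%VS = fullv.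
    apply/eqP; rewrite eqEsubv subvf; apply/subvP => a _.
    by rewrite [a]row_sum_delta; apply: memv_suml => j _; rewrite memvZ // memv_span.
  by rewrite dimvf /dim /= mul1n.
have := auerbach A; rewrite kE => -[v [vA vfree vspan]].
have /choice[bz hbz] : forall i, exists z, z \in pts 1 /\ v i = ir z.
  by move=> i; have /mapP[z zp vz] := vA i; exists z.
pose M := \matrix_i bz i.
have irM : ir M = \matrix_i v i by apply/row_matrixP => i; rewrite rowK -map_row rowK (hbz i).2.
have uM : ir M \in unitmx by rewrite irM free_unitmx.
have dM : \det M != 0.
  by move: uM; rewrite unitmxE det_map_mx unitfE intr_eq0.
have Gv i : G 1 (v i) by rewrite (hbz i).2; apply/mem_pts; case: (hbz i).
have inj (c : zv) : c *m M^T = 0 -> c = 0.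
  move/(congr1 (mulmx^~ (\adj M^T))); rewrite mul0mx -mulmxA mul_mx_adj mul_mx_scalar det_tr.
  move=> h; apply/rowP => i; move/rowP/(_ i): h; rewrite [LHS]mxE => /eqP.
  by rewrite [X in _ == X]mxE mulf_eq0 (negbTE dM) [RHS]mxE => /eqP.
pose inD (c : zv) := forall i, `|(c *m M^T) 0 i| <= rho%:Z.
have [||D0 hD0] := @box_finite_list R r rho zv inD (fun c i => ((c *m M^T) 0 i)%:~R).
- move=> c i hc; split; first exact: intr_int.
  by rewrite -intr_norm -[rho%:R]/(rho%:Z%:~R) ler_int.
- move=> c c' _ _ e; apply/eqP; rewrite -subr_eq0; apply/eqP/inj; rewrite mulmxBl.
  by apply/eqP; rewrite subr_eq0; apply/eqP/rowP => i; have := e i; move/eqP; rewrite eqr_int => /eqP.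
pose D := undup [seq c <- D0 | `[< inD c >]].
have DP c : c \in D <-> inD c.
  rewrite mem_undup mem_filter; split=> [/andP[/asboolP //]|h].
  by rewrite hD0 // andbT; apply/asboolP.
have [T [At [co [rep [coA coE repE]]]]] := transpose_index dM.
have card1 : (rho.+1 ^ r <= size D * #|At|)%N.
  pose X := {ffun 'I_r -> 'I_rho.+1}; pose vz (f : X) : zv := \row_j (f j : nat)%:Z.
  have /choice[rf hrf] : forall t, exists f : X, (exists f', co (vz f') = t) -> co (vz f) = t.
    move=> t; have [[f ft]|no] := pselect (exists f', co (vz f') = t); first by exists f.
    by exists [ffun=> ord0].
  have /choice[cf hcf] : forall f, exists c, vz f - vz (rf (co (vz f))) = c *m M^T.
    by move=> f; apply: coE; rewrite hrf //; exists f.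
  have cD f : cf f \in D.
    apply/DP => i; rewrite -hcf !mxE -!abszE.
    have h1 : (f i <= rho)%N by rewrite -ltnS.
    have h2 : (rf (co (vz f)) i <= rho)%N by rewrite -ltnS.
    by lia.
  pose Z := [seq (c, t) | c <- D, t <- enum At].
  have -> : (size D * #|At| = size Z)%N by rewrite size_allpairs -cardE.
  have <- : #|X| = (rho.+1 ^ r)%N by rewrite card_ffun !card_ord.
  rewrite cardE -(size_map (fun f => (cf f, co (vz f)))); apply: uniq_leq_size.
    rewrite map_inj_uniq ?enum_uniq // => f g [e1 e2].
    have : vz f = vz g.
      by rewrite -[vz f](subrK (vz (rf (co (vz f))))) -[RHS](subrK (vz (rf (co (vz g))))) !hcf e1 e2.
    by move/rowP => e; apply/ffunP => j; have := e j; rewrite !mxE => -[] /val_inj.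
  by move=> _ /mapP[f _ ->]; apply: allpairs_f; rewrite ?mem_enum.
have card2 : (#|At| <= cntZ r.+1%:R)%N.
  pose al t : rv := ir (rep t) *m invmx (ir M).
  pose fl t : zv := \row_j Num.floor (al t 0 j).
  pose g t := rep t - fl t *m M.
  have gE t : ir (g t) = \sum_i (al t 0 i - (fl t 0 i)%:~R) *: v i.
    have -> : ir (g t) = (al t - ir (fl t)) *m ir M.
      by rewrite map_mxB map_mxM mulmxBl mulmxKV.
    by rewrite mulmx_sum_row; apply: eq_bigr => i _; rewrite irM rowK !mxE.
  rewrite cardE -(size_map g); apply: uniq_leq_size.
    rewrite map_inj_in_uniq ?enum_uniq // => s t; rewrite !mem_enum => sA tA e.
    apply: (repE s t (fl s - fl t)) => //.
    rewrite mulmxBl -[rep s](subrK (fl s *m M)) -/(g s) e /g.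
    by move: (fl s *m M) (fl t *m M) => P Q; lmod int.
  move=> _ /mapP[t _ ->]; apply/mem_pts; rewrite gE; apply: (g_sum (l := 1) (t := 1)) => //.
    move=> i; rewrite [fl t 0 i]mxE; have /andP[h1 h2] := floor_itv (al t 0 i); rewrite intrD in h2.
    by rewrite ger0_norm; lra.
  by rewrite !mulr1 ltr_nat.
exists D; split; first exact: undup_uniq.
  by apply: leq_trans card1 _; rewrite leq_mul2l card2 orbT.
move=> c l a /DP cD l0 Ga.
have dv i : `|dot c (v i)| <= rho%:R.
  have -> : dot c (v i) = ((c *m M^T) 0 i)%:~R.
    rewrite mxE rmorph_sum; apply: eq_bigr => j _; rewrite rmorphM !mxE (hbz i).2 !mxE //.
  by rewrite -intr_norm -[rho%:R]/(rho%:Z%:~R) ler_int.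
have dA b : b \in A -> `|dot c b| <= r%:R * rho%:R.
  move=> /vspan[be hbe ->]; rewrite dot_sum; apply: le_trans (ler_norm_sum _ _ _) _.
  apply: le_trans (_ : \sum_(i < r) rho%:R <= _); last by rewrite sumr_const card_ord mulr_natl.
  apply: ler_sum => i _; rewrite normrM; apply: le_trans (dv i).
  by rewrite ler_piMl.
(* Halving leaves room for rounding: a1 and its fractional part are both in G 2^-1, so the integral
   part is a lattice point of G 1, where the forms of D are already bounded. *)
have [a1 aE1] : exists a1, a = (2 * l) *: a1.
  by exists ((2 * l)^-1 *: a); rewrite scalerA mulfV ?scale1r // mulf_neq0 // lt0r_neq0.
have Ga1 : G 2^-1 a1.
  have -> : a1 = (2 * l)^-1 *: a by rewrite aE1 scalerA mulVf ?scale1r // mulf_neq0 // lt0r_neq0.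
  have -> : 2^-1 = (2 * l)^-1 * l :> R by field; exact: lt0r_neq0.
  by apply: (g_scale hG) => //; rewrite invr_gt0 mulr_gt0.
pose fl : zv := \row_j Num.floor (a1 0 j).
pose fr (j : 'I_r) := a1 0 j - (fl 0 j)%:~R.
have fr1 j : 0 <= fr j <= 1.
  rewrite /fr [fl 0 j]mxE; have /andP[h1 h2] := floor_itv (a1 0 j); rewrite intrD in h2.
  by apply/andP; split; lra.
have aE : ir fl = a1 + (-1) *: \sum_j fr j *: delta_mx 0 j.
  have -> : \sum_j fr j *: delta_mx 0 j = a1 - ir fl.
    rewrite [RHS]row_sum_delta; apply: eq_bigr => j _; congr (_ *: _).
    by rewrite [RHS]mxE [X in _ + X]mxE [X in _ - X]mxE.
  by rewrite scaleN1r opprB addrC subrK.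
have flA : ir fl \in A.
  apply/map_f/mem_pts; rewrite aE.
  apply: (@g_mono (2^-1 + 2^-1)); first by lra.
  apply: (g_add hG) => //.
  apply: (g_shrink hG); first by rewrite normrN1.
  apply: (g_sum (l := (2 * r.+1)%:R^-1) (t := 1)) => // [i|].
    by have /andP[h1 h2] := fr1 i; rewrite ger0_norm.
  rewrite mul1r natrM ltr_pdivrMr ?mulr_gt0 ?ltr0n // mulrA mulVf ?mul1r ?ltr_nat //.
  by rewrite pnatr_eq0.
have := dA _ flA; rewrite aE dotD dotZ mulN1r => h1.
have h2 : `|dot c (\sum_j fr j *: delta_mx 0 j)| <= r%:R * (r%:R * rho%:R).
  rewrite dot_sum; apply: le_trans (ler_norm_sum _ _ _) _.
  apply: le_trans (_ : \sum_(i < r) (r%:R * rho%:R) <= _); last by rewrite sumr_const card_ord -[leLHS]mulr_natl.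
  apply: ler_sum => i _; rewrite normrM; apply: le_trans (dA _ (Ad i)).
  by rewrite ler_piMl //; have /andP[? ?] := fr1 i; rewrite ger0_norm.
have -> : dot c a = (2 * l) * dot c a1.
  by rewrite aE1 dotZ.
rewrite normrM gtr0_norm ?mulr_gt0 // mulrAC mulrC [leRHS]mulrC ler_pM2l //.
have h3 : `|dot c a1| <= r%:R * rho%:R + r%:R * (r%:R * rho%:R).
  move: h1 h2; set u := dot c _; set w := dot c _; rewrite !ler_norml => /andP[? ?] /andP[? ?].
  by apply/andP; split; lra.
have h4 : 2 * `|dot c a1| <= 2 * (r%:R * rho%:R + r%:R * (r%:R * rho%:R)) by lra.
apply: le_trans h4 _.
rewrite -!natrM -!natrD -natrM ler_nat.
by nia.
Qed.

(** Two points of P in the same cell of side 1 / N, in Auerbach coordinates, differ by an element of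
    G e and so coincide. The exponent is the dimension of the span of P, and [short_span] relies on
    its being smaller than r. *)
Lemma gauge_packing (e : R) (k : nat) (P : seq zv) : 0 < e -> (0 < k)%N ->
  (forall v : zv, G e (ir v) -> v = 0) -> uniq P -> (forall v, v \in P -> G (k%:R * e) (ir v)) ->
  (size P <= (2 * (r.+1 * k)).+1 ^ \dim <<map ir P>>)%N.
Proof.
move=> e0 k0 sep uP PG; have [v [vA _ vspan]] := auerbach (map ir P).
set d := \dim _ in v vA vspan *; pose N := (r.+1 * k)%N.
have N0 : (0 < N)%N by rewrite muln_gt0.
have dr : (d <= r)%N by apply: leq_trans (dimvS (subvf _)) _; rewrite dimvf /dim /= mul1n.
have /choice[c hc] : forall x, exists c : 'I_d -> R, x \in P ->
    (forall i, `|c i| <= 1) /\ ir x = \sum_i c i *: v i.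
  move=> x; have [xP|] := boolP (x \in P); last by exists (fun=> 0).
  by have [c h1 h2] := vspan _ (map_f ir xP); exists c.
pose code x := [ffun i : 'I_d => inord (Num.truncn ((c x i + 1) * N%:R)) : 'I_(2 * N).+1].
have <- : #|{ffun 'I_d -> 'I_(2 * N).+1}| = ((2 * N).+1 ^ d)%N by rewrite card_ffun !card_ord.
rewrite cardE -(size_map code); apply: uniq_leq_size; last by move=> x _; rewrite mem_enum.
rewrite map_inj_in_uniq // => x y xP yP /ffunP exy.
have [cx xE] := hc x xP; have [cy yE] := hc y yP.
apply/eqP; rewrite -subr_eq0; apply/eqP/sep.
have -> : ir (x - y) = \sum_i (c x i - c y i) *: v i.
  by rewrite map_mxB xE yE -sumrB; apply: eq_bigr => i _; rewrite scalerBl.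
have NR : 0 < N%:R :> R by rewrite ltr0n.
apply: (g_sum (l := k%:R * e) (t := N%:R^-1)); first by rewrite invr_gt0.
- by move=> i; have /mapP[z zP ->] := vA i; exact: PG.
- move=> i; have [b1 b2] := code_close N0 (cx i) (cy i); apply: b2.
  have [b3 _] := code_close N0 (cy i) (cx i).
  by have := exy i; rewrite !ffunE => /(congr1 (@nat_of_ord _)); rewrite !inordK.
have kR : 0 < k%:R :> R by rewrite ltr0n.
have -> : N%:R^-1 * (k%:R * e) = e / r.+1%:R :> R.
  by rewrite /N natrM invfM -mulrA [_ * (k%:R * e)]mulrA mulVf ?mul1r ?gt_eqF // mulrC.
rewrite mulrA ltr_pdivrMr ?ltr0n // mulrC ltr_pM2l // ltr_nat.
by rewrite ltnS.
Qed.

(* Cells of side [1 / N] in the coordinates of an Auerbach basis. *)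
Lemma cell_count (l e : R) (N : nat) : (0 < N)%N -> 0 < l -> r%:R * (N%:R^-1 * l) < e ->
  (cntZ l <= (2 * N).+1 ^ r * cntZ e)%N.
Proof.
move=> N0 l0 le; have [v [vA _ vspan]] := auerbach (map ir (pts l)).
set d := \dim _ in v vA vspan *.
have dr : (d <= r)%N by apply: leq_trans (dimvS (subvf _)) _; rewrite dimvf /dim /= mul1n.
have NR : 0 < N%:R :> R by rewrite ltr0n.
have /choice[c hc] : forall x, exists c : 'I_d -> R, x \in pts l ->
    (forall i, `|c i| <= 1) /\ ir x = \sum_i c i *: v i.
  move=> x; have [xP|] := boolP (x \in pts l); last by exists (fun=> 0).
  by have [c h1 h2] := vspan _ (map_f ir xP); exists c.
pose X := {ffun 'I_d -> 'I_(2 * N).+1}.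
pose code x : X := [ffun i : 'I_d => inord (Num.truncn ((c x i + 1) * N%:R))].
have /choice[rf hrf] : forall t, exists x, (exists2 y, y \in pts l & code y = t) -> x \in pts l /\ code x = t.
  move=> t; have [[y yl yt]|no] := pselect (exists2 y, y \in pts l & code y = t); first by exists y.
  by exists 0.
pose Z := [seq (t, y) | t <- enum X, y <- pts e].
have sZ : size Z = ((2 * N).+1 ^ d * cntZ e)%N.
  by rewrite size_allpairs -cardE card_ffun !card_ord.
apply: leq_trans (_ : (2 * N).+1 ^ d * cntZ e <= _)%N; last first.
  by rewrite leq_mul2r leq_pexp2l ?orbT.
rewrite -sZ /cntZ -(size_map (fun x => (code x, x - rf (code x))) (pts l)); apply: uniq_leq_size.
  rewrite map_inj_in_uniq ?pts_uniq // => x y xl yl [-> h].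
  exact: (addIr (- rf (code y))).
move=> _ /mapP[x xl ->]; apply: allpairs_f; first by rewrite mem_enum.
have [yl exy] := hrf (code x) (ex_intro2 _ _ x xl erefl); move: exy.
move: (rf _) yl => y yl /ffunP exy.
have [cx xE] := hc x xl; have [cy yE] := hc y yl.
apply/mem_pts; have -> : ir (x - y) = \sum_i (c x i - c y i) *: v i.
  by rewrite map_mxB xE yE -sumrB; apply: eq_bigr => i _; rewrite scalerBl.
apply: (g_sum (l := l) (t := N%:R^-1)); first by rewrite invr_gt0.
- by move=> i; have /mapP[z zP ->] := vA i; exact/mem_pts.
- move=> i; have [b1 b2] := code_close N0 (cx i) (cy i); apply: b2.
  have [b3 _] := code_close N0 (cy i) (cx i).
  by have := exy i; rewrite !ffunE => /(congr1 (@nat_of_ord _)); rewrite !inordK.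
apply: le_lt_trans le; apply: ler_wpM2r; last by rewrite ler_nat.
by rewrite mulr_ge0 ?invr_ge0 ?ltW.
Qed.

End Gauge.

(** If the span had dimension below r, the points at scale C e, being separated at scale e, would
    number at most a constant times C^(r - 1). Cutting G (r + 1) into a constant times m^r cells
    would bound [cntZ] by a constant times m^r C^(r - 1), which is too small once C exceeds these
    constants. They depend neither on G nor on m. *)
Lemma short_span (R : realType) (r c c6 : nat) : exists2 C, (0 < C)%N &
  forall (G : R -> set 'rV[R]_r) (hG : is_gauge G) m, (0 < m)%N ->
  (forall v : 'rV[int]_r, G ((c.+1 * (C * m))%:R^-1) (map_mx (intmul (1 : R)) v) -> v = 0) ->
  ((C * m) ^ r <= c6 * cntZ hG r.+1%:R)%N ->
  \dim <<map (map_mx (intmul (1 : R))) (pts hG (C%:R * (c.+1 * (C * m))%:R^-1))>> = r.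
Proof.
pose A := (3 * (c.+1 * r.+1 ^ 2))%N.
pose C := (c6 * A ^ r * (3 * r.+1) ^ r).+1; exists C => // G hG m m0 sep big.
set e := (c.+1 * (C * m))%:R^-1 in sep *.
have e0 : 0 < e :> R by rewrite invr_gt0 ltr0n !muln_gt0.
pose ds := \dim <<map (map_mx (intmul (1 : R))) (pts hG (C%:R * e))>>.
have dr : (ds <= r)%N by apply: leq_trans (dimvS (subvf _)) _; rewrite dimvf /dim /= mul1n.
apply/eqP; rewrite eqn_leq dr /= leqNgt; apply/negP => small.
have CP : (0 < C)%N by [].
have := @gauge_packing _ _ _ hG e C (pts hG (C%:R * e)) e0 CP sep (pts_uniq _ _) (fun v h => (mem_pts hG _ v).1 h).
rewrite -/(cntZ hG _) -/ds => pk.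
pose N := (c.+1 * r.+1 ^ 2 * m)%N.
have N0 : (0 < N)%N by rewrite !muln_gt0 m0.
have NR : 0 < N%:R :> R by rewrite ltr0n.
have cl := @cell_count _ _ _ hG r.+1%:R (C%:R * e) N N0.
have {}cl : (cntZ hG r.+1%:R <= (2 * N).+1 ^ r * cntZ hG (C%:R * e))%N.
  apply: cl; first by rewrite ltr0n.
  have c0 : 0 < c.+1%:R :> R by rewrite ltr0n.
  have mR : 0 < m%:R :> R by rewrite ltr0n.
  have CR : 0 < C%:R :> R by rewrite ltr0n.
  have rR : 0 < r.+1%:R :> R by rewrite ltr0n.
  have -> : C%:R * e = (c.+1%:R * m%:R)^-1.
    rewrite /e !natrM; move: (c.+1%:R : R) (m%:R : R) (C%:R : R) c0 mR CR => x y z x0 y0 z0.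
    by field; rewrite !lt0r_neq0.
  have -> : r%:R * (N%:R^-1 * r.+1%:R) = (r%:R / r.+1%:R) * (c.+1%:R * m%:R)^-1 :> R.
    rewrite /N !natrM; move: (c.+1%:R : R) (m%:R : R) (r.+1%:R : R) c0 mR rR => x y z x0 y0 z0.
    by field; rewrite !lt0r_neq0.
  by rewrite gtr_pMl ?invr_gt0 ?mulr_gt0 // ltr_pdivrMr // mul1r ltr_nat.
have r0 : (0 < r)%N by apply: leq_ltn_trans small.
have h1 : ((2 * N).+1 <= A * m)%N.
  have -> : (A * m = 3 * N)%N by rewrite /A /N -!mulnA.
  by move: (N) N0 => q; lia.
have expW x y n : (x <= y)%N -> (x ^ n <= y ^ n)%N by case: n => // n; rewrite leq_exp2r.
have h2 : ((2 * (r.+1 * C)).+1 <= 3 * r.+1 * C)%N.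
  have : (0 < r.+1 * C)%N by rewrite muln_gt0.
  by rewrite -mulnA; move: (r.+1 * C)%N => q; lia.
have h3 : ((2 * (r.+1 * C)).+1 ^ ds <= (3 * r.+1) ^ r * C ^ r.-1)%N.
  apply: leq_trans (expW _ _ _ h2) _.
  apply: leq_trans (_ : (3 * r.+1 * C) ^ r.-1 <= _)%N.
    by rewrite leq_pexp2l // -ltnS prednK.
  by rewrite expnMn leq_mul2r leq_pexp2l ?leq_pred ?orbT.
have : (C ^ r * m ^ r <= c6 * A ^ r * (3 * r.+1) ^ r * (m ^ r * C ^ r.-1))%N.
  rewrite -expnMn; apply: leq_trans big _.
  apply: leq_trans (leq_mul (leqnn c6) cl) _.
  apply: leq_trans (leq_mul (leqnn c6) (leq_mul (expW _ _ r h1) (leq_trans pk h3))) _.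
  by rewrite expnMn; apply/eq_leq; ring.
have -> : (C ^ r * m ^ r = C * (m ^ r * C ^ r.-1))%N.
  by rewrite -{1}(prednK r0) expnS; ring.
by rewrite leq_pmul2r ?muln_gt0 ?expn_gt0 ?m0 // /C ltnn.
Qed.

(** * The group of a face modulo its pointwise stabilizers *)

Section FaceGroup.
Variables (R : realType) (V : vectType R) (S : polycone V).
Local Notation L := (int_span (pc_b S)).
Local Notation b := (pc_b S).
Local Notation hb := (pc_basis S).
Local Notation C := (pc_C S).
Local Notation Cb := (cone_closure (pc_C S)).
Local Notation G := (pc_G S).
Local Notation hC := (pc_open S).
Local Notation d := (size (pc_b S)).
Local Notation VF := <<pc_fs S>>%VS.
Local Notation f := (f_ S).
Local Notation O := (Oc S).
Local Notation Ob := (cone_closure (Oc S)).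
Local Notation Gf := (Gf S).
Local Notation Vu := (Vu S).
Local Notation hO := (O_open_cone S).
Implicit Types (x y z t u v w X Y : V) (g h : GL V).

(* With [Vu = V^F]: [Hu] is the stabilizer of [V^F]; [Wu] acts trivially on [V / V^F], [Zf] on [V_F]. *)
Definition Hu : set (GL V) := [set g | G g /\ forall v, v \in Vu -> GL_fun g v \in Vu].
Definition Wu : set (GL V) := [set g | G g /\ forall v, GL_fun g v - v \in Vu].
Definition Zf : set (GL V) := [set g | G g /\ forall w, w \in VF -> GL_fun g w = w].
Definition Kf : set (GL V) := [set g | Wu g /\ Zf g].

Lemma GL_stable_inv g (W : {vspace V}) : (forall v, v \in W -> g v \in W) ->
  forall v, v \in W -> GL_fun g^-1%g v \in W.
Proof.
move=> gW v vW.
have sub : (GL_end g @: W <= W)%VS by apply/subvP => _ /memv_imgP[u uW ->]; exact: gW.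
have /eqP e : (GL_end g @: W)%VS == W.
  rewrite -dimv_leqif_eq // limg_dim_eq //.
  by have /eqP -> := valP g; rewrite capv0.
have : v \in (GL_end g @: W)%VS by rewrite e.
by move=> /memv_imgP[u uW ->]; rewrite -[GL_end g u]/(g u) GLK.
Qed.

Lemma Hu1 : Hu 1%g. Proof. by split=> [|v]; [exact: G1|rewrite GL1]. Qed.
Lemma HuM g h : Hu g -> Hu h -> Hu (g * h)%g.
Proof. by move=> [Gg gV] [Gh hV]; split=> [|v vV]; [exact: GM|rewrite GLM gV ?hV]. Qed.
Lemma HuV g : Hu g -> Hu g^-1%g.
Proof. by move=> [Gg gV]; split; [exact: GV|exact: GL_stable_inv]. Qed.

Lemma Gf_Hu g : Gf g -> Hu g.
Proof. by move=> Gg; split=> [|v]; [case: Gg|exact: Gf_Vu]. Qed.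

Lemma WuJ g h : Hu g -> Wu h -> Wu (g * h * g^-1)%g.
Proof.
move=> Hg [Gw wV]; have [Gg gV] := Hg; split; first by apply: GM; [exact: GM|exact: GV].
by move=> v; rewrite !GLM -{2}[v](GLKV g) -GLB gV.
Qed.

Lemma WuV g : Wu g -> Wu g^-1%g.
Proof.
move=> Ww; have [Gw wV] := Ww; split=> [|v]; first exact: GV.
by rewrite -{2}[v](GLKV g) -memvN opprB wV.
Qed.

Lemma WuM g h : Wu g -> Wu h -> Wu (g * h)%g.
Proof.
move=> [Gg gV] [Gh hV]; split=> [|v]; first exact: GM.
by rewrite GLM -[g _](subrK (h v)) -addrA memvD.
Qed.

Lemma ZfM g h : Zf g -> Zf h -> Zf (g * h)%g.
Proof. by move=> [Gg gV] [Gh hV]; split=> [|v vV]; [exact: GM|rewrite GLM hV // gV]. Qed.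

Lemma ZfV g : Zf g -> Zf g^-1%g.
Proof. by move=> [Gg gV]; split=> [|v vV]; [exact: GV|rewrite -{1}[v]gV // GLK]. Qed.

Lemma KfM g h : Kf g -> Kf h -> Kf (g * h)%g.
Proof. by move=> [? ?] [? ?]; split; [exact: WuM|exact: ZfM]. Qed.

Lemma KfV g : Kf g -> Kf g^-1%g.
Proof. by move=> [? ?]; split; [exact: WuV|exact: ZfV]. Qed.

Lemma Kf1 : Kf 1%g.
Proof.
by split; split=> [|v]; [exact: G1|rewrite GL1 subrr mem0v|exact: G1|rewrite GL1].
Qed.

Lemma Kf_Gf g : Kf g -> Gf g.
Proof. by move=> [_ [Gg gV]]; split=> //; apply: gV; exact: f_VF. Qed.

Lemma O_clo_Vu x : O x -> exists2 v, v \in Vu & C (x + v).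
Proof. by move=> [w wV Cw]; exists w => //; exact: VF_Vu. Qed.

Lemma Hu_O g x : Hu g -> O x -> O (g x).
Proof.
move=> [Gg gV] /O_clo_Vu[v vV Cv].
have -> : g x = g (x + v) + - g v by rewrite GLD addrK.
apply: O_Vu; first by rewrite memvN gV.
by apply: C_sub_O; exact: pc_GC.
Qed.

Section Sequences.
Variable ths : seq 'Hom(V, R^o).
Hypotheses (ths_int : forall th, th \in ths -> intform b th)
  (ths_dual : forall th, th \in ths -> dual_of O th)
  (ths_ker : forall v, v \in Vu <-> forall th, th \in ths -> th v = 0).

Definition th0 : 'Hom(V, R^o) := \sum_(th <- ths) th.

Lemma th0E x : th0 x = \sum_(th <- ths) (th x : R).
Proof. by rewrite sum_lfunE. Qed.

Lemma th0_Vu v : v \in Vu -> th0 v = 0.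
Proof. by move=> /ths_ker h; rewrite th0E big_seq big1. Qed.

Lemma ths_ge0 th z : th \in ths -> Ob z -> 0 <= (th z : R).
Proof. by move=> hth; apply: dual_closure hO (ths_dual hth). Qed.

Lemma Cb_Ob z : Cb z -> Ob z.
Proof. by move=> Cz x Ox; rewrite addrC; exact: O_clo. Qed.

Lemma th0_ge0 z : Ob z -> 0 <= (th0 z : R).
Proof. by move=> hz; rewrite th0E big_seq; apply: sumr_ge0 => th hth; exact: ths_ge0. Qed.

Lemma th0_eq0 z : Ob z -> (th0 z : R) <= 0 -> z \in Vu.
Proof.
move=> hz le0; apply/ths_ker => th hth; apply/eqP; rewrite eq_le ths_ge0 // andbT.
apply: le_trans le0; rewrite th0E (big_rem th) //= lerDl big_seq.
by apply: sumr_ge0 => th' /mem_rem h'; exact: ths_ge0.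
Qed.

(* The minimum of [th0] on the orbit under [Hu] is superadditive. *)
Lemma orbit_subseq x (c : nat -> GL V) : L x -> O x -> (forall n, Hu (c n)) ->
  exists2 s, increasing s & forall i j, (i < j)%N ->
    exists2 g, Gf g & GL_fun (c (s j))^-1%g x - g (GL_fun (c (s i))^-1%g x) \in VF.
Proof.
move=> Lx Ox hc; pose p n := GL_fun (c n)^-1%g x.
have hp n : L (p n) /\ O (p n).
  by split; [apply: (pc_GL (GV _)) => //; case: (hc n)|apply: Hu_O => //; exact: HuV].
have [s s_inc hs] := lattice_wqo hp; exists s => // i j ij.
have [g [dl [w [Gg Ld Cd wV E]]]] := hs i j ij; exists g => //.
rewrite -/(p (s j)) -/(p (s i)) E.
have -> : g (p (s i)) + dl + w - g (p (s i)) = dl + w by lmod R.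
rewrite memvD //; apply: Vu_lat => //.
pose mu (m : nat) := `[< exists2 h, Hu h & (th0 (h x) : R) <= m%:R >].
have exm : exists m, mu m.
  exists (Num.truncn (th0 x : R)).+1; apply/asboolP; exists 1%g; first exact: Hu1.
  by rewrite GL1; exact/ltW/truncnS_gt.
have [m /asboolP[h Hh hm] mmin] := ex_minnP exm.
have ge_m h' : Hu h' -> m%:R <= (th0 (h' x) : R).
  move=> Hh'; have Lh : L (h' x) by apply: pc_GL Lx; case: Hh'.
  have /intrP[k kE] : (th0 (h' x) : R) \is a Num.int.
    by rewrite th0E big_seq; apply: rpred_sum => th hth; exact: ths_int.
  have k0 : 0 <= k by rewrite -(ler0z R) -kE; apply/th0_ge0/(oc_sub_closure hO)/Hu_O.
  have kn : k = (absz k)%:Z by rewrite gez0_abs.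
  rewrite kE kn -[m%:R]/((m%:Z)%:~R) ler_int lez_nat; apply: mmin; apply/asboolP; exists h' => //.
  by rewrite kE {1}kn.
(* k carries p (s j) to a point of the orbit where th0 is minimal. As k g p (s i) is in the same
   orbit, its value is at least as large, which leaves th0 (k dl) <= 0. *)
pose k : GL V := (h * c (s j))%g; have Hk : Hu k by exact: HuM.
have kp : k (p (s j)) = h x by rewrite /k /p GLM GLKV.
clearbody k.
have kdO : Ob (k dl) by apply: Cb_Ob; apply: GCb => //; case: Hk.
have kV : k dl \in Vu.
  apply: th0_eq0 => //.
  have Hg := Gf_Hu Gg.
  have := ge_m (k * g * (c (s i))^-1)%g (HuM (HuM Hk Hg) (HuV (hc _))).
  rewrite !GLM -/(p (s i)) => h1.
  have : (th0 (k (p (s j))) : R) = th0 (k (g (p (s i)))) + th0 (k dl).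
    rewrite E !GLD !homD (th0_Vu (v := k w)) ?addr0 //.
    by case: Hk => _; apply; exact: VF_Vu.
  by rewrite kp; lra.
by have [_ h1] := HuV Hk; rewrite -[dl](GLK k); exact: h1.
Qed.

(** For small e the points x + e b_i and x - e b_i are in O. As s n fixes x modulo V^F, the integers
    th (s n b_i) are at most th0 x / e in absolute value, so only finitely many maps are induced on
    V / V^F. *)
Lemma stab_subseq x (s : nat -> GL V) : O x -> (forall n, Hu (s n)) ->
  (forall n, s n x - x \in Vu) ->
  exists2 t, increasing t & forall i j, Wu ((s (t i))^-1 * s (t j))%g.
Proof.
move=> Ox hs sx.
have [e e0 he] : exists2 e : R, 0 < e & forall i : 'I_d, O (x + e *: b`_i) /\ O (x - e *: b`_i).
  have [n hn] := oc_absorb_fam hO (index_enum _) (fun i : 'I_d => b`_i) Ox.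
  have n0 : 0 < n.+1%:R :> R by rewrite ltr0n.
  have nn : n%:R <= n.+1%:R :> R by rewrite ler_nat.
  have key (a : R) (i : 'I_d) : `|a| <= 1 -> O (x + (a * n.+1%:R^-1) *: b`_i).
    move=> a1; have -> : x + (a * n.+1%:R^-1) *: b`_i = (n.+1%:R^-1 : R) *: (n.+1%:R *: x + a *: b`_i).
      by move: n0; move: (n.+1%:R : R) => q n0; lmod_field R.
    apply: (oc_scale hO); first by rewrite invr_gt0.
    have := hn n.+1%:R (fun j => if j == i then a else 0) nn.
    rewrite (bigD1 i) //= eqxx big1 ?addr0; last by move=> j /negbTE ->; rewrite scale0r.
    by apply=> j; case: ifP; rewrite ?normr0.
  exists n.+1%:R^-1 => [|i]; first by rewrite invr_gt0.
  split; first by have := key 1 i; rewrite mul1r normr1; apply.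
  by have := key (-1) i; rewrite mulN1r scaleNr normrN1; apply.
pose M := (Num.truncn ((th0 x : R) / e)).+1.
have hM : (th0 x : R) / e <= M%:R by exact/ltW/truncnS_gt.
pose m := (size ths * d)%N.
(* Pairs formed by a form and a basis vector are numbered by quotient and remainder modulo d. *)
pose phi (g : GL V) (i : 'I_(size ths * d)) : R := ths`_(i %/ d) (g b`_(i %% d)).
have d_gt0 (i : 'I_(size ths * d)) : (0 < d)%N by case: i => i; case: d => //; rewrite muln0.
have bound n (i : 'I_(size ths * d)) : phi (s n) i \is a Num.int /\ `|phi (s n) i| <= M%:R.
  have hth : ths`_(i %/ d) \in ths by rewrite mem_nth // ltn_divLR ?(d_gt0 i).
  have hi : (i %% d < d)%N by rewrite ltn_mod (d_gt0 i).
  have [Gs sV] := hs n.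
  split; first by apply: ths_int => //; apply: pc_GL => //; exact: (lat_basis hb).
  have [h1 h2] := he (Ordinal hi).
  have := ths_ge0 hth (oc_sub_closure hO (Hu_O (hs n) h1)).
  have := ths_ge0 hth (oc_sub_closure hO (Hu_O (hs n) h2)).
  rewrite GLB GLD GLZ homB homD !homZ /= -/(phi (s n) i).
  have -> : (ths`_(i %/ d) (s n x) : R) = ths`_(i %/ d) x.
    by apply/eqP; rewrite -subr_eq0 -homB; apply/eqP; apply: (ths_ker _).1.
  have xle : (ths`_(i %/ d) x : R) <= th0 x.
    rewrite th0E (big_rem _ hth) /= lerDl big_seq; apply: sumr_ge0 => th' /mem_rem h'.
    exact/ths_ge0/(oc_sub_closure hO).
  move=> a1 a2; apply: le_trans hM; move: a1 a2 xle.
  move: (phi (s n) i) (ths`_(i %/ d) x : R) (th0 x : R) => P T U a1 a2 xle; rewrite ler_pdivlMr // -[X in _ * X](gtr0_norm e0) -normrM ler_norml.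
  by clear - a1 a2 xle; rewrite [_ * e]mulrC; apply/andP; split; lra.
have [t t_inc ht] := @box_const_subseq R (size ths * d) M (fun n => phi (s n)) bound.
exists t => // i j; have [Gi iV] := hs (t i); have [Gj jV] := hs (t j).
have HV := HuV (hs (t i)).
split; first by apply: GM => //; exact: GV.
move=> v; rewrite GLM -{2}[v](GLK (s (t i))) -GLB; case: HV => _; apply.
apply/ths_ker => th hth; rewrite [v](crdE hb) !GL_sum -sumrB hom_sum big1 // => l _.
rewrite !GLZ -scalerBr homZ homB.
have lt : (index th ths * d + l < size ths * d)%N.
  by rewrite -ltn_divLR ?divnMDl ?divn_small ?addn0 ?index_mem // (leq_ltn_trans _ (ltn_ord l)).
have dl : (0 < d)%N by apply: leq_ltn_trans (ltn_ord l).
have phiE g : phi g (Ordinal lt) = th (g b`_l).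
  by rewrite /phi /= divnMDl // divn_small // addn0 modnMDl modn_small // nth_index.
by rewrite -!phiE !ht subrr mulr0.
Qed.

(** The image of a generator of the face is a summand of g f = f, so its height is at most that of
    f: [Gf] acts on V_F through a finite group. *)
Lemma Gf_subseq (g : nat -> GL V) : (forall n, Gf (g n)) ->
  exists2 t, increasing t & forall i j w, w \in VF -> g (t i) w = g (t j) w.
Proof.
move=> hg; have [A hA] := xi0_finite S (xi0 S f).
have gA n (i : 'I_(size (pc_fs S))) : g n (pc_fs S)`_i \in A.
  have hi : (pc_fs S)`_i \in pc_fs S by rewrite mem_nth.
  have [Gg gf] := hg n.
  apply: hA; [exact: pc_GL (pc_fs_lat hi)|exact: GCb (pc_fs_clo hi)|].
  rewrite -[X in _ <= (xi0 S X : R)]gf /f_ (big_rem _ hi) /= GLD homD lerDl; apply: xi0_ge0.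
  by apply: GCb => //; rewrite big_seq; apply: clo_sum => y /mem_rem; exact: pc_fs_clo.
have [t t_inc ht] := const_fam_subseq gA; exists t => // i j w.
apply: GL_span => y ys; have hy : (index y (pc_fs S) < size (pc_fs S))%N by rewrite index_mem.
by have := ht i (Ordinal hy); rewrite -(ht j (Ordinal hy)) /= nth_index.
Qed.

(** On a subsequence some g_n in [Gf] carries (c_0)^-1 x to (c_n)^-1 x modulo V_F, so q_n = c_n g_n
    (c_0)^-1 fixes x modulo V^F. For suitable i < j, (q_i)^-1 q_j is in [Wu] and g_i, g_j agree on
    V_F; then (c_i)^-1 c_j is the conjugate of (q_i)^-1 q_j by g_i (c_0)^-1, times g_i (g_j)^-1. *)
Lemma face_product_index (c : nat -> GL V) : (forall n, Hu (c n)) ->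
  exists i j, (i < j)%N /\ exists w z : GL V, [/\ Wu w, Zf z & ((c i)^-1 * c j = w * z)%g].
Proof.
move=> hc; have [x Lx Cx] := lat_point S; have Ox := C_sub_O Cx.
have [s s_inc hs] := orbit_subseq Lx Ox hc.
have /choice[g hg] : forall j, exists g, Gf g /\
    GL_fun (c (s j.+1))^-1%g x - g (GL_fun (c (s 0%N))^-1%g x) \in VF.
  by move=> j; have [g Gg gV] := hs 0%N j.+1 isT; exists g.
have [t t_inc ht] := Gf_subseq (fun n => (hg n).1).
pose q n : GL V := (c (s (t n).+1) * g (t n) * (c (s 0%N))^-1)%g.
have Hq n : Hu (q n).
  by apply: HuM; [apply: HuM => //; apply: Gf_Hu; case: (hg (t n))|exact: HuV].
have qx n : q n x - x \in Vu.
  have [_ gV] := hg (t n); have [_ cV] := hc (s (t n).+1).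
  have /cV := VF_Vu gV; rewrite GLB GLKV -!GLM -/(q n) => h.
  by rewrite -memvN opprB.
have [u u_inc hu] := stab_subseq Ox Hq qx.
exists (s (t (u 0%N)).+1), (s (t (u 1%N)).+1); split.
  by apply: s_inc; rewrite ltnS; apply/t_inc/u_inc.
pose i := t (u 0%N); pose j := t (u 1%N); rewrite -/i -/j.
pose k : GL V := (g i * (c (s 0%N))^-1)%g.
have Hk : Hu k by apply: HuM; [apply: Gf_Hu; case: (hg i)|exact: HuV].
exists (k * ((q (u 0%N))^-1 * q (u 1%N)) * k^-1)%g, (g i * (g j)^-1)%g; split.
- exact: WuJ.
- have [Gi _] := hg i; have [Gj _] := hg j.
  split; first by apply: GM; [case: Gi|apply: GV; case: Gj].
  move=> w wV; rewrite GLM (ht _ (u 1%N)) ?GLKV //.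
  exact: Gf_VF (GfV Gj) wV.
rewrite /q -/i -/j /k !invgM !invgK !mulgA.
by rewrite !(mulgVK, mulgK, mulgV, mul1g).
Qed.

(* This expresses, through [finite_cover], that the lattice points of a fibre of
   [V -> V / V^F] are finite in number modulo [Kf] and [V_F]. *)
Lemma fibre_subseq x (p : nat -> V) : L x -> O x -> (forall n, L (p n) /\ p n - x \in Vu) ->
  exists i j, (i < j)%N /\ exists2 k, Kf k & p j - k (p i) \in VF.
Proof.
move=> Lx Ox hp.
have [|||s s_inc hs] := @bounded_orbits _ _ S (2%:R *: x) p.
- exact: (latZn hb).
- by apply: (oc_scale hO).
- move=> n; have [Lp pV] := hp n; split=> //.
    by rewrite -[p n](subrK x) addrC; exact: O_Vu.
  have -> : 2%:R *: x - p n = x + - (p n - x) by lmod R.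
  by apply: O_Vu; rewrite ?memvN.
have /choice[g hg] : forall j, exists g, Gf g /\ p (s j.+1) - g (p (s 0%N)) \in VF.
  by move=> j; have [g Gg gV] := hs 0%N j.+1 isT; exists g.
have [t t_inc ht] := Gf_subseq (fun n => (hg n).1).
have pO n : O (p n) by have [Lp pV] := hp n; rewrite -[p n](subrK x) addrC; exact: O_Vu.
have Hq n : Hu (g (t n)) by apply: Gf_Hu; case: (hg (t n)).
have qx n : g (t n) (p (s 0%N)) - p (s 0%N) \in Vu.
  have -> : g (t n) (p (s 0%N)) - p (s 0%N) = (p (s (t n).+1) - x) - (p (s 0%N) - x) -
    (p (s (t n).+1) - g (t n) (p (s 0%N))) by lmod R.
  apply: memvB; last by apply: VF_Vu; case: (hg (t n)).
  by apply: memvB; [case: (hp (s (t n).+1))|case: (hp (s 0%N))].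
have [u u_inc hu] := stab_subseq (pO _) Hq qx.
pose i := t (u 0%N); pose j := t (u 1%N).
exists (s i.+1), (s j.+1); split; first by apply: s_inc; rewrite ltnS; apply/t_inc/u_inc.
have [Gi iV] := hg i; have [Gj jV] := hg j.
exists (g j * (g i)^-1)%g; last first.
  have -> : p (s j.+1) - GL_fun (g j * (g i)^-1)%g (p (s i.+1)) =
     (p (s j.+1) - g j (p (s 0%N))) - GL_fun (g j * (g i)^-1)%g (p (s i.+1) - g i (p (s 0%N))).
    by rewrite GLB !GLM GLK; lmod R.
  by rewrite memvB //; apply: Gf_VF => //; apply: GfM => //; exact: GfV.
split.
  have -> : (g j * (g i)^-1 = g i * ((g i)^-1 * g j) * (g i)^-1)%g by rewrite !mulgA mulgV mul1g.
  by apply: WuJ; [exact: Gf_Hu|exact: hu].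
split; first by apply: GM; [case: Gj|apply: GV; case: Gi].
move=> w wV; rewrite GLM (ht _ (u 0%N)) ?GLKV //.
exact: Gf_VF (GfV Gi) wV.
Qed.

End Sequences.

End FaceGroup.

(** * Growth of the fibres over the face *)

(** Used in [fibre_growth] with m < 2 j (t + 1) and i = t j, where i t is bounded by a multiple of
    n. *)
Lemma square_slope (j t : nat) : ((2 * j * t.+1) ^ 2 <= 8 * (j * (t * j * t)) + 8 * j ^ 2)%N.
Proof.
have sq : (t.+1 * t.+1 <= 2 * (t * t) + 2)%N.
  by case: t => // t; rewrite !mulSn !mulnS; lia.
have := leq_mul (leqnn (4 * (j * j))) sq; rewrite -!mulnn; lia.
Qed.

Section FibreBasics.
Variables (R : realType) (V : vectType R) (S : polycone V).
Local Notation L := (int_span (pc_b S)).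
Local Notation b := (pc_b S).
Local Notation hb := (pc_basis S).
Local Notation C := (pc_C S).
Local Notation Cb := (cone_closure (pc_C S)).
Local Notation G := (pc_G S).
Local Notation hC := (pc_open S).
Local Notation d := (size (pc_b S)).
Local Notation VF := <<pc_fs S>>%VS.
Local Notation f := (f_ S).
Local Notation O := (Oc S).
Local Notation Vu := (Vu S).
Local Notation Kf := (Kf S).
Local Notation xi0 := (xi0 S).
Implicit Types (x y z t u v w X Y : V) (g h k : GL V).

Lemma form_bound (e : 'Hom(V, R^o)) : exists K : nat, forall y (B : R), 0 <= B ->
  (forall th, th \in pc_xis S -> `|th y : R| <= B) -> `|e y : R| <= K%:R * B.
Proof.
have [v h0|c hc] := @hom_span _ _ (pc_xis S) e; first by rewrite (pc_xis_ker h0) hom0.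
exists (Num.truncn (\sum_(i < size (pc_xis S)) `|c i|)).+1 => y B B0 hB.
rewrite hc; apply: le_trans (ler_norm_sum _ _ _) _.
apply: le_trans (_ : (\sum_(i < size (pc_xis S)) `|c i|) * B <= _).
  rewrite mulr_suml; apply: ler_sum => i _; rewrite normrM; apply: ler_wpM2l => //.
  by apply: hB; rewrite mem_nth.
by apply: ler_wpM2r => //; exact/ltW/truncnS_gt.
Qed.

(** A quantitative [VF_absorb]: the multiple of f that is needed is linear in the size of w. *)
Lemma VF_bound : exists K : nat, forall w (B : R), 0 <= B -> w \in VF ->
  (forall th, th \in pc_xis S -> `|th w : R| <= B) ->
  Cb ((K%:R * B) *: f + w) /\ Cb ((K%:R * B) *: f - w).
Proof.
have /choice[K hK] := fun i : 'I_(size (pc_fs S)) => form_bound (linfun (coord (in_tuple (pc_fs S)) i : V -> R^o)).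
exists (\sum_i K i)%N => w B B0 wV hB.
have cK i : `|coord (in_tuple (pc_fs S)) i w| <= (\sum_i K i)%:R * B.
  have := hK i w B B0 hB; rewrite lfunE /= => h; apply: le_trans h _.
  by apply: ler_wpM2r => //; rewrite ler_nat (bigD1 i) //= leq_addr.
move: (_ * B) cK => q cK; rewrite {1 2}(coord_span (X := in_tuple (pc_fs S)) wV).
rewrite /f_ (big_nth 0) big_mkord scaler_sumr -sumrN -!big_split /=.
by split; apply: clo_sum => i _; rewrite -?scaleNr -scalerDl; apply: (clo_scale hC);
  [|by apply: pc_fs_clo; rewrite mem_nth| |by apply: pc_fs_clo; rewrite mem_nth];
  have := cK i; rewrite ler_norml => /andP[]; lra.
Qed.

Lemma VF_f g w : Kf g -> w \in VF -> g w = w.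
Proof. by move=> [_ [_ h]]; exact: h. Qed.

Lemma Kf_G g : Kf g -> G g. Proof. by move=> [_ []]. Qed.
Lemma Kf_fx g : Kf g -> g f = f. Proof. by move=> Kg; apply: VF_f => //; exact: f_VF. Qed.
Lemma Kf_diff g v : Kf g -> g v - v \in Vu. Proof. by move=> [[_ h] _]; exact: h. Qed.

Variables (us : seq V).
Hypotheses (us_lat : forall u, u \in us -> L u) (us_span : Vu = <<us>>%VS).

(** The constant 8 serves [fibre_balance]: four times the error of rounding a vector of V^F is
    absorbed by x / 2. *)
Lemma base_point : exists x, [/\ L x, C x & forall c : 'I_(size us) -> R,
  (forall i, `|c i| <= 1) -> sym_box C ((8^-1 : R) *: x) (\sum_i c i *: us`_i)].
Proof.
have [x0 Lx0 Cx0] := lat_point S.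
have [n hn] := oc_absorb_fam hC (index_enum _) (fun i : 'I_(size us) => us`_i) Cx0.
exists ((8 * n.+1)%:R *: x0); split.
- exact: (latZn hb).
- by apply: (oc_scale hC); rewrite ?ltr0n ?muln_gt0.
have -> : (8^-1 : R) *: ((8 * n.+1)%:R *: x0) = n.+1%:R *: x0 by rewrite natrM; lmod_field R.
have nn : n%:R <= n.+1%:R :> R by rewrite ler_nat.
move=> c hc; split; first exact: hn.
rewrite -sumrN; under eq_bigr do rewrite -scaleNr.
by apply: hn => // i; rewrite normrN.
Qed.

Variable x : V.
Hypotheses (Lx : L x) (Cx : C x) (x_cube : forall c : 'I_(size us) -> R,
  (forall i, `|c i| <= 1) -> sym_box C ((8^-1 : R) *: x) (\sum_i c i *: us`_i)).

Lemma Vu_round t : t \in Vu -> exists t' r, [/\ L t', t' \in Vu, t = t' + r &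
  sym_box C ((8^-1 : R) *: x) r].
Proof.
rewrite us_span => /(coord_span (X := in_tuple us)) /= tE.
pose c i := coord (in_tuple us) i t.
exists (\sum_(i < size us) (Num.floor (c i))%:~R *: us`_i),
  (\sum_(i < size us) (c i - (Num.floor (c i))%:~R) *: us`_i); split.
- by apply: (lat_sum hb) => i _; apply: (latZ hb); [exact: intr_int|apply: us_lat; rewrite mem_nth].
- by apply: memv_suml => i _; rewrite memvZ // memv_span // mem_nth.
- by rewrite {1}tE -big_split /=; apply: eq_bigr => i _; rewrite -scalerDl addrC subrK.
apply: x_cube => i; have /andP[h1 h2] := floor_itv (c i); rewrite intrD in h2.
by rewrite ger0_norm; lra.
Qed.

Section Forms.
Variable ths : seq 'Hom(V, R^o).
Hypotheses (ths_int : forall th, th \in ths -> intform b th)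
  (ths_dual : forall th, th \in ths -> dual_of O th)
  (ths_ker : forall v, v \in Vu <-> forall th, th \in ths -> th v = 0).

(** Finiteness is [fibre_subseq]. Each representative is pushed into C by a multiple of f and then
    moved to a point of its [Kf]-orbit where the height, a nonnegative integer, is minimal. *)
Lemma fibre_reps : exists (N : nat) (xl : 'I_N -> V),
  (forall l, [/\ L (xl l), C (xl l), xl l - x \in Vu &
     forall k, Kf k -> (xi0 (xl l) : R) <= xi0 (k (xl l))]) /\
  forall p, L p -> p - x \in Vu -> exists l k, Kf k /\ p - k (xl l) \in VF.
Proof.
have Ox := C_sub_O Cx.
have [N [xs [xsP xs_cover]]] := finite_cover (P := fun p => L p /\ p - x \in Vu)
  (E := fun p p' => exists2 k, Kf k & p' - k p \in VF)
  (fun p hp => fibre_subseq ths_int ths_dual ths_ker Lx Ox hp).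
have /choice[xl hxl] : forall l, exists y, [/\ L y, C y, y - x \in Vu &
     forall k, Kf k -> (xi0 y : R) <= xi0 (k y)] /\ exists2 k, Kf k & xs l - k y \in VF.
  move=> l; have [Ll lV] := xsP l.
  have Ol : O (xs l) by rewrite -[xs l](subrK x) addrC; exact: O_Vu.
  have [n hn] := O_absorb Ol; pose y := xs l + n%:R *: f.
  have Ly : L y by apply: (latD hb) => //; apply: (latZn hb); exact: f_lat.
  have Cy : C y by exact: hn.
  pose mu (m : nat) := `[< exists2 k, Kf k & (xi0 (k y) : R) <= m%:R >].
  have exm : exists m, mu m.
    exists (Num.truncn (xi0 y : R)).+1; apply/asboolP; exists 1%g; first exact: Kf1.
    by rewrite GL1; exact/ltW/truncnS_gt.
  have [m /asboolP[k Kk km] mmin] := ex_minnP exm.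
  exists (k y); split; last first.
    exists k^-1%g; first exact: KfV.
    rewrite GLK /y; have -> : xs l - (xs l + n%:R *: f) = (- n%:R) *: f by lmod R.
    by rewrite memvZ // f_VF.
  split.
  - by apply: pc_GL Ly; exact: Kf_G.
  - by apply: pc_GC Cy; exact: Kf_G.
  - have -> : k y - x = (k y - y) + (xs l - x) + n%:R *: f by rewrite /y; lmod R.
    by apply: memvD; [apply: memvD => //; exact: Kf_diff|rewrite memvZ // VF_Vu // f_VF].
  move=> h Kh; apply: le_trans km _; rewrite -GLM.
  have Khk : Kf (h * k)%g by exact: KfM.
  have Lh : L (GL_fun (h * k)%g y) by apply: pc_GL Ly; exact: Kf_G.
  have Ch : Cb (GL_fun (h * k)%g y) by apply/(oc_sub_closure hC)/(pc_GC (Kf_G Khk)).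
  have /intrP[q qE] := xi0_int Lh.
  have q0 : 0 <= q by rewrite -(ler0z R) -qE; exact: xi0_ge0.
  have qn : q = (absz q)%:Z by rewrite gez0_abs.
  rewrite qE qn -[m%:R]/((m%:Z)%:~R) ler_int lez_nat; apply: mmin; apply/asboolP; exists (h * k)%g => //.
  by rewrite qE {1}qn.
exists N, xl; split=> [l|p Lp pV]; first by case: (hxl l).
have [l [k Kk kV]] := xs_cover p (conj Lp pV); exists l.
have [_ [h Kh hV]] := hxl l; exists (k * h)%g; split; first exact: KfM.
have -> : p - GL_fun (k * h)%g (xl l) = (p - k (xs l)) + k (xs l - h (xl l)).
  by rewrite GLM GLB; lmod R.
by rewrite memvD // VF_f.
Qed.

End Forms.

Variables (N : nat) (xl : 'I_N -> V).
Hypotheses (xl_lat : forall l, L (xl l)) (xl_C : forall l, C (xl l))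
  (xl_min : forall l k, Kf k -> (xi0 (xl l) : R) <= xi0 (k (xl l)))
  (xl_cover : forall p, L p -> p - x \in Vu -> exists l k, Kf k /\ p - k (xl l) \in VF).

(* Writing [x + i v = h_i x_l + w_i], the forms [xi0 \o h_i^-1] are supporting lines
   of a concave function of [i]; their integral slopes [s i] drop at a linear rate,
   because equal slopes confine [h_i^-1 h_j x_l] to a finite set. *)
Lemma fibre_growth : exists K : nat, forall (n m : nat) v w, (0 < n)%N ->
  L v -> v \in Vu -> v \notin VF -> w \in VF ->
  sym_box C (x + n%:R *: f) (m%:R *: v + w) -> (m ^ 2 <= K * n)%N.
Proof.
pose B := \sum_l (xi0 (xl l) : R).
have xlB l : (xi0 (xl l) : R) <= B.
  rewrite /B (bigD1 l) //= lerDl; apply: sumr_ge0 => j _; exact/xi0_ge0/(oc_sub_closure hC).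
have [A hA] := xi0_finite S B; pose J := (size A).+1.
pose C1 := (Num.truncn (xi0 x + xi0 f : R)).+1.
have hC1 : xi0 x + xi0 f <= C1%:R :> R by exact/ltW/truncnS_gt.
have xi0x : 0 <= (xi0 x : R) by exact/xi0_ge0/(oc_sub_closure hC).
have xi0f : 0 <= (xi0 f : R) by exact/xi0_ge0/f_clo.
exists (16 * J * C1 + 8 * J ^ 2)%N => n m v w n0 Lv vV vF wF Bm.
pose z (i : nat) := x + i%:R *: v.
have /choice[D hD] : forall i, exists D : 'I_N * GL V, Kf D.2 /\ z i - D.2 (xl D.1) \in VF.
  move=> i; have [||l [k [Kk kV]]] := xl_cover (p := z i).
  - by apply: (latD hb) => //; exact: (latZn hb).
  - by rewrite /z addrC addKr memvZ.
  by exists (l, k).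
pose h i := (D i).2; pose y i := xl (D i).1; pose ww i := z i - h i (y i).
have Kh i : Kf (h i) by case: (hD i).
have wwF i : ww i \in VF by case: (hD i).
have zE i : z i = h i (y i) + ww i by rewrite /ww addrC subrK.
pose q i (p : V) : R := xi0 (GL_fun (h i)^-1%g p).
have qD i p p' : q i (p + p') = q i p + q i p' by rewrite /q GLD homD.
have qZ i a p : q i (a *: p) = a * q i p by rewrite /q GLZ homZ.
have qF i p : p \in VF -> q i p = xi0 p by move=> pF; rewrite /q VF_f //; exact: KfV.
have qz i j : q i (z j) = xi0 (GL_fun ((h i)^-1 * h j)%g (y j)) + xi0 (ww j).
  by rewrite zE qD (qF _ _ (wwF j)) /q GLM.
have qzz i : q i (z i) = xi0 (y i) + xi0 (ww i) by rewrite qz mulVg GL1.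
have qmin i j : q j (z j) <= q i (z j).
  by rewrite qzz qz lerD2r; apply: xl_min; apply: KfM => //; exact: KfV.
pose s i := q i v.
have qzs i j : q i (z j) = q i x + j%:R * s i by rewrite /z qD qZ.
have s_int i : s i \is a Num.int.
  by apply: (xi0_int (S := S)); apply: pc_GL Lv; apply: GV; exact: Kf_G.
have s_mono i j : (i <= j)%N -> s j <= s i.
  rewrite leq_eqVlt => /orP[/eqP -> //|ij].
  have := qmin i j; have := qmin j i; rewrite !qzs => h1 h2.
  have ijR : 0 < j%:R - i%:R :> R by rewrite subr_gt0 ltr_nat.
  rewrite -(ler_pM2l ijR) !mulrBl; lra.
have s_drop i : s (i + J)%N <= s i - 1.
  rewrite leNgt; apply/negP => lt.
  have sE j : (i <= j <= i + J)%N -> s j = s i.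
    move=> /andP[ij jJ]; apply/eqP; rewrite eq_le s_mono //=.
    apply: le_trans (s_mono _ _ jJ).
    have /intrP[a aE] := s_int i; have /intrP[c cE] := s_int (i + J)%N.
    have : a%:~R < (c + 1)%:~R :> R by rewrite intrD; move: lt; rewrite aE cE; lra.
    by rewrite aE cE ltr_int ler_int; lia.
  have qE j : (i <= j <= i + J)%N -> q i (z j) = q j (z j).
    move=> hj; have := qmin i j; have := qmin j i; rewrite !qzs (sE j) // => h1 h2.
    by apply/eqP; rewrite eq_le; apply/andP; split; lra.
  pose pt (j : 'I_J.+1) := GL_fun ((h i)^-1 * h (i + j)%N)%g (y (i + j)%N).
  have ptA j : pt j \in A.
    have hj : (i <= i + j <= i + J)%N by rewrite leq_addr leq_add2l -ltnS ltn_ord.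
    have KK : Kf ((h i)^-1 * h (i + j)%N)%g by apply: KfM => //; exact: KfV.
    apply: hA.
    - by apply: pc_GL (xl_lat _); exact: Kf_G.
    - by apply/(oc_sub_closure hC); apply: pc_GC (xl_C _); exact: Kf_G.
    apply: le_trans (xlB (D (i + j)%N).1).
    have := qE _ hj; rewrite qz qzz => /addIr e.
    by rewrite -[X in X <= _]/(xi0 (pt j) : R) /pt e.
  have : ~~ injectiveb pt.
    apply/negP => /injectiveP inj; have := @uniq_leq_size _ (map pt (enum 'I_J.+1)) A.
    rewrite map_inj_uniq // enum_uniq size_map size_enum_ord => /(_ isT).
    have sub : {subset map pt (enum 'I_J.+1) <= A} by move=> _ /mapP[j _ ->].
    by move/(_ sub); rewrite /J => /ltnW; rewrite ltnn.
  move/injectivePn => [j1 [j2 j12 pE]].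
  have zpt (j : 'I_J.+1) : z (i + j)%N = h i (pt j) + ww (i + j)%N by rewrite /pt GLM GLKV -zE.
  have : z (i + j1)%N - z (i + j2)%N \in VF.
    by rewrite !zpt pE opprD addrACA subrr add0r memvB.
  have -> : z (i + j1)%N - z (i + j2)%N = (j1%:R - j2%:R) *: v by rewrite /z !natrD; lmod R.
  have c0 : j1%:R - j2%:R != 0 :> R.
    by rewrite subr_eq0 eqr_nat; apply: contra j12 => /eqP e; apply/eqP/val_inj.
  by move/(memvZ (j1%:R - j2%:R)^-1); rewrite scalerA mulVf // scale1r (negbTE vF).
have s_lin (t : nat) : s (t * J)%N <= s 0%N - t%:R.
  elim: t => [|t IH]; first by rewrite mul0n subr0.
  rewrite mulSn addnC; apply: le_trans (s_drop _) _; rewrite -natr1; lra.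
(* With i = t J at most m / 2, the factor m - i in [e6] is at least i, while [s_lin] gives a slope
   drop of at least t. *)
pose t := (m %/ (2 * J))%N; have [i iE] : exists i, i = (t * J)%N by exists (t * J)%N.
have im : (2 * i <= m)%N by rewrite iE; have := leq_trunc_div m (2 * J); rewrite -/t; lia.
have mt : (m < 2 * J * t.+1)%N.
  have J0 : (0 < 2 * J)%N by [].
  by rewrite mulnC; exact: ltn_ceil.
have [B1 B2] := Bm.
have q_ge0 j p : C p -> 0 <= q j p.
  by move=> Cp; apply/xi0_ge0/(oc_sub_closure hC)/(pc_GC _ Cp); apply: GV; exact: Kf_G.
have e1 := q_ge0 i _ B1; have e2 := q_ge0 0%N _ B2.
rewrite !qD -scaleN1r !qZ !qD !qZ -/(s 0%N) (qF _ _ wF) (qF _ _ (f_VF S)) in e2.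
rewrite !qD !qZ -/(s i) (qF _ _ wF) (qF _ _ (f_VF S)) in e1.
have e3 := qmin 0%N i; rewrite !qzs in e3.
have e4 : q 0%N x <= xi0 x.
  have := @xl_min (D 0%N).1 (h 0%N) (Kh 0%N); rewrite -/(y 0%N).
  have := qzz 0%N; have z0 : z 0%N = x by rewrite /z scale0r addr0.
  have : (xi0 (z 0%N) : R) = xi0 (h 0%N (y 0%N)) + xi0 (ww 0%N) by rewrite {1}zE homD.
  by rewrite z0; lra.
have e5 := s_lin t; rewrite -iE in e5.
have n1 : 1 <= n%:R :> R by rewrite ler1n.
(* [e1] and [e2] state that [q i] and [q 0] are nonnegative at the two points x + n f + (m v + w)
   and x + n f - (m v + w). They are added, and [e3] trades [q i x] for [q 0 x]. *)
have e6 : (m%:R - i%:R) * (s 0%N - s i) <= 2 * (C1%:R * n%:R).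
  have : xi0 x + n%:R * xi0 f <= C1%:R * n%:R :> R.
    by apply: le_trans (_ : (xi0 x + xi0 f) * n%:R <= _); [nra|apply: ler_wpM2r].
  by nra.
have e7 : (i * t <= 2 * (C1 * n))%N.
  rewrite -(ler_nat R) !natrM; apply: le_trans e6.
  apply: ler_pM; rewrite ?ler0n //; last by lra.
  by rewrite lerBrDr -natrD ler_nat addnn -mul2n.
have : (m ^ 2 <= (2 * J * t.+1) ^ 2)%N by rewrite leq_exp2r // ltnW.
move=> h1; apply: leq_trans h1 _.
apply: leq_trans (_ : 8 * (J * (i * t)) + 8 * J ^ 2 <= _)%N.
  by rewrite iE; exact: square_slope.
rewrite mulnDl leq_add //; last by rewrite leq_pmulr.
have -> : (16 * J * C1 * n = 8 * (J * (2 * (C1 * n))))%N by rewrite !mulnA [(8 * J * 2)%N]mulnAC.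
by rewrite !leq_mul2l e7 !orbT.
Qed.

End FibreBasics.

(** * Approximate symmetry of the fibres over V / V^F *)

Section FibreBalance.
Variables (R : realType) (V : vectType R) (S : polycone V).
Local Notation L := (int_span (pc_b S)).
Local Notation hb := (pc_basis S).
Local Notation C := (pc_C S).
Local Notation Cb := (cone_closure (pc_C S)).
Local Notation hC := (pc_open S).
Local Notation d := (size (pc_b S)).
Local Notation VF := <<pc_fs S>>%VS.
Local Notation f := (f_ S).
Local Notation Vu := (Vu S).
Local Notation Kf := (Kf S).
Local Notation xi0 := (xi0 S).
Local Notation cnt := (cnt S).
Local Notation hO := (O_open_cone S).
Implicit Types (x y z t u v w X Y : V) (g h k : GL V).

Variables (us : seq V).
Hypotheses (us_lat : forall u, u \in us -> L u) (us_span : Vu = <<us>>%VS).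
Variable x : V.
Hypotheses (Lx : L x) (Cx : C x) (x_cube : forall c : 'I_(size us) -> R,
  (forall i, `|c i| <= 1) -> sym_box C ((8^-1 : R) *: x) (\sum_i c i *: us`_i)).
Variables (N : nat) (xl : 'I_N -> V).
Hypotheses (xl_C : forall l, C (xl l))
  (xl_cover : forall p, L p -> p - x \in Vu -> exists l k, Kf k /\ p - k (xl l) \in VF).

Lemma xis_norm_le th y (B : R) : th \in pc_xis S -> C y -> (xi0 y : R) <= B -> `|th y : R| <= B.
Proof.
move=> hth Cy yB; have Cb_y := oc_sub_closure hC Cy.
by rewrite ger0_norm ?(xis_ge0 hth) // (le_trans (xis_le_xi0 hth Cb_y)).
Qed.

(* The lattice point of the fibre nearest to [x + t / 2] is a translate of some [x_l],
   so the box around it contains about as many lattice points as the one around [x],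
   although it also contains [t]; [packing] then applies. *)
Lemma fibre_balance : exists E K0 : nat, [/\ (0 < E)%N, (0 < K0)%N & forall n t, (0 < n)%N ->
  t \in Vu -> C (x + t) -> (xi0 (x + t) : R) <= n%:R ->
  sym_box C (x + (E * n)%:R *: f) ((K0%:R^-1 : R) *: t)].
Proof.
have Ox := C_sub_O Cx.
have [c0 hc0] := VF_bound S.
pose B0 := \sum_l (xi0 (xl l) : R).
have xlB l : (xi0 (xl l) : R) <= B0.
  rewrite /B0 (bigD1 l) //= lerDl; apply: sumr_ge0 => j _; exact/xi0_ge0/(oc_sub_closure hC).
have B00 : 0 <= B0 by apply: sumr_ge0 => j _; exact/xi0_ge0/(oc_sub_closure hC).
have xi0x : 0 <= (xi0 x : R) by exact/xi0_ge0/(oc_sub_closure hC).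
pose B1 := (Num.truncn (2 * B0 + xi0 x + 1)).+1.
have hB1 : 2 * B0 + xi0 x + 1 <= B1%:R by exact/ltW/truncnS_gt.
have /choice[D1 hD1] : forall l, exists D : nat * nat, C (D.1%:R *: x - xl l + D.2%:R *: f).
  move=> l; have [n1 hn1] := oc_absorb hO (- xl l) Ox.
  have [n2 hn2] := O_absorb (hn1 n1%:R (lexx _)).
  by exists (n1, n2); exact: hn2.
pose D := \max_l (D1 l).1; pose n0 := \max_l (D1 l).2.
have Cf : Cb f by exact: f_clo.
have Cbx : Cb x by exact: (oc_sub_closure hC).
have hD l : C (D%:R *: x - xl l + n0%:R *: f).
  have d1 : (D1 l).1%:R <= D%:R :> R by rewrite ler_nat; exact: (leq_bigmax l).
  have d2 : (D1 l).2%:R <= n0%:R :> R by rewrite ler_nat; exact: (leq_bigmax l).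
  have -> : D%:R *: x - xl l + n0%:R *: f = ((D%:R - (D1 l).1%:R) *: x + (n0%:R - (D1 l).2%:R) *: f) +
     ((D1 l).1%:R *: x - xl l + (D1 l).2%:R *: f) by lmod R.
  have h : Cb ((D%:R - (D1 l).1%:R) *: x + (n0%:R - (D1 l).2%:R) *: f).
    by apply: clo_add; apply: (clo_scale hC); rewrite ?subr_ge0.
  exact: h.
(* By [VF_bound], c0 B1 n f dominates w; the summand n0 pays for the comparison of the x_l with D x.
   Thus q = E n covers both. *)
pose E := (c0 * B1 + n0).+1.
have E1 : c0%:R * B1%:R <= E%:R :> R by rewrite -natrM ler_nat /E -addSn addnC -addSnnS leq_addl.
have E2 : n0%:R <= E%:R :> R by rewrite ler_nat; apply/leqW/leq_addl.
(* The constant of [packing] times the losses of the dilations by 4 and by D + 2. *)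
pose K1 := (32 ^ d * (8 ^ d * (2 * (D + 2)) ^ d))%N.
exists (2 * E)%N, K1.+1; split=> // n t n_gt0 tV Cy yn; set y := x + t in Cy yn.
have n1 : 1 <= n%:R :> R by rewrite ler1n.
have [t' [r [Lt' t'V tE rB]]] := Vu_round us_lat us_span x_cube (memvZ (2^-1 : R) tV).
(* A lattice point near the midpoint of x and y = x + t; both e and its reflection x + y - e are
   still in C. *)
pose e := x + t'.
have eE : e = 2^-1 *: x + 2^-1 *: y - r.
  have -> : e = x + 2^-1 *: t - r by rewrite tE /e; lmod R.
  by rewrite /y; lmod_field R.
have [rB1 rB2] := rB.
have Ce : C e.
  have -> : e = (2^-1 - 8^-1) *: x + 2^-1 *: y + (8^-1 *: x - r) by rewrite eE; lmod_field R.
  apply: (oc_add hC) => //; apply: (oc_add hC); apply: (oc_scale hC) => //; lra.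
have xye : C (x + y - e).
  have -> : x + y - e = (2^-1 - 8^-1) *: x + 2^-1 *: y + (8^-1 *: x + r) by rewrite eE; lmod_field R.
  apply: (oc_add hC) => //; apply: (oc_add hC); apply: (oc_scale hC) => //; lra.
have Le : L e by exact: (latD hb).
have [|l [k [Kk wV]]] := xl_cover Le; first by rewrite /e addrC addKr.
pose w := e - k (xl l); rewrite -/w in wV.
have eK : e = k (xl l + w) by rewrite GLD (VF_f Kk wV) /w addrC subrK.
have Gk := Kf_G Kk; have GkV := GV Gk.
have xi0e : (xi0 e : R) <= xi0 x + n%:R.
  have := xi0_ge0 (oc_sub_closure hC xye); rewrite homB homD; lra.
have Cxw : C (xl l + w) by rewrite -[xl l + w](GLK k) -eK; exact: pc_GC.
have xi0w : (xi0 w : R) <= xi0 x + n%:R.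
  have := xi0_ge0 (oc_sub_closure hC (pc_GC Gk (xl_C l))).
  by rewrite /w homB; lra.
have wB th : th \in pc_xis S -> `|th w : R| <= B1%:R * n%:R.
  move=> hth; have a1 := xis_norm_le hth (xl_C l) (xlB l).
  have : (xi0 (xl l + w) : R) <= B0 + (xi0 x + n%:R) by rewrite homD lerD.
  move/(xis_norm_le hth Cxw); rewrite homD => a2.
  have : B0 + (B0 + (xi0 x + n%:R)) <= B1%:R * n%:R.
    by apply: le_trans (_ : (2 * B0 + xi0 x + 1) * n%:R <= _); [nra|apply: ler_wpM2r].
  apply: le_trans.
  have -> : (th w : R) = (th (xl l) + th w) - th (xl l) by rewrite addrC addKr.
  by apply: le_trans (ler_normB _ _) _; rewrite addrC lerD.
have Bn0 : 0 <= B1%:R * n%:R :> R by rewrite mulr_ge0.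
have [_ wf] := hc0 w _ Bn0 wV wB; pose q : R := E%:R * n%:R.
have {}wf : Cb (q *: f - w).
  have -> : q *: f - w = (q - c0%:R * (B1%:R * n%:R)) *: f + ((c0%:R * (B1%:R * n%:R)) *: f - w).
    by lmod R.
  apply: clo_add => //; apply: (clo_scale hC) => //.
  by rewrite subr_ge0 /q mulrA ler_wpM2r.
have q0 : 0 <= q by rewrite /q mulr_ge0.
have n0q : n0%:R <= q by apply: le_trans E2 _; rewrite /q ler_peMr.
have -> : (2 * E * n)%:R = 2 * q :> R by rewrite !natrM /q mulrA.
pose X := x + (2 * q) *: f.
have CX : C X by rewrite /X addrC; apply: nf_C; rewrite ?mulr_ge0.
have [m1 hm1] := cube_absorb CX.
pose m := (4 * m1.+1)%N; have mR : 0 < m%:R :> R by rewrite ltr0n.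
apply: contrapT => nB.
(* Transport by k^-1 turns e + 2 q f into x_l + w + 2 q f, which is at most x_l + 3 q f and hence at
   most (D + 2) X. So the boxes around e and around x have comparable counts, whatever k is. *)
have Ytw : (32 ^ d * cnt (4%:R *: (m%:R *: (e + (2 * q) *: f))) < K1.+1 * cnt (m%:R *: X))%N.
  have h1 := @cnt_dilate _ _ S 4 (m%:R *: (e + (2 * q) *: f)) isT.
  pose Y := xl l + (3 * q) *: f.
  have h2 : (cnt (m%:R *: (e + (2 * q) *: f)) <= cnt (m%:R *: Y))%N.
    apply: leq_trans (_ : cnt (m%:R *: Y) <= _)%N => //.
    have := cnt_GL (m%:R *: k Y) GkV; rewrite -{2}GLZ GLK; apply: leq_trans.
    apply: cnt_mono; rewrite -scalerBr; apply: (clo_scale hC); first exact: ltW.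
    have -> : k Y - (e + (2 * q) *: f) = q *: f - w; last by [].
    by rewrite /Y GLD GLZ (Kf_fx Kk) /w; lmod R.
  have h3 : (cnt (m%:R *: Y) <= cnt ((D + 2)%:R *: (m%:R *: X)))%N.
    apply: cnt_mono; have -> : (D + 2)%:R *: (m%:R *: X) - m%:R *: Y =
       m%:R *: ((D%:R *: x - xl l + n0%:R *: f) + (2 *: x + (2 * (D%:R + 2) * q - 3 * q - n0%:R) *: f)).
      by rewrite /X /Y natrD; lmod R.
    apply: (clo_scale hC); first exact: ltW.
    apply: clo_add; first exact: (oc_sub_closure hC).
    apply: clo_add; apply: (clo_scale hC) => //.
    have : 0 <= D%:R * q by rewrite mulr_ge0.
    by lra.
  have D20 : (0 < D + 2)%N by rewrite addn2.
  have h4 := @cnt_dilate _ _ S (D + 2) (m%:R *: X) D20.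
  have cX : (0 < cnt (m%:R *: X))%N by apply/cnt_gt0/(oc_scale hC).
  apply: leq_ltn_trans (_ : K1 * cnt (m%:R *: X) < _)%N; last by rewrite ltn_pmul2r.
  rewrite /K1 -mulnA leq_mul2l; apply/orP; right.
  apply: leq_trans h1 _; rewrite -mulnA leq_mul2l; apply/orP; right.
  exact: leq_trans h2 (leq_trans h3 h4).
move: Ytw; apply/negP; rewrite -leqNgt.
have e4 : 4%:R *: (e + (2 * q) *: f) = 2 *: x + 2 *: y - 4 *: r + (8 * q) *: f.
  by rewrite eE; lmod_field R.
have scale4 : 4%:R *: (m%:R *: (e + (2 * q) *: f)) = m%:R *: (2 *: x + 2 *: y - 4 *: r + (8 * q) *: f).
  by rewrite -e4; lmod R.
apply: (@packing _ _ S _ _ (m%:R *: t)) => //.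
- rewrite scale4 -scalerBr; apply: (clo_scale hC); first exact: ltW.
  have -> : 2 *: x + 2 *: y - 4 *: r + (8 * q) *: f - X =
     ((2 - 1 - 4 * 8^-1) *: x + 2 *: y) + 4 *: (8^-1 *: x - r) + (6 * q) *: f.
    by rewrite /X; lmod_field R.
  apply: clo_add; last by apply: (clo_scale hC) => //; rewrite mulr_ge0.
  apply: clo_add; last by apply: (clo_scale hC) => //; exact: (oc_sub_closure hC).
  by apply: clo_add; apply: (clo_scale hC); do ?[exact: (oc_sub_closure hC)]; lra.
- rewrite scale4; apply: (boxZ hC) => //; split.
    have -> : 2 *: x + 2 *: y - 4 *: r + (8 * q) *: f + t =
       (8 * q) *: f + ((1 - 4 * 8^-1) *: x + 3 *: y + 4 *: (8^-1 *: x - r)).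
      by rewrite /y; lmod_field R.
    apply: nf_C; first by rewrite mulr_ge0.
    apply: (oc_add hC); last exact: (oc_scale hC).
    by apply: (oc_add hC); apply: (oc_scale hC) => //; lra.
  have -> : 2 *: x + 2 *: y - 4 *: r + (8 * q) *: f - t =
     (8 * q) *: f + ((3 - 4 * 8^-1) *: x + y + 4 *: (8^-1 *: x - r)).
    by rewrite /y; lmod_field R.
  apply: nf_C; first by rewrite mulr_ge0.
  apply: (oc_add hC); last exact: (oc_scale hC).
  by apply: (oc_add hC) => //; apply: (oc_scale hC) => //; lra.
- move=> h; apply: nB.
  have -> : x + (2 * q) *: f = m%:R^-1 *: (m%:R *: X) by rewrite /X; lmod_field R.
  have -> : (K1.+1%:R^-1 : R) *: t = m%:R^-1 *: (K1.+1%:R^-1 *: (m%:R *: t)).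
    by move: (K1.+1%:R^-1 : R) => a; lmod_field R.
  by apply: (boxZ hC) => //; rewrite invr_gt0.
move=> c hc; have -> : (4^-1 : R) *: (m%:R *: X) = m1.+1%:R *: X.
  by rewrite /m natrM; move: (m1.+1%:R : R) => a; lmod_field R.
by apply: hm1 => //; rewrite ler_nat.
Qed.

End FibreBalance.

(** Coordinates on T: integral forms es and rational vectors ts, dual to each other modulo V_F, with
    D a common denominator of the ts. A new generator u outside the previous space comes with an
    integral form e0 that vanishes there; u minus its component along the previous ts, divided by e0
    u, extends the dual system. *)
Lemma fibre_coords (R : realType) (V : vectType R) (S : polycone V) (us : seq V) :
  (forall u, u \in us -> int_span (pc_b S) u) ->
  exists (es : seq 'Hom(V, R^o)) (ts : seq V) (D : nat), [/\ (0 < D)%N /\ size es = size ts,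
    forall e, e \in es -> intform (pc_b S) e /\ forall w, w \in <<pc_fs S>>%VS -> e w = 0,
    forall t, t \in ts -> int_span (pc_b S) (D%:R *: t) /\ t \in (<<pc_fs S>> + <<us>>)%VS,
    forall i j, (i < size ts)%N -> (j < size ts)%N -> es`_i ts`_j = (i == j)%:R :> R &
    forall v, v \in (<<pc_fs S>> + <<us>>)%VS ->
      v - \sum_(i < size ts) (es`_i v : R) *: ts`_i \in <<pc_fs S>>%VS].
Proof.
have hb := pc_basis S.
elim: us => [|u us IH] uL.
  exists [::], [::], 1%N; split=> // v.
  by rewrite span_nil addv0 big_ord0 subr0.
have {}IH := IH (fun v h => uL v (mem_behead (s := u :: us) h)).
have [es [ts [D [[D0 sz] hes hts dual dec]]]] := IH.
have sub : (<<pc_fs S>> + <<us>> <= <<pc_fs S>> + <<u :: us>>)%VS.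
  by apply: addvS => //; rewrite span_cons addvSr.
have [uin|uout] := boolP (u \in (<<pc_fs S>> + <<us>>)%VS).
  have sub' : (<<pc_fs S>> + <<u :: us>> <= <<pc_fs S>> + <<us>>)%VS.
    by rewrite span_cons !subv_add addvSl addvSr -memvE uin.
  exists es, ts, D; split=> //.
    by move=> t /hts[Lt tin]; split=> //; exact: subvP sub _ tin.
  by move=> v /(subvP sub'); exact: dec.
have [|es' es'_int es'_ker] := @lat_equations _ _ _ hb (pc_fs S ++ us).
  move=> y; rewrite mem_cat => /orP[|yu]; first exact: pc_fs_lat.
  by apply: uL; rewrite inE yu orbT.
rewrite span_cat in es'_ker.
have [e0 e0in e0u] : exists2 e, e \in es' & e u != 0 :> R.
  apply: contrapT => no; move/negP: uout; apply; apply/es'_ker => e ein; apply/eqP.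
  by apply: contrapT => /negP h; apply: no; exists e.
have e0K v : v \in (<<pc_fs S>> + <<us>>)%VS -> e0 v = 0 :> R by move=> /es'_ker; apply.
have Lu : int_span (pc_b S) u by apply: uL; rewrite mem_head.
pose sm (v : V) := \sum_(i < size ts) (es`_i v : R) *: ts`_i.
have sm_in v : sm v \in (<<pc_fs S>> + <<us>>)%VS.
  by apply: memv_suml => i _; rewrite memvZ //; case: (hts ts`_i (mem_nth _ (ltn_ord i))).
pose t0 := ((e0 u : R)^-1) *: (u - sm u).
have smD v w : sm (v + w) = sm v + sm w.
  by rewrite -big_split; apply: eq_bigr => i _; rewrite homD scalerDl.
have smZ (a : R) v : sm (a *: v) = a *: sm v.
  by rewrite scaler_sumr; apply: eq_bigr => i _; rewrite homZ scalerA.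
have e0t0 : e0 t0 = 1 :> R by rewrite homZ homB (e0K _ (sm_in u)) subr0 mulVf.
have est0 i : (i < size ts)%N -> es`_i t0 = 0 :> R.
  move=> li; rewrite homZ homB hom_sum (bigD1 (Ordinal li)) //= homZ dual // eqxx mulr1.
  rewrite big1 ?addr0 ?subrr ?mulr0 // => j ji; rewrite homZ dual //.
  by rewrite eq_sym -[(_ == _)]/(j == Ordinal li) (negbTE ji) mulr0.
have /intrP[z zE] := es'_int e0 e0in u Lu.
have z0 : z != 0 by apply: contraNneq e0u => z0; rewrite zE z0.
exists (e0 :: es), (t0 :: ts), (D * absz z)%N; split.
- by rewrite muln_gt0 D0 absz_gt0 z0 /= sz.
- move=> e; rewrite inE => /orP[/eqP ->|/hes //]; split; first exact: es'_int.
  by move=> w wV; apply: e0K; apply: subvP (addvSl _ _) _ wV.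
- move=> t; rewrite inE => /orP[/eqP ->|/hts[Lt tin]]; last first.
    split; last exact: subvP sub _ tin.
    by rewrite natrM mulrC -scalerA; exact: (latZn hb).
  split; last first.
    rewrite memvZ // memvB //; last exact: subvP sub _ (sm_in u).
    by apply: subvP (addvSr _ _) _ _; rewrite memv_span // mem_head.
  have -> : (D * absz z)%:R *: t0 = (sgz z)%:~R *: (D%:R *: u - \sum_(i < size ts) (es`_i u : R) *: (D%:R *: ts`_i)).
    have -> : \sum_(i < size ts) (es`_i u : R) *: (D%:R *: ts`_i) = D%:R *: sm u.
      by rewrite scaler_sumr; apply: eq_bigr => i _; rewrite !scalerA mulrC.
    have zR : z%:~R != 0 :> R by rewrite intr_eq0.
    have azE : (absz z)%:R = (sgz z)%:~R * z%:~R :> R.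
      by rewrite -intrM -abszEsg.
    rewrite /t0 zE natrM azE -scalerBr !scalerA -mulrA mulfK // mulrC //.
  apply: (latZ hb); first exact: intr_int.
  apply: (latB hb); first exact: (latZn hb).
  apply: (lat_sum hb) => i _; have hei : es`_i \in es by rewrite mem_nth // sz.
  apply: (latZ hb); first by case: (hes _ hei) => h _; exact: h.
  by case: (hts ts`_i (mem_nth _ (ltn_ord i))).
- move=> [|i] [|j] //= li lj; first by rewrite e0K //; case: (hts ts`_j (mem_nth _ lj)).
    by rewrite est0.
  by rewrite dual.
move=> v; rewrite span_cons [(<[u]> + _)%VS]addvC addvA => /memv_addP[v' v'in [v2 /vlineP[a ->] ->]].
rewrite big_ord_recl /=; have -> : \sum_(i < size ts) (es`_i (v' + a *: u) : R) *: ts`_i = sm (v' + a *: u) by [].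
rewrite smD smZ homD homZ (e0K _ v'in) add0r.
have -> : (a * e0 u) *: t0 = a *: (u - sm u) by rewrite /t0 scalerA mulfK.
have := dec v' v'in; rewrite -/(sm v').
suff -> : v' - sm v' = v' + a *: u - (a *: (u - sm u) + (sm v' + a *: sm u)) by [].
by lmod R.
Qed.

(** * The gauges induced on T by the symmetric intervals *)

Section FibreGauge.
Variables (R : realType) (V : vectType R) (S : polycone V).
Local Notation L := (int_span (pc_b S)).
Local Notation b := (pc_b S).
Local Notation C := (pc_C S).
Local Notation hC := (pc_open S).
Local Notation VF := <<pc_fs S>>%VS.
Local Notation f := (f_ S).
Local Notation Vu := (Vu S).
Local Notation Kf := (Kf S).
Local Notation xi0 := (xi0 S).
Local Notation ir := (map_mx (intmul (1 : R))).
Implicit Types (x y z u v w X Y p : V) (g h k : GL V).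

Variables (r : nat) (e : 'I_r -> 'Hom(V, R^o)) (t : 'I_r -> V) (D : nat).
Hypotheses (D0 : (0 < D)%N) (e_int : forall i, intform b (e i))
  (e_VF : forall i w, w \in VF -> e i w = 0) (t_lat : forall i, L (D%:R *: t i))
  (t_Vu : forall i, t i \in Vu) (e_t : forall i j, e i (t j) = (i == j)%:R :> R)
  (e_dec : forall v, v \in Vu -> v - \sum_i (e i v : R) *: t i \in VF).

Definition vec (a : 'rV[R]_r) : V := \sum_i a 0 i *: t i.
Definition cv v : 'rV[R]_r := \row_i (e i v : R).

Lemma vecD a c : vec (a + c) = vec a + vec c.
Proof. by rewrite -big_split; apply: eq_bigr => i _; rewrite mxE scalerDl. Qed.

Lemma vecZ (s : R) a : vec (s *: a) = s *: vec a.
Proof. by rewrite scaler_sumr; apply: eq_bigr => i _; rewrite mxE scalerA. Qed.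

Lemma vec_delta j : vec (delta_mx 0 j) = t j.
Proof.
rewrite /vec (bigD1 j) //= mxE !eqxx scale1r big1 ?addr0 // => i ij.
by rewrite mxE (negbTE ij) andbF scale0r.
Qed.

Lemma vec_Vu a : vec a \in Vu.
Proof. by apply: memv_suml => i _; rewrite memvZ. Qed.

Lemma cv_vec a : cv (vec a) = a.
Proof.
apply/rowP => i; rewrite mxE hom_sum (bigD1 i) //= homZ e_t eqxx mulr1 big1 ?addr0 // => j ji.
by rewrite homZ e_t eq_sym (negbTE ji) mulr0.
Qed.

Lemma cvD v w : cv (v + w) = cv v + cv w.
Proof. by apply/rowP => i; rewrite !mxE homD. Qed.

Lemma cvZ (s : R) v : cv (s *: v) = s *: cv v.
Proof. by apply/rowP => i; rewrite !mxE homZ. Qed.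

Lemma cv_VF w : w \in VF -> cv w = 0.
Proof. by move=> wV; apply/rowP => i; rewrite !mxE e_VF. Qed.

Lemma vec_cv v : v \in Vu -> v - vec (cv v) \in VF.
Proof.
move=> vV; have -> : vec (cv v) = \sum_i (e i v : R) *: t i by apply: eq_bigr => i _; rewrite mxE.
exact: e_dec.
Qed.

Lemma cv_eq0 v : v \in Vu -> cv v = 0 -> v \in VF.
Proof.
move=> vV v0; have := vec_cv vV; rewrite v0.
by have -> : vec 0 = 0; [rewrite /vec big1 // => i _; rewrite mxE scale0r|rewrite subr0].
Qed.

Lemma cv_int v : L v -> exists a : 'rV[int]_r, cv v = ir a.
Proof.
move=> Lv; have /choice[a ha] : forall i, exists z : int, (e i v : R) = z%:~R.
  by move=> i; apply/intrP; exact: e_int.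
by exists (\row_i a i); apply/rowP => i; rewrite !mxE.
Qed.

Variables (x : V) (K0 : nat).
Hypotheses (Cx : C x) (K00 : (0 < K0)%N).

(** The image in T of the symmetric interval of K0 l (x + n f), in coordinates; w is free in V_F
    because only classes modulo V_F count. The factor K0 cancels the 1 / K0 of [fibre_balance]. *)
Definition fgauge (n : nat) (l : R) : set 'rV[R]_r :=
  [set a | exists2 w, w \in VF & sym_box C ((K0%:R * l) *: (x + n%:R *: f)) (vec a + w)].

Lemma base_C (n : nat) : C (x + n%:R *: f).
Proof. by rewrite addrC; exact: nf_C. Qed.

Lemma fgaugeP (n : nat) : is_gauge (fgauge n).
Proof.
have K0R : 0 < K0%:R :> R by rewrite ltr0n.
split.
- move=> l m a c [w wV h] [w' wV' h']; exists (w + w'); first exact: memvD.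
  rewrite vecD mulrDr scalerDl addrACA; exact: (boxD hC).
- move=> s l a s0 [w wV h]; exists (s *: w); first exact: memvZ.
  by rewrite mulrCA -scalerA vecZ -scalerDr; exact: (boxZ hC).
- move=> s l a s1 [w wV h]; exists (s *: w); first exact: memvZ.
  by rewrite vecZ -scalerDr; exact: (box_shrink hC).
- move=> l l0; exists 0; first exact: mem0v.
  have -> : vec 0 + 0 = 0 by rewrite addr0 /vec big1 // => i _; rewrite mxE scale0r.
  by apply/box0/(oc_scale hC); [exact: mulr_gt0|exact: base_C].
move=> l; have /choice[Ke hKe] := fun i => form_bound S (e i).
set X := (K0%:R * l) *: (x + n%:R *: f).
pose M := (Num.truncn (\sum_i (Ke i)%:R * (xi0 X : R))).+1.
have [||A hA] := @box_finite_list R r M 'rV[int]_r (fun v : 'rV[int]_r => fgauge n l (ir v)) (fun (v : 'rV[int]_r) i => (v 0 i)%:~R).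
- move=> v i [w wV Bv]; split; first exact: intr_int.
  have CX := boxO hC Bv; have X0 : 0 <= (xi0 X : R) by exact/xi0_ge0/(oc_sub_closure hC).
  have -> : (v 0 i)%:~R = (e i (vec (ir v) + w) : R).
    have := congr1 (fun m : 'rV[R]_r => m 0 i) (cv_vec (ir v)).
    by rewrite homD (e_VF i wV) addr0 !mxE => ->.
  apply: le_trans (_ : (Ke i)%:R * (xi0 X : R) <= _).
    apply: hKe => // th hth; have [h1 h2] := Bv.
    have a1 := xis_ge0 hth (oc_sub_closure hC h1); have a2 := xis_ge0 hth (oc_sub_closure hC h2).
    have a3 := xis_le_xi0 hth (oc_sub_closure hC CX).
    move: a1 a2 a3; rewrite homB homD; move: (th X : R) (xi0 X : R) (th _ : R) => a c q a1 a2 a3.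
    by rewrite ler_norml; apply/andP; split; lra.
  apply: le_trans (_ : \sum_i (Ke i)%:R * (xi0 X : R) <= _); last exact/ltW/truncnS_gt.
  by rewrite (bigD1 i) //= lerDl; apply: sumr_ge0 => j _; rewrite mulr_ge0.
- move=> v v' _ _ h; apply/rowP => i; have := h i; move/eqP; rewrite eqr_int => /eqP //.
by exists A => v; exact: hA.
Qed.

End FibreGauge.

(** * A lower bound for the number of lattice points in the gauges *)

Lemma int_code_bound (z : int) (M : nat) : `|z| <= M%:Z ->
  (absz (z + M%:Z)%R < (2 * M).+1)%N /\ 0 <= z + M%:Z.
Proof. by lia. Qed.

Lemma int_code_inj (z1 z2 : int) (M : nat) : 0 <= z1 + M%:Z -> 0 <= z2 + M%:Z ->
  absz (z1 + M%:Z)%R = absz (z2 + M%:Z)%R -> z1 = z2.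
Proof. by lia. Qed.

Section FibreCount.
Variables (R : realType) (V : vectType R) (S : polycone V).
Local Notation L := (int_span (pc_b S)).
Local Notation b := (pc_b S).
Local Notation hb := (pc_basis S).
Local Notation C := (pc_C S).
Local Notation Cb := (cone_closure (pc_C S)).
Local Notation hC := (pc_open S).
Local Notation VF := <<pc_fs S>>%VS.
Local Notation f := (f_ S).
Local Notation O := (Oc S).
Local Notation Vu := (Vu S).
Local Notation Kf := (Kf S).
Local Notation xi0 := (xi0 S).
Local Notation ir := (map_mx (intmul (1 : R))).
Implicit Types (x y z u v w X Y p : V) (g h k : GL V).

Variables (r : nat) (e : 'I_r -> 'Hom(V, R^o)) (t : 'I_r -> V) (D : nat).
Hypotheses (D0 : (0 < D)%N) (e_int : forall i, intform b (e i))
  (e_VF : forall i w, w \in VF -> e i w = 0) (t_lat : forall i, L (D%:R *: t i))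
  (t_Vu : forall i, t i \in Vu) (e_t : forall i j, e i (t j) = (i == j)%:R :> R)
  (e_dec : forall v, v \in Vu -> v - \sum_i (e i v : R) *: t i \in VF).
Variables (x : V) (E K0 : nat).
Hypotheses (Lx : L x) (Cx : C x) (E_gt0 : (0 < E)%N) (K00 : (0 < K0)%N).
Variables (N : nat) (xl : 'I_N -> V).
Hypotheses (xl_lat : forall l, L (xl l)) (xl_C : forall l, C (xl l))
  (xl_Vu : forall l, xl l - x \in Vu)
  (xl_cover : forall p, L p -> p - x \in Vu -> exists l k, Kf k /\ p - k (xl l) \in VF).
Hypothesis balance : forall (n : nat) v, (0 < n)%N -> v \in Vu -> C (x + v) ->
  (xi0 (x + v) : R) <= n%:R -> sym_box C (x + (E * n)%:R *: f) ((K0%:R^-1 : R) *: v).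

Local Notation vec := (vec t).
Local Notation cv := (cv e).
Local Notation fg := (fgauge S t x K0).
Local Notation hG := (fgaugeP e_VF e_t Cx K00).

(** The balance estimate at n' concerns the interval of x + E n' f, and the conditions on mu make mu
    (x + n f) dominate x + E n' f. *)
Lemma orbit_gauge (n n' : nat) (mu : R) p : C p -> p - x \in Vu -> (0 < n')%N ->
  (xi0 p : R) <= n'%:R -> 1 <= mu -> E%:R * n'%:R <= mu * n%:R -> fg n mu (cv (p - x)).
Proof.
move=> Cp pV n'0 pn mu1 En; have K0R : 0 < K0%:R :> R by rewrite ltr0n.
have pE : x + (p - x) = p by rewrite addrC subrK.
have h : sym_box C (x + (E * n')%:R *: f) ((K0%:R^-1 : R) *: (p - x)).
  by apply: balance; rewrite ?pE.
exists ((p - x) - vec (cv (p - x))); first exact: (vec_cv e_dec).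
rewrite [vec _ + _]addrC subrK.
have -> : p - x = K0%:R *: ((K0%:R^-1 : R) *: (p - x)) by rewrite scalerA mulfV ?scale1r // gt_eqF.
have -> : (K0%:R * mu) *: (x + n%:R *: f) = K0%:R *: (x + (E * n')%:R *: f) +
   (K0%:R *: ((mu - 1) *: x + (mu * n%:R - E%:R * n'%:R) *: f)) by rewrite natrM; lmod R.
apply: box_clo; first exact: (boxZ hC).
apply: (clo_scale hC); first exact: ltW.
apply: clo_add; apply: (clo_scale hC); rewrite ?subr_ge0 //; first exact: (oc_sub_closure hC).
exact: f_clo.
Qed.

(** For every a > 0, a x plus or minus t j is in O, because t j is in the lineality space; a large
    multiple of f brings it into C. *)
Lemma unit_gauge : exists nmin : nat, forall n : nat, (nmin <= n)%N ->
  forall j, fg n ((2 * r.+1)%:R^-1) (delta_mx 0 j).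
Proof.
pose a : R := K0%:R * (2 * r.+1)%:R^-1.
have a0 : 0 < a by rewrite mulr_gt0 ?invr_gt0 ?ltr0n.
have Oy v : v \in Vu -> O (a *: x + v).
  by move=> vV; apply: O_Vu => //; apply: C_sub_O; exact: (oc_scale hC).
have /choice[n1 hn1] : forall j, exists m : nat, forall c : R, m%:R <= c ->
    sym_box C (a *: x + c *: f) (t j).
  move=> j; have [m1 h1] := O_absorb (Oy _ (t_Vu j)).
  have [|m2 h2] := O_absorb (Oy (- t j) _); first by rewrite memvN.
  exists (m1 + m2)%N => c hc; rewrite natrD in hc.
  have m10 : 0 <= m1%:R :> R := ler0n _ _; have m20 : 0 <= m2%:R :> R := ler0n _ _.
  split; rewrite addrAC; first by apply: h1; lra.
  by apply: h2; lra.
exists (Num.truncn ((\max_j (n1 j))%:R / a)).+1 => n hn j.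
exists 0; first exact: mem0v.
rewrite vec_delta addr0 -/a scalerDr scalerA; apply: hn1.
rewrite mulrC -ler_pdivrMr //.
apply: le_trans (_ : (\max_j (n1 j))%:R / a <= _).
  by rewrite ler_pM2r ?invr_gt0 // ler_nat; exact: (leq_bigmax j).
by apply/ltW/(lt_le_trans (truncnS_gt _)); rewrite ler_nat.
Qed.

Lemma orbit_Vu h l : Kf h -> h (xl l) - x \in Vu.
Proof.
move=> Kh; have -> : h (xl l) - x = (h (xl l) - xl l) + (xl l - x) by lmod R.
by apply: memvD => //; exact: Kf_diff.
Qed.

Lemma orbit_cover p : L p -> p - x \in Vu -> exists lk : 'I_N * GL V,
  Kf lk.2 /\ p - lk.2 (xl lk.1) \in VF.
Proof. by move=> Lp pV; have [l [k hk]] := xl_cover Lp pV; exists (l, k). Qed.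

(* The representatives must not depend on the form [c] of [fibre_gauge_count]. *)
Lemma orbit_section : exists H : 'rV[int]_r -> 'I_N * GL V, forall (a : 'rV[int]_r) l h,
  Kf h -> cv (h (xl l) - x) = ir a ->
  [/\ Kf (H a).2, cv ((H a).2 (xl (H a).1) - x) = ir a &
    (xi0 ((H a).2 (xl (H a).1)) : R) <= xi0 (h (xl l))].
Proof.
have [l0 _] := xl_cover Lx (eq_ind_r (fun v => v \in Vu) (mem0v _) (subrr x)).
suff /choice[H hH] : forall a : 'rV[int]_r, exists lh : 'I_N * GL V, forall l h,
  Kf h -> cv (h (xl l) - x) = ir a ->
  [/\ Kf lh.2, cv (lh.2 (xl lh.1) - x) = ir a & (xi0 (lh.2 (xl lh.1)) : R) <= xi0 (h (xl l))].
  by exists H => a l h; exact: hH.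
move=> a; pose Q (lh : 'I_N * GL V) := Kf lh.2 /\ cv (lh.2 (xl lh.1) - x) = ir a.
have [[lh0 Qlh0]|no] := pselect (exists lh, Q lh); last first.
  by exists (l0, 1%g) => l h Kh ha; exfalso; apply: no; exists (l, h).
pose P (m : nat) := `[< exists2 lh, Q lh & (xi0 (lh.2 (xl lh.1)) : R) <= m%:R >].
have exP : exists m, P m.
  exists (Num.truncn (xi0 (lh0.2 (xl lh0.1)) : R)).+1; apply/asboolP; exists lh0 => //.
  exact/ltW/truncnS_gt.
have [m /asboolP[lh [Kh ha] hm] mmin] := ex_minnP exP.
exists lh => l h Kh' ha'; split=> //.
have Lp : L (h (xl l)) by apply: pc_GL (xl_lat l); exact: Kf_G.
have Cp : Cb (h (xl l)) by apply/(oc_sub_closure hC)/(pc_GC (Kf_G Kh')).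
have /intrP[q qE] := xi0_int Lp.
have q0 : 0 <= q by rewrite -(ler0z R) -qE; exact: xi0_ge0.
have qn : q = (absz q)%:Z by rewrite gez0_abs.
apply: le_trans hm _; rewrite qE qn -[m%:R]/((m%:Z)%:~R) ler_int lez_nat.
by apply: mmin; apply/asboolP; exists (l, h) => //=; rewrite qE {1}qn.
Qed.

(* If the integral form [c] is bounded by [n / (4 E)] on the gauge, then [xi0 + c] is bounded
   below on the orbit, and its near-minimizers lie in the gauge; the increments of [xi0 + c]
   at a near-minimizer take boundedly many values and determine [c]. *)
Lemma fibre_gauge_count : exists Eg nmin : nat, forall n : nat, (nmin <= n)%N ->
  (n ^ r <= Eg * cntZ (hG n) r.+1%:R ^ 2)%N.
Proof.
have [H hH] := orbit_section; have [nu hnu] := unit_gauge.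
have xV0 : x - x \in Vu by rewrite subrr mem0v.
have [[l0 k0] /= [Kk0 k0V]] := orbit_cover Lx xV0.
pose M0 : R := xi0 (k0 (xl l0)).
have M00 : 0 <= M0 by apply/xi0_ge0/(oc_sub_closure hC)/(pc_GC (Kf_G Kk0)).
pose sg (s : bool) : R := (-1) ^+ s.
(* Moving x_l by D t_i or - D t_i leads to a translate of some representative, up to V_F. The errors
   [ww] form a finite family independent of n and c, and M bounds their heights. *)
have /choice[W hW] : forall lis : 'I_N * 'I_r * bool, exists lk : 'I_N * GL V, Kf lk.2 /\
    xl lis.1.1 + sg lis.2 *: (D%:R *: t lis.1.2) - lk.2 (xl lk.1) \in VF.
  move=> [[l i] s] /=; apply: orbit_cover.
    by apply: (latD hb) => //; rewrite /sg; case: s; rewrite ?expr1 ?expr0 ?scaleN1r ?scale1r //; exact: (latN hb).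
  have -> : xl l + sg s *: (D%:R *: t i) - x = (xl l - x) + sg s *: (D%:R *: t i) by lmod R.
  by apply: memvD => //; rewrite !memvZ.
pose ww lis := xl lis.1.1 + sg lis.2 *: (D%:R *: t lis.1.2) - (W lis).2 (xl (W lis).1).
pose M := (Num.truncn (\sum_lis (`|xi0 (ww lis) : R| + 1))).+1.
have hM lis : `|xi0 (ww lis) : R| + 1 <= M%:R.
  apply: le_trans (ltW (truncnS_gt _)); rewrite (bigD1 lis) //= lerDl.
  by apply: sumr_ge0 => j _; rewrite addr_ge0.
(* Th is the constant of [polar_count]; with rho = n / A the forms of Ds are at most n / (4 E) on
   the unit gauge. *)
pose Th := (4 * r.+1 ^ 2)%N; pose A := (4 * Th * E)%N.
have A0 : (0 < A)%N by rewrite !muln_gt0 E_gt0.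
(* At a near-minimizer p, val p <= M0 + 1 and [val_ge] give 3/4 xi0 p <= M0 + 5/4 + n / (4 E); this
   threshold on n then yields E n' <= n, so that p - x is in the unit gauge. *)
pose nM := (Num.truncn (E%:R * (2 * M0 + 4))).+1.
have hnM : E%:R * (2 * M0 + 4) <= nM%:R by exact/ltW/truncnS_gt.
exists (A ^ r * (2 * M).+1 ^ r)%N, (nu + nM).+1 => n hn.
have n_gt0 : (0 < n)%N by apply: leq_trans hn.
have nR : 0 < n%:R :> R by rewrite ltr0n.
have ER : 1 <= E%:R :> R by rewrite ler1n.
have nMn : E%:R * (2 * M0 + 4) <= n%:R.
  by apply: le_trans hnM _; rewrite ler_nat; apply: leq_trans (leq_addl nu _) (ltnW hn).
have nun : (nu <= n)%N by apply: leq_trans (leq_addr nM _) (ltnW hn).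
pose rho := (n %/ A)%N; have [Ds [uD bigD polD]] := polar_count (hG n) rho (hnu n nun).
have rho_n : 4 * E%:R * (Th * rho)%:R <= n%:R :> R.
  have : (A * rho <= n)%N by rewrite mulnC; exact: leq_trunc_div.
  by rewrite -(ler_nat R) /A !natrM; lra.
have lt_n : (n <= A * rho.+1)%N by rewrite mulnC; apply: ltnW; exact: ltn_ceil.
have key : (size Ds <= (2 * M).+1 ^ r * cntZ (hG n) r.+1%:R)%N.
  have /choice[ac hac] : forall c, exists a : 'rV[int]_r, c \in Ds ->
      [/\ fg n 1 (ir a), Kf (H a).2 & forall i, `|(xi0 ((H a).2 (D%:R *: t i)) : R) +
          dot c (cv ((H a).2 (D%:R *: t i)))| <= M%:R].
    move=> c; have [cD|_] := boolP (c \in Ds); last by exists 0.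
    pose qc v : R := dot c (cv v).
    have qcD u v : qc (u + v) = qc u + qc v by rewrite /qc cvD dotD.
    have qcZ a v : qc (a *: v) = a * qc v by rewrite /qc cvZ dotZ.
    have qcF w : w \in VF -> qc w = 0.
      by move=> wV; rewrite /qc (cv_VF e_VF wV) /dot big1 // => j _; rewrite mxE mulr0.
    pose val p : R := xi0 p + qc (p - x).
    (* With mu = 1 + E n' / n the vector p - x is in the gauge at mu, where c is at most n / (4 E) +
       n' / 4 in absolute value, and n' <= xi0 p + 1. *)
    have val_ge l h : Kf h -> 3 / 4 * xi0 (h (xl l)) - n%:R / (4 * E%:R) - 1 / 4 <= val (h (xl l)).
      move=> Kh; set p := h (xl l); pose n' := (Num.truncn (xi0 p : R)).+1.
      have Cp : C p by apply: pc_GC (xl_C l); exact: Kf_G.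
      have p0 : 0 <= (xi0 p : R) by exact/xi0_ge0/(oc_sub_closure hC).
      have pn' : (xi0 p : R) <= n'%:R by exact/ltW/truncnS_gt.
      have n'p : n'%:R <= xi0 p + 1 :> R.
        by rewrite -natr1 lerD2r; have /andP[] := truncn_itv p0.
      pose mu : R := 1 + E%:R * n'%:R / n%:R.
      have En0 : 0 <= E%:R * n'%:R / n%:R :> R by rewrite !mulr_ge0 ?invr_ge0.
      have mu1 : 1 <= mu by rewrite lerDl.
      have := @orbit_gauge n n' mu p Cp (orbit_Vu l Kh) isT pn' mu1.
      have -> : mu * n%:R = n%:R + E%:R * n'%:R by rewrite /mu mulrDl mul1r divfK // gt_eqF.
      rewrite lerDr => /(_ (ltW nR)) /(polD c _ _ cD (lt_le_trans ltr01 mu1)).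
      rewrite -/Th -/(qc (p - x)) => q1.
      have q2 : (Th * rho)%:R * mu <= n%:R / (4 * E%:R) + n'%:R / 4.
        have -> : n%:R / (4 * E%:R) + n'%:R / 4 = (n%:R / (4 * E%:R)) * mu.
          by rewrite /mu; field; rewrite ?gt_eqF // (lt_le_trans ltr01 ER).
        rewrite ler_pM2r ?(lt_le_trans ltr01) // ler_pdivlMr; last by lra.
        by rewrite mulrC.
      have := le_trans q1 q2; rewrite ler_norml => /andP[q3 _].
      by rewrite /val; move: q3 n'p; lra.
    have val_gt l h : Kf h -> 0 <= val (h (xl l)) + n%:R + 1.
      move=> Kh; have := val_ge l h Kh.
      have : 0 <= (xi0 (h (xl l)) : R) by apply/xi0_ge0/(oc_sub_closure hC)/(pc_GC (Kf_G Kh)).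
      have : n%:R / (4 * E%:R) <= n%:R :> R.
        rewrite ler_pdivrMr; last by lra.
        by rewrite -[leLHS]mulr1 ler_pM2l //; lra.
      by move: (xi0 _ : R) (n%:R / _ : R) (val _) nR => a d v; lra.
    pose P (m : nat) := `[< exists lh : 'I_N * GL V, Kf lh.2 /\ val (lh.2 (xl lh.1)) + n%:R + 1 <= m%:R >].
    have exP : exists m, P m.
      exists (Num.truncn (val (k0 (xl l0)) + n%:R + 1)).+1; apply/asboolP; exists (l0, k0); split=> //=.
      exact/ltW/truncnS_gt.
    have [m /asboolP[[l h] /= [Kh hm]] mmin] := ex_minnP exP.
    have near l' h' : Kf h' -> val (h (xl l)) <= val (h' (xl l')) + 1.
      move=> Kh'; have /andP[k1 k2] := truncn_itv (val_gt l' h' Kh').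
      have : (m <= (Num.truncn (val (h' (xl l')) + n%:R + 1)).+1)%N.
        by apply: mmin; apply/asboolP; exists (l', h'); split=> //=; exact: ltW.
      rewrite -(ler_nat R) -natr1; move: hm k1; lra.
    have Lp : L (h (xl l) - x) by apply: (latB hb) => //; apply: pc_GL (xl_lat l); exact: Kf_G.
    have [a aE] := cv_int e_int Lp; have [KH Ha minH] := hH a l h Kh aE.
    set p := (H a).2 (xl (H a).1) in Ha minH.
    have vp : val p <= val (h (xl l)) by rewrite /val /qc Ha aE lerD2r.
    have {}near l' h' : Kf h' -> val p <= val (h' (xl l')) + 1.
      by move=> Kh'; apply: le_trans vp _; exact: near.
    exists a => _; split=> //.
      rewrite -Ha; pose n' := (Num.truncn (xi0 p : R)).+1.
      have p0 : 0 <= (xi0 p : R) by apply/xi0_ge0/(oc_sub_closure hC)/(pc_GC (Kf_G KH)).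
      apply: (@orbit_gauge n n') => //.
      - by apply: pc_GC (xl_C _); exact: Kf_G.
      - exact: orbit_Vu.
      - exact/ltW/truncnS_gt.
      have n'p : n'%:R <= xi0 p + 1 :> R.
        by rewrite -natr1 lerD2r; have /andP[] := truncn_itv p0.
      have := near l0 k0 Kk0; rewrite {2}/val -/M0.
      have -> : qc (k0 (xl l0) - x) = 0 by apply: qcF; rewrite -memvN opprB.
      have := val_ge (H a).1 (H a).2 KH; rewrite -/p => v1 v2.
      have v3 : E%:R * (3 / 4 * xi0 p - n%:R / (4 * E%:R) - 1 / 4) <= E%:R * (M0 + 0 + 1) :> R.
        by rewrite ler_pM2l ?(lt_le_trans ltr01) //; apply: le_trans v1 v2.
      have v4 : E%:R * (n%:R / (4 * E%:R)) = n%:R / 4 :> R.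
        by field; rewrite gt_eqF // (lt_le_trans ltr01 ER).
      have v5 : E%:R * n'%:R <= E%:R * (xi0 p + 1) :> R by rewrite ler_pM2l ?(lt_le_trans ltr01).
      rewrite mul1r; move: v3 v4 v5 nMn.
      rewrite !mulrDr !mulrN; move: (E%:R * (n%:R / _) : R) => a1.
      have -> : E%:R * (3 / 4 * xi0 p) = 3 / 4 * (E%:R * xi0 p) :> R by ring.
      have -> : E%:R * (2 * M0) = 2 * (E%:R * M0) :> R by ring.
      by move: (E%:R * n'%:R : R) (E%:R * xi0 p : R) (E%:R * M0 : R) => a2 a3 a4; lra.
    (* Up to V_F, p moved by D t_i through [H a] is again a translate of some x_l, so
       near-minimality bounds the increment from below; the two signs bound it on both sides. *)
    have step i s : (xi0 (ww ((H a).1, i, s)) : R) - 1 <=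
        sg s * (xi0 ((H a).2 (D%:R *: t i)) + qc ((H a).2 (D%:R *: t i))).
      have [Kk kV] := hW ((H a).1, i, s); set lk := W _ in Kk kV.
      have KK : Kf ((H a).2 * lk.2)%g by exact: KfM.
      have := near lk.1 _ KK; rewrite GLM.
      have -> : lk.2 (xl lk.1) = xl (H a).1 + sg s *: (D%:R *: t i) - ww ((H a).1, i, s).
        by rewrite /ww /= -/lk; lmod R.
      have HwF := VF_f KH kV; rewrite -/(ww ((H a).1, i, s)) in HwF kV *.
      rewrite GLB GLD GLZ HwF -/p /val.
      have -> : p + sg s *: (H a).2 (D%:R *: t i) - ww ((H a).1, i, s) - x =
          (p - x) + sg s *: (H a).2 (D%:R *: t i) + (-1) *: ww ((H a).1, i, s) by lmod R.
      rewrite !qcD !qcZ (qcF _ kV) homB homD homZ mulrDr.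
      by move: (sg s * _) (sg s * _) (xi0 p : R) (qc _) (xi0 _ : R); move=> *; lra.
    move=> i; rewrite -/(qc _) ler_norml; apply/andP; split.
      have := step i false; rewrite /sg expr0 mul1r; apply: le_trans.
      have := hM ((H a).1, i, false); move: (xi0 (ww _) : R) => y.
      by have := ler_norm (- y); rewrite normrN; lra.
    have := step i true; rewrite /sg expr1 mulN1r.
    have := hM ((H a).1, i, true); move: (xi0 (ww _) : R) (xi0 _ + qc _) => y z.
    by have := ler_norm (- y); rewrite normrN; lra.
  have /choice[zc hzc] : forall ci : 'rV[int]_r * 'I_r, exists z : int, ci.1 \in Ds ->
      (xi0 ((H (ac ci.1)).2 (D%:R *: t ci.2)) : R) +
          dot ci.1 (cv ((H (ac ci.1)).2 (D%:R *: t ci.2))) = z%:~R.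
    move=> [c i] /=; have [cD|_] := boolP (c \in Ds); last by exists 0.
    have [_ KH _] := hac c cD; set v := (H (ac c)).2 _.
    have Lv : L v by apply: pc_GL (t_lat i); exact: Kf_G.
    have /intrP[z1 ->] := xi0_int Lv; have [a ->] := cv_int e_int Lv.
    exists (z1 + \sum_j c 0 j * a 0 j) => _; rewrite intrD; congr (_ + _).
    have -> : (\sum_j c 0 j * a 0 j)%:~R = \sum_j (c 0 j * a 0 j)%:~R :> R by rewrite rmorph_sum.
    by apply: eq_bigr => j _; rewrite mxE -intrM.
  have zB c i : c \in Ds -> (absz (zc (c, i) + M%:Z)%R < (2 * M).+1)%N /\ 0 <= zc (c, i) + M%:Z.
    move=> cD; have [_ _ /(_ i)] := hac c cD; rewrite (hzc (c, i) cD) -intr_norm -[M%:R]/((M%:Z)%:~R) ler_int.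
    exact: int_code_bound.
  (* Equal codes give the same a, hence the same element [H a], and the same increments. Subtracting
     xi0, the two forms agree on the images of the t i under that element, which again span T. *)
  pose code (c : 'rV[int]_r) := (ac c, [ffun i : 'I_r => inord (absz (zc (c, i) + M%:Z)%R) : 'I_(2 * M).+1]).
  have inj : {in Ds &, injective code}.
    move=> c c' cD c'D [ea /ffunP ez].
    have [_ KH _] := hac c cD; set Ha := (H (ac c)).2 in KH.
    have ze i : zc (c, i) = zc (c', i).
      have := congr1 (@nat_of_ord _) (ez i); rewrite !ffunE.
      have [l1 l2] := zB c i cD; have [l3 l4] := zB c' i c'D; rewrite !inordK //.
      exact: int_code_inj.
    have dE i : dot c (cv (Ha (D%:R *: t i))) = dot c' (cv (Ha (D%:R *: t i))).
      have := hzc (c, i) cD; have := hzc (c', i) c'D; rewrite /= -ea -/Ha -ze => <- /addrI //.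
    have DR : D%:R != 0 :> R by rewrite pnatr_eq0 -lt0n.
    have {}dE i : dot c (cv (Ha (t i))) = dot c' (cv (Ha (t i))).
      by have := dE i; rewrite GLZ cvZ !dotZ => /(mulfI DR).
    have Gi := Gf_Vu (Kf_Gf (KfV KH)).
    have tE j : cv (t j) = \sum_i (e i (GL_fun Ha^-1%g (t j)) : R) *: cv (Ha (t i)).
      have := e_dec (Gi _ (t_Vu j)); set w := _ - _ => wV.
      have : t j = \sum_i (e i (GL_fun Ha^-1%g (t j)) : R) *: Ha (t i) + w.
        rewrite -(VF_f KH wV) /w GLB GLKV GL_sum addrC.
        have -> : \sum_i (e i (GL_fun Ha^-1%g (t j)) : R) *: Ha (t i) =
            \sum_i Ha ((e i (GL_fun Ha^-1%g (t j)) : R) *: t i).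
          by apply: eq_bigr => i _; rewrite GLZ.
        by rewrite subrK.
      move=> {1}->; rewrite cvD (cv_VF e_VF wV) addr0.
      apply/rowP => q; rewrite mxE hom_sum summxE; apply: eq_bigr => i _.
      by rewrite !mxE homZ.
    apply/rowP => j; apply/eqP; rewrite -(eqr_int R); apply/eqP.
    have dj (d : 'rV[int]_r) : (d 0 j)%:~R = dot d (cv (t j)).
      rewrite /dot (bigD1 j) //= mxE e_t eqxx mulr1 big1 ?addr0 // => i ij.
      by rewrite mxE e_t (negbTE ij) mulr0.
    by rewrite !dj tE !dot_sum; apply: eq_bigr => i _; rewrite dE.
  have sub : {subset map code Ds <= [seq (a, q) | a <- pts (hG n) 1,
      q <- enum {ffun 'I_r -> 'I_(2 * M).+1}]}.
    move=> _ /mapP[c cD ->]; apply/allpairsP; exists (code c); split=> //=.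
    - by apply/mem_pts; case: (hac c cD).
    - by rewrite mem_enum.
  have := uniq_leq_size _ sub; rewrite map_inj_in_uniq // => /(_ uD).
  rewrite size_map size_allpairs -cardE card_ffun !card_ord mulnC => h; apply: leq_trans h _.
  rewrite leq_mul2l; apply/orP; right; apply: uniq_leq_size; first exact: pts_uniq.
  by move=> v /mem_pts h; apply/mem_pts; move: h; apply: (g_mono (hG n)); rewrite ler1n.
apply: leq_trans (_ : A ^ r * rho.+1 ^ r <= _)%N; first by rewrite -expnMn; case: (posnP r) => [->|r_gt0]; rewrite ?expn0 ?leq_exp2r.
rewrite -!mulnA leq_mul2l; apply/orP; right; apply: leq_trans bigD _.
by rewrite expnS expn1 mulnA leq_mul2r key orbT.
Qed.

End FibreCount.

(** * Finiteness of the action of [Kf] on T *)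

Lemma fibre_action_finite (R : realType) (V : vectType R) (S : polycone V) (k : nat -> GL V) :
  (forall i, Kf S (k i)) -> exists i j, (i < j)%N /\
  forall v, v \in Vu S -> k i v - k j v \in <<pc_fs S>>%VS.
Proof.
move=> Kk; have hb := pc_basis S; have hC := pc_open S; pose f := f_ S.
have [us us_lat us_span] := Vu_rational S.
have [ths [ths_int ths_dual ths_ker]] := Vu_forms S.
have [x [Lx Cx x_cube]] := base_point S us.
have [N [xl [hxl xl_cover]]] := fibre_reps Lx Cx ths_int ths_dual ths_ker.
have xl_lat l : int_span (pc_b S) (xl l) by case: (hxl l).
have xl_C l : pc_C S (xl l) by case: (hxl l).
have xl_Vu l : xl l - x \in Vu S by case: (hxl l).
have xl_min l g : Kf S g -> (xi0 S (xl l) : R) <= xi0 S (g (xl l)) by case: (hxl l) => _ _ _; apply.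
have [Kb growth] := fibre_growth Lx Cx xl_lat xl_C xl_min xl_cover.
have [E [K0 [E0 K00 balance]]] := fibre_balance us_lat us_span Lx Cx x_cube xl_C xl_cover.
have [es [ts [D [[D0 sz] hes hts dual dec]]]] := @fibre_coords R V S us us_lat.
have VuE : (<<pc_fs S>> + <<us>>)%VS = Vu S.
  by apply/eqP; rewrite -us_span eqEsubv addvSr subv_add subvv !andbT; apply/subvP => w; exact: VF_Vu.
rewrite VuE in hts dec.
set r := size ts in dual dec *.
pose e (i : 'I_r) := es`_i; pose t (i : 'I_r) := ts`_i.
have e_in i : e i \in es by rewrite mem_nth // sz.
have t_in i : t i \in ts by rewrite mem_nth.
have e_int i : intform (pc_b S) (e i) by case: (hes _ (e_in i)).
have e_VF i w : w \in <<pc_fs S>>%VS -> e i w = 0 by case: (hes _ (e_in i)) => _; apply.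
have t_lat i : int_span (pc_b S) (D%:R *: t i) by case: (hts _ (t_in i)).
have t_Vu i : t i \in Vu S by case: (hts _ (t_in i)).
have e_t i j : e i (t j) = (i == j)%:R :> R by exact: dual.
have e_dec v : v \in Vu S -> v - \sum_i (e i v : R) *: t i \in <<pc_fs S>>%VS by exact: dec.
have [Eg [nmin count]] := fibre_gauge_count D0 e_int e_VF t_lat t_Vu e_t e_dec Lx Cx E0 K00
  xl_lat xl_C xl_Vu xl_cover balance.
pose hG := fgaugeP e_VF e_t Cx K00.
pose c := (K0 * D * Kb.+1).-1.
have cE : c.+1 = (K0 * D * Kb.+1)%N by rewrite prednK // !muln_gt0 K00 D0.
have [Cs Cs0 sspan] := short_span R r c Eg.
(* P will be a set of lattice points spanning T at scale Cs ep, and Q, at scale kk ep, will contain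
   the images of D P. Their sizes are at most Bd for every n, so the number Nk of maps from P to Q
   is bounded before n is chosen. *)
pose kk := (2 * D * Cs)%N; pose Bd := ((2 * (r.+1 * kk)).+1 ^ r)%N.
have Bd0 : (0 < Bd)%N by rewrite expn_gt0.
pose Nk := (Bd ^ Bd)%N.
have /choice[n1 hn1] : forall i, exists m : nat, forall a : R, m%:R <= a ->
    pc_C S (x - (k i x - x) + a *: f).
  by move=> i; apply/O_absorb/O_Vu; [rewrite memvN; exact: Kf_diff|exact: C_sub_O].
(* n is a square whose root m0 is a multiple of Cs, as [short_span] requires; it exceeds the
   thresholds n1 of the first Nk + 1 elements, the only ones used. *)
pose m := (nmin + \max_(i < Nk.+1) n1 i).+1; pose m0 := (Cs * m)%N; pose n := (m0 ^ 2)%N.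
have mm0 : (m <= m0)%N by rewrite leq_pmull.
have m00 : (0 < m0)%N by apply: leq_trans mm0.
have m0n : (m0 <= n)%N by rewrite /n expnS expn1 leq_pmull.
have nn : (nmin <= n)%N by apply: leq_trans (leq_trans mm0 m0n); rewrite leqW // leq_addr.
have n1n (i : 'I_Nk.+1) : (n1 i)%:R <= n%:R :> R.
  rewrite ler_nat; apply: leq_trans (leq_trans mm0 m0n).
  by apply: leqW; apply: leq_trans (leq_addl _ _); exact: (leq_bigmax i).
have n0 : (0 < n)%N by apply: leq_trans m0n.
pose ep : R := (c.+1 * (Cs * m))%:R^-1.
have ep0 : 0 < ep by rewrite invr_gt0 ltr0n !muln_gt0 Cs0.
have K0R : K0%:R != 0 :> R by rewrite pnatr_eq0 -lt0n.
have DR : D%:R != 0 :> R by rewrite pnatr_eq0 -lt0n.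
have m0R : m0%:R != 0 :> R by rewrite pnatr_eq0 -lt0n.
have vecL (v : 'rV[int]_r) : int_span (pc_b S) (D%:R *: vec t (map_mx (intmul 1) v)).
  rewrite scaler_sumr; apply: (lat_sum hb) => i _; rewrite scalerA mulrC -scalerA mxE.
  by apply: (latZ hb) => //; exact: intr_int.
(* Multiplied by D (Kb + 1) m0, a nonzero v would put (Kb + 1) m0 times a lattice vector in the
   interval of x + n f, against [growth], since ((Kb + 1) m0)^2 > Kb n. The value of c makes this
   multiplier the right one. *)
have sep (v : 'rV[int]_r) : fgauge S t x K0 n ep (map_mx (intmul (1 : R)) v) -> v = 0.
  move=> [w wV Bv]; set y := vec t _ in Bv.
  have [yV|yV] := boolP (y \in <<pc_fs S>>%VS).
    have := cv_VF e_VF yV; rewrite (cv_vec e_t) => /rowP h; apply/rowP => i.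
    by have := h i; rewrite !mxE => /eqP; rewrite intr_eq0 => /eqP.
  have DyV : D%:R *: y \notin <<pc_fs S>>%VS.
    apply: contra yV => /(memvZ (D%:R^-1)).
    by rewrite scalerA mulVf // scale1r.
  have DyVu : D%:R *: y \in Vu S by rewrite memvZ // (vec_Vu t_Vu).
  pose M := (D * (Kb.+1 * m0))%N; have M0 : 0 < M%:R :> R by rewrite ltr0n !muln_gt0 D0 Cs0.
  have DwV : M%:R *: w \in <<pc_fs S>>%VS by rewrite memvZ.
  have := boxZ hC M0 Bv.
  have -> : M%:R *: ((K0%:R * ep) *: (x + n%:R *: f_ S)) = x + n%:R *: f_ S.
    rewrite scalerA; have -> : M%:R * (K0%:R * ep) = 1 :> R; last by rewrite scale1r.
    have aux (q : nat) : q%:R != 0 :> R ->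
        (D * (Kb.+1 * q))%:R * (K0%:R * (K0 * D * Kb.+1 * q)%:R^-1) = 1 :> R.
      rewrite !natrM; move: K0R DR; have : Kb.+1%:R != 0 :> R by rewrite pnatr_eq0.
      by move: (Kb.+1%:R : R) (q%:R : R) (K0%:R : R) (D%:R : R) => a1 a2 a3 a4 h1 h2 h3 h4;
        field; rewrite h1 h2 h3 h4.
    by rewrite /ep cE; exact: aux.
  have -> : M%:R *: (y + w) = (Kb.+1 * m0)%:R *: (D%:R *: y) + M%:R *: w.
    by rewrite scalerDr /M natrM mulrC -scalerA.
  move=> /(growth n _ _ _ n0 (vecL v) DyVu DyV DwV).
  rewrite expnMn -/n leq_pmul2r // => h; exfalso; move: h; clear.
  by rewrite leqNgt expnS expn1; nia.
have big : ((Cs * m) ^ r <= Eg * cntZ (hG n) r.+1%:R)%N.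
  rewrite -leq_sqr -/m0; have := count n nn; rewrite -/hG; move: (cntZ _ _) => q.
  rewrite /n -expnM mulnC expnM => h; apply: leq_trans h _.
  by rewrite expnMn leq_mul2r; apply/orP; right; case: (Eg) => // a; rewrite expnS expn1 leq_pmulr.
have := sspan _ (hG n) m isT sep big; rewrite -/ep; set P := pts _ _ => Pspan.
pose Q := pts (hG n) (kk%:R * ep).
have sQ : (size Q <= Bd)%N.
  have kk0 : (0 < kk)%N by rewrite !muln_gt0 D0 Cs0.
  have := gauge_packing (hG n) ep0 kk0 sep (pts_uniq _ _) (fun v h => (mem_pts (hG n) _ v).1 h).
  move=> h; apply: leq_trans h _; rewrite leq_pexp2l //.
  by apply: leq_trans (dimvS (subvf _)) _; rewrite dimvf /dim /= mul1n.
have PQ : {subset P <= Q}.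
  move=> v /mem_pts h; apply/mem_pts; move: h; apply: (g_mono (hG n)).
  by rewrite ler_pM2r // ler_nat leq_pmull // muln_gt0 D0.
have sP : (size P <= Bd)%N by apply: leq_trans sQ; apply: uniq_leq_size PQ; exact: pts_uniq.
(* With X_n = x + n f, k i X_n plus 2 x - k i x + n f equals 2 X_n, and the second summand is in C
   because n >= n1 i. So k i at most doubles the gauge, and D makes the vectors integral. *)
have moved (i : 'I_Nk.+1) (v : 'rV[int]_r) : exists v' : 'rV[int]_r, v \in P -> v' \in Q /\
    map_mx (intmul (1 : R)) v' = cv e (k i (D%:R *: vec t (map_mx (intmul 1) v))).
  have [vP|_] := boolP (v \in P); last by exists 0.
  set y := D%:R *: _; have Ly : int_span (pc_b S) (k i y) by apply: pc_GL (vecL v); exact: Kf_G.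
  have [v' v'E] := cv_int e_int Ly; exists v' => _; split=> //; apply/mem_pts; rewrite -v'E.
  move: vP => /mem_pts[w wV Bv].
  have yV : k i y \in Vu S by apply: Gf_Vu; [exact: Kf_Gf|rewrite memvZ // (vec_Vu t_Vu)].
  exists (D%:R *: w + (k i y - vec t (cv e (k i y)))).
    by rewrite memvD ?memvZ // (vec_cv e_dec).
  have -> : vec t (cv e (k i y)) + (D%:R *: w + (k i y - vec t (cv e (k i y)))) = k i y + D%:R *: w.
    by lmod R.
  have D0R : 0 < D%:R :> R by rewrite ltr0n.
  have := boxZ hC D0R Bv; rewrite [D%:R *: (vec _ _ + _)]scalerDr -/y => /(box_GL (Kf_G (Kk i))).
  rewrite GLD [k i (D%:R *: w)]GLZ (VF_f (Kk i) wV) !GLZ GLD GLZ (Kf_fx (Kk i)).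
  move=> B1; have := box_clo (Y := (D%:R * (K0%:R * (Cs%:R * ep))) *: (x - (k i x - x) + n%:R *: f)) B1.
  have -> : D%:R *: ((K0%:R * (Cs%:R * ep)) *: (k i x + n%:R *: f_ S)) +
     (D%:R * (K0%:R * (Cs%:R * ep))) *: (x - (k i x - x) + n%:R *: f) =
     (K0%:R * (kk%:R * ep)) *: (x + n%:R *: f_ S) by rewrite /kk !natrM /f; lmod R.
  apply; apply: (clo_scale hC); first by rewrite !mulr_ge0 // ltW.
  by apply: (oc_sub_closure hC); exact: hn1.
have /choice[rh hrh] : forall iv : 'I_Nk.+1 * 'rV[int]_r, exists v' : 'rV[int]_r, iv.2 \in P ->
    v' \in Q /\ map_mx (intmul (1 : R)) v' = cv e (k iv.1 (D%:R *: vec t (map_mx (intmul 1) iv.2))).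
  by move=> [i v]; exact: moved.
pose code (i : 'I_Nk.+1) : {ffun 'I_(size P) -> 'I_Bd.-1.+1} :=
  [ffun q : 'I_(size P) => inord (index (rh (i, P`_q)%R) Q)].
have : ~~ injectiveb code.
  apply/negP => /injectiveP/leq_card; rewrite card_ffun !card_ord prednK // leqNgt ltnS.
  by rewrite leq_pexp2l.
move=> /injectivePn[i [j ij /ffunP ecode]].
have rhE (v : 'rV[int]_r) : v \in P -> rh (i, v) = rh (j, v).
  move=> vP; have lv : (index v P < size P)%N by rewrite index_mem.
  have := congr1 (@nat_of_ord _) (ecode (Ordinal lv)); rewrite !ffunE /= nth_index //.
  have [h1 _] := hrh (i, v) vP; have [h2 _] := hrh (j, v) vP.
  have l1 : (index (rh (i, v)) Q < Bd)%N by apply: leq_trans sQ; rewrite index_mem.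
  have l2 : (index (rh (j, v)) Q < Bd)%N by apply: leq_trans sQ; rewrite index_mem.
  by rewrite !inordK ?prednK // => /index_inj; exact.
pose good (a : 'rV[R]_r) := k i (vec t a) - k j (vec t a) \in <<pc_fs S>>%VS.
have goodP (v : 'rV[int]_r) : v \in P -> good (map_mx (intmul 1) v).
  move=> vP; have [_ h1] := hrh (i, v) vP; have [_ h2] := hrh (j, v) vP.
  rewrite /= -rhE // in h1 h2; have yV := vec_Vu t_Vu (map_mx (intmul 1) v); rewrite /good.
  set y := vec t _ in h1 h2 yV *.
  have : D%:R *: (k i y - k j y) \in <<pc_fs S>>%VS.
    apply: (cv_eq0 e_dec); first by rewrite memvZ // memvB //; apply: Gf_Vu => //; exact: Kf_Gf.
    rewrite scalerBr -!GLZ -scaleN1r cvD cvZ -h1 -h2.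
    by rewrite scaleN1r subrr.
  by move=> /(memvZ (D%:R^-1)); rewrite scalerA mulVf // scale1r.
have good_all a : good a.
  have : a \in <<map (map_mx (intmul (1 : R))) P>>%VS.
    suff -> : <<map (map_mx (intmul (1 : R))) P>>%VS = fullv by exact: memvf.
    by apply/eqP; rewrite -(dimv_leqif_eq (subvf _)) Pspan dimvf /dim /= mul1n.
  move=> /(coord_span (X := in_tuple _)) ->; rewrite /good.
  elim/big_ind: _ => [|a1 a2 h1 h2|q _].
  - have -> : vec t 0 = 0 by rewrite /vec big1 // => q _; rewrite mxE scale0r.
    by rewrite !GL0 subrr mem0v.
  - rewrite vecD !GLD opprD addrACA; exact: memvD.
  rewrite vecZ !GLZ -scalerBr memvZ //.
  have /mapP[v vP ->] : (map (map_mx (intmul (1 : R))) P)`_q \in map (map_mx (intmul (1 : R))) P by rewrite mem_nth.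
  exact: goodP.
have fin v : v \in Vu S -> k i v - k j v \in <<pc_fs S>>%VS.
  move=> vV; have wV := vec_cv e_dec vV; set w := v - _ in wV.
  have -> : k i v - k j v = k i (vec t (cv e v)) - k j (vec t (cv e v)).
    have vE : v = vec t (cv e v) + w by rewrite /w addrC subrK.
    have kE q : k q v = k q (vec t (cv e v)) + w by rewrite {1}vE GLD (VF_f (Kk q) wV).
    by rewrite !kE; lmod R.
  exact: good_all.
have := ij; rewrite -val_eqE neq_ltn => /orP[lt|lt]; first by exists i, j.
exists j, i; split=> // v vV; rewrite -memvN opprB; exact: fin.
Qed.

(** * Rational hulls and faces *)

From mathcomp Require Import convex interval_inference.
Import numFieldNormedType.Exports.
Import passmx.

Section ConvexCones.
Variables (R : realType) (V : vectType R).
Implicit Types (x y z v w p : V) (C X : set V).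

Lemma convex_setE (W : lmodType R) (A : set W) : convex_set A <->
  forall (x y : W) (t : R), 0 <= t <= 1 -> A x -> A y -> A ((1 - t) *: x + t *: y).
Proof.
split=> [cA x y t /andP[t0 t1] Ax Ay|cA x y t /set_mem Ax /set_mem Ay].
  have := cA y x (Itv01 t0 t1); rewrite !inE => /(_ Ay Ax).
  by rewrite addrC.
apply/mem_set; have := cA y x (t%:num) _ Ay Ax; rewrite addrC; apply.
by rewrite ge0 le1.
Qed.

Lemma hull_convex (W : lmodType R) (Z : set W) : convex_set (convex_hull Z).
Proof.
apply/convex_setE => x y t t01 hx hy A [cA ZA].
by move/convex_setE: (cA); apply => //; [exact: hx|exact: hy].
Qed.

Lemma hull_sub (W : lmodType R) (Z X : set W) :
  (forall (x y : W) (t : R), 0 <= t <= 1 -> X x -> X y -> X ((1 - t) *: x + t *: y)) ->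
  Z `<=` X -> convex_hull Z `<=` X.
Proof. by move=> /convex_setE cX ZX; exact: smallest_sub. Qed.

Lemma hull_gen (W : lmodType R) (Z : set W) : Z `<=` convex_hull Z.
Proof. exact: sub_gen_smallest. Qed.

Lemma coordinatesE (a : R) x y i j :
  coordinates (x + a *: y) i j = coordinates x i j + a * coordinates y i j.
Proof. by rewrite /coordinates !mxE linearD linearZ. Qed.

Lemma ball_coordinates x y (e : R) : ball (coordinates x) e (coordinates y) <->
  0 < e /\ forall i j, `|coordinates x i j - coordinates y i j| < e.
Proof. by []. Qed.

Lemma ball_step x v (e : R) : 0 < e ->
  exists2 d : R, 0 < d & ball (coordinates x) e (coordinates (x + d *: v)).
Proof.
move=> e0; pose s : R := \sum_i \sum_j `|coordinates v i j|.
have s0 : 0 <= s by apply: sumr_ge0 => i _; apply: sumr_ge0.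
have s1 : 0 < s + 1 by rewrite ltr_wpDl.
exists (e / (s + 1)); first by rewrite divr_gt0.
apply/ball_coordinates; split=> // i j; rewrite coordinatesE opprD addrA subrr sub0r normrN.
rewrite normrM gtr0_norm ?divr_gt0 // mulrAC ltr_pdivrMr // ltr_pM2l //.
apply: le_lt_trans (_ : s < _); last by rewrite ltrDl.
rewrite /s (bigD1 i) //= (bigD1 j) //= -addrA lerDl addr_ge0 //.
  exact: sumr_ge0.
by apply: sumr_ge0 => k _; apply: sumr_ge0.
Qed.

Lemma coordinates_inj : injective (@coordinates R V).
Proof. exact: can_inj (rVofK (vbasisP {:V})). Qed.

Lemma openVP C x : openV C -> C x ->
  exists2 e : R, 0 < e & forall y, ball (coordinates x) e (coordinates y) -> C y.
Proof.
move=> oC Cx; have : nbhs (coordinates x) (@coordinates R V @` C).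
  by apply: open_nbhs_nbhs; split=> //; exists x.
move=> /nbhs_ballP[e e0 sub]; exists e => // y /sub[z Cz /coordinates_inj <-] //.
Qed.

Variables (C : set V) (hC : open_nondegenerate_cone C).

Lemma nondegenerate_open_cone : is_open_cone C.
Proof.
have [oC cC nC sC _] := hC; move/convex_setE: cC => cC; split=> //.
  move=> x y Cx Cy.
  have -> : x + y = (2 : R) *: ((1 - 2^-1) *: x + 2^-1 *: y) by lmod_field R.
  by apply: sC; rewrite ?ltr0n //; apply: cC => //; apply/andP; split; lra.
move=> x v Cx; have [e e0 he] := openVP oC Cx.
by have [d d0 hd] := ball_step x v e0; exists d => //; exact: he.
Qed.
Let oc := nondegenerate_open_cone.

Lemma closureV_cone : closureV C = cone_closure C.
Proof.
have [oC _ [c Cc] _ _] := hC; apply/seteqP; split=> x.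
  move=> cx z Cz; have [e e0 he] := openVP oC Cz.
  have [] := cx (ball (coordinates x) e); first exact: nbhsx_ballx.
  move=> _ [[y Cy <-] /ball_coordinates[_ xy]].
  have -> : x + z = y + (z + (x - y)) by lmod R.
  apply: (oc_add oc) => //; apply: he; apply/ball_coordinates; split=> // i j.
  rewrite -[x - y]scale1r coordinatesE mul1r.
  rewrite -[- y]scaleN1r coordinatesE mulN1r.
  by rewrite opprD addrA subrr sub0r normrN.
move=> hx B /nbhs_ballP[e e0 sub].
have [d d0 hd] := ball_step x c e0; exists (coordinates (x + d *: c)); split.
  by exists (x + d *: c) => //; apply: hx; exact: (oc_scale oc).
exact: sub.
Qed.

Lemma nondegenerate_noline p d : (forall t : R, C (p + t *: d)) -> d = 0.
Proof.
have [_ _ _ _ nl] := hC; move=> h; apply/eqP; apply: contrapT => /negP d0.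
by apply: nl; exists p, d.
Qed.

End ConvexCones.

Section ConeSpans.
Variables (R : realType) (V : vectType R).
Implicit Types (x y z : V) (s : seq V).

Lemma cs_sum s (I : Type) (r : seq I) (F : I -> V) :
  (forall i, cone_spanned_by s (F i)) -> cone_spanned_by s (\sum_(i <- r) F i).
Proof.
move=> hF; elim/big_ind: _ => [|x y [a a0 <-] [c c0 <-]|//].
  by exists (fun=> 0) => //; rewrite big1 // => i _; rewrite scale0r.
exists (fun i => a i + c i) => [i|]; first by rewrite addr_ge0 ?a0 ?c0.
by rewrite -big_split; apply: eq_bigr => i _; rewrite scalerDl.
Qed.

Lemma csZ s (t : R) x : 0 <= t -> cone_spanned_by s x -> cone_spanned_by s (t *: x).
Proof.
move=> t0 [a a0 <-]; exists (fun i => t * a i) => [i|]; first by rewrite mulr_ge0 ?a0.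
by rewrite scaler_sumr; apply: eq_bigr => i _; rewrite scalerA.
Qed.

Lemma cs_mem s x : x \in s -> cone_spanned_by s x.
Proof.
move=> xs; have lx : (index x s < size s)%N by rewrite index_mem.
exists (fun i : 'I_(size s) => (i == Ordinal lx)%:R) => [i|]; first by rewrite ler0n.
rewrite (bigD1 (Ordinal lx)) //= eqxx scale1r nth_index // big1 ?addr0 // => i /negbTE ->.
by rewrite scale0r.
Qed.

Lemma cs_sub s s' : (forall x, x \in s -> cone_spanned_by s' x) ->
  cone_spanned_by s `<=` cone_spanned_by s'.
Proof.
move=> h x [a a0 <-]; apply: cs_sum => i; apply: csZ; first exact: a0.
by apply: h; rewrite mem_nth.
Qed.

Lemma csD s x y : cone_spanned_by s x -> cone_spanned_by s y -> cone_spanned_by s (x + y).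
Proof.
move=> hx hy; have := @cs_sum s bool [:: true; false] (fun c => if c then x else y).
by rewrite !big_cons big_nil addr0; apply; case.
Qed.

End ConeSpans.

Section RationalHull.
Variables (R : realType) (V : vectType R) (C : set V) (b : seq V).
Hypotheses (hC : open_nondegenerate_cone C) (hb : basis_of {:V} b).
Local Notation L := (int_span b).
Local Notation Cb := (cone_closure C).
Local Notation X := (rat_hull (rat_span b) C).
Implicit Types (x y z v w p : V).
Let oc := nondegenerate_open_cone hC.

Lemma rat_multiple x : rat_span b x -> exists2 n : nat, (0 < n)%N & L (n%:R *: x).
Proof.
move=> [q _ <-]; pose n := (\prod_i absz (denq (q i)))%N.
have n0 : (0 < n)%N by apply: prodn_gt0 => i; rewrite absz_gt0 denq_neq0.
exists n => //; apply/(latP hb) => i; rewrite crdZ crd_sumE //.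
have dE : (absz (denq (q i)))%:R = (denq (q i))%:~R :> R.
  by rewrite -[in RHS](gtz0_abs (denq_gt0 (q i))).
have d0 : (denq (q i))%:~R != 0 :> R by rewrite intr_eq0 denq_neq0.
rewrite /n (bigD1 i) //= natrM dE /ratr mulrAC mulrCA mulfV // mulr1.
by rewrite rpredM ?natr_int ?intr_int.
Qed.

Lemma lat_rat x : L x -> rat_span b x.
Proof.
move=> [z _ <-]; exists (fun i => (z i)%:~R) => //.
by apply: eq_bigr => i _; rewrite ratr_int.
Qed.

Lemma clo_rat_hull x : Cb x -> rat_span b x -> X x.
Proof. by move=> hx qx; apply: hull_gen; split; rewrite ?closureV_cone. Qed.

Lemma lat_hull x : L x -> Cb x -> X x.
Proof. by move=> /lat_rat qx hx; exact: clo_rat_hull. Qed.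

Lemma hull_comb x y (t : R) : 0 <= t <= 1 -> X x -> X y -> X ((1 - t) *: x + t *: y).
Proof. by move/convex_setE: (@hull_convex R V (closureV C `&` rat_span b)); apply. Qed.

Lemma hull0 : X 0.
Proof. by apply: lat_hull; [exact: (lat0 hb)|exact: clo0]. Qed.

(** Rational points are stable only under rational scalars, so a x is obtained on the segment from 0
    to an integral multiple of x. *)
Lemma hullZ (a : R) x : 0 <= a -> X x -> X (a *: x).
Proof.
move=> a0; move: x; apply: hull_sub => [x y t t01 hx hy|x [hx qx]] /=.
  by rewrite scalerDr !scalerA [a * _]mulrC [a * t]mulrC -!scalerA; exact: hull_comb.
rewrite closureV_cone // in hx.
pose n := (Num.truncn a).+1; have an : a <= n%:R by exact/ltW/truncnS_gt.
have n0 : 0 < n%:R :> R by rewrite ltr0n.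
have -> : a *: x = (1 - a / n%:R) *: 0 + (a / n%:R) *: (n%:R *: x).
  by rewrite scaler0 add0r scalerA divfK // gt_eqF.
apply: hull_comb; first by rewrite divr_ge0 // ?ler_pdivrMr // ?mul1r ?an // ltW.
  exact: hull0.
apply: clo_rat_hull; first by apply: (clo_scale oc) => //; exact: ltW.
have [q _ <-] := qx; exists (fun i => n%:R * q i) => //.
by rewrite scaler_sumr; apply: eq_bigr => i _; rewrite scalerA rmorphM /= ratr_nat.
Qed.

Lemma hullD x y : X x -> X y -> X (x + y).
Proof.
move=> hx hy; have -> : x + y = (1 - 2^-1) *: (2 *: x) + (2^-1 : R) *: (2 *: y) by lmod_field R.
by apply: hull_comb; [apply/andP; split; lra|exact: hullZ|exact: hullZ].
Qed.

Lemma hullP x : X x <-> exists zs, (forall z, z \in zs -> L z /\ Cb z) /\ cone_spanned_by zs x.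
Proof.
split; last first.
  move=> [zs [hzs [a a0 <-]]]; elim/big_ind: _ => [||i _]; [exact: hull0|exact: hullD|].
  have [Lz hz] := hzs zs`_i (mem_nth 0 (ltn_ord i)).
  by apply: hullZ; [exact: a0|exact: lat_hull].
move: x; apply: hull_sub => [x y t /andP[t0 t1] [zs [hzs hx]] [ws [hws hy]]|x [hx qx]] /=.
  exists (zs ++ ws); split=> [z|]; first by rewrite mem_cat => /orP[/hzs|/hws].
  apply: csD; apply: csZ; rewrite ?subr_ge0 //.
    by apply: cs_sub hx => z zz; apply: cs_mem; rewrite mem_cat zz.
  by apply: cs_sub hy => z zz; apply: cs_mem; rewrite mem_cat zz orbT.
rewrite closureV_cone // in hx; have [n n0 Ln] := rat_multiple qx.
exists [:: n%:R *: x]; split=> [z|].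
  by rewrite inE => /eqP ->; split=> //; apply: (clo_scale oc).
have -> : cone_spanned_by [:: n%:R *: x] x = cone_spanned_by [:: n%:R *: x] (n%:R^-1 *: (n%:R *: x)).
  by rewrite [n%:R^-1 *: _]scalerA mulVf ?scale1r // pnatr_eq0 -lt0n.
by apply: csZ; [rewrite invr_ge0|apply: cs_mem; rewrite mem_head].
Qed.

(* A large multiple of a point of [C] lies in a unit cell of the lattice contained in [C]. *)
Lemma cone_hull x : C x -> X x.
Proof.
move=> Cx; have [n hn] := oc_absorb_fam oc (index_enum _) (fun i : 'I_(size b) => b`_i) Cx.
pose N := (n * 2).+1; have N0 : 0 < N%:R :> R by rewrite ltr0n.
pose y := N%:R *: x; pose l := lat_round b y.
have [c0 hc0 yE] := lat_round_err hb y; rewrite -/l in yE.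
have cell (c : 'I_(size b) -> R) : (forall i, 0 <= c i <= 1) -> C (l + \sum_(i < size b) c i *: b`_i).
  move=> hc; have -> : l + \sum_(i < size b) c i *: b`_i = y + \sum_(i < size b) (c i - c0 i) *: b`_i.
    have -> : \sum_(i < size b) (c i - c0 i) *: b`_i = \sum_(i < size b) c i *: b`_i - (y - l).
      by rewrite yE -sumrB; apply: eq_bigr => i _; rewrite scalerBl.
    by lmod R.
  apply: hn => [|i]; first by rewrite ler_nat /N ltnW // ltnS leq_pmulr.
  have /andP[h1 h2] := hc i; have /andP[h3 h4] := hc0 i.
  by rewrite ler_norml; apply/andP; split; lra.
(* A point of the cell is a convex combination of its vertices: the list s contains the coordinates
   not yet equal to 0 or 1, and they are treated one by one. *)
suff Xl (s : seq 'I_(size b)) (c : 'I_(size b) -> R) : (forall i, 0 <= c i <= 1) ->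
    (forall i, i \notin s -> c i = 0 \/ c i = 1) -> X (l + \sum_(i < size b) c i *: b`_i).
  have -> : x = N%:R^-1 *: (l + \sum_(i < size b) c0 i *: b`_i).
    by rewrite -yE addrC subrK scalerA mulVf ?scale1r // gt_eqF.
  apply: hullZ; first by rewrite invr_ge0 ltW.
  by apply: (Xl (index_enum _)) => // i; rewrite mem_index_enum.
elim: s c => [|i s IH] c hc ci.
  apply: lat_hull; last by apply: (oc_sub_closure oc); exact: cell.
  apply: (latD hb); first exact: lat_roundP.
  apply: (lat_sum hb) => i _; apply: (latZ hb); last exact: lat_basis.
  by have [->|->] := ci i isT; rewrite ?rpred0 ?rpred1.
pose upd (v : R) j := if j == i then v else c j.
have -> : l + \sum_(j < size b) c j *: b`_j =
    (1 - c i) *: (l + \sum_(j < size b) upd 0 j *: b`_j) + c i *: (l + \sum_(j < size b) upd 1 j *: b`_j).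
  have -> : \sum_(j < size b) c j *: b`_j =
      (1 - c i) *: (\sum_(j < size b) upd 0 j *: b`_j) + c i *: (\sum_(j < size b) upd 1 j *: b`_j).
    rewrite !scaler_sumr -big_split /=; apply: eq_bigr => j _; rewrite !scalerA -scalerDl /upd.
    by congr (_ *: _); case: eqP => [->|_]; ring.
  by lmod R.
have updP (v : R) : v = 0 \/ v = 1 -> X (l + \sum_(j < size b) upd v j *: b`_j).
  move=> v01; apply: IH => j; rewrite /upd; case: eqP => [_|/eqP ji]; rewrite ?hc //.
    by case: v01 => ->; rewrite ?lexx ler01.
  by move=> js; apply: ci; rewrite inE negb_or ji.
by apply: hull_comb; [exact: hc|apply: updP; left|apply: updP; right].
Qed.

Variable F : set V.
Hypothesis hF : is_face X F.

Lemma face_hull x : F x -> X x. Proof. by have [h _ _ _] := hF; exact: h. Qed.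

Lemma face_cases x y p : X x -> X y -> segment x y p -> F p ->
  segment x y `<=` F \/ p = x \/ p = y.
Proof.
move=> hx hy xyp Fp; have [_ _ _ h] := hF; have [||sub|[e ex eE]] := h x y.
- by move=> q [t /= t01 <-]; exact: hull_comb.
- by exists p.
- by left.
right; have : (segment x y `&` F) p by [].
by rewrite eE => ->; case: ex => ->; [left|right].
Qed.

Lemma segmentP x y (t : R) : 0 <= t <= 1 -> segment x y ((1 - t) *: x + t *: y).
Proof. by move=> t01; exists t. Qed.

Lemma face0Z x (t : R) : F x -> 0 <= t -> F 0 /\ F (t *: x).
Proof.
move=> Fx t0; have hx := face_hull Fx; pose m := t + 2; have m0 : 0 < m by rewrite /m; lra.
have xin : segment 0 (m *: x) x.
  exists m^-1; last by rewrite scaler0 add0r scalerA mulVf ?scale1r // gt_eqF.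
  by rewrite /= invr_ge0 ltW //= invf_le1 //; rewrite /m; lra.
have [|sub|[x0|xE]] := @face_cases 0 (m *: x) x hull0 _ xin Fx.
- by apply: hullZ => //; exact: ltW.
- split; apply: sub.
    by have := @segmentP 0 (m *: x) 0; rewrite scale0r addr0 scaler0; apply; rewrite lexx ler01.
  have := @segmentP 0 (m *: x) (t / m); rewrite scaler0 add0r scalerA divfK ?gt_eqF //; apply.
  by rewrite divr_ge0 //= ?(ltW m0) // ler_pdivrMr // mul1r /m; lra.
- by rewrite x0 scaler0 -x0.
have : (m - 1) *: x = 0 by rewrite scalerBl scale1r -xE subrr.
move/eqP; rewrite scaler_eq0 => /orP[|/eqP x0]; last by rewrite x0 scaler0; rewrite x0 in Fx.
by move=> /eqP h; exfalso; move: h; rewrite /m; lra.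
Qed.

Lemma face0 : F 0.
Proof. by have [_ [x Fx] _ _] := hF; case: (face0Z Fx (lexx 0)). Qed.

Lemma faceZ x (t : R) : 0 <= t -> F x -> F (t *: x).
Proof. by move=> t0 Fx; case: (face0Z Fx t0). Qed.

Lemma faceD x y : F x -> F y -> F (x + y).
Proof.
move=> Fx Fy; have [_ _ /convex_setE cF _] := hF.
have -> : x + y = (2 : R) *: ((1 - 2^-1) *: x + 2^-1 *: y) by lmod_field R.
by apply: faceZ; [rewrite ler0n|apply: cF => //; apply/andP; split; lra].
Qed.

(** x + y is the midpoint of the segment from 2 x to 2 y. If it is an end point of that segment,
    then x = y. *)
Lemma face_split x y : X x -> X y -> F (x + y) -> F x.
Proof.
move=> hx hy Fxy; have m01 : 0 <= (2^-1 : R) <= 1 by apply/andP; split; lra.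
have xyE : (1 - 2^-1) *: (2 *: x) + (2^-1 : R) *: (2 *: y) = x + y by lmod_field R.
have xyin : segment (2 *: x) (2 *: y) (x + y) by rewrite -xyE; exact: segmentP.
have half z : F (2 *: z) -> F z.
  have -> : F z = F ((2^-1 : R) *: (2 *: z)) by rewrite [2^-1 *: _]scalerA mulVf ?scale1r // pnatr_eq0.
  by apply: faceZ; rewrite invr_ge0 ler0n.
have [||sub|[e|e]] := @face_cases (2 *: x) (2 *: y) (x + y) _ _ xyin Fxy; try exact: hullZ.
- apply: half; apply: sub; have := @segmentP (2 *: x) (2 *: y) 0.
  by rewrite subr0 scale1r scale0r addr0; apply; rewrite lexx ler01.
- by apply: half; rewrite -e.
have xy : x = y by apply/(addIr y); rewrite e; lmod R.
by apply: half; have -> : (2 : R) *: x = x + y by [rewrite -xy; lmod R].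
Qed.

Lemma face_sum_split (I : eqType) (r : seq I) (G : I -> V) : (forall i, X (G i)) ->
  F (\sum_(i <- r) G i) -> forall i, i \in r -> F (G i).
Proof.
move=> hG; elim: r => // j r IH; rewrite big_cons => Fs i; rewrite inE => /orP[/eqP ->|].
  apply: face_split Fs => //; elim/big_ind: _ => //; [exact: hull0|exact: hullD].
apply: IH; rewrite addrC in Fs; apply: face_split Fs => //.
by elim/big_ind: _ => //; [exact: hull0|exact: hullD].
Qed.

(** A point of F is a nonnegative combination of lattice points of the closed cone; those with
    nonzero coefficient are in F by [face_split]. So F has a rational span, and it is recovered from
    that span. *)
Lemma face_seq : exists fs, [/\ forall x, x \in fs -> [/\ F x, L x & Cb x],
  <<fs>>%VS = lin_span F & forall x, F x <-> X x /\ x \in <<fs>>%VS].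
Proof.
have [fs [_ hfs fsE]] := lin_span_seq [set x | [/\ F x, L x & Cb x]].
have spanE : <<fs>>%VS = lin_span F.
  have [sF minF] := lin_spanP F; have [sA minA] := lin_spanP [set x | [/\ F x, L x & Cb x]].
  rewrite -fsE; apply/eqP; rewrite eqEsubv; apply/andP; split.
    by apply: minA => x [Fx _ _]; exact: sF.
  apply: minF => x Fx; have [zs [hzs [a a0 xE]]] := (hullP x).1 (face_hull Fx).
  have Xz (i : 'I_(size zs)) : X zs`_i.
    by have [Lz hz] := hzs zs`_i (mem_nth 0 (ltn_ord i)); exact: lat_hull.
  rewrite -xE; apply: memv_suml => i _.
  have [->|ai] := eqVneq (a i) 0; first by rewrite scale0r mem0v.
  apply: memvZ; apply: sA; have [Lz hz] := hzs zs`_i (mem_nth 0 (ltn_ord i)); split=> //.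
  have : F (a i *: zs`_i).
    apply: (@face_sum_split _ (index_enum _) (fun i : 'I_(size zs) => a i *: zs`_i)).
    - by move=> j; apply: hullZ => //; exact: a0.
    - by rewrite xE.
    - by rewrite mem_index_enum.
  move/(faceZ (t := (a i)^-1)); rewrite invr_ge0 => /(_ (a0 i)).
  by rewrite scalerA mulVf // scale1r.
exists fs; split=> // x; split=> [Fx|[hx]].
  by split; [exact: face_hull|rewrite spanE; exact: (lin_spanP F).1].
move=> /(coord_span (X := in_tuple fs)); set c := coord _ => xE.
pose n := \sum_i `|c i x|.
(* The second summand is chosen so that the total is n times the sum of the fs, a point of F. *)
apply: (@face_split x (\sum_(i < size fs) (n - c i x) *: fs`_i)) => //.
  elim/big_ind: _ => [||i _]; [exact: hull0|exact: hullD|].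
  have [Fi _ _] := hfs fs`_i (mem_nth 0 (ltn_ord i)); apply: hullZ; last exact: face_hull.
  rewrite subr_ge0 (le_trans (ler_norm _)) // /n (bigD1 i) //= lerDl sumr_ge0 //.
rewrite {1}xE -big_split /=.
elim/big_ind: _ => [||i _]; [exact: face0|exact: faceD|].
have [Fi _ _] := hfs fs`_i (mem_nth 0 (ltn_ord i)).
rewrite -scalerDl addrC subrK; apply: faceZ => //; exact: sumr_ge0.
Qed.

End RationalHull.

Lemma face_polycone (R : realType) (V : vectType R) (VQ C : set V) (Gam : set (GL V)) (F : set V) :
  polyhedral_triple VQ C Gam -> is_face (rat_hull VQ C) F -> exists S : polycone V,
  [/\ pc_C S = C, pc_G S = Gam, VQ = rat_span (pc_b S), <<pc_fs S>>%VS = lin_span F &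
    forall x, F x <-> rat_hull VQ C x /\ x \in <<pc_fs S>>%VS].
Proof.
move=> [_ hC GG GC [L [b [hb VQE] ->] GL_] [P [[s ->] PX GPX]]] hF.
rewrite {}VQE in PX GPX hF *; have oc := nondegenerate_open_cone hC.
have [fs [hfs fsE FP]] := face_seq hC hb hF.
have [zs [hzs szs]] : exists zs, (forall z, z \in zs -> int_span b z /\ cone_closure C z) /\
    forall x, x \in s -> cone_spanned_by zs x.
  have sX x : x \in s -> rat_hull (rat_span b) C x by move=> xs; apply: PX; exact: cs_mem.
  elim: s sX {PX GPX} => [|x s IH] sX; first by exists [::].
  have [|zs [hzs szs]] := IH; first by move=> y ys; apply: sX; rewrite inE ys orbT.
  have [ws [hws xws]] := (hullP hC hb x).1 (sX x (mem_head _ _)).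
  exists (ws ++ zs); split=> [z|y]; first by rewrite mem_cat => /orP[/hws|/hzs].
  rewrite inE => /orP[/eqP ->|ys].
    by apply: cs_sub xws => z zin; apply: cs_mem; rewrite mem_cat zin.
  by apply: cs_sub (szs y ys) => z zin; apply: cs_mem; rewrite mem_cat zin orbT.
(* Zero generators are dropped because [lattice_cover] uses that all translates of generators have
   height at least 1. *)
pose ws := [seq z <- zs | z != 0].
have zws x : cone_spanned_by zs x -> cone_spanned_by ws x.
  apply: cs_sub => z zin; have [->|z0] := eqVneq z 0.
    by have := @cs_sum R V ws void [::] (fun _ => 0); rewrite big_nil; apply; case.
  by apply: cs_mem; rewrite mem_filter z0.
have wsP (i : 'I_(size ws)) : [/\ int_span b ws`_i, cone_closure C ws`_i & ws`_i <> 0].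
  have : ws`_i \in ws by rewrite mem_nth.
  by rewrite mem_filter => /andP[/eqP z0 /hzs[]].
have lineality v : v \in 0%VS <-> forall x (t : R), C x -> C (x + t *: v).
  rewrite memv0; split=> [/eqP -> x t Cx|h]; first by rewrite scaler0 addr0.
  have [x Cx] := oc_ne oc; apply/eqP; apply: (nondegenerate_noline hC (p := x)) => t.
  exact: h.
(* C contains no line, so its lineality space is 0 and the integral forms obtained have trivial
   common kernel. *)
have [||xis [xis_int xis_dual xis_ker]] := rational_dual hb oc lineality (s := [::]) => //.
  by rewrite span_nil.
unshelve eexists (@PolyCone R V b C Gam (size ws) (fun i => ws`_i) xis fs hb oc
  (nondegenerate_noline hC) GG _ _ _ _ _ _ xis_int xis_dual _ _ _ _).
- by move=> g Gg x Cx; rewrite -(GC g Gg); exists x.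
- by move=> g Gg x Lx; rewrite -(GL_ g Gg); exists x.
- by move=> i; case: (wsP i).
- by move=> i; case: (wsP i).
- by move=> i; case: (wsP i).
- move=> p hp Lp; have := lat_hull hC Lp hp; rewrite -GPX => -[g Gg [x xs <-]].
  exists g => //; have [a a0 <-] := zws _ (cs_sub szs xs).
  by exists a.
- by move=> v h; apply/eqP; rewrite -memv0; apply/xis_ker.
- by move=> x /hfs[].
- by move=> x /hfs[].
- move=> x y Lx hx Ly hy xyV.
  have Xx := lat_hull hC Lx hx; have Xy := lat_hull hC Ly hy.
  have : F (x + y) by apply/FP; split=> //; exact: (hullD hC hb).
  by move=> /(face_split hC hb hF Xx Xy) /FP[].
by split.
Qed.

(** * Cosets, and the dictionary between a face and its lattice cone *)

Section Cosets.
Variable gT : groupType.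
Implicit Types (Z N : set gT) (g h : gT).

Lemma left_coset_eq Z g h : is_subgroup Z -> left_coset g Z = left_coset h Z <-> Z (h^-1 * g)%g.
Proof.
move=> [Z1 ZM ZV]; split=> [e|hg].
  have : left_coset g Z g by exists 1%g => //; rewrite mulg1.
  by rewrite e => -[z Zz <-]; rewrite mulKg.
apply/seteqP; split=> _ [z Zz <-].
  by exists (h^-1 * g * z)%g; [exact: ZM|rewrite !mulgA mulgV mul1g].
exists ((h^-1 * g)^-1 * z)%g; first by apply: ZM => //; exact: ZV.
by rewrite invgM invgK !mulgA mulgV mul1g.
Qed.

Lemma left_coset_mul Z g h : is_subgroup Z -> (forall z, Z z -> Z (h^-1 * z * h)%g) ->
  set_mulg (left_coset g Z) (left_coset h Z) = left_coset (g * h)%g Z.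
Proof.
move=> [Z1 ZM ZV] ZJ; apply/seteqP; split.
  move=> _ [_ [z Zz <-] [_ [z' Zz' <-] <-]]; exists (h^-1 * z * h * z')%g; first by apply: ZM; auto.
  by rewrite !mulgA mulgK.
move=> _ [z Zz <-]; exists g; first by exists 1%g => //; rewrite mulg1.
by exists (h * z)%g; [exists z|rewrite mulgA].
Qed.

End Cosets.

Section FaceInterface.
Variables (R : realType) (V : vectType R) (S : polycone V) (F : set V).
Local Notation b := (pc_b S).
Local Notation hb := (pc_basis S).
Local Notation C := (pc_C S).
Local Notation G := (pc_G S).
Local Notation VF := <<pc_fs S>>%VS.
Local Notation VQ := (rat_span b).
Local Notation X := (rat_hull VQ C).
Local Notation O := (Oc S).
Implicit Types (x y z v w : V) (g h u : GL V) (xi : 'Hom(V, R^o)).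

Hypotheses (VFE : VF = lin_span F) (FP : forall x, F x <-> X x /\ x \in VF).
Local Notation Fd := (face_dual VQ C F).

Lemma F_VF x : F x -> x \in VF. Proof. by case/FP. Qed.

Lemma GL_rat g x : G g -> VQ x -> VQ (g x).
Proof.
move=> Gg /(rat_multiple hb)[n n0 Lx].
have nR : n%:R != 0 :> R by rewrite pnatr_eq0 -lt0n.
have [z _ zE] := pc_GL Gg Lx; exists (fun i => (z i)%:~R / n%:R) => //.
have -> : g x = n%:R^-1 *: g (n%:R *: x) by rewrite GLZ scalerA mulVf // scale1r.
rewrite -zE scaler_sumr; apply: eq_bigr => i _.
by rewrite scalerA rmorphM fmorphV /= ratr_int ratr_nat mulrC.
Qed.

Lemma contragredientE g xi x : contragredient g xi x = xi (GL_fun g^-1%g x).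
Proof. by rewrite /contragredient comp_lfunE. Qed.

Lemma dual_hull_ge0 xi : dual_rat_hull VQ C xi -> forall x, C x -> 0 <= (xi x : R).
Proof.
apply: (hull_sub (X := [set xi : 'Hom(V, R^o) | forall x, C x -> 0 <= (xi x : R)])).
  move=> xi1 xi2 t /andP[t0 t1] h1 h2 x Cx /=.
  rewrite add_lfunE !scale_lfunE; apply: addr_ge0; apply: mulr_ge0; rewrite ?subr_ge0 //.
    exact: h1.
  exact: h2.
by move=> xi' [h _].
Qed.

Lemma face_dual_O xi : Fd xi -> forall w, w \in VF -> xi w = 0 :> R.
Proof.
move=> [_ h] w; rewrite VFE => wV.
have : w \in lker xi.
  by apply: subvP wV; apply: (lin_spanP F).2 => x Fx /=; rewrite memv_ker h.
by rewrite memv_ker => /eqP.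
Qed.

(** The forms given by [Vu_forms] belong to F^dagger. Conversely a form of F^dagger vanishes on V_F,
    hence is nonnegative on O, hence vanishes on the lineality space. *)
Lemma V_upperE : V_upper VQ C F = Vu S.
Proof.
have [ths [ths_int ths_dual ths_ker]] := Vu_forms S.
apply/vspaceP => v; apply/idP/idP => [/common_zerosP h|vV].
  apply/ths_ker => th hth; apply: h; split; last first.
    by move=> x Fx; apply: (ths_ker x).1 hth; apply: VF_Vu; exact: F_VF.
  apply: hull_gen; split=> [x Cx|x Qx]; first by apply: (ths_dual th hth); exact: C_sub_O.
  have [n n0 Lx] := rat_multiple hb Qx.
  have nR : n%:R != 0 :> R by rewrite pnatr_eq0 -lt0n.
  have := ths_int th hth _ Lx; rewrite homZ => /intrP[z zE].
  exists (z%:~R / n%:R); rewrite rmorphM fmorphV /= ratr_int ratr_nat -zE.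
  by rewrite mulrC mulKf.
apply/common_zerosP => xi hxi; have [x0 Cx0] := oc_ne (pc_open S).
have Oge y : O y -> 0 <= (xi y : R).
  move=> [w wV Cyw]; have := dual_hull_ge0 hxi.1 Cyw.
  by rewrite homD (face_dual_O hxi wV) addr0.
have line (t : R) : 0 <= (xi x0 + t * xi v : R).
  by rewrite -homZ -homD; apply: Oge; apply: O_Vu; [rewrite memvZ|exact: C_sub_O].
pose a : R := xi v; pose c : R := xi x0; rewrite -[xi v]/a.
have {}line (t : R) : 0 <= c + t * a by exact: line.
apply/eqP; apply: contrapT => /negP a0.
have := line (- (c + 1) / a); rewrite divfK //; lra.
Qed.

Lemma fixatorF : fixator (@GL_fun R V) G F = Zf S.
Proof.
apply/seteqP; split=> g [Gg h]; split=> //.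
  move=> w; rewrite VFE; have [s [_ sF ->]] := lin_span_seq F => wV.
  have := @GL_span _ _ g 1%g s _ w wV; rewrite GL1; apply => x /sF Fx.
  by rewrite GL1 h.
by move=> x Fx; apply: h; exact: F_VF.
Qed.

(** g fixes all xi in F^dagger if and only if they vanish on all g v - v, that is, if these vectors
    lie in V^F. *)
Lemma fixatorD : fixator (@contragredient R V) G Fd = Wu S.
Proof.
apply/seteqP; split=> g [Gg h]; split=> //.
  move=> v; rewrite -V_upperE; apply/common_zerosP => xi hxi.
  have := h xi hxi; move/(congr1 (fun l : 'Hom(V, R^o) => l (GL_fun g v) : R)).
  by rewrite contragredientE GLK homB => ->; rewrite subrr.
move=> xi hxi; apply/lfunP => v; rewrite contragredientE.
have [Gg' h'] := WuV (conj Gg h).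
have := h' v; rewrite -V_upperE => /common_zerosP/(_ xi hxi) /eqP.
by rewrite homB subr_eq0 => /eqP.
Qed.

Lemma stabD_Hu g : stabilizer (@contragredient R V) G Fd g -> Hu S g.
Proof.
move=> [Gg gE]; split=> // v; rewrite -V_upperE => /common_zerosP h.
apply/common_zerosP => xi; rewrite -gE => -[xi' hxi' <-].
by rewrite contragredientE GLK; exact: h.
Qed.

Lemma N_VF g w : N_face G F g -> w \in VF -> g w \in VF.
Proof.
move=> [Gg gF]; have [s [_ sF sE]] := lin_span_seq F; rewrite VFE sE.
move: w; apply: GL_span_stable => x xs; rewrite -sE; apply: (lin_spanP F).1.
by rewrite -gF; exists x => //; exact: sF.
Qed.

Lemma stabilizer_group (T : Type) (act : GL V -> T -> T) (Y : set T) :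
  act 1%g =1 id -> (forall g h (x : T), act (g * h)%g x = act g (act h x)) ->
  is_subgroup (stabilizer act G Y).
Proof.
move=> a1 aM; split.
- split; first exact: G1.
  by apply/seteqP; split=> [_ [x Yx <-]|x Yx]; [rewrite a1|exists x; rewrite ?a1].
- move=> g h [Gg gY] [Gh hY]; split; first exact: GM.
  apply/seteqP; split=> [_ [x Yx <-]|x Yx].
    by rewrite aM -gY; exists (act h x) => //; rewrite -hY; exists x.
  rewrite -gY in Yx; have [y Yy <-] := Yx; rewrite -hY in Yy; have [z Yz <-] := Yy.
  by exists z; rewrite ?aM.
move=> g [Gg gY]; split; first exact: GV.
apply/seteqP; split=> [_ [x Yx <-]|x Yx].
  rewrite -gY in Yx; have [y Yy <-] := Yx.
  by rewrite -aM mulVg a1.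
exists (act g x); first by rewrite -gY; exists x.
by rewrite -aM mulVg a1.
Qed.

Lemma N_group : is_subgroup (N_face G F).
Proof. by apply: stabilizer_group => [x|g h x]; rewrite ?GL1 ?GLM. Qed.

Lemma N_stabD g : N_face G F g -> stabilizer (@contragredient R V) G Fd g.
Proof.
have sub h : N_face G F h -> forall xi, Fd xi -> Fd (contragredient h xi).
  move=> Nh; have [_ _ /(_ h Nh) [Gh' hF']] := N_group; have [Gh _] := Nh.
  move=> xi [hxi vxi]; split; last first.
    by move=> x Fx; rewrite contragredientE; apply: vxi; rewrite -hF'; exists x.
  move: xi hxi {vxi}; apply: (hull_sub (X := [set xi | dual_rat_hull VQ C (contragredient h xi)])).
    move=> xi1 xi2 t t01 h1 h2 /=.
    have -> : contragredient h ((1 - t) *: xi1 + t *: xi2) =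
        (1 - t) *: contragredient h xi1 + t *: contragredient h xi2.
      by apply/lfunP => x; rewrite add_lfunE !scale_lfunE !contragredientE add_lfunE !scale_lfunE.
    by move/convex_setE: (@hull_convex R 'Hom(V, R^o) (dual_cone C `&` dual_rat VQ)); apply.
  move=> xi [h1 h2] /=; apply: hull_gen; split=> x hx; rewrite contragredientE.
    by apply: h1; exact: pc_GC.
  by apply: h2; exact: GL_rat.
move=> Ng; have [_ _ /(_ g Ng) Ng'] := N_group; have [Gg _] := Ng; split=> //.
apply/seteqP; split=> [_ [xi hxi <-]|xi hxi]; first exact: sub.
exists (contragredient g^-1%g xi); first exact: sub.
by apply/lfunP => x; rewrite !contragredientE invgK GLKV.
Qed.

Lemma Zf_N g : Zf S g -> N_face G F g.
Proof.
move=> [Gg h]; split=> //; apply/seteqP; split=> [_ [x Fx <-]|x Fx].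
  by rewrite h //; exact: F_VF.
by exists x => //; rewrite h //; exact: F_VF.
Qed.

Lemma Zf_group : is_subgroup (Zf S).
Proof.
split; [split=> [|w _]; [exact: G1|by rewrite GL1]|exact: ZfM|exact: ZfV].
Qed.

Lemma Wu_group : is_subgroup (Wu S).
Proof.
split; [split=> [|v]; [exact: G1|by rewrite GL1 subrr mem0v]|exact: WuM|exact: WuV].
Qed.

Lemma face_kerE : face_ker VQ C G F = Kf S.
Proof.
rewrite /face_ker /face_hom fixatorF fixatorD; apply/seteqP; split=> g.
  move=> [_ [/(left_coset_eq _ _ Zf_group) hz /(left_coset_eq _ _ Wu_group) hw]].
  by move: hz hw; rewrite invg1 mul1g.
move=> [Wg Zg]; split; first exact: Zf_N.
by congr pair; [apply/(left_coset_eq _ _ Zf_group)|apply/(left_coset_eq _ _ Wu_group)];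
  rewrite invg1 mul1g.
Qed.

Lemma U_faceE u : U_face VQ C G F u <-> Kf S u /\ forall v, v \in Vu S -> u v - v \in VF.
Proof.
rewrite /U_face face_kerE V_upperE; split=> -[Ku h]; split=> // v vV.
  by rewrite VFE; apply/(quot_mapP (V_lower F)); exact: h.
by apply/quot_mapP; rewrite /V_lower -VFE; exact: h.
Qed.

End FaceInterface.

(** * Finite index of the image of the stabilizer of F *)

Section FaceIndex.
Variables (R : realType) (V : vectType R) (S : polycone V) (F : set V).
Local Notation b := (pc_b S).
Local Notation C := (pc_C S).
Local Notation G := (pc_G S).
Local Notation VF := <<pc_fs S>>%VS.
Local Notation VQ := (rat_span b).
Local Notation X := (rat_hull VQ C).
Local Notation N := (N_face G F).
Implicit Types (g h n c : GL V).

Hypotheses (VFE : VF = lin_span F) (FP : forall x, F x <-> X x /\ x \in VF).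
Local Notation Ng := (N_group S F).

Lemma face_homE g : face_hom VQ C G F g = (left_coset g (Zf S), left_coset g (Wu S)).
Proof. by rewrite /face_hom (fixatorF VFE FP) (fixatorD VFE FP). Qed.

Lemma Zf_conj n g : N n -> Zf S g -> Zf S (n^-1 * g * n)%g.
Proof.
move=> Nn [Gg h]; have [Gn _] := Nn; split; first by apply: GM => //; apply: GM => //; exact: GV.
by move=> w wV; rewrite !GLM h ?GLK //; exact: (N_VF VFE Nn).
Qed.

Lemma N_Hu n : N n -> Hu S n.
Proof. by move=> Nn; apply: (stabD_Hu VFE FP); exact: N_stabD. Qed.

Lemma Wu_conj n g : Hu S n -> Wu S g -> Wu S (n^-1 * g * n)%g.
Proof. by move=> Hn Wg; have := WuJ (HuV Hn) Wg; rewrite invgK. Qed.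

(* The translate of the image of [N_face] by [(a Zf, b' Wu)] only depends on [c = b' a^-1],
   and not on the class of [c] modulo [Wu Zf]. *)
Let T c : set (set (GL V) * set (GL V)) :=
  [set p | exists2 n, N n & p = (left_coset n (Zf S), left_coset (c * n)%g (Wu S))].

Lemma translate_sub c c' : (exists w z, [/\ Wu S w, Zf S z & c' = (c * (w * z))%g]) ->
  T c' `<=` T c.
Proof.
move=> [w [z [Ww Zz ->]]] p [n Nn ->].
have Nz : N z by exact: (Zf_N FP).
have [_ NM NV] := Ng; have Nzn : N (z * n)%g by exact: NM.
exists (z * n)%g => //; congr pair; first apply/(left_coset_eq _ _ (Zf_group S)).
  rewrite invgM -mulgA; have := Zf_conj Nn (ZfV Zz).
  by rewrite -mulgA.
apply/(left_coset_eq _ _ (Wu_group S)).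
have := Wu_conj (N_Hu Nzn) Ww.
by have -> : ((c * (z * n))^-1 * (c * (w * z) * n) = (z * n)^-1 * w * (z * n))%g;
  [rewrite invgM !mulgA mulgVK|].
Qed.

Lemma face_image_index : finite_index (prod_law (@set_mulg (GL V)) (@set_mulg (GL V)))
  (face_hom VQ C G F @` N) (Gam_face G F `*` Gam_face_dual VQ C G F).
Proof.
have [N1 NM NV] := Ng.
split.
  move=> _ [g Nn <-]; split; first by exists g.
  by exists g => //; exact: N_stabD.
have [ths [ths_int ths_dual ths_ker]] := Vu_forms S.
have [k [x [Hx cover]]] := finite_cover
  (P := Hu S) (E := fun c c' => exists w z : GL V, [/\ Wu S w, Zf S z & (c^-1 * c' = w * z)%g])
  (face_product_index ths_int ths_dual ths_ker).
apply: (@sub_finite_set _ _ [set T (x i) | i in [set: 'I_k]]); last first.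
  by apply: finite_image; exact: finite_finset.
move=> _ [[p1 p2] [[/= a Na <-] [/= d Sd <-]] <-].
have Hd := stabD_Hu VFE FP Sd; have Ha := N_Hu Na.
have Hc : Hu S (d * a^-1)%g by apply: HuM => //; exact: HuV.
have [i [w [z [Ww Zz cE]]]] := cover _ Hc; exists i => //.
have cE' : (d * a^-1 = x i * (w * z))%g by rewrite -cE mulVKg.
transitivity (T (d * a^-1)%g).
  apply/seteqP; split; last by apply: translate_sub; exists w, z.
  apply: translate_sub; exists (z^-1 * w^-1 * z)%g, z^-1%g; split.
  - apply: Wu_conj; last exact: WuV.
    by apply: N_Hu; exact: (Zf_N FP).
  - exact: ZfV.
  by rewrite cE' !mulgA !mulgK.
rewrite (fixatorF VFE FP) (fixatorD VFE FP); apply/seteqP; split.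
  move=> _ [n Nn ->]; exists (face_hom VQ C G F (a^-1 * n)%g).
    by exists (a^-1 * n)%g => //; apply: NM => //; exact: NV.
  have Nan : N (a^-1 * n)%g by apply: NM => //; exact: NV.
  rewrite face_homE /prod_law /= !left_coset_mul.
  - by rewrite mulVKg mulgA.
  - exact: Wu_group.
  - by move=> g; apply: Wu_conj; exact: N_Hu.
  - exact: Zf_group.
  - by move=> g; exact: Zf_conj.
move=> _ [_ [n Nn <-] <-]; exists (a * n)%g; first exact: NM.
rewrite face_homE /prod_law /= !left_coset_mul.
- by rewrite -!mulgA mulKg.
- exact: Wu_group.
- by move=> g; apply: Wu_conj; exact: N_Hu.
- exact: Zf_group.
- by move=> g; exact: Zf_conj.
Qed.

End FaceIndex.

(** * Free abelian groups of unipotent elements *)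

(** Induction on a list of coordinates separating the points of A. The elements with vanishing k-th
    coordinate form a smaller instance, and an element with least positive k-th coordinate completes
    their basis by Euclidean division. *)
Lemma int_subgroup_basis (I : finType) (A : set {ffun I -> int}) :
  A 0 -> (forall x y, A x -> A y -> A (x + y)) -> (forall x, A x -> A (- x)) ->
  exists (r : nat) (e : 'I_r -> {ffun I -> int}), [/\ forall i, A (e i),
    forall x, A x -> exists c : 'I_r -> int, x = \sum_i e i *~ c i &
    forall c : 'I_r -> int, \sum_i e i *~ c i = 0 -> forall i, c i = 0].
Proof.
have MzE (x : {ffun I -> int}) n i : (x *~ n) i = x i * n.
  have ev m : (x *+ m) i = x i *+ m by elim: m => [|m IHm]; rewrite ?mulr0n ?mulrS ffunE ?IHm.
  by rewrite -mulrzz; case: n => n; rewrite ?NegzE ?mulrNz ?ffunE -!pmulrn ev.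
suff gen (s : seq I) : forall A' : set {ffun I -> int},
    A' 0 -> (forall x y, A' x -> A' y -> A' (x + y)) -> (forall x, A' x -> A' (- x)) ->
    (forall x, A' x -> (forall i, i \in s -> x i = 0) -> x = 0) ->
    exists (r : nat) (e : 'I_r -> {ffun I -> int}), [/\ forall i, A' (e i),
    forall x, A' x -> exists c : 'I_r -> int, x = \sum_i e i *~ c i &
    forall c : 'I_r -> int, \sum_i e i *~ c i = 0 -> forall i, c i = 0].
  move=> A0 AD AN; apply: (gen (enum I)) => // x _ h; apply/ffunP => i; rewrite h ?ffunE //.
  by rewrite mem_enum.
elim: s => [|k s IH] {A}A A0 AD AN Asep.
  exists 0%N, (fun i => 0); split=> [i|x Ax|c _ []//]; first by [].
  by exists (fun=> 0); rewrite big_ord0; apply: Asep.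
have AMz x n : A x -> A (x *~ n).
  move=> Ax; have Am m : A (x *+ m) by elim: m => [|m h]; rewrite ?mulr0n // mulrS; exact: AD.
  by case: n => n; [exact: Am|rewrite NegzE mulrNz; apply: AN; exact: Am].
have [||||r [e [eA eG ef]]] := IH [set x | A x /\ x k = 0].
- by rewrite /= ffunE.
- by move=> x y [Ax xk] [Ay yk]; split; [exact: AD|rewrite ffunE xk yk addr0].
- by move=> x [Ax xk]; split; [exact: AN|rewrite ffunE xk oppr0].
- move=> x [Ax xk] xs; apply: Asep => // i; rewrite inE => /orP[/eqP -> //|]; exact: xs.
have [[x0 [Ax0 x0k]]|all0] := pselect (exists x, A x /\ x k != 0); last first.
  exists r, e; split=> [i|x Ax|//]; first by case: (eA i).
  apply: eG; split=> //; apply/eqP; apply: contrapT => /negP xk; apply: all0; by exists x.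
pose P (n : nat) := `[< exists x, A x /\ x k = n.+1%:Z >].
have exP : exists n, P n.
  exists (absz (x0 k)).-1; apply/asboolP; rewrite prednK ?absz_gt0 //.
  have [x0p|x0n] := leP 0 (x0 k); first by exists x0; split=> //; rewrite gez0_abs.
  by exists (- x0); split; [exact: AN|rewrite ffunE ltz0_abs].
have [n /asboolP[a [Aa ak]] nmin] := ex_minnP exP.
have adiv x : A x -> (x k %% a k)%Z = 0.
  move=> Ax; apply/eqP; apply: contrapT => /negP m0.
  have Ay : A (x - a *~ (x k %/ a k)%Z) by apply: AD => //; apply/AN/AMz.
  have yk : (x - a *~ (x k %/ a k)%Z) k = (x k %% a k)%Z.
    by rewrite !ffunE MzE mulrC {1}(divz_eq (x k) (a k)) addrC addKr.
  have ap : 0 < a k by rewrite ak.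
  have m1 : 0 <= (x k %% a k)%Z by apply: modz_ge0; rewrite gt_eqF.
  have m2 : (x k %% a k)%Z < a k by apply: ltz_pmod.
  have mg : (0 < absz (x k %% a k)%Z)%N by rewrite absz_gt0.
  have Pm : P (absz (x k %% a k)%Z).-1.
    apply/asboolP; exists (x - a *~ (x k %/ a k)%Z); split=> //.
    by rewrite yk prednK // gez0_abs.
  have := nmin _ Pm; move: m1 m2 mg; rewrite ak; move: (x k %% _)%Z => m; clear; lia.
pose e' (i : 'I_r.+1) := oapp e a (unlift ord0 i).
have e'0 : e' ord0 = a by rewrite /e' unlift_none.
have e'S i : e' (lift ord0 i) = e i by rewrite /e' liftK.
exists r.+1, e'; split.
- by move=> i; have [j ->|->] := unliftP ord0 i; rewrite ?e'0 ?e'S //; case: (eA j).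
- move=> x Ax; have [|c cE] := eG (x - a *~ (x k %/ a k)%Z).
    split; first by apply: AD => //; apply/AN/AMz.
    by rewrite !ffunE MzE mulrC {1}(divz_eq (x k) (a k)) adiv // addr0 subrr.
  exists (fun i => oapp c (x k %/ a k)%Z (unlift ord0 i)).
  rewrite big_ord_recl e'0 unlift_none /=.
  under eq_bigr => i _ do rewrite e'S liftK /=.
  by rewrite -cE addrC subrK.
move=> c; rewrite big_ord_recl e'0; under eq_bigr => i _ do rewrite e'S.
move=> h; have c0 : c ord0 = 0.
  have := congr1 (fun x : {ffun I -> int} => x k) h; rewrite !ffunE MzE sum_ffunE.
  rewrite big1 => [|i _]; last by rewrite MzE; case: (eA i) => _ ->; rewrite mul0r.
  by rewrite addr0 => /eqP; rewrite mulf_eq0 ak => /orP[//|/eqP].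
move=> i; have [j ->|-> //] := unliftP ord0 i.
by move: h; rewrite c0 mulr0z add0r => /(ef (fun j => c (lift ord0 j))).
Qed.

Lemma free_abelian_int (gT : groupType) (G : set gT) (I : finType) (psi : gT -> {ffun I -> int}) :
  is_subgroup G -> (forall u v, G u -> G v -> psi (u * v)%g = psi u + psi v) ->
  (forall u v, G u -> G v -> psi u = psi v -> u = v) -> is_free_abelian G.
Proof.
move=> [G1 GM GV] psiM psiI.
have psi1 : psi 1%g = 0 by apply: (addrI (psi 1%g)); rewrite -psiM // mulg1 addr0.
have psiV u : G u -> psi u^-1%g = - psi u.
  by move=> Gu; apply: (addrI (psi u)); rewrite -psiM ?mulgV ?psi1 ?subrr //; exact: GV.
pose A := psi @` G.
have A0 : A 0 by exists 1%g.
have AD x y : A x -> A y -> A (x + y).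
  by move=> [u Gu <-] [v Gv <-]; exists (u * v)%g; [exact: GM|exact: psiM].
have AN x : A x -> A (- x) by move=> [u Gu <-]; exists u^-1%g; [exact: GV|exact: psiV].
have [r [e [eA eG ef]]] := int_subgroup_basis A0 AD AN.
have AMz x n : A x -> A (x *~ n).
  move=> Ax; have Am m : A (x *+ m) by elim: m => [|m h]; rewrite ?mulr0n // mulrS; exact: AD.
  by case: n => n; [exact: Am|rewrite NegzE mulrNz; apply: AN; exact: Am].
have /choice[f hf] : forall x : {freeg 'I_r / int}, exists u, G u /\ psi u = \sum_i e i *~ coeff i x.
  move=> x; suff [u Gu uE] : A (\sum_i e i *~ coeff i x) by exists u.
  by elim/big_ind: _ => // i _; apply: AMz.
exists 'I_r, f; split.
  move=> x y; have [Gx xE] := hf x; have [Gy yE] := hf y; have [Gxy xyE] := hf (x + y).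
  apply: psiI => //; first exact: GM.
  by rewrite psiM // xE yE xyE -big_split; apply: eq_bigr => i _; rewrite coeffD mulrzDr.
split.
- by move=> x _; case: (hf x).
- move=> x y _ _ xy; have [_ xE] := hf x; have [_ yE] := hf y.
  have : \sum_i e i *~ (coeff i x - coeff i y) = 0.
    under eq_bigr do rewrite mulrzBr; rewrite sumrB -xE -yE xy subrr //.
  move=> /(ef (fun i => coeff i x - coeff i y)) h; apply/eqP/freeg_eqP => i.
  by apply/eqP; rewrite -subr_eq0 h.
move=> u Gu; have [c cE] := eG _ (ex_intro2 _ _ u Gu erefl).
exists (\sum_i << c i *g i >>) => //; have [Gx xE] := hf (\sum_i << c i *g i >>).
apply: psiI => //; rewrite xE cE; apply: eq_bigr => i _; congr (_ *~ _).
rewrite raddf_sum /= (bigD1 i) //= coeffU eqxx mulr1 big1 ?addr0 // => j ji.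
by rewrite coeffU (negbTE ji) mulr0.
Qed.

Section UnipotentGroup.
Variables (R : realType) (V : vectType R) (S : polycone V).
Local Notation b := (pc_b S).
Local Notation hb := (pc_basis S).
Local Notation L := (int_span b).
Local Notation C := (pc_C S).
Local Notation hC := (pc_open S).
Local Notation G := (pc_G S).
Local Notation VF := <<pc_fs S>>%VS.
Local Notation Vu := (Vu S).
Implicit Types (x y z v w : V) (g h u : GL V).

Definition Ug : set (GL V) := [set u | Kf S u /\ forall v, v \in Vu -> u v - v \in VF].

Lemma Ug_G u : Ug u -> G u. Proof. by move=> [/Kf_G]. Qed.

Lemma Ug_group : is_subgroup Ug.
Proof.
split.
- by split=> [|v _]; [exact: Kf1|rewrite GL1 subrr mem0v].
- move=> g h [Kg hg] [Kh hh]; split=> [|v vV]; first exact: KfM.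
  have -> : GL_fun (g * h)%g v - v =
      (GL_fun g (GL_fun h v - v) - (GL_fun h v - v)) + (GL_fun h v - v) + (GL_fun g v - v).
    by rewrite GLM GLB; lmod R.
  apply: memvD; last exact: hg.
  by apply: memvD; [apply: hg; apply: VF_Vu|]; exact: hh.
move=> g [Kg hg]; split=> [|v vV]; first exact: KfV.
have KV := KfV Kg; have gV : GL_fun g^-1%g v \in Vu by apply: Gf_Vu => //; exact: Kf_Gf.
by have := hg _ gV; rewrite GLKV -memvN opprB.
Qed.

Lemma Ug_index : finite_index ( *%g ) Ug (Kf S).
Proof.
split=> [u []//|].
have [n [x [Kx cover]]] := finite_cover (P := Kf S)
  (E := fun k k' => forall v, v \in Vu -> k v - k' v \in VF) (@fibre_action_finite R V S).
apply: (@sub_finite_set _ _ [set left_coset (x i) Ug | i in [set: 'I_n]]); last first.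
  by apply: finite_image; exact: finite_finset.
move=> _ [k Kk <-]; have [i hi] := cover k Kk; exists i => //.
apply/(left_coset_eq _ _ Ug_group); split; first by apply: KfM => //; exact: KfV.
move=> v vV; have -> : GL_fun (k^-1 * x i)%g v - v = GL_fun k^-1%g (x i v - GL_fun k v).
  by rewrite GLM GLB GLK.
by rewrite (VF_f (KfV Kk) (hi v vV)) hi.
Qed.

Definition nl u : 'End(V) := (GL_end u - \1)%VF.

Lemma nlE u x : nl u x = u x - x.
Proof. by rewrite add_lfunE opp_lfunE id_lfunE. Qed.

Lemma nl_Vu u x : Ug u -> nl u x \in Vu.
Proof. by move=> [Ku _]; rewrite nlE; exact: Kf_diff. Qed.

Lemma nl_VF u v : Ug u -> v \in Vu -> nl u v \in VF.
Proof. by move=> [_ h] vV; rewrite nlE; exact: h. Qed.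

Lemma nl_0 u w : Ug u -> w \in VF -> nl u w = 0.
Proof. by move=> [Ku _] wV; rewrite nlE (VF_f Ku wV) subrr. Qed.

Lemma nl3 u u' u'' x : Ug u -> Ug u' -> Ug u'' -> nl u (nl u' (nl u'' x)) = 0.
Proof. by move=> Uu Uu' Uu''; rewrite nl_0 // nl_VF // nl_Vu. Qed.

Lemma nlM u u' x : nl (u * u')%g x = nl u x + nl u' x + nl u (nl u' x).
Proof. by rewrite !nlE GLM GLB; lmod R. Qed.

(* The powers of [g] move [x] along the line through [x] and [g x]. *)
Lemma unipotent_trivial g : G g -> (forall x, g (g x - x) = g x - x) -> g = 1%g.
Proof.
move=> Gg gg; suff gC x : C x -> g x = x.
  apply: GL_ext => v; rewrite GL1; have [x Cx] := oc_ne hC.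
  have [n hn] := oc_absorb hC v Cx; have := gC _ (hn n%:R (lexx _)).
  by rewrite GLD GLZ (gC x Cx) => /addrI.
move=> Cx; pose d := g x - x; have gd : g d = d by exact: gg.
have gVd : GL_fun g^-1%g d = d by rewrite -{1}gd GLK.
have up (n : nat) : C (x + n%:R *: d).
  elim: n => [|n IH]; first by rewrite scale0r addr0.
  have -> : x + n.+1%:R *: d = g (x + n%:R *: d).
    by rewrite GLD GLZ gd -natr1 /d; lmod R.
  exact: pc_GC.
have gVx : GL_fun g^-1%g x = x - d.
  by apply: (GL_inj (g := g)); rewrite GLKV GLB gd /d; lmod R.
have down (n : nat) : C (x - n%:R *: d).
  elim: n => [|n IH]; first by rewrite scale0r subr0.
  have -> : x - n.+1%:R *: d = GL_fun g^-1%g (x - n%:R *: d).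
    by rewrite GLB GLZ gVd gVx -natr1; lmod R.
  by apply: pc_GC => //; exact: GV.
suff : d = 0 by rewrite /d => /eqP; rewrite subr_eq0 => /eqP.
apply: (pc_noline (p := x)) => t; pose n := (Num.truncn `|t|).+1.
have tn : `|t| <= n%:R by exact/ltW/truncnS_gt.
have n0 : 0 < n%:R :> R by rewrite ltr0n.
pose s := (1 + t / n%:R) / 2.
have tn1 : -1 <= t / n%:R <= 1.
  by rewrite -ler_norml normrM normfV (gtr0_norm n0) ler_pdivrMr // mul1r.
have s01 : 0 <= s <= 1 by rewrite /s; move: tn1 => /andP[]; lra.
have -> : x + t *: d = (1 - s) *: (x - n%:R *: d) + s *: (x + n%:R *: d).
  by rewrite /s; lmod_goals R; field; rewrite gt_eqF.
exact: (oc_convex hC).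
Qed.

(** The products (u - 1) (u' - 1) take values in V_F, so u u' and u' u agree modulo V_F. Their
    quotient moves every x by a vector of V_F, which it fixes, and [unipotent_trivial] applies. *)
Lemma Ug_commute u u' : Ug u -> Ug u' -> (u * u' = u' * u)%g.
Proof.
move=> Uu Uu'; have [U1 UM UV] := Ug_group.
pose v : GL V := (u' * u)%g; have Uv : Ug v by exact: UM.
have Ug_uu' : Ug (u * u' * v^-1)%g by exact: UM _ _ (UM _ _ Uu Uu') (UV _ Uv).
have gg : (u * u' * v^-1)%g = 1%g.
  apply: unipotent_trivial => [|x].
    exact: Ug_G Ug_uu'.
  pose y := GL_fun v^-1%g x; have xE : x = v y by rewrite /y GLKV.
  have yV : GL_fun (u * u' * v^-1)%g x - x \in VF.
    have -> : GL_fun (u * u' * v^-1)%g x - x = nl (u * u')%g y - nl v y.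
      by rewrite !nlE [GL_fun (u * u' * v^-1)%g x]GLM -/y xE; lmod R.
    rewrite /v !nlM; set a := nl u _; set a' := nl u' _; set c := nl u _; set c' := nl u' _.
    have -> : a + a' + c - (a' + a + c') = c - c' by lmod R.
    by rewrite memvB // /c /c' nl_VF // nl_Vu.
  by case: Ug_uu' => Kg _; exact: VF_f Kg yV.
by have := congr1 (fun k : GL V => k * v)%g gg; rewrite mulgVK mul1g.
Qed.

Lemma nlC u u' x : Ug u -> Ug u' -> nl u (nl u' x) = nl u' (nl u x).
Proof.
move=> Uu Uu'; have := congr1 (fun k : GL V => nl k x) (Ug_commute Uu Uu').
by rewrite !nlM [nl u' x + nl u x]addrC => /addrI.
Qed.

(** The logarithm of u, whose series stops here because (u - 1)^3 = 0. *)
Definition lg u : 'End(V) := nl u - 2^-1 *: (nl u \o nl u)%VF.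

Lemma lgE u x : lg u x = nl u x - 2^-1 *: nl u (nl u x).
Proof. by rewrite add_lfunE opp_lfunE scale_lfunE comp_lfunE. Qed.

Lemma lgM u u' : Ug u -> Ug u' -> lg (u * u')%g = lg u + lg u'.
Proof.
move=> Uu Uu'; apply/lfunP => x; rewrite add_lfunE !lgE !nlM !linearD /=.
rewrite !(nl3 _ Uu) ?(nl3 _ Uu') // (nlC _ Uu' Uu) ?(nl3 _ Uu) // !raddf0.
by lmod_field R.
Qed.

Lemma lg_Vu u x : Ug u -> lg u x \in Vu.
Proof. by move=> Uu; rewrite lgE memvB ?memvZ ?nl_Vu. Qed.

Lemma lg_VF u v : Ug u -> v \in Vu -> lg u v \in VF.
Proof. by move=> Uu vV; rewrite lgE memvB ?memvZ ?nl_VF ?nl_Vu. Qed.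

Lemma lg_0 u w : Ug u -> w \in VF -> lg u w = 0.
Proof. by move=> Uu wV; rewrite lgE !(nl_0 Uu wV) raddf0 scaler0 subrr. Qed.

Lemma lg_lg u u' x : Ug u -> Ug u' -> lg u (lg u' x) = nl u (nl u' x).
Proof.
move=> Uu Uu'; rewrite !lgE !linearB /= !linearZ /= !(nl3 _ Uu) // !raddf0.
by rewrite !addr0.
Qed.

Lemma nl_lg u x : Ug u -> nl u x = lg u x + 2^-1 *: lg u (lg u x).
Proof. by move=> Uu; rewrite lg_lg // lgE subrK. Qed.

Lemma Ug_free : is_free_abelian Ug.
Proof.
pose E u (ij : 'I_(size b) * 'I_(size b)) : R := crd ij.1 (2 *: lg u b`_ij.2).
have E_int u ij : Ug u -> E u ij \is a Num.int.
  move=> Uu; suff : L (2 *: lg u b`_ij.2) by move/(latP hb); apply.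
  have Lb := lat_basis hb (ltn_ord ij.2).
  have Ln v : L v -> L (nl u v).
    by move=> Lv; rewrite nlE; apply: (latB hb) => //; apply: pc_GL => //; exact: Ug_G.
  (* Doubling clears the denominator of the logarithm. *)
  have -> : 2 *: lg u b`_ij.2 = 2 *: nl u b`_ij.2 - nl u (nl u b`_ij.2).
    by rewrite lgE; lmod_field R.
  by apply: (latB hb); [exact: (latZn hb _ (Ln _ Lb))|exact: Ln (Ln _ Lb)].
pose psi u := [ffun ij => Num.floor (E u ij)].
have psiE u ij : Ug u -> (psi u ij)%:~R = E u ij.
  by move=> Uu; rewrite ffunE; apply/eqP; rewrite -intrEfloor E_int.
have [U1 UM UV] := Ug_group.
apply: (free_abelian_int (psi := psi)) => //.
  move=> u v Uu Uv; apply/ffunP => ij; apply/eqP; rewrite -(eqr_int R); apply/eqP.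
  have -> : (psi u + psi v) ij = psi u ij + psi v ij by rewrite [LHS]ffunE.
  rewrite intrD !psiE //; last exact: UM.
  by rewrite /E lgM // add_lfunE scalerDr crdD.
move=> u v Uu Uv uv; have lgE' : lg u = lg v.
  apply/lfunP => x; rewrite (crdE hb x) !linear_sum; apply: eq_bigr => j _.
  rewrite !linearZ; congr (_ *: _); rewrite [LHS](crdE hb) [RHS](crdE hb).
  apply: eq_bigr => i _; congr (_ *: _).
  have : E u (i, j) = E v (i, j) by rewrite -!psiE // uv.
  by rewrite /E !crdZ // => /mulfI; apply; rewrite pnatr_eq0.
apply: GL_ext => x; have := nl_lg x Uu; rewrite lgE' -nl_lg // !nlE.
by move/addIr.
Qed.

End UnipotentGroup.

(** * The homomorphism sigma and its induced maps *)

Section FaceLogarithm.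
Variables (R : realType) (V : vectType R) (S : polycone V) (F : set V).
Local Notation b := (pc_b S).
Local Notation hb := (pc_basis S).
Local Notation C := (pc_C S).
Local Notation L := (int_span b).
Local Notation Cb := (cone_closure C).
Local Notation G := (pc_G S).
Local Notation VF := <<pc_fs S>>%VS.
Local Notation VQ := (rat_span b).
Local Notation X := (rat_hull VQ C).
Local Notation Vu := (Vu S).
Local Notation Ug := (Ug S).
Implicit Types (x y z v w : V) (g h u : GL V).

Hypotheses (hC : open_nondegenerate_cone C) (hF : is_face X F)
  (VFE : VF = lin_span F) (FP : forall x, F x <-> X x /\ x \in VF).
Local Notation Wl := (V_lower F).
Local Notation Wh := (V_upper VQ C F).
Let oc := pc_open S.

Lemma mem_lower w : (w \in Wl) = (w \in VF). Proof. by rewrite VFE. Qed.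
Lemma mem_upper v : (v \in Wh) = (v \in Vu). Proof. by rewrite (V_upperE VFE FP). Qed.

Lemma U_face_Ug : U_face VQ C G F = Ug.
Proof. by apply/seteqP; split=> u /(U_faceE VFE FP). Qed.

(* [u^n z = z + n (u - 1) z + n (n - 1) / 2 (u - 1)^2 z] has dominant term [(u - 1)^2 z]. *)
Lemma nl_sq_clo u z : Ug u -> Cb z -> Cb (nl u (nl u z)).
Proof.
move=> Uu hz; have Gu := Ug_G Uu; have uE y : u y = y + nl u y by rewrite nlE addrC subrK.
have pow (n : nat) : Cb (z + n%:R *: nl u z + (n%:R * (n%:R - 1) / 2) *: nl u (nl u z)).
  elim: n => [|n IH]; first by rewrite mul0r mul0r !scale0r !addr0.
  have := GCb Gu IH; rewrite !GLD !GLZ !uE (nl3 z Uu Uu Uu) addr0 -natr1.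
  congr (Cb _); lmod_goals R; by field.
apply: (clo_lim oc (p := 2 *: z + 2 *: nl u z)).
  by rewrite -scalerDr -uE; apply: (clo_scale oc) => //; exact: GCb.
move=> n; have n0 : 0 < n.+2%:R :> R by rewrite ltr0n.
(* The expansion of u^(n + 2) z is multiplied by 2 / (n + 2), which gives (u - 1)^2 z the
   coefficient n + 1 expected by [clo_lim]; the last summand adjusts the coefficient of z to 2. *)
have -> : n.+1%:R *: nl u (nl u z) + (2 *: z + 2 *: nl u z) =
  (2 / n.+2%:R) *: (z + n.+2%:R *: nl u z + (n.+2%:R * (n.+2%:R - 1) / 2) *: nl u (nl u z))
  + (2 - 2 / n.+2%:R) *: z.
  have -> : n.+1%:R = n.+2%:R - 1 :> R by rewrite -[in RHS]natr1 addrK.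
  by lmod_goals R; field; rewrite gt_eqF.
apply: clo_add; apply: (clo_scale oc); rewrite ?divr_ge0 ?ler0n //.
by rewrite subr_ge0 ler_pdivrMr // ler_peMr ?ler0n // ler1n.
Qed.

Lemma nl_sq_face u x : Ug u -> X x -> F (nl u (nl u x)).
Proof.
move=> Uu /(hullP hC hb)[zs [hzs [a a0 <-]]]; rewrite !linear_sum.
elim/big_ind: _ => [||i _]; [exact: (face0 hC hb hF)|exact: (faceD hC hb hF)|].
rewrite !linearZ; apply: (faceZ hC hb hF); first exact: a0.
have [Lz hz] := hzs zs`_i (mem_nth 0 (ltn_ord i)).
have Ln v : L v -> L (nl u v).
  by move=> Lv; rewrite nlE; apply: (latB hb) => //; apply: pc_GL => //; exact: Ug_G.
apply/FP; split; last by rewrite nl_VF // nl_Vu.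
by apply: (lat_hull hC); [exact: Ln (Ln _ Lz)|exact: nl_sq_clo].
Qed.

(** If (u - 1)^2 kills an interior point x, adding a multiple of x to any v shows that (u - 1)^2 v
    is in the closed cone, and likewise for - v; so (u - 1)^2 = 0 and [unipotent_trivial] gives u =
    1. *)
Lemma nl_sq_neq0 u x : Ug u -> u <> 1%g -> C x -> nl u (nl u x) <> 0.
Proof.
move=> Uu u1 Cx N0; apply: u1; apply: (unipotent_trivial (Ug_G Uu)).
have clo y : C y -> Cb (nl u (nl u y)).
  by move=> Cy; apply: nl_sq_clo => //; exact: (oc_sub_closure oc).
have half v : Cb (nl u (nl u v)).
  have [n hn] := oc_absorb oc v Cx; have := clo _ (hn n%:R (lexx _)).
  by rewrite !linearP /= N0 scaler0 add0r.
move=> v; apply/eqP; rewrite -subr_eq0 -!nlE; apply/eqP.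
apply: (@xi0_eq0 _ _ S) => //; apply/eqP; rewrite eq_le xi0_ge0 // andbT.
by have := xi0_ge0 (half (- v)); rewrite !linearN /= oppr_ge0.
Qed.

Definition sec (W : {vspace V}) : 'Hom(quotv W, V) := (quot_map W)^-1%VF.

Lemma secK (W : {vspace V}) (q : quotv W) : quot_map W (sec W q) = q.
Proof.
by rewrite /sec limg_lfunVK //; have [x <-] := quot_map_surj q; rewrite memv_img ?memvf.
Qed.

Lemma sec_diff (W : {vspace V}) x : sec W (quot_map W x) - x \in W.
Proof. by apply/quot_mapP; rewrite secK. Qed.

(** [lg u] kills V_F, so the result does not depend on the linear section [sec]. *)
Definition sigma u : 'Hom(quotv Wl, subvs_of Wh) :=
  (linfun (vsproj Wh) \o lg u \o sec Wl)%VF.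
Definition jmap u : 'Hom(quotv Wh, subvs_of (T_face VQ C F)) :=
  (linfun (vsproj (T_face VQ C F)) \o quot_map Wl \o lg u \o sec Wh)%VF.
Definition kmap u : 'Hom(subvs_of (T_face VQ C F), subvs_of Wl) :=
  (linfun (vsproj Wl) \o lg u \o sec Wl \o linfun vsval)%VF.

Lemma lg_sec u x : Ug u -> lg u (sec Wl (quot_map Wl x)) = lg u x.
Proof.
move=> Uu; apply/eqP; rewrite -subr_eq0 -linearB /= (lg_0 Uu) //.
by rewrite -mem_lower sec_diff.
Qed.

Lemma sigmaE u q : Ug u -> \val (sigma u q) = lg u (sec Wl q).
Proof. by move=> Uu; rewrite !comp_lfunE lfunE /= vsprojK // mem_upper lg_Vu. Qed.

Lemma sigma_quot u x : Ug u -> \val (sigma u (quot_map Wl x)) = lg u x.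
Proof. by move=> Uu; rewrite sigmaE // lg_sec. Qed.

Lemma jmapE u x : Ug u -> \val (jmap u (quot_map Wh x)) = quot_map Wl (lg u x).
Proof.
move=> Uu; rewrite !comp_lfunE lfunE /= vsprojK; last first.
  by rewrite memv_img // mem_upper lg_Vu.
by apply/quot_mapP; rewrite mem_lower -linearB lg_VF // -mem_upper sec_diff.
Qed.

Lemma sec_T t : t \in T_face VQ C F -> sec Wl t \in Vu.
Proof.
move=> /memv_imgP[y yV ->]; rewrite -[sec _ _](subrK y) memvD -?mem_upper //.
by rewrite mem_upper VF_Vu // -mem_lower sec_diff.
Qed.

Lemma kmapE u t : Ug u -> \val (kmap u t) = lg u (sec Wl (\val t)).
Proof.
move=> Uu; rewrite /kmap !comp_lfunE [linfun vsval _]lfunE [linfun (vsproj _) _]lfunE /=.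
by rewrite vsprojK // mem_lower lg_VF // sec_T // subvsP.
Qed.

Lemma kjE u u' x : Ug u -> Ug u' -> \val (kmap u (jmap u' (quot_map Wh x))) = nl u (nl u' x).
Proof. by move=> Uu Uu'; rewrite kmapE // jmapE // lg_sec // (lg_lg _ Uu Uu'). Qed.

Lemma log_hom_sigma : log_hom G sigma.
Proof.
rewrite /log_hom U_face_Ug; split; [|split].
- move=> u v Uu Uv; rewrite /sigma (lgM Uu Uv); apply/lfunP => q.
  by rewrite add_lfunE !comp_lfunE add_lfunE linearD.
- by move=> u Uu t tT; rewrite sigmaE // mem_lower lg_VF // sec_T.
exists jmap, kmap; split.
- move=> u Uu; split=> [x|t]; first by rewrite jmapE // sigma_quot.
  by rewrite kmapE // sigmaE.
- by move=> u Uu x; rewrite sigma_quot // kjE // lgE addrA subrK nlE addrC subrK.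
- move=> u v Uu Uv; apply/lfunP => q; have [x <-] := quot_map_surj q.
  have cE u1 u2 : (kmap u1 \o jmap u2)%VF (quot_map Wh x) = kmap u1 (jmap u2 (quot_map Wh x)).
    by rewrite comp_lfunE.
  by apply: val_inj; rewrite !cE !kjE // (nlC _ Uu Uv).
move=> u Uu u1 x Cx; rewrite kjE //; split; last exact: nl_sq_neq0.
by apply: nl_sq_face => //; exact: (cone_hull hC hb).
Qed.

(** Let s be the endomorphism of V induced by sigma' u. Property (i) reads u - 1 = s + s^2 / 2, and
    s^3 = 0, so s is recovered as (u - 1) - (u - 1)^2 / 2. *)
Lemma log_hom_unique sigma' : log_hom G sigma' -> forall u, Ug u -> sigma' u = sigma u.
Proof.
rewrite /log_hom U_face_Ug => -[_ [sT [j [k [jk form _ _]]]]] u Uu.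
pose s x := \val (sigma' u (quot_map Wl x)).
have sD x y : s (x + y) = s x + s y by rewrite /s !linearD.
have sZ (a : R) x : s (a *: x) = a *: s x by rewrite /s !linearZ.
have s_Vu x : s x \in Vu by rewrite -mem_upper subvsP.
have s_VF v : v \in Vu -> s v \in VF.
  by move=> vV; rewrite -mem_lower sT // memv_img // mem_upper.
have s_0 w : w \in VF -> s w = 0.
  move=> wV; have wl : quot_map Wl w = quot_map Wl 0.
    by apply/quot_mapP; rewrite subr0 mem_lower.
  by rewrite /s wl !linear0.
have nE x : nl u x = s x + 2^-1 *: s (s x).
  have [hj hk] := jk u Uu; rewrite nlE (form u Uu x) hk hj -/(s x) -/(s (s x)).
  by lmod R.
apply/lfunP => q; have [x <-] := quot_map_surj q; apply: val_inj.
rewrite [RHS]sigma_quot // lgE !nE -/(s x) !(sD, sZ).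
rewrite !(s_0 (s (s (s _)))) ?s_VF // !(s_0 (s (s _))) ?s_VF //.
by lmod R.
Qed.

End FaceLogarithm.

Theorem theorem5p1 (R : realType) (V : vectType R) (VQ C : set V)
    (Gam : set (GL V)) (F : set V)
    (hT : polyhedral_triple VQ C Gam) (hF : is_face (rat_hull VQ C) F) :
  let U := U_face VQ C Gam F in
  let K := face_ker VQ C Gam F in
  finite_index (prod_law (@set_mulg (GL V)) (@set_mulg (GL V)))
    (face_hom VQ C Gam F @` N_face Gam F)
    (Gam_face Gam F `*` Gam_face_dual VQ C Gam F) /\
  [/\ is_subgroup U, is_free_abelian U & finite_index ( *%g ) U K] /\
  [/\ two_step_unipotent U,
      forall u : GL V, U u ->
        ((GL_end u - \1) \o (GL_end u - \1) \o (GL_end u - \1) = 0)%VF &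
      exists2 sigma : GL V -> 'Hom(quotv (V_lower F), subvs_of (V_upper VQ C F)),
        log_hom Gam sigma &
        forall sigma', log_hom Gam sigma' -> forall u, U u -> sigma' u = sigma u].
Proof.
move=> U K; have [S [CE GE QE VFE FP]] := face_polycone hT hF.
have hC : open_nondegenerate_cone (pc_C S) by rewrite CE; exact: triple_cone hT.
rewrite {hT}/U {U}/K {K}; subst C Gam VQ.
rewrite (U_face_Ug VFE FP) (face_kerE VFE FP); split; first exact: face_image_index.
split; first by split; [exact: Ug_group|exact: Ug_free|exact: Ug_index].
split.
- exists (V_lower F), (V_upper (rat_span (pc_b S)) (pc_C S) F).
  split; first by apply/subvP => x; rewrite (mem_lower VFE) (mem_upper VFE FP); exact: VF_Vu.
  move=> u Uu; split=> x; rewrite ?(mem_lower VFE) ?(mem_upper VFE FP).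
  + by case: Uu => Ku _; exact: VF_f Ku.
  + by case: Uu => _; apply.
  + by case: Uu => Ku _; exact: Kf_diff Ku.
- move=> u Uu; apply/lfunP => x; rewrite zero_lfunE !comp_lfunE.
  exact: (nl3 x Uu Uu Uu).
exists (@sigma R V S F); first exact: log_hom_sigma.
by move=> sigma' h u Uu; exact: (log_hom_unique VFE FP h).
Qed.
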